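(* For every $z\in Z$ there exists a unique weak solution $(E,B)$ of the state system with right-hand side $f:=I_{\rm src}+\operatorname{curl}z$ and initial data $(E_0,B_0)$. Moreover, $$\|\partial_tE\|_{L^2(0,T;H_0(\operatorname{curl};\Omega)^* )}+\|\partial_tB\|_{L^2(0,T;H(\operatorname{curl};\Omega)^* )}+\|E\|_{C([0,T];L^2(\Omega)^3)}+\|B\|_{C([0,T];L^2(\Omega)^3)}\le C\big(\|I_{\rm src}\|_{L^2(0,T;L^2(\Omega))}+\|z\|_Z+\|E_0\|_{L^2(\Omega)}+\|B_0\|_{L^2(\Omega)}\big)$$ with a constant $C>0$ independent of $z$. Consequently, the control-to-state map $S:Z\to Y$, $S(z)=(E,B)$, is affine and bounded. Writing $S(z)=S_0z+(E^{\rm src},B^{\rm src})$, the operator $S_0:Z\to Y$ is linear and bounded, where $S_0z$ is the weak solution corresponding to $I_{\rm src}\equiv0$ and zero initial data.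
   Context: $\Omega\subset\mathbb R^3$ is a bounded Lipschitz domain with outward unit normal $\nu$, and $T>0$. $(\cdot,\cdot)$ is the $L^2(\Omega)$ inner product (scalar or vector). The tensors $\varepsilon,\mu,\sigma\in L^\infty(\Omega;\mathbb R^{3\times3})$ are symmetric; there are $\varepsilon_0,\mu_0>0$ with $\xi^\top\varepsilon(x)\xi\ge\varepsilon_0|\xi|^2$, $\xi^\top\mu(x)\xi\ge\mu_0|\xi|^2$ for a.e. $x\in\Omega$ and all $\xi\in\mathbb R^3$; $\sigma$ is positive semidefinite; $I_{\rm src}\in L^2(0,T;L^2(\Omega)^3)$; $E_0,B_0\in L^2(\Omega)^3$ with $\operatorname{div}B_0=0$ in $L^2(\Omega)$. $H(\operatorname{curl};\Omega)=\{v\in L^2(\Omega)^3:\operatorname{curl}v\in L^2(\Omega)^3\}$, $H_0(\operatorname{curl};\Omega)=\{v\in H(\operatorname{curl};\Omega):v\times\nu=0\text{ on }\partial\Omega\}$, $H(\operatorname{div}^0;\Omega)=\{v\in L^2(\Omega)^3:\operatorname{div}v=0\}$. $X^*$ is the dual of $X$ and $\langle\cdot,\cdot\rangle_{X^*,X}$ the duality pairing. $Z=L^2(0,T;H(\operatorname{curl};\Omega))$ with $\|z\|_Z^2=\int_0^T(\alpha_1\|z\|_{L^2(\Omega)^3}^2+\alpha_2\|\operatorname{curl}z\|_{L^2(\Omega)^3}^2)\,dt$, $\alpha_1,\alpha_2>0$. $Y=L^2(0,T;L^2(\Omega)^3)\times L^2(0,T;L^2(\Omega)^3)$. $(E^{\rm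 src},B^{\rm src})=S(0)$ is the state for $z=0$. State system: $\varepsilon\,\partial_tE-\operatorname{curl}(\mu^{-1}B)+\sigma E=I_{\rm src}+\operatorname{curl}z$ and $\partial_tB+\operatorname{curl}E=0$ in $\Omega\times(0,T)$, $E\times\nu=0$ on $\partial\Omega\times(0,T)$, $E(0)=E_0$, $B(0)=B_0$ in $\Omega$. Weak solution with right-hand side $f\in L^2(0,T;L^2(\Omega)^3)$: $(E,B)$ with $E\in H^1(0,T;H_0(\operatorname{curl};\Omega)^* )\cap C([0,T];L^2(\Omega)^3)$, $B\in H^1(0,T;H(\operatorname{curl};\Omega)^* )\cap C([0,T];L^2(\Omega)^3)$ such that for a.e. $t\in(0,T)$ $$\langle\varepsilon\,\partial_tE,\psi\rangle_{H_0(\operatorname{curl};\Omega)^*,H_0(\operatorname{curl};\Omega)}+(\sigma E,\psi)-(\mu^{-1}B,\operatorname{curl}\psi)=(f,\psi)\quad\forall\psi\in H_0(\operatorname{curl};\Omega),$$ $$\langle\partial_tB,\phi\rangle_{H(\operatorname{curl};\Omega)^*,H(\operatorname{curl};\Omega)}+(E,\operatorname{curl}\phi)=0\quad\forall\phi\in H(\operatorname{curl};\Omega),$$ with $E(0)=E_0$, $B(0)=B_0$ in $L^2(\Omega)^3$. If, in addition, $\operatorname{div}B_0=0$ in $L^2(\Omega)$, then $B\in L^\infty(0,T;H(\operatorname{div}^0;\Omega))$.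
   Formalization: Since ε is only bounded, ε∂ₜE is undefined for ∂ₜE in H₀(curl;Ω)*; ∂ₜE, its regularity and its norm are read with the ε-weighted pivot, as the functional ψ ↦ d/dt(εE,ψ), i.e. as ∂ₜ(εE). *)

(* Defs.v *)
From HB Require Import structures.
From mathcomp Require Import all_boot all_order all_algebra.
From mathcomp Require Import all_classical all_reals all_analysis.

Set Implicit Arguments.
Unset Strict Implicit.
Unset Printing Implicit Defensive.

Import Order.TTheory GRing.Theory Num.Theory.
Import numFieldNormedType.Exports.

Local Open Scope classical_set_scope.
Local Open Scope ring_scope.

(* A vector field is a function defined on all of R^3; every notion below only
   depends on its values on Omega, up to null sets. *)
Definition R3 (R : realType) : Type :=
  (measurableTypeR R * measurableTypeR R * measurableTypeR R)%type.
Definition vfield (R : realType) : Type := R3 R -> 'cV[R]_3.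
Definition mfield (R : realType) : Type := R3 R -> 'M[R]_3.

Definition leb1 (R : realType) : {measure set (measurableTypeR R) -> \bar R} :=
  @lebesgue_measure R.
Definition leb3 (R : realType) : {measure set (R3 R) -> \bar R} :=
  ((@lebesgue_measure R \x @lebesgue_measure R) \x @lebesgue_measure R)%E.

Definition dotp (R : realType) (u v : 'cV[R]_3) : R :=
  \sum_(i < 3) u i 0 * v i 0.
Definition axis (R : realType) (i : 'I_3) : R3 R :=
  ((i == 0)%:R, (i == 1)%:R, (i == 2)%:R).
Definition col_point (R : realType) (y : 'cV[R]_3) : R3 R :=
  (y 0 0, y 1 0, y 2 0).

(* Locally, after a translation and an orthogonal change of coordinates, Omega
   is the strict epigraph of a Lipschitz function; that the boundary is the
   graph, and passes through the origin of the chart, follows. *)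
Definition bounded_Lipschitz_domain (R : realType) (Omega : set (R3 R)) : Prop :=
  [/\ Omega !=set0, open Omega, connected Omega, bounded_set Omega &
   forall x0, (closure Omega `\` Omega) x0 ->
   exists (Q : 'M[R]_3) (gamma : R * R -> R) (r h L : R),
     [/\ Q^T *m Q = 1%:M, 0 < r, 0 < h, L.-lipschitz gamma &
      forall y : 'cV[R]_3, `|y 0 0| < r -> `|y 1 0| < r -> `|y 2 0| < h ->
        Omega (x0 + col_point (Q *m y)) <-> gamma (y 0 0, y 1 0) < y 2 0]].

Fixpoint Ck (R : realType) (V : normedModType R) (n : nat) (f : V -> R) : Prop :=
  continuous f /\
  if n is m.+1 then
    forall v : V, (forall x, derivable f x v) /\ Ck m (fun x => 'D_v f x)
  else True.

Definition test_fun (R : realType) (V : normedModType R) (U : set V)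
    (phi : V -> R) : Prop :=
  (forall n, Ck n phi) /\
  exists K : set V, [/\ compact K, K `<=` U & forall x, ~ K x -> phi x = 0].

Definition test_vfield (R : realType) (Omega : set (R3 R))
    (phi : vfield R) : Prop :=
  forall i, test_fun Omega (fun x => phi x i 0).

Definition grad_smooth (R : realType) (phi : R3 R -> R) : vfield R :=
  fun x => \col_i 'D_(axis R i) phi x.

(* indices in 'I_3 are taken modulo 3 *)
Definition curl_smooth (R : realType) (phi : vfield R) : vfield R :=
  fun x => \col_i ('D_(axis R (i + 1)) (fun y => phi y (i - 1) 0) x
                 - 'D_(axis R (i - 1)) (fun y => phi y (i + 1) 0) x).

(* A space of (classes of) functions is a set of representatives in a vector
   space together with its seminorm; classes are equal when the seminorm of the
   difference of representatives vanishes. *)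
Record nspace (R : realType) := NSpace {
  carrier :> lmodType R;
  dom : set carrier;
  nrm : carrier -> R }.
Arguments dom {R} n.
Arguments nrm {R} n.

Section Fields.
Variables (R : realType) (Omega : set (R3 R)).

Definition sqint (g : R3 R -> R) : Prop := (g \_ Omega) \in Lfun (@leb3 R) 2%:E.

Definition ip (u v : vfield R) : R :=
  \int[@leb3 R]_(x in Omega) (dotp (u x) (v x)).

Definition L2 : nspace R :=
  @NSpace R (vfield R : lmodType R)
    [set v | forall i, sqint (fun x => v x i 0)]
    (fun v => Num.sqrt (ip v v)).

Definition weak_curl (v w : vfield R) : Prop :=
  forall phi, test_vfield Omega phi -> ip v (curl_smooth phi) = ip w phi.

(* xget picks a representative: here, and for dt and state below, the set is a
   single class whenever the object exists. *)
Definition curl (v : vfield R) : vfield R :=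
  xget 0 [set w | dom L2 w /\ weak_curl v w].

Definition Hcurl : nspace R :=
  @NSpace R (vfield R : lmodType R)
    [set v | dom L2 v /\ exists w, dom L2 w /\ weak_curl v w]
    (fun v => Num.sqrt (nrm L2 v ^+ 2 + nrm L2 (curl v) ^+ 2)).

Definition H1_scalar (g : R3 R -> R) : Prop :=
  sqint g /\
  forall i, exists d, sqint d /\
    forall phi, test_fun Omega phi ->
      \int[@leb3 R]_(x in Omega) (g x * 'D_(axis R i) phi x)
      = - \int[@leb3 R]_(x in Omega) (d x * phi x).

Definition H1_vfield (phi : vfield R) : Prop :=
  forall i, H1_scalar (fun x => phi x i 0).

(* The tangential trace v x nu of v in H(curl), an element of H^{-1/2}(bd Omega)^3
   given by Green's formula: its pairing with the trace of phi in H^1(Omega)^3,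
   which is the boundary integral of (v x nu) . phi for smooth fields. *)
Definition tangential_trace (v phi : vfield R) : R :=
  ip v (curl phi) - ip (curl v) phi.

Definition H0curl : nspace R :=
  @NSpace R (vfield R : lmodType R)
    [set v | dom Hcurl v /\
             forall phi, H1_vfield phi -> tangential_trace v phi = 0]
    (nrm Hcurl).

Definition div_free (v : vfield R) : Prop :=
  forall phi, test_fun Omega phi -> ip v (grad_smooth phi) = 0.

Definition Hdiv0 : nspace R :=
  @NSpace R (vfield R : lmodType R)
    [set v | dom L2 v /\ div_free v] (nrm L2).

Definition Linf_mfield (A : mfield R) : Prop :=
  forall i j, measurable_fun Omega (fun x => A x i j) /\
    exists M : R, \forall x \ae @leb3 R, Omega x -> `|A x i j| <= M.

Definition symmetric_mfield (A : mfield R) : Prop :=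
  \forall x \ae @leb3 R, Omega x -> (A x)^T = A x.

(* for c = 0 this is positive semidefiniteness *)
Definition bounded_below_mfield (c : R) (A : mfield R) : Prop :=
  \forall x \ae @leb3 R, Omega x ->
    forall xi : 'cV[R]_3, c * dotp xi xi <= dotp xi (A x *m xi).

End Fields.

Definition mulf (R : realType) (A : mfield R) (v : vfield R) : vfield R :=
  fun x => A x *m v x.
Definition invf (R : realType) (A : mfield R) : mfield R :=
  fun x => invmx (A x).

Unset Implicit Arguments.
Section Bochner.
Variables (R : realType) (T : R).
Implicit Types X : nspace R.

(* values outside dom X are irrelevant *)
Definition dual X : nspace R :=
  @NSpace R ((X -> R^o) : lmodType R)
    [set l : X -> R |
      (forall (a : R) u v, dom X u -> dom X v -> l (a *: u + v) = a * l u + l v)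
      /\ exists M : R, forall v, dom X v -> `|l v| <= M * nrm X v]
    (fun l : X -> R => sup [set `|l v| | v in [set v | dom X v /\ nrm X v <= 1]]).

Definition simple_fun X (s : R -> X) : Prop :=
  exists (n : nat) (A : 'I_n -> set (measurableTypeR R)) (x : 'I_n -> X),
    (forall i, measurable (A i) /\ dom X (x i)) /\
    s = (fun t => \sum_(i < n) (\1_(A i) t : R) *: x i).

Definition Bochner_measurable X (f : R -> X) : Prop :=
  exists s : nat -> R -> X,
    (forall n, simple_fun X (s n)) /\
    \forall t \ae @leb1 R, `]0, T[%classic t ->
      dom X (f t) /\ (fun n => nrm X (s n t - f t)) @ \oo --> (0 : R).

(* t |-> nrm (f t) is in general only a.e. equal to a Borel function; the value of
   the integral (a supremum over simple functions below) is not affected. *)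
Definition in_L2t X (f : R -> X) : Prop :=
  Bochner_measurable X f /\
  (\int[@leb1 R]_(t in `]0%R, T[) ((nrm X (f t)) ^+ 2)%:E < +oo)%E.

Definition nrm_L2t X (f : R -> X) : R :=
  Num.sqrt (\int[@leb1 R]_(t in `]0, T[) (nrm X (f t) ^+ 2)).

Definition in_Linft X (f : R -> X) : Prop :=
  Bochner_measurable X f /\
  exists M : R, \forall t \ae @leb1 R, `]0, T[%classic t -> nrm X (f t) <= M.

Definition in_Ct X (f : R -> X) : Prop :=
  forall s, `[0, T]%classic s -> dom X (f s) /\
    (fun t => nrm X (f t - f s)) @ within `[0, T]%classic (nbhs s) --> (0 : R).

Definition nrm_Ct X (f : R -> X) : R :=
  sup [set nrm X (f t) | t in `[0, T]%classic].

(* l' = g in the sense of X^*-valued distributions on (0,T); the identity between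
   Bochner integrals in X^* is tested on each element of X. *)
Definition weak_deriv X (l g : R -> dual X) : Prop :=
  forall psi : X, dom X psi ->
  forall theta : R -> R, test_fun (`]0, T[%classic : set R) theta ->
    \int[@leb1 R]_(t in `]0, T[) (l t psi * derive1 theta t)
    = - \int[@leb1 R]_(t in `]0, T[) (g t psi * theta t).

Definition in_H1t X (l : R -> dual X) : Prop :=
  in_L2t (dual X) l /\ exists g : R -> dual X, in_L2t (dual X) g /\ weak_deriv X l g.

Definition dt X (l : R -> dual X) : R -> dual X :=
  xget 0 [set g | in_L2t (dual X) g /\ weak_deriv X l g].

Definition eq_aet X (f g : R -> X) : Prop :=
  \forall t \ae @leb1 R, `]0, T[%classic t -> nrm X (f t - g t) = 0.

End Bochner.
Set Implicit Arguments.
Arguments dual {R} X.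
Arguments simple_fun {R} X.
Arguments Bochner_measurable {R} T X.
Arguments in_L2t {R} T X.
Arguments nrm_L2t {R} T X.
Arguments in_Linft {R} T X.
Arguments in_Ct {R} T X.
Arguments nrm_Ct {R} T X.
Arguments weak_deriv {R} T X.
Arguments in_H1t {R} T X.
Arguments dt {R} T X.
Arguments eq_aet {R} T X.


Section Maxwell.
Variables (R : realType) (Omega : set (R3 R)) (T : R).
Variables (eps mu sigma : mfield R).
Notation L2 := (L2 Omega).
Notation Hcurl := (Hcurl Omega).
Notation H0curl := (H0curl Omega).
Notation "( u , v )_2" := (ip Omega u v) (at level 0).

(* The embeddings of L^2(Omega)^3 into H0(curl)^* and H(curl)^*.  Since eps is
   merely bounded, multiplication by eps does not act on H0(curl)^*: the symbol
   eps d_t E only makes sense when the pivot space for E carries the equivalent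
   inner product (eps u, v), so that <eps d_t E, psi> = d/dt (eps E, psi). *)
Definition embE (E : R -> vfield R) : R -> dual H0curl :=
  fun t psi => (mulf eps (E t), psi)_2.
Definition embB (B : R -> vfield R) : R -> dual Hcurl :=
  fun t phi => (B t, phi)_2.

Definition weak_solution (f : R -> vfield R) (E0 B0 : vfield R)
    (EB : (R -> vfield R) * (R -> vfield R)) : Prop :=
  let E := EB.1 in let B := EB.2 in
  [/\ in_H1t T H0curl (embE E) /\ in_Ct T L2 E,
      in_H1t T Hcurl (embB B) /\ in_Ct T L2 B,
      \forall t \ae @leb1 R, `]0, T[%classic t ->
        forall psi, dom H0curl psi ->
          dt T H0curl (embE E) t psi + (mulf sigma (E t), psi)_2
          - (mulf (invf mu) (B t), curl Omega psi)_2 = (f t, psi)_2,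
      \forall t \ae @leb1 R, `]0, T[%classic t ->
        forall phi, dom Hcurl phi ->
          dt T Hcurl (embB B) t phi + (E t, curl Omega phi)_2 = 0 &
      nrm L2 (E 0 - E0) = 0 /\ nrm L2 (B 0 - B0) = 0].

Definition in_Z (z : R -> vfield R) : Prop := in_L2t T Hcurl z.

Definition nrm_Z (a1 a2 : R) (z : R -> vfield R) : R :=
  Num.sqrt (\int[@leb1 R]_(t in `]0, T[) (
    a1 * nrm L2 (z t) ^+ 2 + a2 * nrm L2 (curl Omega (z t)) ^+ 2)).

Definition in_Y (y : (R -> vfield R) * (R -> vfield R)) : Prop :=
  in_L2t T L2 y.1 /\ in_L2t T L2 y.2.

Definition nrm_Y (y : (R -> vfield R) * (R -> vfield R)) : R :=
  Num.sqrt (nrm_L2t T L2 y.1 ^+ 2 + nrm_L2t T L2 y.2 ^+ 2).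

Definition eq_Y (y y' : (R -> vfield R) * (R -> vfield R)) : Prop :=
  eq_aet T L2 y.1 y'.1 /\ eq_aet T L2 y.2 y'.2.

Definition rhs (Isrc z : R -> vfield R) : R -> vfield R :=
  fun t => Isrc t + curl Omega (z t).

Definition state (Isrc : R -> vfield R) (E0 B0 : vfield R)
    (z : R -> vfield R) : (R -> vfield R) * (R -> vfield R) :=
  xget 0 [set EB | weak_solution (rhs Isrc z) E0 B0 EB].

End Maxwell.
Arguments embE {R} Omega eps E.
Arguments embB {R} Omega B.

(* Main.v *)
Require Import Defs.
From HB Require Import structures.
From mathcomp Require Import all_boot all_order all_algebra.
From mathcomp Require Import all_classical all_reals all_analysis.
From mathcomp Require Import measurable_realfun ring lra zify.

Set Implicit Arguments.
Unset Strict Implicit.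
Unset Printing Implicit Defensive.

Import Order.TTheory GRing.Theory Num.Theory.
Import numFieldNormedType.Exports.

Local Open Scope classical_set_scope.
Local Open Scope ring_scope.

(* On the space V of pairs (E,B) in L^2 x L^2 with the energy product
   (eps E, E') + (mu^-1 B, B') the system reads U' = G U + F, where G is known only
   weakly, through the functionals p U = (eps E, psi) + (B, phi) and
   q U = -(sigma E, psi) + (mu^-1 B, curl psi) - (E, curl phi) for psi in H0(curl)
   and phi in H(curl): W = G U means p W = q U for all tests.  Green's formula
   (E, curl v) = (curl E, v) for E in H0(curl) and v in H(curl) makes G dissipative,
   and the Riesz theorem for the form (eps u,v) + h (sigma u,v) + h^2 (mu^-1 curl u, curl v)
   on H0(curl) solves U - h G U = F.  Green's formula needs H^1 fields that approximate
   v up to the boundary: a cutoff of v is averaged over small inward translations, which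
   the Lipschitz boundary provides.  The implicit Euler scheme then converges,
   for data in the domain of G^2 and by density in general, to the unique continuous U with
   p U(t) = p U(0) + int_0^t (q U + p F), and |U(t)| <= |U(0)| + int_0^t |F|.
   By du Bois-Reymond's lemma, weak solutions are exactly these mild solutions.
   The weak time derivative of an X^*-valued function is determined almost everywhere
   because the countably many values of its simple approximants are normed by
   countably many elements of X.  Linearity of S_0 follows from uniqueness, and div B = 0
   from testing with gradients, whose curl vanishes. *)

(** * Semi-inner product spaces *)

(** Fields are representatives, so every space carries a mere seminorm, vectors are compared through
    a vanishing seminorm of their difference, and the generator is a relation whose values are
    determined up to null vectors. The electric field of a weak solution need not lie in H0(curl),
    so the equation cannot be tested with the solution itself: uniqueness is proved for the time
    primitive, which does lie in the domain of the generator. Halving an Euler step of size h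
    changes the result by O(h^2) only if second differences are controlled, hence the data to which
    the generator applies twice; the force enters the scheme through its time primitive, which is
    Lipschitz even where the force jumps. H0(curl) is defined by pairings with H^1 fields only,
    whereas the resolvent equation needs the pairing with every field of H(curl): closing this gap
    is where the Lipschitz boundary enters. Norms of derivatives picked by [xget] need not be
    measurable in time, so their integrals are estimated as suprema over simple functions below
    them. *)

Record semi_hilbert (R : realType) (V : lmodType R) (m : V -> V -> R) : Prop :=
  SemiHilbert {
  sh_lin : forall a u v w, m (a *: u + v) w = a * m u w + m v w;
  sh_sym : forall u v, m u v = m v u;
  sh_ge0 : forall u, 0 <= m u u;
  sh_complete : forall u : nat -> V,
    (forall e, 0 < e -> exists N, forall j k, (N <= j)%N -> (N <= k)%N ->
       m (u j - u k) (u j - u k) < e) ->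
    exists l, (fun k => m (u k - l) (u k - l)) @ \oo --> (0 : R) }.

Definition hn (R : realType) (V : lmodType R) (m : V -> V -> R) (u : V) : R :=
  Num.sqrt (m u u).

(** The trial value [t = - a / (b + 1)] turns the quadratic into a nonpositive multiple of [a ^+ 2];
    the shift by 1 covers [b = 0]. Every first variation argument below ends here. *)
Lemma quadratic_ge0_lin (R : realFieldType) (a b : R) :
  0 <= b -> (forall t, 0 <= 2 * t * a + t ^+ 2 * b) -> a = 0.
Proof.
move=> b0 H.
have b1 : 0 < b + 1 by lra.
have := H (- a / (b + 1)).
have -> : 2 * (- a / (b + 1)) * a + (- a / (b + 1)) ^+ 2 * b =
   - (a ^+ 2 * ((b + 2) / (b + 1) ^+ 2)).
  by field; rewrite gt_eqF.
rewrite oppr_ge0 => h.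
have c0 : 0 < (b + 2) / (b + 1) ^+ 2 by rewrite divr_gt0 ?exprn_gt0 //; lra.
apply/eqP; rewrite -sqrf_eq0 eq_le sqr_ge0 andbT.
by move: h; rewrite pmulr_lle0.
Qed.

Lemma cvgr0_le (R : realType) (u c : nat -> R) :
  (forall n, 0 <= u n <= c n) -> c @ \oo --> (0 : R) -> u @ \oo --> (0 : R).
Proof.
move=> uc c0; apply: (@squeeze_cvgr _ _ _ _ (fun=> 0) c) => //; last exact: cvg_cst.
by near=> n; exact: uc.
Unshelve. all: by end_near. Qed.

Lemma cvgr_dist_le (R : realType) (u c : nat -> R) (l : R) :
  (forall n, `|u n - l| <= c n) -> c @ \oo --> (0 : R) -> u @ \oo --> l.
Proof.
move=> uc c0; apply/subr_cvg0/norm_cvg0P; apply: (@cvgr0_le _ _ c) => // n.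
by rewrite normr_ge0 uc.
Qed.

Lemma cvgr_ge_near (R : realType) (u : nat -> R) (l a : R) :
  u @ \oo --> l -> (\forall n \near \oo, a <= u n) -> a <= l.
Proof. by move=> ul h; apply: (ler_cvg_to (cvg_cst a) ul). Qed.

Lemma cvg_sqrt0 (R : realType) (u : nat -> R) :
  u @ \oo --> (0 : R) -> (fun n => Num.sqrt (u n)) @ \oo --> (0 : R).
Proof.
move=> h; rewrite -[X in _ --> X](@sqrtr0 R).
by apply: (cvg_comp _ _ h); exact: sqrt_continuous.
Qed.

Lemma cvgZ_harmonic (R : realType) (a : R) :
  (fun n => a * n.+1%:R^-1) @ \oo --> (0 : R).
Proof.
by rewrite -[X in _ --> X](mulr0 a); apply: cvgM; [exact: cvg_cst | exact: cvg_harmonic].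
Qed.

Section SemiHilbert.
Context (R : realType) (V : lmodType R) (m : V -> V -> R) (H : semi_hilbert m).
Implicit Types u v w : V.

Lemma shDl u v w : m (u + v) w = m u w + m v w.
Proof. by have := sh_lin H 1 u v w; rewrite scale1r mul1r. Qed.
Lemma sh0l w : m 0 w = 0.
Proof. have := shDl 0 0 w; rewrite addr0; lra. Qed.
Lemma shZl a u w : m (a *: u) w = a * m u w.
Proof. by have := sh_lin H a u 0 w; rewrite addr0 sh0l addr0. Qed.
Lemma shNl u w : m (- u) w = - m u w.
Proof. by rewrite -scaleN1r shZl mulN1r. Qed.
Lemma shDr u v w : m w (u + v) = m w u + m w v.
Proof. by rewrite sh_sym // shDl ![m _ w]sh_sym. Qed.
Lemma sh0r w : m w 0 = 0. Proof. by rewrite sh_sym // sh0l. Qed.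
Lemma shZr a u w : m w (a *: u) = a * m w u.
Proof. by rewrite sh_sym // shZl [m _ w]sh_sym. Qed.
Lemma shNr u w : m w (- u) = - m w u.
Proof. by rewrite sh_sym // shNl [m _ w]sh_sym. Qed.
Definition shE := (shDl, shDr, shZl, shZr, shNl, shNr, sh0l, sh0r).

Lemma hn_ge0 u : 0 <= hn m u. Proof. exact: sqrtr_ge0. Qed.
Lemma hn_sqr u : hn m u ^+ 2 = m u u. Proof. by rewrite sqr_sqrtr // sh_ge0. Qed.
Lemma hn0 : hn m 0 = 0. Proof. by rewrite /hn sh0l sqrtr0. Qed.
Lemma hnN u : hn m (- u) = hn m u. Proof. by rewrite /hn !shE opprK. Qed.
Lemma hnBC u v : hn m (u - v) = hn m (v - u). Proof. by rewrite -hnN opprB. Qed.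
Lemma hnZ a u : hn m (a *: u) = `|a| * hn m u.
Proof. by rewrite /hn !shE mulrA -expr2 sqrtrM ?sqr_ge0 // sqrtr_sqr. Qed.

Lemma hn_eq0P u : hn m u = 0 <-> m u u = 0.
Proof.
split=> h; first by rewrite -hn_sqr h expr0n.
by rewrite /hn h sqrtr0.
Qed.

Lemma cauchy_schwarz u v : `|m u v| <= hn m u * hn m v.
Proof.
have [v0|v0] := eqVneq (m v v) 0.
  have -> : m u v = 0.
    apply: (@quadratic_ge0_lin _ _ (m u u)) => [|t]; first exact: sh_ge0.
    have := sh_ge0 H (t *: u + v).
    by rewrite !shE v0 (sh_sym H v u); lra.
  by rewrite normr0 mulr_ge0 ?hn_ge0.
have vp : 0 < m v v by rewrite lt_def v0 sh_ge0.
have := sh_ge0 H (m v v *: u - m u v *: v).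
rewrite !shE (sh_sym H v u) => h.
have : 0 <= m v v * (m u u * m v v - m u v ^+ 2) by move: h; lra.
rewrite pmulr_rge0 // subr_ge0 => h2.
rewrite -(@ler_pXn2r _ 2) // ?nnegrE ?mulr_ge0 ?hn_ge0 //.
by rewrite exprMn !hn_sqr real_normK // num_real.
Qed.

Lemma hnD u v : hn m (u + v) <= hn m u + hn m v.
Proof.
rewrite -(@ler_pXn2r _ 2) // ?nnegrE ?addr_ge0 ?hn_ge0 //.
rewrite sqrrD !hn_sqr !shE (sh_sym H v u).
have := cauchy_schwarz u v; have := ler_norm (m u v); lra.
Qed.

Lemma hnB u v : hn m (u - v) <= hn m u + hn m v.
Proof. by rewrite -(hnN v) hnD. Qed.

Lemma hnBD w u v : hn m (u - v) <= hn m (u - w) + hn m (w - v).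
Proof. by apply: le_trans (hnD _ _); rewrite addrA subrK. Qed.

Lemma hn_le u v : hn m u <= hn m (u - v) + hn m v.
Proof. by apply: le_trans (hnD _ _); rewrite subrK. Qed.

Lemma hn_dist u v : `|hn m u - hn m v| <= hn m (u - v).
Proof.
rewrite ler_norml; have := hn_le u v; have := hn_le v u; rewrite (hnBC v u).
by move=> h1 h2; apply/andP; split; lra.
Qed.

Lemma hn_null_l u w : hn m u = 0 -> m u w = 0.
Proof.
move=> u0; apply/eqP; rewrite -normr_eq0 eq_le normr_ge0 andbT.
by apply: le_trans (cauchy_schwarz _ _) _; rewrite u0 mul0r.
Qed.

Lemma hn_cvg (u : nat -> V) l :
  (fun k => m (u k - l) (u k - l)) @ \oo --> (0 : R) ->
  (fun k => hn m (u k - l)) @ \oo --> (0 : R).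
Proof. exact: cvg_sqrt0. Qed.

(** Letting one index tend to infinity keeps the Cauchy modulus [c] as an error bound for the limit.
    For families indexed by time this yields convergence uniform in time. *)
Lemma hn_complete (u : nat -> V) (c : nat -> R) :
  c @ \oo --> (0 : R) ->
  (forall N j k, (N <= j)%N -> (N <= k)%N -> hn m (u j - u k) <= c N) ->
  exists l, (fun k => hn m (u k - l)) @ \oo --> (0 : R) /\
            (forall k, hn m (u k - l) <= c k).
Proof.
move=> c0 uc.
have [|l ul] := @sh_complete _ _ _ H u.
  move=> e e0.
  have se : 0 < Num.sqrt e by rewrite sqrtr_gt0.
  have /cvgr0Pnorm_lt /(_ _ se) [N _ hN] := c0.
  exists N => j k Nj Nk; rewrite -hn_sqr.
  rewrite -[e]sqr_sqrtr ?(ltW e0) // ltr_pXn2r // ?nnegrE ?hn_ge0 ?sqrtr_ge0 //.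
  apply: le_lt_trans (uc N j k Nj Nk) _.
  by apply: le_lt_trans (hN N (leqnn N)); exact: ler_norm.
exists l; have ul' := hn_cvg ul; split => // k.
have lk : (fun j => hn m (u j - l) + c k) @ \oo --> c k.
  by rewrite -[X in _ --> X]add0r; apply: cvgD ul' _; exact: cvg_cst.
apply: (cvgr_ge_near lk).
near=> j; rewrite (hnBC _ l).
apply: le_trans (hnBD (u j) _ _) _.
rewrite (hnBC l) lerD2l uc //.
by near: j; exact: nbhs_infty_ge.
Unshelve. all: by end_near. Qed.

Lemma sh_cvg (u : nat -> V) l w :
  (fun k => hn m (u k - l)) @ \oo --> (0 : R) -> (fun k => m (u k) w) @ \oo --> m l w.
Proof.
move=> ul; apply: (@cvgr_dist_le _ _ (fun k => hn m (u k - l) * hn m w)) => [k|].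
  by rewrite -shNl -shDl cauchy_schwarz.
by rewrite -(mul0r (hn m w)); apply: cvgM ul _; exact: cvg_cst.
Qed.

(* Minimizing [m u u - 2 l u] over a subspace. *)
Lemma riesz_subspace (S : set V) (l : V -> R) (C : R) :
  S 0 -> (forall a u v, S u -> S v -> S (a *: u + v)) ->
  (forall a u v, S u -> S v -> l (a *: u + v) = a * l u + l v) ->
  (forall u, S u -> `|l u| <= C * hn m u) ->
  exists p, (exists2 s : nat -> V, forall k, S (s k) &
               (fun k => hn m (s k - p)) @ \oo --> (0 : R)) /\
            forall s, S s -> m p s = l s.
Proof.
move=> S0 SL lL lC.
pose J u := m u u - 2 * l u.
have l0 : l 0 = 0 by have := lL 1 0 0 S0 S0; rewrite scale1r addr0; lra.
have SZ a u : S u -> S (a *: u) by move=> Su; rewrite -[_ *: _]addr0; exact: SL.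
have lZ a u : S u -> l (a *: u) = a * l u.
  by move=> Su; have := lL a u 0 Su S0; rewrite l0 !addr0.
have Jlow u : S u -> - C ^+ 2 <= J u.
  move=> Su; rewrite /J -hn_sqr; have := lC _ Su; have := ler_norm (l u).
  have := sqr_ge0 (hn m u - C); rewrite sqrrB; lra.
pose A := [set J u | u in S].
have infA : has_inf A.
  by split; [exists (J 0), 0 | exists (- C ^+ 2) => _ [u Su <-]; exact: Jlow].
pose d := inf A.
have Jd u : S u -> d <= J u by move=> Su; apply: ge_inf; [case: infA | exists u].
have /choice[s sP] (k : nat) : exists u, S u /\ J u <= d + k.+1%:R^-1.
  have [_ [u Su <-] /ltW Ju] : exists2 x, A x & x < d + k.+1%:R^-1.
    by apply: inf_adherent => //; rewrite invr_gt0.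
  by exists u.
(* The parallelogram identity at the midpoint of two almost minimizers. *)
have par j k : hn m (s j - s k) ^+ 2 <= 2 * (j.+1%:R^-1 + k.+1%:R^-1).
  have [Sj Jj] := sP j; have [Sk Jk] := sP k.
  have Sjk : S (2^-1 *: s j + 2^-1 *: s k).
    by apply: SL => //; exact: SZ.
  have := Jd _ Sjk; rewrite /J lL ?lZ //; last exact: SZ.
  move: Jj Jk; rewrite /J hn_sqr !shE (sh_sym H (s k) (s j)); set a := j.+1%:R^-1; set b := k.+1%:R^-1; lra.
have hcvg : (fun N => Num.sqrt (4 * N.+1%:R^-1)) @ \oo --> (0 : R).
  exact/cvg_sqrt0/cvgZ_harmonic.
have [|p [sp _]] := @hn_complete s _ hcvg.
  move=> N j k Nj Nk.
  rewrite -(@ler_pXn2r _ 2) // ?nnegrE ?hn_ge0 ?sqrtr_ge0 //.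
  rewrite [leRHS]sqr_sqrtr ?mulr_ge0 ?invr_ge0 //.
  apply: le_trans (par _ _) _.
  have : j.+1%:R^-1 <= N.+1%:R^-1 :> R by rewrite lef_pV2 ?posrE // ler_nat.
  have : k.+1%:R^-1 <= N.+1%:R^-1 :> R by rewrite lef_pV2 ?posrE // ler_nat.
  by set a := j.+1%:R^-1; set b := k.+1%:R^-1; set c := N.+1%:R^-1; lra.
exists p; split; first by exists s => // k; case: (sP k).
move=> x Sx; apply/eqP; rewrite -subr_eq0; apply/eqP.
apply: (@quadratic_ge0_lin _ _ (m x x)) => [|t]; first exact: sh_ge0.
(* First variation along the minimizing sequence instead of at [p]: the subspace is not assumed
   closed, so [p] may lie outside of it and cannot be used as a competitor. *)
have hx : (fun k => 2 * t * (m (s k) x - l x) + t ^+ 2 * m x x + k.+1%:R^-1) @ \oo -->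
    2 * t * (m p x - l x) + t ^+ 2 * m x x + 0.
  apply: cvgD (@cvg_harmonic R); apply: cvgD; last exact: cvg_cst.
  apply: cvgM; first exact: cvg_cst.
  by apply: cvgB; [exact: sh_cvg | exact: cvg_cst].
rewrite addr0 in hx; apply: (cvgr_ge_near hx).
near=> k.
have [Sk Jk] := sP k.
have := Jd _ (SL t _ _ Sx Sk); move: Jk; rewrite /J lL // !shE (sh_sym H x (s k)); set e := k.+1%:R^-1.
by lra.
Unshelve. all: by end_near. Qed.

Lemma riesz (l : V -> R) (C : R) :
  (forall a u v, l (a *: u + v) = a * l u + l v) ->
  (forall u, `|l u| <= C * hn m u) -> exists p, forall u, m p u = l u.
Proof.
move=> lL lC.
have [||||p [_ pl]] := @riesz_subspace setT l C; rewrite //.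
by exists p => u; exact: pl.
Qed.

(** The functional [m x] restricted to [S] is represented by a limit [p] of elements of [S]; then
    [p - x] is orthogonal to [S], hence null. *)
Lemma dense_subspace (S : set V) :
  S 0 -> (forall a u v, S u -> S v -> S (a *: u + v)) ->
  (forall z, (forall s, S s -> m z s = 0) -> hn m z = 0) ->
  forall x, exists2 s : nat -> V, forall k, S (s k) &
    (fun k => hn m (s k - x)) @ \oo --> (0 : R).
Proof.
move=> S0 SL So x.
have [||||p [[s Ss sp] pl]] := @riesz_subspace S (m x) (hn m x); rewrite //.
- by move=> a u v _ _; rewrite !shE.
- by move=> u _; exact: cauchy_schwarz.
have px : hn m (p - x) = 0 by apply: So => u Su; rewrite !shE pl // subrr.
exists s => //; apply: cvgr0_le sp => k; rewrite hn_ge0 /=.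
by apply: le_trans (hnBD p _ _) _; rewrite px addr0.
Qed.

End SemiHilbert.

(** * Integrals of real functions over compact intervals *)

Section IntervalIntegral.
Context (R : realType).
Implicit Types (f g : R -> R) (s t : R).

(** Integrability is asked on all compact intervals, so that splitting an integral leaves no side
    condition. *)
Definition ii f :=
  forall s t, (@lebesgue_measure R).-integrable `[s, t] (EFin \o f).
(** There is no orientation: for [t < s] the interval is empty and the value is 0. *)
Definition iint f s t : R := \int[@lebesgue_measure R]_(r in `[s, t]) f r.

Lemma ii_continuous f : continuous f -> ii f.
Proof.
move=> cf s t; apply: continuous_compact_integrable; first exact: segment_compact.
by apply: continuous_subspaceT.
Qed.

Lemma ii_cst c : ii (fun=> c).
Proof. by apply: ii_continuous => x; exact: cvg_cst. Qed.

Lemma iiD f g : ii f -> ii g -> ii (fun r => f r + g r).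
Proof.
move=> hf hg s t; rewrite (_ : _ \o _ = (EFin \o f) \+ (EFin \o g))%E //.
exact: integrableD.
Qed.

Lemma iiZ a f : ii f -> ii (fun r => a * f r).
Proof.
move=> hf s t; rewrite (_ : _ \o _ = (fun r => a%:E * (EFin \o f) r))%E //.
exact: integrableZl.
Qed.

Lemma iiB f g : ii f -> ii g -> ii (fun r => f r - g r).
Proof.
move=> hf hg; have := iiD hf (iiZ (-1) hg).
by under [X in ii X -> _]eq_fun do rewrite mulN1r.
Qed.

Lemma ii_norm f : ii f -> ii (fun r => `|f r|).
Proof. by move=> hf s t; have := integrable_abse (hf s t). Qed.

Lemma iint_add f s t u : ii f -> s <= t -> t <= u ->
  iint f s u = iint f s t + iint f t u.
Proof.
move=> hf st tu; rewrite /iint.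
have := @Rintegral_itvB _ f (BLeft s) (BRight u) t (hf s u).
rewrite !bnd_simp => /(_ st tu) h.
rewrite -[X in _ = _ + X]Rintegral_itv_obnd_cbnd; first by rewrite -h addrC subrK.
apply: integrableS (hf t u) => //.
by move=> r /=; rewrite !in_itv /= => /andP[/ltW -> ->].
Qed.

Lemma iint_refl f s : iint f s s = 0.
Proof. by rewrite /iint set_itv1 Rintegral_set1. Qed.

Lemma iintD f g s t : ii f -> ii g ->
  iint (fun r => f r + g r) s t = iint f s t + iint g s t.
Proof. by move=> hf hg; exact: RintegralD. Qed.

Lemma iintB f g s t : ii f -> ii g ->
  iint (fun r => f r - g r) s t = iint f s t - iint g s t.
Proof. by move=> hf hg; exact: RintegralB. Qed.

Lemma iintZ a f s t : ii f -> iint (fun r => a * f r) s t = a * iint f s t.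
Proof. by move=> hf; exact: RintegralZl. Qed.

Lemma iint_cst c s t : s <= t -> iint (fun=> c) s t = (t - s) * c.
Proof.
move=> st; rewrite /iint Rintegral_cst // mulrC; congr (_ * _).
rewrite -[RHS]/(fine (t - s)%:E); congr fine.
apply: (etrans (lebesgue_measure_itv _)); rewrite /= lte_fin.
by case: ltP => // ts; congr EFin; lra.
Qed.

Lemma eq_iint f g s t : (forall r, s <= r <= t -> f r = g r) ->
  iint f s t = iint g s t.
Proof.
by move=> h; apply: eq_Rintegral => r; rewrite inE /= in_itv /= => /h.
Qed.

Lemma iint_le f g s t : ii f -> ii g ->
  (forall r, s <= r <= t -> f r <= g r) -> iint f s t <= iint g s t.
Proof.
by move=> hf hg h; apply: le_Rintegral => // r; rewrite /= in_itv /= => /h.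
Qed.

Lemma iint_ge0 f s t : (forall r, s <= r <= t -> 0 <= f r) -> 0 <= iint f s t.
Proof. by move=> h; apply: Rintegral_ge0 => r; rewrite /= in_itv /= => /h. Qed.

Lemma iint_norm f s t : ii f -> `|iint f s t| <= iint (fun r => `|f r|) s t.
Proof. by move=> hf; exact: le_normr_Rintegral. Qed.

Lemma iint_dist f q e s t : ii f -> s <= t ->
  (forall r, s <= r <= t -> `|f r - q| <= e) ->
  `|iint f s t - (t - s) * q| <= (t - s) * e.
Proof.
move=> hf st h; rewrite -iint_cst // -iintB //; last exact: ii_cst.
apply: le_trans (iint_norm _ _ _) _; first by apply: iiB => //; exact: ii_cst.
rewrite -iint_cst //; apply: iint_le => //; last exact: ii_cst.
by apply/ii_norm/iiB => //; exact: ii_cst.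
Qed.

Lemma iint_bound f e s t : ii f -> s <= t ->
  (forall r, s <= r <= t -> `|f r| <= e) -> `|iint f s t| <= (t - s) * e.
Proof.
move=> hf st h; have := @iint_dist f 0 e s t hf st; rewrite mulr0 subr0.
by apply => r /h; rewrite subr0.
Qed.

Lemma iint_le_sub f s t u v : ii f -> (forall r, 0 <= f r) ->
  s <= t -> t <= u -> u <= v -> iint f t u <= iint f s v.
Proof.
move=> hf f0 st tu uv.
rewrite (iint_add hf st) ?(le_trans tu) // (iint_add hf tu uv).
have := @iint_ge0 f s t (fun r _ => f0 r); have := @iint_ge0 f u v (fun r _ => f0 r).
lra.
Qed.

End IntervalIntegral.

(** The retraction of the line onto the interval from 0 to [T]. Functions of time are extended by
    constants through it, so that continuity can be stated on the whole line. *)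
Definition clamp (R : realType) (T t : R) : R := Num.max 0 (Num.min t T).

Lemma clamp_itv (R : realType) (T t : R) : 0 < T -> 0 <= clamp T t <= T.
Proof.
move=> T0; rewrite /clamp le_max lexx /= ge_max (ltW T0) /=.
by rewrite ge_min lexx orbT.
Qed.

Lemma clamp_id (R : realType) (T t : R) : 0 <= t <= T -> clamp T t = t.
Proof. by move=> /andP[t0 tT]; rewrite /clamp min_l // max_r. Qed.

Lemma clamp_lip (R : realType) (T s t : R) : `|clamp T s - clamp T t| <= `|s - t|.
Proof.
rewrite /clamp /Num.max /Num.min; do !case: ifPn; rewrite -?leNgt => *;
rewrite ler_norml; have := ler_norm (s - t); have := ler_norm (t - s);
rewrite distrC => *; apply/andP; split; lra.
Qed.

Lemma lebesgue_itv_lty (R : realType) (s t : R) :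
  ((@lebesgue_measure R) `[s, t] < +oo)%E.
Proof.
apply: (eq_ind_r (fun x => x < +oo)%E _ (lebesgue_measure_itv `[s, t])).
by rewrite /= lte_fin; case: ifP => _; rewrite ?ltry // -EFinB ltry.
Qed.

(* Reflexive normalization of linear combinations in a module: [lmod] reduces
   an equation between vectors to the equality of the coefficients. *)
Inductive lexp (R : Type) : Type :=
  LVar of nat | LZero | LAdd of lexp R & lexp R | LOpp of lexp R
| LScale of R & lexp R.
Arguments LVar {R}. Arguments LZero {R}.

Section LinearExpressions.
Context (R : pzRingType) (V : lmodType R).

Fixpoint leval (env : seq V) (e : lexp R) : V :=
  match e with
  | LVar k => nth 0 env k
  | LZero => 0
  | LAdd a b => leval env a + leval env b
  | LOpp a => - leval env a
  | LScale c a => c *: leval env a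
  end.

Fixpoint lcoef (n : nat) (e : lexp R) : R :=
  match e with
  | LVar k => if Nat.eqb k n then 1 else 0
  | LZero => 0
  | LAdd a b => lcoef n a + lcoef n b
  | LOpp a => - lcoef n a
  | LScale c a => c * lcoef n a
  end.

Fixpoint all_coef (n : nat) (a b : lexp R) : Prop :=
  if n is n'.+1 then lcoef n' a = lcoef n' b /\ all_coef n' a b else True.

Lemma leval_coef env e :
  leval env e = \sum_(i < size env) lcoef i e *: nth 0 env i.
Proof.
elim: e => [k||a IHa b IHb|a IHa|c a IHa] /=.
- have [kn|nk] := ltnP k (size env).
    rewrite (bigD1 (Ordinal kn)) //= PeanoNat.Nat.eqb_refl scale1r big1 ?addr0 //.
    move=> i; rewrite -val_eqE /= => /negPf ik.
    by case: PeanoNat.Nat.eqb_spec => [e|_]; [rewrite e eqxx in ik|rewrite scale0r].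
  rewrite nth_default // big1 // => i _.
  case: PeanoNat.Nat.eqb_spec => [e|_]; last by rewrite scale0r.
  by have := ltn_ord i; rewrite -e ltnNge nk.
- by rewrite big1 // => i _; rewrite scale0r.
- by rewrite IHa IHb -big_split /=; apply: eq_bigr => i _; rewrite scalerDl.
- by rewrite IHa -sumrN; apply: eq_bigr => i _; rewrite scaleNr.
- by rewrite IHa scaler_sumr; apply: eq_bigr => i _; rewrite scalerA.
Qed.

Lemma lmod_eq env a b : all_coef (size env) a b -> leval env a = leval env b.
Proof.
move=> h; rewrite !leval_coef; apply: eq_bigr => i _; congr (_ *: _).
elim: (size env) i h => [[]//|n IH] i /= [h1 h2].
have [e|ne] := eqVneq (i : nat) n; first by rewrite e.
have ltin : (i < n)%N by rewrite ltn_neqAle ne -ltnS ltn_ord.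
exact: (IH (Ordinal ltin)).
Qed.

End LinearExpressions.

Ltac lmod_find x env :=
  lazymatch env with
  | x :: _ => constr:(O)
  | _ :: ?t => let n := lmod_find x t in constr:(S n)
  end.
Ltac lmod_mem x env :=
  lazymatch env with
  | nil => constr:(false) | x :: _ => constr:(true) | _ :: ?t => lmod_mem x t end.
Ltac lmod_env e env :=
  lazymatch e with
  | GRing.add ?a ?b => let env := lmod_env a env in lmod_env b env
  | GRing.opp ?a => lmod_env a env
  | GRing.scale _ ?a => lmod_env a env
  | GRing.zero => env
  | _ => lazymatch lmod_mem e env with true => env | false => constr:(e :: env) end
  end.
Ltac lmod_quote R e env :=
  lazymatch e with
  | GRing.add ?a ?b => let a := lmod_quote R a env in let b := lmod_quote R b env in
      constr:(@LAdd R a b)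
  | GRing.opp ?a => let a := lmod_quote R a env in constr:(@LOpp R a)
  | GRing.scale ?c ?a => let a := lmod_quote R a env in constr:(@LScale R c a)
  | GRing.zero => constr:(@LZero R)
  | _ => let n := lmod_find e env in constr:(@LVar R n)
  end.
Ltac lmod_reduce R V :=
  lazymatch goal with |- ?a = ?b =>
    let env := lmod_env a (@nil (GRing.Lmodule.sort V)) in let env := lmod_env b env in
    let qa := lmod_quote (Real.sort R) a env in
    let qb := lmod_quote (Real.sort R) b env in
    change (@leval R V env qa = @leval R V env qb);
    apply: lmod_eq; cbn [size all_coef lcoef Nat.eqb]; repeat split
  end.
Ltac lmod R V := lmod_reduce R V; ring.

(** * The implicit Euler scheme *)

Section Evolution.
Context (R : realType) (V : lmodType R) (m : V -> V -> R) (H : semi_hilbert m).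
Context (I : Type) (p q : I -> V -> R).
Hypothesis p_lin : forall i a u v, p i (a *: u + v) = a * p i u + p i v.
Hypothesis q_lin : forall i a u v, q i (a *: u + v) = a * q i u + q i v.
Hypothesis p_bd : forall i, exists C, forall u, `|p i u| <= C * hn m u.
Hypothesis q_bd : forall i, exists C, forall u, `|q i u| <= C * hn m u.
Hypothesis p_inj : forall w, (forall i, p i w = 0) -> hn m w = 0.

(* [gr u w]: the generator, known only through the functionals, maps [u] to [w] *)
Definition gr (u w : V) := forall i, p i w = q i u.

Hypothesis gr_diss : forall u w, gr u w -> m w u <= 0.
Hypothesis gr_range : forall (h : R) f, 0 < h -> exists u, gr u (h^-1 *: (u - f)).

Lemma gr_lin a u w u' w' : gr u w -> gr u' w' -> gr (a *: u + u') (a *: w + w').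
Proof. by move=> h h' i; rewrite p_lin q_lin h h'. Qed.

Lemma grD u w u' w' : gr u w -> gr u' w' -> gr (u + u') (w + w').
Proof. by move=> h h'; have := gr_lin 1 h h'; rewrite !scale1r. Qed.

Lemma grB u w u' w' : gr u w -> gr u' w' -> gr (u - u') (w - w').
Proof.
move=> h h'; have := gr_lin (-1) h' h.
by rewrite !scaleN1r ![- _ + _]addrC.
Qed.

Lemma gr0 : gr 0 0.
Proof.
move=> i; have := p_lin i 1 0 0; have := q_lin i 1 0 0.
by rewrite scale1r addr0; lra.
Qed.

Lemma grZ a u w : gr u w -> gr (a *: u) (a *: w).
Proof. by move=> h; have := gr_lin a h gr0; rewrite !addr0. Qed.

(** By dissipativity the product of [u - h *: w] with [u] is at least the square of the norm of [u];
    Cauchy-Schwarz concludes. *)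
Lemma gr_contr h u w : 0 <= h -> gr u w -> hn m u <= hn m (u - h *: w).
Proof.
move=> h0 /gr_diss uw.
have [->|u0] := eqVneq (hn m u) 0; first exact: hn_ge0.
have up : 0 < hn m u by rewrite lt_def u0 hn_ge0.
rewrite -(ler_pM2r up) -expr2 (hn_sqr H).
apply: le_trans (le_trans (ler_norm _) (cauchy_schwarz H _ _)).
rewrite !(shDl H) !(shNl H) !(shZl H) lerDl oppr_ge0.
by rewrite mulr_ge0_le0.
Qed.

Lemma gr_fun u w w' : gr u w -> gr u w' -> hn m (w - w') = 0.
Proof.
move=> h h'; apply: p_inj => i.
by have := grB h h' i; rewrite subrr (_ : q i 0 = 0) //; have := gr0 i => <-;
  have := p_lin i 1 0 0; rewrite scale1r addr0; lra.
Qed.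

Lemma resolvent_contr h u f : 0 < h -> gr u (h^-1 *: (u - f)) -> hn m u <= hn m f.
Proof.
move=> h0 /(gr_contr (ltW h0)); rewrite scalerA divff ?gt_eqF // scale1r.
by rewrite opprB addrC subrK.
Qed.

(** The resolvent commutes with the generator: the difference quotient [w] of a step solves the step
    equation with the image [f1] of the datum. *)
Lemma resolvent_graph h u f f1 : 0 < h -> gr f f1 -> gr u (h^-1 *: (u - f)) ->
  let w := h^-1 *: (u - f) in gr w (h^-1 *: (w - f1)) /\ hn m w <= hn m f1.
Proof.
move=> h0 ff1 uw w.
have g : gr w (h^-1 *: (w - f1)) by apply: grZ; exact: grB.
by split => //; exact: resolvent_contr g.
Qed.

(** For [z] orthogonal to the domain, the solution [u] of the resolvent equation with datum [z] and
    step 1 is orthogonal to [z], so dissipativity makes it null; its image [u - z] is then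
    annihilated by all tests, and [z] is null. *)
Lemma gr_dom_dense (x : V) : exists2 s : nat -> V, forall k, exists w, gr (s k) w &
  (fun k => hn m (s k - x)) @ \oo --> (0 : R).
Proof.
apply: (dense_subspace H (S := [set u | exists w, gr u w])) => /=.
- by exists 0; exact: gr0.
- by move=> a u v [w uw] [w' vw']; exists (a *: w + w'); exact: gr_lin.
move=> z hz; have [u] := gr_range z ltr01; rewrite invr1 scale1r => uz.
have zu : m z u = 0 by apply: hz; exists (u - z).
have u0 : hn m u = 0.
  apply/hn_eq0P => //; apply/eqP; rewrite eq_le (sh_ge0 H) andbT.
  by have := gr_diss uz; rewrite (shDl H) (shNl H) zu subr0.
have : hn m (u - z) = 0.
  apply: p_inj => i; rewrite uz; apply/eqP; rewrite -normr_eq0 eq_le normr_ge0 andbT.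
  by have [C hC] := q_bd i; apply: le_trans (hC _) _; rewrite u0 mulr0.
move=> uz0; apply/eqP; rewrite eq_le (hn_ge0 m) andbT.
by apply: le_trans (hn_le H z u) _; rewrite (hnBC H) uz0 u0 addr0.
Qed.

(** Approximate [x] by [u] in the domain, and the image [w] of [u] by [w'] in the domain. The
    solution [u'] of the resolvent equation with datum [u - w'] has image [u' - u + w'], again in
    the domain, and contractivity bounds [u' - u] by [w' - w]. *)
Lemma gr_dom2_dense (x : V) (e : R) : 0 < e ->
  exists y y1 y2, [/\ gr y y1, gr y1 y2 & hn m (y - x) < e].
Proof.
move=> e0; have e20 : 0 < e / 2 by lra.
have near_dom (z : V) : exists u w, gr u w /\ hn m (u - z) < e / 2.
  have [s sD sz] := gr_dom_dense z.
  have /cvgr0Pnorm_lt /(_ _ e20) [N _ hN] := sz.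
  have [w sw] := sD N; exists (s N), w; split => //.
  by apply: le_lt_trans (hN N (leqnn N)); exact: ler_norm.
have [u [w [uw ux]]] := near_dom x.
have [w' [w1 [ww1 ww']]] := near_dom w.
have [u'] := gr_range (u - w') ltr01; rewrite invr1 scale1r => u'g.
have [v u'v] : exists v, gr (u' - (u - w')) v.
  by eexists; apply: grB u'g _; apply: grB uw ww1.
exists u', (u' - (u - w')), v; split => //.
apply: le_lt_trans (hnBD H u _ _) _.
suff : hn m (u' - u) <= hn m (w' - w) by move=> h; lra.
apply: le_trans (gr_contr (ler01) (grB u'g uw)) _.
rewrite (_ : _ - _ = - (w' - w)) ?(hnN H) //.
by lmod R V.
Qed.

(* One implicit Euler step of size [2 k] against two steps of size [k]. *)
Lemma half_step (k : R) (y y' a b b1 w1 w2 v z : V) : 0 < k -> gr b b1 ->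
  gr w1 (k^-1 *: (w1 - (y + a))) -> gr w2 (k^-1 *: (w2 - (w1 + b))) ->
  gr (k^-1 *: (w2 - (w1 + b))) v ->
  gr z ((2 * k)^-1 *: (z - (y' + (a + b)))) ->
  hn m (w2 - z) <= hn m (y - y') + k * (k * hn m v + hn m b1).
Proof.
move=> k0 bb1 g1 g2 gv gz; have kn := lt0r_neq0 k0.
have h2 : 0 < 2 * k by lra.
have h2n := lt0r_neq0 h2.
apply: le_trans (gr_contr (ltW h2) (grB g2 gz)) _.
set W1 := k^-1 *: _ in g1; set W2 := k^-1 *: (w2 - _) in g2 gv *.
(* The two schemes are driven by the same increment, so only the difference of the two consecutive
   discrete derivatives [W1] and [W2] is left. *)
have -> : w2 - z - (2 * k) *: (W2 - (2 * k)^-1 *: (z - (y' + (a + b)))) =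
    (y - y') + (- k) *: (W2 - W1).
  by rewrite /W1 /W2; lmod_reduce R V; field.
apply: le_trans (hnD H _ _) _; rewrite lerD2l (hnZ H) normrN gtr0_norm //.
rewrite ler_pM2l //.
(* Since [w2 - w1] lies in the domain, the second difference [W2 - W1] equals its image
   [k *: v + b1] up to a null vector; this gains the second factor [k]. *)
have e : w2 - w1 = k *: W2 + b by rewrite /W2; lmod_reduce R V; field.
have g3 : gr (w2 - w1) (k *: v + b1) by rewrite e; exact: gr_lin.
have := gr_fun (grB g2 g1) g3 => d0.
apply: le_trans (hn_le H _ (k *: v + b1)) _; rewrite d0 add0r.
by apply: le_trans (hnD H _ _) _; rewrite (hnZ H) gtr0_norm.
Qed.

Definition resolvent h f : V := xget 0 [set u | gr u (h^-1 *: (u - f))].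

Lemma resolventP h f : 0 < h -> gr (resolvent h f) (h^-1 *: (resolvent h f - f)).
Proof. by move=> /(gr_range f); exact: (xgetPex 0). Qed.

(** * Convergence of the scheme for data to which the generator applies twice *)

Section SmoothData.
Context (T : R) (y y1 y2 : V) (al al1 al2 : R -> V) (be : R -> R) (L : R).
Hypothesis T0 : 0 < T.
Hypotheses (yy1 : gr y y1) (y1y2 : gr y1 y2).
Hypotheses (gal : forall t, gr (al t) (al1 t)) (gal1 : forall t, gr (al1 t) (al2 t)).
Hypothesis L0 : 0 <= L.
Hypothesis al_lip : forall s t, hn m (al t - al s) <= L * `|t - s|.
Hypothesis al1_lip : forall s t, hn m (al1 t - al1 s) <= L * `|t - s|.
Hypothesis al2_lip : forall s t, hn m (al2 t - al2 s) <= L * `|t - s|.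
Hypothesis al_be : forall s t : R, 0 <= s -> s <= t -> t <= T ->
  hn m (al t - al s) <= be t - be s.

(** [al] stands for the time primitive of the force, and a step adds its increment. Only Lipschitz
    bounds of [al] and of its images [al1], [al2] under the generator enter the error; [be]
    majorizes the variation of [al] and gives the stability bound without loss. *)
Fixpoint euler (h : R) (j : nat) : V :=
  if j is j'.+1 then
    resolvent h (euler h j' + (al (j'.+1%:R * h) - al (j'%:R * h)))
  else y.

Let M := hn m y1 + hn m y2 + L * T.

Lemma M_ge0 : 0 <= M.
Proof. by rewrite /M !addr_ge0 ?hn_ge0 // mulr_ge0 // ltW. Qed.

(** Since the resolvent commutes with the generator, both successive images of an iterate are
    propagated by the same contraction and grow by at most [L * h] per step. For [j = 0] the first
    image is [y1], which is no difference quotient; hence the restriction in the last clause. *)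
Lemma euler_chain (h : R) j : 0 < h -> j%:R * h <= T ->
  exists v w, [/\ gr (euler h j) v, gr v w, hn m v <= M, hn m w <= M &
    j != 0%N ->
    v = h^-1 *: (euler h j - (euler h j.-1 + (al (j%:R * h) - al (j.-1%:R * h))))].
Proof.
move=> h0 jT.
suff [v [w [h1 h2 h3 h4 h5]]] : exists v w, [/\ gr (euler h j) v, gr v w,
    hn m v <= hn m y1 + L * (j%:R * h), hn m w <= hn m y2 + L * (j%:R * h) &
    j != 0%N -> v = h^-1 *:
      (euler h j - (euler h j.-1 + (al (j%:R * h) - al (j.-1%:R * h))))].
  have := ler_wpM2l L0 jT; have := hn_ge0 m y1; have := hn_ge0 m y2 => a1 a2 a3.
  by exists v, w; split => //; rewrite /M; lra.
elim: j jT => [_|j IH jT].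
  by exists y1, y2; rewrite mul0r mulr0 !addr0; split.
have jh : j%:R * h <= T.
  by apply: le_trans jT; rewrite ler_pM2r // ler_nat.
have [v [w [uv vw bv bw _]]] := IH jh.
set D := fun a : R -> V => a (j.+1%:R * h) - a (j%:R * h).
have dist : `|j.+1%:R * h - j%:R * h| = h.
  by rewrite -mulrBl -natrB // subSnn mul1r gtr0_norm.
have Dlip a : (forall s t, hn m (a t - a s) <= L * `|t - s|) -> hn m (D a) <= L * h.
  by move=> al_; apply: le_trans (al_ _ _) _; rewrite dist.
have g1 : gr (euler h j + D al) (v + D al1) by apply: grD => //; exact: grB.
have g2 : gr (v + D al1) (w + D al2) by apply: grD => //; exact: grB.
have [g3 b3] := resolvent_graph h0 g1 (resolventP (euler h j + D al) h0).
have [g4 b4] := resolvent_graph h0 g2 g3.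
have e : L * (j.+1%:R * h) = L * (j%:R * h) + L * h.
  by rewrite -[j.+1%:R]natr1; ring.
eexists; eexists; split; [exact: resolventP|exact: g3| | |by []].
- apply: le_trans b3 _; apply: le_trans (hnD H _ _) _; rewrite e addrA lerD //.
  exact: Dlip.
- apply: le_trans b4 _; apply: le_trans (hnD H _ _) _; rewrite e addrA lerD //.
  exact: Dlip.
Qed.

Lemma euler_bound (h : R) j : 0 < h -> j%:R * h <= T ->
  hn m (euler h j) <= hn m y + (be (j%:R * h) - be 0).
Proof.
move=> h0; elim: j => [_|j IH jT]; first by rewrite mul0r subrr addr0.
have jh1 : j%:R * h <= j.+1%:R * h by rewrite ler_pM2r // ler_nat.
have jh := le_trans jh1 jT.
apply: le_trans (resolvent_contr h0 (resolventP _ h0)) _.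
apply: le_trans (hnD H _ _) _.
have := IH jh; have := al_be (mulr_ge0 (ler0n _ j) (ltW h0)) jh1 jT; lra.
Qed.

Lemma euler_incr (h : R) j : 0 < h -> j.+1%:R * h <= T ->
  hn m (euler h j.+1 - euler h j) <= h * (M + L).
Proof.
move=> h0 jT; have [v [w [_ _ bv _ /(_ isT)]]] := euler_chain h0 jT.
set F := euler h j.+1.-1 + _ => e.
have -> : euler h j.+1 - euler h j =
    h *: v + (al (j.+1%:R * h) - al (j%:R * h)).
  by rewrite e /F -pred_Sn; lmod_reduce R V; field; rewrite gt_eqF.
apply: le_trans (hnD H _ _) _; rewrite (hnZ H) gtr0_norm // mulrDr lerD //.
  by rewrite ler_pM2l.
apply: le_trans (al_lip _ _) _.
by rewrite -mulrBl -natrB // subSnn mul1r gtr0_norm // mulrC.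
Qed.

(** By [half_step] each coarse step adds at most a quarter of [h ^+ 2 * (M + L)]; the factor is
    dropped. *)
Lemma euler_half (h : R) j : 0 < h -> j%:R * h <= T ->
  hn m (euler (h / 2) j.*2 - euler h j) <= j%:R * (h ^+ 2 * (M + L)).
Proof.
move=> h0; have k0 : 0 < h / 2 by lra.
elim: j => [_|j IH jT]; first by rewrite mul0r subrr (hn0 H).
have jh : j%:R * h <= T by apply: le_trans jT; rewrite ler_pM2r // ler_nat.
have tj (i : nat) : i.*2%:R * (h / 2) = i%:R * h.
  by rewrite -muln2 natrM; field.
have jT2 : j.*2.+2%:R * (h / 2) <= T by rewrite -doubleS tj.
have [v [w [gv gw bv bw /(_ isT) ev]]] := euler_chain k0 jT2.
set t1 := j.*2.+1%:R * (h / 2).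
have E : hn m (euler (h / 2) j.*2.+2 - euler h j.+1) <=
    hn m (euler (h / 2) j.*2 - euler h j) +
    (h / 2) * ((h / 2) * hn m w + hn m (al1 (j.*2.+2%:R * (h / 2)) - al1 t1)).
  apply: (@half_step (h / 2) _ _ (al t1 - al (j.*2%:R * (h / 2)))
    (al (j.*2.+2%:R * (h / 2)) - al t1) _ (euler (h / 2) j.*2.+1)) => //.
  - exact: grB.
  - exact: resolventP.
  - exact: resolventP.
  - by rewrite -ev.
  - rewrite (_ : 2 * (h / 2) = h); last by field.
    rewrite (_ : al t1 - _ + _ = al (j.+1%:R * h) - al (j%:R * h)); first exact: resolventP.
    by rewrite -doubleS !tj; lmod R V.
rewrite doubleS; apply: le_trans E _.
have := al1_lip t1 (j.*2.+2%:R * (h / 2)).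
rewrite /t1 -mulrBl -natrB // subSnn mul1r gtr0_norm //.
move: (hn m _) (IH jh) => b IHj bL.
have -> : j.+1%:R * (h ^+ 2 * (M + L)) = j%:R * (h ^+ 2 * (M + L)) + h ^+ 2 * (M + L).
  by rewrite -natr1 mulrDl mul1r.
apply: lerD => //.
have h1 := ler_wpM2l (ltW k0) bw; have h2 := ler_wpM2l (ltW k0) bL.
have h3 := ler_wpM2l (ltW k0) (lerD h1 bL).
apply: le_trans h3 _.
have := mulr_ge0 (sqr_ge0 h) M_ge0; have := mulr_ge0 (sqr_ge0 h) L0.
by rewrite expr2; lra.
Qed.

(** Dyadic steps make successive grids nested. [uk k] is the scheme frozen at the last grid point
    before [t]. In [C], the summand [T] pays for the accumulated error and the summand 1 for a
    possible additional fine step. *)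
Let hk (k : nat) := T / 2 ^+ k.
Let uk k t : V := euler (hk k) (Num.truncn (t / hk k)).
Let C := (T + 1) * (M + L).

Lemma hk_gt0 k : 0 < hk k.
Proof. by rewrite divr_gt0 // exprn_gt0. Qed.

Lemma hkS k : hk k.+1 = hk k / 2.
Proof. by rewrite /hk exprS; field; rewrite expf_neq0. Qed.

Lemma hk_cvg0 : hk @ \oo --> (0 : R).
Proof.
have -> : hk = (fun k => T * 2^-1 ^+ k).
  by apply/funext => k; rewrite /hk exprVn.
rewrite -[X in _ --> X](mulr0 T); apply: cvgM; first exact: cvg_cst.
by apply: cvg_expr; rewrite ger0_norm; lra.
Qed.

Lemma trunc_hk k (t : R) : 0 <= t ->
  (Num.truncn (t / hk k))%:R * hk k <= t < (Num.truncn (t / hk k))%:R * hk k + hk k.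
Proof.
move=> t0; have h0 := hk_gt0 k.
have /truncn_itv : 0 <= t / hk k by rewrite divr_ge0 // ltW.
set n := Num.truncn _ => /andP[a b]; rewrite -ler_pdivlMr // a /=.
rewrite -[X in _ < _ + X]mul1r -mulrDl natr1 -ltr_pdivrMr //.
Qed.

Lemma ML_ge0 : 0 <= M + L. Proof. exact: addr_ge0 M_ge0 L0. Qed.

Lemma C_ge0 : 0 <= C.
Proof. by rewrite mulr_ge0 ?ML_ge0 // addr_ge0 // ltW. Qed.

Lemma uk_step k t : 0 <= t <= T -> hn m (uk k.+1 t - uk k t) <= hk k * C.
Proof.
move=> /andP[t0 tT]; rewrite /uk.
set n := Num.truncn (t / hk k); set n' := Num.truncn _.
have /andP[a1 a2] := trunc_hk k t0; rewrite -/n in a1 a2.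
have /andP[b1 b2] := trunc_hk k.+1 t0; rewrite -/n' hkS in b1 b2.
have h0 := hk_gt0 k; have k0 : 0 < hk k / 2 by lra.
have half := euler_half h0 (le_trans a1 tT).
have b3 : n%:R * (hk k ^+ 2 * (M + L)) <= hk k * (T * (M + L)).
  rewrite expr2 -mulrA mulrCA ler_pM2l // mulrA ler_wpM2r ?ML_ge0 //.
  exact: le_trans a1 tT.
(* The fine index depends on which half of the coarse cell contains [t]. *)
have : n' = n.*2 \/ n' = n.*2.+1.
  have tj (i : nat) : i.*2%:R * (hk k / 2) = i%:R * hk k.
    by rewrite -muln2 natrM; field.
  have e1 : (n.*2 <= n')%N.
    rewrite -ltnS -(ltr_nat R) -(ltr_pM2r k0) tj -[n'.+1%:R]natr1; lra.
  have e2 : (n' <= n.*2.+1)%N.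
    rewrite -ltnS -(ltr_nat R) -(ltr_pM2r k0) -doubleS tj -[n.+1%:R]natr1; lra.
  by move: e1 e2; rewrite leq_eqVlt => /orP[/eqP <-|]; [left|right; apply/eqP; rewrite eqn_leq; apply/andP].
case=> en; rewrite en hkS; rewrite en in b1.
  apply: le_trans half _; apply: le_trans b3 _.
  by rewrite ler_pM2l // /C mulrDl lerDl mul1r ML_ge0.
apply: le_trans (hnBD H (euler (hk k / 2) n.*2) _ _) _.
have := euler_incr k0 (le_trans b1 tT); have := mulr_ge0 (ltW h0) ML_ge0.
move: half b3; rewrite /C mulrDl mul1r; lra.
Qed.

(** The bounds of [uk_step] telescope, because [hk k] is twice [hk k - hk k.+1]. *)
Lemma uk_dist k n t : 0 <= t <= T ->
  hn m (uk (k + n) t - uk k t) <= 2 * C * (hk k - hk (k + n)).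
Proof.
move=> tT; elim: n => [|n IH]; first by rewrite addn0 !subrr (hn0 H) mulr0.
apply: le_trans (hnBD H (uk (k + n) t) _ _) _; rewrite addnS.
have := uk_step (k + n) tT; rewrite hkS => h; move: IH; lra.
Qed.

Lemma uk_cauchy N j k t : 0 <= t <= T -> (N <= j)%N -> (N <= k)%N ->
  hn m (uk j t - uk k t) <= 4 * C * hk N.
Proof.
move=> tT Nj Nk; apply: le_trans (hnBD H (uk N t) _ _) _.
have := uk_dist N (k - N) tT; have := uk_dist N (j - N) tT.
rewrite !subnKC // (hnBC H (uk N t)).
have := mulr_ge0 C_ge0 (ltW (hk_gt0 j)); have := mulr_ge0 C_ge0 (ltW (hk_gt0 k)).
lra.
Qed.

Lemma euler_dist (h : R) i j : 0 < h -> (i <= j)%N -> j%:R * h <= T ->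
  hn m (euler h j - euler h i) <= (j%:R - i%:R) * h * (M + L).
Proof.
move=> h0; elim: j => [|j IH].
  by rewrite leqn0 => /eqP ->; rewrite !subrr (hn0 H) !mul0r.
rewrite leq_eqVlt => /orP[/eqP -> _|]; first by rewrite !subrr (hn0 H) !mul0r.
rewrite ltnS => ij jT; apply: le_trans (hnBD H (euler h j) _ _) _.
have jh : j%:R * h <= T by apply: le_trans jT; rewrite ler_pM2r // ler_nat.
have := IH ij jh; have := euler_incr h0 jT; rewrite -[j.+1%:R]natr1; lra.
Qed.

Lemma uk_lip k s t : 0 <= s -> s <= t -> t <= T ->
  hn m (uk k t - uk k s) <= (t - s + hk k) * (M + L).
Proof.
move=> s0 st tT; have t0 := le_trans s0 st; have h0 := hk_gt0 k.
have /andP[a1 a2] := trunc_hk k t0; have /andP[b1 b2] := trunc_hk k s0.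
rewrite /uk; set n := Num.truncn _ in a1 a2 *; set l := Num.truncn _ in b1 b2 *.
have ln : (l <= n)%N by apply: le_truncn; rewrite ler_pM2r // invr_gt0.
apply: le_trans (euler_dist h0 ln (le_trans a1 tT)) _.
by rewrite ler_wpM2r ?ML_ge0 //; lra.
Qed.

Theorem smooth_solution : exists U : R -> V,
  [/\ forall s t, hn m (U t - U s) <= (M + L) * `|t - s|,
      hn m (U 0 - y) = 0,
      forall t, 0 <= t <= T -> hn m (U t) <= hn m y + (be T - be 0) &
      forall i t, 0 <= t <= T ->
        p i (U t) = p i y + iint (fun r => q i (U r)) 0 t + p i (al t - al 0)].
Proof.
have c0 : (fun k => 4 * C * hk k) @ \oo --> (0 : R).
  by rewrite -[X in _ --> X](mulr0 (4 * C)); apply: cvgM hk_cvg0; exact: cvg_cst.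
have /choice[U UP] (t : R) : exists l,
    (fun k => hn m (uk k (clamp T t) - l)) @ \oo --> (0 : R) /\
    (forall k, hn m (uk k (clamp T t) - l) <= 4 * C * hk k).
  by apply: (hn_complete H c0) => N j k; apply: uk_cauchy; exact: clamp_itv.
have UE (t : R) k : 0 <= t <= T -> hn m (uk k t - U t) <= 4 * C * hk k.
  by move=> tT; have [_ /(_ k)] := UP t; rewrite clamp_id.
(* An estimate whose error is proportional to every step size is exact. *)
have small (x D : R) : (forall k, x <= D * hk k) -> x <= 0.
  move=> xD; have hD : (fun k => D * hk k) @ \oo --> (0 : R).
    by rewrite -[X in _ --> X](mulr0 D); apply: cvgM hk_cvg0; exact: cvg_cst.
  by apply: (cvgr_ge_near hD); near=> k.
have ukc s t k : hn m (uk k (clamp T t) - uk k (clamp T s)) <=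
    (`|t - s| + hk k) * (M + L).
  wlog st : s t / clamp T s <= clamp T t.
    move=> W; have [/W//|/ltW /W] := leP (clamp T s) (clamp T t).
    by rewrite (hnBC H) distrC.
  have /andP[s0 _] := clamp_itv s T0; have /andP[_ tT] := clamp_itv t T0.
  apply: le_trans (uk_lip k s0 st tT) _.
  rewrite ler_wpM2r ?ML_ge0 // lerD2r; apply: le_trans (clamp_lip T _ _).
  exact: ler_norm.
have Ulip s t : hn m (U t - U s) <= (M + L) * `|t - s|.
  rewrite -subr_le0; apply: (small _ (8 * C + (M + L))) => k.
  have [_ /(_ k)] := UP t; have [_ /(_ k)] := UP s; have := ukc s t k.
  move=> h1 h2; rewrite (hnBC H) => h3.
  have := hnBD H (uk k (clamp T t)) (U t) (U s).
  have := hnBD H (uk k (clamp T s)) (uk k (clamp T t)) (U s).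
  move: h1 h2 h3; lra.
have U0 : hn m (U 0 - y) = 0.
  apply/eqP; rewrite eq_le (hn_ge0 m) andbT; apply: (small _ (4 * C)) => k.
  have /(UE 0 k) : 0 <= (0 : R) <= T by rewrite lexx ltW.
  by rewrite /uk mul0r truncn0 /= (hnBC H).
have be_le s t : 0 <= s -> s <= t -> t <= T -> be s <= be t.
  by move=> s0 st tT; have := al_be s0 st tT; have := hn_ge0 m (al t - al s); lra.
have Ubd t : 0 <= t <= T -> hn m (U t) <= hn m y + (be T - be 0).
  move=> tT; rewrite -subr_le0; apply: (small _ (4 * C)) => k.
  have /andP[t0 tT'] := tT; have /andP[a1 a2] := trunc_hk k t0.
  have := hn_le H (U t) (uk k t); rewrite (hnBC H); have := UE t k tT.
  have := euler_bound (hk_gt0 k) (le_trans a1 tT').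
  have := be_le _ _ (mulr_ge0 (ler0n _ _) (ltW (hk_gt0 k))) (le_trans a1 tT') (lexx T).
  by rewrite -/(uk k t); move: (be (_ * _)) => b; lra.
exists U; split => // i t tT.
have [Cp hp] := p_bd i; have [Cq hq] := q_bd i.
have pB u v : p i (u - v) = p i u - p i v.
  by rewrite addrC -scaleN1r p_lin mulN1r addrC.
have qB u v : q i (u - v) = q i u - q i v.
  by rewrite addrC -scaleN1r q_lin mulN1r addrC.
have pD u v : p i (u + v) = p i u + p i v.
  by rewrite -[u in LHS]scale1r p_lin mul1r.
pose Cp' : R := `|Cp|; pose Cq' : R := `|Cq|.
have hp' u : `|p i u| <= Cp' * hn m u.
  by apply: le_trans (hp _) _; rewrite ler_wpM2r ?hn_ge0 ?ler_norm.
have hq' u : `|q i u| <= Cq' * hn m u.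
  by apply: le_trans (hq _) _; rewrite ler_wpM2r ?hn_ge0 ?ler_norm.
have Cp0 : 0 <= Cp' by exact: normr_ge0.
have Cq0 : 0 <= Cq' by exact: normr_ge0.
have qc : continuous (fun r => q i (U r)).
  move=> r; apply/cvgrPdist_le => e e0.
  have D0 : 0 < Cq' * (M + L) + 1.
    by have := mulr_ge0 Cq0 ML_ge0; lra.
  near=> r'; rewrite -qB; apply: le_trans (hq' _) _.
  apply: le_trans (ler_wpM2l Cq0 (Ulip _ _)) _.
  rewrite mulrA; apply: (@le_trans _ _ ((Cq' * (M + L) + 1) * `|r - r'|)).
    by rewrite ler_wpM2r // lerDl.
  rewrite mulrC -ler_pdivlMr // distrC.
  by near: r'; apply: cvgr_distC_le; rewrite ?divr_gt0.
have qi := ii_continuous qc.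
have tr k (n : nat) : Num.truncn (n%:R * hk k / hk k) = n.
  by rewrite mulfK ?natrK // gt_eqF // hk_gt0.
pose E t := p i (U t) - p i y - p i (al t - al 0) - iint (fun r => q i (U r)) 0 t.
(* At grid points the defect of the integrated equation grows by O(h^2) per step: on one cell, the
   integrand differs from the value used by the scheme through the motion of [U] and through the
   error of the scheme. *)
have grid k (n : nat) : n%:R * hk k <= T ->
   `|p i (euler (hk k) n) - p i y - p i (al (n%:R * hk k) - al 0)
     - iint (fun r => q i (U r)) 0 (n%:R * hk k)|
   <= n%:R * hk k * (hk k * (Cq' * (4 * C + (M + L)))).
  have h0 := hk_gt0 k; elim: n => [_|n IH nT].
    by rewrite !mul0r iint_refl /= pB !(subrr, subr0) normr0 lexx.
  have nh1 : n%:R * hk k <= n.+1%:R * hk k by rewrite ler_pM2r // ler_nat.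
  have nh0 : 0 <= n%:R * hk k by rewrite mulr_ge0 // ltW.
  have nT' := le_trans nh1 nT.
  have := resolventP (euler (hk k) n + (al (n.+1%:R * hk k) - al (n%:R * hk k))) h0.
  move=> /(_ i); rewrite -/(euler (hk k) n.+1).
  have pZ a u : p i (a *: u) = a * p i u.
    by rewrite -[_ *: u]addr0 p_lin -[in p i 0](subrr (0 : V)) pB subrr addr0.
  rewrite pZ pB pD pB => step.
  have step' : p i (euler (hk k) n.+1) = p i (euler (hk k) n) +
      (p i (al (n.+1%:R * hk k)) - p i (al (n%:R * hk k))) +
      hk k * q i (euler (hk k) n.+1).
    by rewrite -step mulVKf ?gt_eqF //; ring.
  rewrite (iint_add qi nh0 nh1).
  have dist : n.+1%:R * hk k - n%:R * hk k = hk k.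
    by rewrite -mulrBl -natrB // subSnn mul1r.
  have := @iint_dist _ (fun r => q i (U r)) (q i (euler (hk k) n.+1))
    (hk k * (Cq' * (4 * C + (M + L)))) _ _ qi nh1.
  rewrite dist => cell.
  have IH' := IH nT'.
  have -> : p i (euler (hk k) n.+1) - p i y - p i (al (n.+1%:R * hk k) - al 0)
     - (iint (fun r => q i (U r)) 0 (n%:R * hk k) +
        iint (fun r => q i (U r)) (n%:R * hk k) (n.+1%:R * hk k)) =
    (p i (euler (hk k) n) - p i y - p i (al (n%:R * hk k) - al 0)
     - iint (fun r => q i (U r)) 0 (n%:R * hk k)) -
    (iint (fun r => q i (U r)) (n%:R * hk k) (n.+1%:R * hk k) -
     hk k * q i (euler (hk k) n.+1)).
    by rewrite step' !pB; ring.
  apply: le_trans (ler_normB _ _) _.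
  have -> : n.+1%:R * hk k * (hk k * (Cq' * (4 * C + (M + L)))) =
    n%:R * hk k * (hk k * (Cq' * (4 * C + (M + L)))) +
    hk k * (hk k * (Cq' * (4 * C + (M + L)))).
    by rewrite -natr1; ring.
  apply: lerD IH' (cell _) => r /andP[r1 r2].
  rewrite -qB; apply: le_trans (hq' _) _.
  rewrite [leRHS]mulrCA; apply: ler_wpM2l => //.
  have tn : 0 <= n.+1%:R * hk k <= T by rewrite nT (le_trans nh0).
  have := UE _ k tn; rewrite /uk tr => h1.
  apply: le_trans (hnBD H (U (n.+1%:R * hk k)) _ _) _.
  rewrite (hnBC H _ (euler _ _)).
  have h2 : hn m (U r - U (n.+1%:R * hk k)) <= (M + L) * hk k.
    apply: le_trans (Ulip _ _) _; rewrite ler_wpM2l ?ML_ge0 //.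
    rewrite ler_norml; apply/andP; split; lra.
  move: h1 h2; lra.
have : `|E t| = 0.
  pose K := hn m y + (be T - be 0).
  (* The five terms are the defect on the grid, the error of the scheme, the motions of [U] and of
     [al] since the last grid point, and the integral over the last partial cell. *)
  pose D := T * (Cq' * (4 * C + (M + L))) + Cp' * (4 * C) + Cp' * (M + L) + Cp' * L
     + Cq' * K.
  apply/eqP; rewrite eq_le normr_ge0 andbT; apply: (small _ D) => k.
  have /andP[t0 tT'] := tT; have /andP[a1 a2] := trunc_hk k t0.
  set n := Num.truncn _ in a1 a2; have h0 := hk_gt0 k.
  have nT := le_trans a1 tT'; have nh0 : 0 <= n%:R * hk k by rewrite mulr_ge0 // ltW.
  have tn : 0 <= n%:R * hk k <= T by rewrite nh0.
  have dn : `|t - n%:R * hk k| <= hk k.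
    by rewrite ler_norml; apply/andP; split; lra.
  have e1 := grid k n nT.
  have e2 : `|p i (euler (hk k) n - U (n%:R * hk k))| <= Cp' * (4 * C * hk k).
    apply: le_trans (hp' _) _; rewrite ler_wpM2l //.
    by have := UE _ k tn; rewrite /uk tr.
  have e3 : `|p i (U t - U (n%:R * hk k))| <= Cp' * ((M + L) * hk k).
    apply: le_trans (hp' _) _; rewrite ler_wpM2l //.
    by apply: le_trans (Ulip _ _) _; rewrite ler_wpM2l ?ML_ge0.
  have e4 : `|p i (al t - al (n%:R * hk k))| <= Cp' * (L * hk k).
    apply: le_trans (hp' _) _; rewrite ler_wpM2l //.
    by apply: le_trans (al_lip _ _) _; rewrite ler_wpM2l.
  have e5 : `|iint (fun r => q i (U r)) (n%:R * hk k) t| <= hk k * (Cq' * K).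
    have K0 : 0 <= K.
      by rewrite /K; have := hn_ge0 m y; have := be_le 0 T (lexx 0) (ltW T0) (lexx T); lra.
    apply: le_trans (iint_bound (e := Cq' * K) qi a1 _) _.
      move=> r /andP[r1 r2]; apply: le_trans (hq' _) _; rewrite ler_wpM2l //.
      by apply: Ubd; rewrite (le_trans nh0 r1) (le_trans r2).
    by rewrite ler_wpM2r ?mulr_ge0 //; lra.
  have e6 : n%:R * hk k * (hk k * (Cq' * (4 * C + (M + L)))) <=
            T * (hk k * (Cq' * (4 * C + (M + L)))).
    apply: ler_wpM2r nT; apply: mulr_ge0 (ltW h0) _; apply: mulr_ge0 => //.
    by apply: addr_ge0 ML_ge0; apply: mulr_ge0 C_ge0; exact: ler0n.
  have -> : E t =
    (p i (euler (hk k) n) - p i y - p i (al (n%:R * hk k) - al 0)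
       - iint (fun r => q i (U r)) 0 (n%:R * hk k))
    + (p i (U t - U (n%:R * hk k)) - p i (euler (hk k) n - U (n%:R * hk k)))
    - p i (al t - al (n%:R * hk k)) - iint (fun r => q i (U r)) (n%:R * hk k) t.
    by rewrite /E (iint_add qi nh0 a1) !pB; ring.
  apply: le_trans (ler_normB _ _) _; apply: le_trans (lerD (ler_normB _ _) (lexx _)) _.
  apply: le_trans (lerD (lerD (ler_normD _ _) (lexx _)) (lexx _)) _.
  have e7 := ler_normB (p i (U t - U (n%:R * hk k))) (p i (euler (hk k) n - U (n%:R * hk k))).
  rewrite /D; move: e1 e2 e3 e4 e5 e6 e7; lra.
by move=> /normr0_eq0; rewrite /E; lra.
Unshelve. all: by end_near. Qed.

End SmoothData.
End Evolution.

(** * Mild solutions *)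

Section Mild.
Context (R : realType) (V : lmodType R) (m : V -> V -> R) (H : semi_hilbert m).
Context (I : Type) (p q : I -> V -> R).
Hypothesis p_lin : forall i a u v, p i (a *: u + v) = a * p i u + p i v.
Hypothesis q_lin : forall i a u v, q i (a *: u + v) = a * q i u + q i v.
Hypothesis p_bd : forall i, exists C, forall u, `|p i u| <= C * hn m u.
Hypothesis q_bd : forall i, exists C, forall u, `|q i u| <= C * hn m u.
Hypothesis p_inj : forall w, (forall i, p i w = 0) -> hn m w = 0.
Hypothesis gr_diss : forall u w, gr p q u w -> m w u <= 0.
Hypothesis gr_range : forall (h : R) f, 0 < h -> exists u, gr p q u (h^-1 *: (u - f)).
Context (T : R).
Hypothesis T0 : 0 < T.

Definition hcont (U : R -> V) := forall s, hn m (U t - U s) @[t --> s] --> (0 : R).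

Lemma hcontB U W : hcont U -> hcont W -> hcont (fun t => U t - W t).
Proof.
move=> hU hW s.
have h : (fun t => hn m (U t - U s) + hn m (W t - W s)) @ s --> (0 : R).
  by rewrite -[X in _ --> X]addr0; apply: cvgD; [exact: hU|exact: hW].
apply: (squeeze_cvgr _ (cvg_cst 0) h); near=> t.
rewrite hn_ge0 /=; have -> : U t - W t - (U s - W s) = (U t - U s) - (W t - W s).
  by lmod R V.
exact: hnB.
Unshelve. all: by end_near. Qed.

Lemma hcont_lip U (L : R) : (forall s t, hn m (U t - U s) <= L * `|t - s|) -> hcont U.
Proof.
move=> hU s.
have h : (fun t => L * `|t - s|) @ s --> (0 : R).
  have : (fun t => L * `|t - s|) @ s --> L * `|s - s|.
    apply: cvgM; first exact: cvg_cst.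
    by apply: cvg_norm; apply: cvgB; [exact: cvg_id|exact: cvg_cst].
  by rewrite subrr normr0 mulr0.
apply: (squeeze_cvgr _ (cvg_cst 0) h); near=> t.
by rewrite hn_ge0 /= hU.
Unshelve. all: by end_near. Qed.

Lemma hcont_lin U (l : V -> R) (C : R) :
  (forall a u v, l (a *: u + v) = a * l u + l v) ->
  (forall u, `|l u| <= C * hn m u) -> hcont U -> continuous (l \o U).
Proof.
move=> ll lC hU s; apply/subr_cvg0/norm_cvg0P.
have h : (fun t => C * hn m (U t - U s)) @ s --> (0 : R).
  by rewrite -[X in _ --> X](mulr0 C); apply: cvgM; [exact: cvg_cst|exact: hU].
apply: (squeeze_cvgr _ (cvg_cst 0) h); near=> t.
rewrite normr_ge0 /=; apply: le_trans (lC _).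
by rewrite -[U t - U s]addrC -scaleN1r ll mulN1r addrC.
Unshelve. all: by end_near. Qed.

Lemma hcont_hn U : hcont U -> continuous (hn m \o U).
Proof.
move=> hU s; apply/subr_cvg0/norm_cvg0P.
apply: (squeeze_cvgr _ (cvg_cst 0) (hU s)); near=> t.
by rewrite normr_ge0 /= hn_dist.
Unshelve. all: by end_near. Qed.

Lemma hcont_m U x : hcont U -> continuous (fun t => m (U t) x).
Proof.
apply: (@hcont_lin U (fun u => m u x) (hn m x)) => [a u v|u].
  by rewrite (shDl H) (shZl H).
by rewrite mulrC cauchy_schwarz.
Qed.

Lemma hcont_bound U : hcont U ->
  exists2 K : R, 0 <= K & forall t : R, 0 <= t <= T -> hn m (U t) <= K.
Proof.
move=> hU.
have [|c _ hc] := @EVT_max R (hn m \o U) 0 T (ltW T0).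
  by apply: continuous_subspaceT; exact: hcont_hn.
exists (hn m (U c)) => [|t tT]; first exact: hn_ge0.
by apply: hc; rewrite in_itv.
Qed.

(** A functional represented by a vector inherits measurability and commutation with integrals from
    the inner product. *)
Lemma p_riesz i : exists x, forall u, p i u = m u x.
Proof.
have [C hC] := p_bd i; have [x hx] := riesz H (p_lin i) hC.
by exists x => u; rewrite (sh_sym H) hx.
Qed.

Lemma q_riesz i : exists x, forall u, q i u = m u x.
Proof.
have [C hC] := q_bd i; have [x hx] := riesz H (q_lin i) hC.
by exists x => u; rewrite (sh_sym H) hx.
Qed.

(* The primitive [W] of [U], given by the Riesz theorem, satisfies [gr (W t) (U t)];
   by dissipativity [m (W t) (W t)] grows at most quadratically in the time step,
   hence does not grow. *)
Theorem mild_unique U : hcont U ->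
  (forall i (t : R), 0 <= t <= T -> p i (U t) = iint (fun r => q i (U r)) 0 t) ->
  forall t : R, 0 <= t <= T -> hn m (U t) = 0.
Proof.
move=> hU eqU.
have [K K0 UK] := hcont_bound hU.
have mi x := ii_continuous (@hcont_m U x hU).
(* The primitive is defined weakly, so no vector-valued integral is needed; the clamp makes the
   bound [K] available for every [t]. *)
have /choice[W W'E] (t : R) : exists w,
    forall x, m w x = iint (fun r => m (U r) x) 0 (clamp T t).
  have /andP[t0 tT] := clamp_itv t T0.
  have [||w hw] := @riesz _ _ _ H (fun x => iint (fun r => m (U r) x) 0 (clamp T t))
    (clamp T t * K).
  - move=> a u v; rewrite -(iintZ a _ _ (mi u)) -iintD //; last exact: iiZ.
    by apply: eq_iint => r _; rewrite !(shDr H) (shZr H).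
  - move=> u; have := @iint_bound _ _ (K * hn m u) 0 _ (mi u) t0.
    rewrite subr0 mulrA; apply => r /andP[r0 rt].
    apply: le_trans (cauchy_schwarz H _ _) _; rewrite ler_wpM2r ?hn_ge0 //.
    by rewrite UK // r0 (le_trans rt).
  - by exists w.
have WE (t : R) : 0 <= t <= T -> forall x, m (W t) x = iint (fun r => m (U r) x) 0 t.
  by move=> tT x; rewrite W'E clamp_id.
have Wg (t : R) : 0 <= t <= T -> gr p q (W t) (U t).
  move=> tT i; rewrite eqU //; have [x hx] := q_riesz i.
  by rewrite hx WE //; apply: eq_iint => r _; rewrite hx.
have W0 : hn m (W 0) = 0.
  apply/hn_eq0P => //; rewrite WE ?iint_refl ?lexx ?ltW //.
have WD (s t : R) x : 0 <= s -> s <= t -> t <= T ->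
    m (W t - W s) x = iint (fun r => m (U r) x) s t.
  move=> s0 st tT; rewrite (shDl H) (shNl H) !WE ?s0 ?(le_trans s0) ?(le_trans st) //.
  by rewrite (iint_add (mi x) s0 st) addrAC subrr add0r.
have Wlip (s t : R) : 0 <= s -> s <= t -> t <= T -> hn m (W t - W s) <= K * (t - s).
  move=> s0 st tT.
  have [->|d0] := eqVneq (hn m (W t - W s)) 0; first by rewrite mulr_ge0 // subr_ge0.
  have dp : 0 < hn m (W t - W s) by rewrite lt_def d0 hn_ge0.
  rewrite -(ler_pM2r dp) -expr2 (hn_sqr H) WD //.
  have := @iint_bound _ _ (K * hn m (W t - W s)) s t (mi (W t - W s)) st.
  rewrite mulrA [_ * K]mulrC => h; apply: le_trans (ler_norm _) (h _) => r /andP[r0 rt].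
  apply: le_trans (cauchy_schwarz H _ _) _; rewrite ler_wpM2r ?hn_ge0 //.
  by rewrite UK // (le_trans s0) // (le_trans rt).
have Wgrow (s t : R) : 0 <= s -> s <= t -> t <= T ->
    hn m (W t) ^+ 2 - hn m (W s) ^+ 2 <= 2 * K ^+ 2 * (t - s) ^+ 2.
  move=> s0 st tT.
  have -> : hn m (W t) ^+ 2 - hn m (W s) ^+ 2 = m (W t - W s) (W t + W s).
    by rewrite !(hn_sqr H) !(shDl H, shDr H, shNl H) (sh_sym H (W s) (W t)); ring.
  rewrite WD // (_ : 2 * K ^+ 2 * _ = (t - s) * (2 * K ^+ 2 * (t - s))); last by ring.
  rewrite -iint_cst //; apply: iint_le; [exact: mi|exact: ii_cst|move=> r /andP[sr rt]].
  have r0 := le_trans s0 sr; have rT := le_trans rt tT.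
  have := gr_diss (Wg r _); rewrite r0 rT => /(_ isT) dis.
  (* Up to increments of size [K * (t - s)] the sum is twice [W r], and the product of [U r] with
     [W r] is nonpositive by dissipativity. *)
  have -> : W t + W s = 2 *: W r + ((W t - W r) - (W r - W s)) by lmod R V.
  rewrite (shDr H) (shZr H).
  have := cauchy_schwarz H (U r) ((W t - W r) - (W r - W s)).
  have := hnB H (W t - W r) (W r - W s).
  have := Wlip _ _ r0 rt tT; have := Wlip _ _ s0 sr rT.
  have UKr : hn m (U r) <= K by apply: UK; rewrite r0.
  move=> h1 h2 h3 h4.
  have h5 := le_trans (ler_norm _) h4.
  have h6 : hn m (U r) * hn m ((W t - W r) - (W r - W s)) <= K * (K * (t - s)).
    by apply: ler_pM; rewrite ?hn_ge0 //; lra.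
  have h7 : 0 <= K * (K * (t - s)) by rewrite !mulr_ge0 // subr_ge0.
  rewrite expr2; move: dis h5 h6 h7; lra.
have Wz (t : R) : 0 <= t <= T -> hn m (W t) = 0.
  move=> /andP[t0 tT].
  (* With [n.+1] equal steps the quadratic increments add up to a bound of order [n.+1%:R^-1]. *)
  have part n k : (k <= n.+1)%N -> hn m (W (k%:R * (t / n.+1%:R))) ^+ 2 <=
      k%:R * (2 * K ^+ 2 * (t / n.+1%:R) ^+ 2).
    have d0 : 0 <= t / n.+1%:R by rewrite divr_ge0.
    elim: k => [_|k IH kn]; first by rewrite !mul0r W0 expr0n.
    have a1 : 0 <= k%:R * (t / n.+1%:R) by rewrite mulr_ge0.
    have a2 : k%:R * (t / n.+1%:R) <= k.+1%:R * (t / n.+1%:R).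
      by rewrite ler_wpM2r // ler_nat.
    have a3 : k.+1%:R * (t / n.+1%:R) <= T.
      rewrite mulrA ler_pdivrMr // mulrC; apply: ler_pM; rewrite // ler_nat //.
    have := Wgrow _ _ a1 a2 a3; rewrite -mulrBl -natrB // subSnn mul1r => h.
    have e (x : R) : k.+1%:R * x = k%:R * x + x by rewrite -natr1 mulrDl mul1r.
    rewrite [leRHS]e; apply: le_trans (lerD (IH (ltnW kn)) h).
    by rewrite addrC subrK.
  apply/eqP; rewrite -sqrf_eq0 eq_le sqr_ge0 andbT.
  apply: (cvgr_ge_near (cvgZ_harmonic (2 * K ^+ 2 * t ^+ 2))); near=> n.
  have := part n n.+1 (leqnn _); rewrite mulrC divfK ?pnatr_eq0 // => h.
  apply: le_trans h _; rewrite expr_div_n [n.+1%:R ^+ 2]expr2 invfM.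
  rewrite le_eqVlt; apply/orP; left; apply/eqP; field.
  by rewrite nat1r pnatr_eq0.
move=> t tT; apply: p_inj => i; rewrite (Wg t tT i); have [x ->] := q_riesz i.
by apply: hn_null_l => //; exact: Wz.
Unshelve. all: by end_near. Qed.

(** A simple function is a list of weighted indicators of possibly overlapping sets: induction over
    the list replaces partitions, and sums are concatenations. *)
Definition sfun (s : seq (set (measurableTypeR R) * V)) (r : R) : V := \sum_(a <- s) (\1_(a.1) r : R) *: a.2.
Definition mset (s : seq (set (measurableTypeR R) * V)) := forall a, List.In a s -> measurable a.1.

Lemma ii_indic (A : set (measurableTypeR R)) : measurable A -> ii (\1_A : R -> R).
Proof.
move=> mA s t; apply: measurable_bounded_integrable => //.
- exact: lebesgue_itv_lty.
- exists 1; split => // x x1 r _ /=; rewrite indicE; case: (_ \in _) => /=.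
    by rewrite normr1 ltW.
  by rewrite normr0 (le_trans _ (ltW x1)).
Qed.

Lemma iint_indic (A : set (measurableTypeR R)) s t : measurable A -> s <= t ->
  0 <= iint (\1_A : R -> R) s t <= t - s.
Proof.
move=> mA st; rewrite iint_ge0 //=.
rewrite -[leRHS]mulr1 -iint_cst //.
apply: iint_le => [||r _]; [exact: ii_indic|exact: ii_cst|].
by rewrite indicE; case: (_ \in _).
Qed.

Lemma sfun_m s x : mset s -> ii (fun r => m (sfun s r) x) /\
  forall t u, iint (fun r => m (sfun s r) x) t u =
    m (\sum_(a <- s) iint (\1_(a.1) : R -> R) t u *: a.2) x.
Proof.
rewrite /sfun; elim: s => [_|a s IH ms].
  split => [|t u].
    by under [X in ii X]eq_fun do rewrite big_nil (sh0l H); exact: ii_cst.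
  rewrite big_nil (sh0l H) (eq_iint (g := fun=> 0 * 1)) => [|r _].
    by rewrite (iintZ 0 t u (ii_cst 1)) mul0r.
  by rewrite big_nil (sh0l H) mul0r.
have [ih1 ih2] : _ /\ _ := IH (fun b bs => ms b (or_intror bs)).
have ia : ii (\1_(a.1) : R -> R) by apply: ii_indic; exact: ms (or_introl erefl).
have e r : m (\sum_(b <- a :: s) (\1_(b.1) r : R) *: b.2) x =
    m a.2 x * \1_(a.1) r + m (\sum_(b <- s) (\1_(b.1) r : R) *: b.2) x.
  by rewrite big_cons (shDl H) (shZl H) mulrC.
split => [|t u].
  by under [X in ii X]eq_fun do rewrite e; apply: iiD ih1; exact: iiZ.
rewrite (eq_iint (fun r _ => e r)) iintD // ?iintZ //; last exact: iiZ.
by rewrite big_cons (shDl H) (shZl H) mulrC ih2.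
Qed.

Definition dom2 (x : V) := exists x1 x2, gr p q x x1 /\ gr p q x1 x2.
Definition D2set (s : seq (set (measurableTypeR R) * V)) := forall a, List.In a s -> dom2 a.2.

(** The equation is integrated in time and tested, so it survives uniform limits of [U] and limits
    of [F] in L^1. The second clause fixes the values outside the time interval. *)
Definition mild (y : V) (F U : R -> V) :=
  [/\ hcont U, forall t, U (clamp T t) = U t &
   forall i t, 0 <= t <= T ->
     p i (U t) = p i y + iint (fun r => q i (U r)) 0 t + iint (fun r => p i (F r)) 0 t].

(** The primitive of a simple force is a combination of its values with the scalar primitives of the
    indicators as coefficients. It is Lipschitz in time, and so are its images, obtained by applying
    the generator to the values. *)
Lemma mild_simple y s : dom2 y -> mset s -> D2set s -> ii (fun r => hn m (sfun s r)) ->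
  exists U, mild y (sfun s) U /\
    forall t, 0 <= t <= T -> hn m (U t) <= hn m y + iint (fun r => hn m (sfun s r)) 0 T.
Proof.
move=> [y1 [y2 [yy1 y1y2]]] ms Ds ihn.
(* One choice of images for the values serves all coefficients, hence all times at once. *)
pose comb c (s : seq (set (measurableTypeR R) * V)) : V := \sum_(a <- s) c a.1 *: a.2.
have [s1 [s2 [ms1 ms2 hs]]] : exists s1 s2, [/\ mset s1, mset s2 &
    forall c, gr p q (comb c s) (comb c s1) /\ gr p q (comb c s1) (comb c s2)].
  rewrite /comb; elim: s ms Ds {ihn} => [_ _|a s IH ms Ds].
    exists [::], [::]; split => // c; rewrite !big_nil.
    by split; exact: (gr0 p_lin q_lin).
  have [||s1 [s2 [ms1 ms2 hs]]] := IH.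
  - by move=> b bs; apply: ms; right.
  - by move=> b bs; apply: Ds; right.
  have [x1 [x2 [g1 g2]]] := Ds a (or_introl erefl).
  exists ((a.1, x1) :: s1), ((a.1, x2) :: s2); split.
  - by move=> b /= [<-|]; [exact: ms (or_introl erefl)|exact: ms1].
  - by move=> b /= [<-|]; [exact: ms (or_introl erefl)|exact: ms2].
  - by move=> c; rewrite !big_cons; have [h1 h2] := hs c; split; exact: gr_lin.
pose al (s : seq (set (measurableTypeR R) * V)) t := \sum_(a <- s) iint (\1_(a.1) : R -> R) 0 t *: a.2.
have Lip s0 : mset s0 -> exists2 L : R, 0 <= L & forall t u,
    hn m (al s0 u - al s0 t) <= L * `|u - t|.
  rewrite /al; elim: s0 => [_|a s0 IH ms0].
    exists 0 => // t u; rewrite !big_nil subrr (hn0 H) mul0r //.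
  have [L L0 hL] := IH (fun b bs => ms0 b (or_intror bs)).
  exists (L + hn m a.2) => [|t u]; first by rewrite addr_ge0 ?hn_ge0.
  rewrite !big_cons; set x := \sum_(_ <- _) _; set x' := \sum_(_ <- _) _.
  have ma : measurable a.1 := ms0 a (or_introl erefl).
  have ia := ii_indic ma.
  have -> (c d : R) : c *: a.2 + x - (d *: a.2 + x') = (c - d) *: a.2 + (x - x').
    by lmod R V.
  apply: le_trans (hnD H _ _) _; rewrite [leRHS]mulrDl [leRHS]addrC.
  apply: lerD; last exact: hL.
  rewrite (hnZ H) mulrC.
  rewrite ler_wpM2l ?hn_ge0 //.
  (* Integrals from 0 to a negative bound vanish, so the primitive is Lipschitz on the whole
     line. *)
  have i0 (v : R) : v <= 0 -> iint (\1_(a.1) : R -> R) 0 v = 0.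
    rewrite le_eqVlt => /predU1P[->|v0]; first exact: iint_refl.
    by rewrite /iint set_itv_ge ?Rintegral_set0 // bnd_simp -ltNge.
  wlog tu : t u {x x'} / t <= u.
    move=> W; have [/W //|/ltW /W] := leP t u.
    by rewrite distrC [`|u - t|]distrC.
  have [u0|/ltW u0] := leP u 0; first by rewrite !i0 ?subrr ?normr0 // (le_trans tu).
  have [t0|/ltW t0] := leP t 0.
    rewrite (i0 t) // subr0; have /andP[a1 a2] := iint_indic ma u0.
    by rewrite !ger0_norm ?subr_ge0 //; lra.
  rewrite (iint_add ia t0 tu) addrAC subrr add0r.
  have /andP[a1 a2] := iint_indic ma tu.
  by rewrite !ger0_norm ?subr_ge0.
have [L0 L00 hL0] := Lip s ms; have [L1 L10 hL1] := Lip s1 ms1.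
have [L2 L20 hL2] := Lip s2 ms2.
pose L := L0 + L1 + L2; have Lge0 : 0 <= L by rewrite !addr_ge0.
have LL (a : R) (x : R) b : 0 <= b -> b <= L -> a <= b * `|x| -> a <= L * `|x|.
  by move=> b0 bL /le_trans; apply; rewrite ler_wpM2r.
have [|||||||U [h1 h2 h3 h4]] :=
  @smooth_solution R V m H I p q p_lin q_lin p_bd q_bd p_inj gr_diss gr_range T
   y y1 y2 (al s) (al s1) (al s2) (fun t => iint (fun r => hn m (sfun s r)) 0 t) L T0 yy1 y1y2.
- by move=> t; have [] := hs (fun A => iint (\1_A : R -> R) 0 t).
- by move=> t; have [] := hs (fun A => iint (\1_A : R -> R) 0 t).
- exact: Lge0.
- by move=> t u; apply: (LL _ _ L0) => //; rewrite /L; lra.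
- by move=> t u; apply: (LL _ _ L1) => //; rewrite /L; lra.
- by move=> t u; apply: (LL _ _ L2) => //; rewrite /L; lra.
- move=> t u t0 tu uT; rewrite (iint_add ihn t0 tu) addrAC subrr add0r.
  have -> : al s u - al s t = \sum_(a <- s) iint (\1_(a.1) : R -> R) t u *: a.2.
    rewrite /al; elim: s ms {Ds ihn hs hL0 LL} => [|a s IH ms]; first by rewrite !big_nil subrr.
    rewrite !big_cons -(IH (fun b bs => ms b (or_intror bs))).
    rewrite (iint_add (ii_indic (ms a (or_introl erefl))) t0 tu).
    move: (\sum_(_ <- _) _) (\sum_(_ <- _) _) (iint _ 0 t) (iint _ t u) => S1 S2 c d.
    by lmod R V.
  set d := \sum_(_ <- _) _.
  (* The norm of the integral is at most the integral of the norm: the increment [d] is paired with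
     itself and the product is pulled under the integral. *)
  have [->|d0] := eqVneq (hn m d) 0; first by apply: iint_ge0 => r _; exact: hn_ge0.
  have dp : 0 < hn m d by rewrite lt_def d0 hn_ge0.
  have [im em] := sfun_m d ms.
  rewrite -(ler_pM2r dp) -expr2 (hn_sqr H) {1}/d -em [leRHS]mulrC -iintZ //.
  apply: iint_le => // [|r _]; first exact: iiZ.
  by apply: le_trans (le_trans (ler_norm _) (cauchy_schwarz H _ _)) _; rewrite mulrC.
have U0 t : 0 <= t <= T -> clamp T t = t by exact: clamp_id.
exists (fun t => U (clamp T t)); split; last first.
  by move=> t tT; rewrite U0 //; have := h3 t tT; rewrite iint_refl subr0.
split.
- apply: (@hcont_lip _ (hn m y1 + hn m y2 + L * T + L)) => t u.
  apply: le_trans (h1 _ _) _; apply: ler_wpM2l (clamp_lip _ _ _).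
  apply: (addr_ge0 _ Lge0); apply: (addr_ge0 _ (mulr_ge0 Lge0 (ltW T0))).
  exact: addr_ge0 (hn_ge0 _ _) (hn_ge0 _ _).
- by move=> t; rewrite (U0 (clamp T t)) // clamp_itv.
move=> i t tT; rewrite U0 // h4 //; congr (_ + _ + _).
  apply: eq_iint => r /andP[r0 rt]; rewrite U0 // r0 (le_trans rt) //.
  by case/andP: tT.
have [x px] := p_riesz i; rewrite px; have [im em] := sfun_m x ms.
rewrite [in RHS](eq_iint (g := fun r => m (sfun s r) x)) => [|r _]; last by rewrite px.
rewrite em; congr (m _ x); rewrite [X in _ - X](_ : _ = 0) ?subr0 // /al.
by rewrite big1_seq // => a _; rewrite iint_refl scale0r.
Qed.

Definition meas (f : R -> R) := measurable_fun [set: measurableTypeR R] f.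

Lemma ii_dom f g : meas f -> ii g -> (forall r, `|f r| <= g r) -> ii f.
Proof.
move=> mf ig fg s t; apply: (le_integrable _ _ _ (ig s t)) => //.
  by apply/measurable_EFinP; apply: measurable_funTS.
by move=> r _ /=; rewrite lee_fin; apply: le_trans (fg r) (ler_norm _).
Qed.

Lemma meas_sum (s : seq (set (measurableTypeR R) * V)) (h : R -> V -> R) : mset s ->
  (forall x, meas (fun r => h r x)) ->
  meas (fun r => \sum_(a <- s) \1_(a.1) r * h r a.2).
Proof.
move=> ms mh; rewrite /meas; elim: s ms => [_|a s IH ms].
  by under [X in measurable_fun _ X]eq_fun do rewrite big_nil; exact: measurable_cst.
under [X in measurable_fun _ X]eq_fun do rewrite big_cons.
apply: measurable_funD; last by apply: IH => b bs; apply: ms; right.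
apply: measurable_funM; last exact: mh.
by apply/measurable_indicP; apply: ms; left.
Qed.

Lemma m_sfun s r x : m (sfun s r) x = \sum_(a <- s) \1_(a.1) r * m a.2 x.
Proof.
rewrite /sfun; elim: s => [|a s IH]; first by rewrite !big_nil (sh0l H).
by rewrite !big_cons (shDl H) (shZl H) IH.
Qed.

(** The regularity of the force that suffices for a mild solution: weak measurability, an integrable
    norm, and approximation by simple functions in L^1. *)
Record good (F : R -> V) : Prop := Good {
  good_m : forall x, meas (fun r => m (F r) x);
  good_hn : meas (fun r => hn m (F r));
  good_ii : ii (fun r => hn m (F r));
  good_approx : forall e, 0 < e -> exists2 s, mset s &
     iint (fun r => hn m (F r - sfun s r)) 0 T < e }.

Lemma meas_sfun_m s (F : R -> V) : mset s -> (forall x, meas (fun r => m (F r) x)) ->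
  meas (fun r => m (F r) (sfun s r)).
Proof.
move=> ms mF; have := meas_sum ms mF; rewrite /meas.
by apply: eq_measurable_fun => r _; rewrite (sh_sym H) m_sfun;
  apply: eq_bigr => a _; rewrite (sh_sym H).
Qed.

Lemma meas_m_sfun s x : mset s -> meas (fun r => m (sfun s r) x).
Proof.
move=> ms; have := meas_sum ms (fun y => measurable_cst (m y x)); rewrite /meas.
by apply: eq_measurable_fun => r _; rewrite m_sfun.
Qed.

Lemma meas_sqrt (f : R -> R) : meas f -> meas (fun r => Num.sqrt (f r)).
Proof.
move=> mf; apply: (@measurableT_comp _ _ _ _ _ _ (Num.sqrt : R -> R)) mf.
by apply: continuous_measurable_fun; exact: sqrt_continuous.
Qed.

Lemma meas_hn_sfun s : mset s -> meas (fun r => hn m (sfun s r)).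
Proof.
by move=> ms; apply: meas_sqrt; apply: meas_sfun_m => // x; exact: meas_m_sfun.
Qed.

Lemma ii_hn_sfun s : mset s -> ii (fun r => hn m (sfun s r)).
Proof.
move=> ms; apply: (@ii_dom _ (fun=> \sum_(a <- s) hn m a.2)).
- exact: meas_hn_sfun.
- exact: ii_cst.
move=> r; rewrite ger0_norm ?hn_ge0 // /sfun.
elim: (s) => [|a l IH]; first by rewrite !big_nil (hn0 H).
rewrite !big_cons; apply: le_trans (hnD H _ _) (lerD _ IH).
rewrite (hnZ H) indicE; case: (_ \in _); rewrite /= ?normr1 ?mul1r // normr0 mul0r hn_ge0 //.
Qed.

Lemma ii_hnB_sfun F s : good F -> mset s -> ii (fun r => hn m (F r - sfun s r)).
Proof.
move=> gF ms; apply: (@ii_dom _ (fun r => hn m (F r) + hn m (sfun s r))); last first.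
- by move=> r; rewrite ger0_norm ?hn_ge0 // hnB.
- by apply: iiD; [exact: good_ii|exact: ii_hn_sfun].
apply: meas_sqrt.
have : meas (fun r => hn m (F r) ^+ 2 - 2 * m (F r) (sfun s r) + hn m (sfun s r) ^+ 2).
  apply: measurable_funD; last by apply: measurable_funX; exact: meas_hn_sfun.
  apply: measurable_funB; first by apply: measurable_funX; exact: good_hn.
  by apply: measurable_funM => //; apply: meas_sfun_m => //; exact: good_m.
apply: eq_measurable_fun => r _; rewrite !(hn_sqr H) !(shDl H, shDr H, shNl H, shNr H).
by rewrite (sh_sym H (sfun s r)); ring.
Qed.

Lemma dom2_lin a x x' : dom2 x -> dom2 x' -> dom2 (a *: x + x').
Proof.
move=> [x1 [x2 [h1 h2]]] [y1 [y2 [h3 h4]]].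
by exists (a *: x1 + y1), (a *: x2 + y2); split; exact: gr_lin.
Qed.

(** Replacing each value by a nearby one in [dom2] changes the function uniformly in time, since
    indicators are at most 1. *)
Lemma sfun_dom2 s e : mset s -> 0 < e -> exists s', [/\ mset s', D2set s' &
  forall r, hn m (sfun s r - sfun s' r) <= e].
Proof.
rewrite /sfun; elim: s e => [e _ e0|a s IH e ms e0].
  by exists [::]; split => // r; rewrite !big_nil subrr (hn0 H) ltW.
have e20 : 0 < e / 2 by lra.
have [s' [ms' Ds' hs']] := IH _ (fun b bs => ms b (or_intror bs)) e20.
have [y [y1 [y2 [h1 h2 h3]]]] := gr_dom2_dense H p_lin q_lin q_bd p_inj gr_diss gr_range a.2 e20.
exists ((a.1, y) :: s'); split.
- by move=> b /= [<-|]; [exact: ms (or_introl erefl)|exact: ms'].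
- by move=> b /= [<-|]; [exists y1, y2|exact: Ds'].
move=> r; rewrite !big_cons /=; move: (hs' r).
move: (\sum_(_ <- _) _) (\sum_(_ <- _) _) => S2 S1 hS.
have -> (c : R) : c *: a.2 + S1 - (c *: y + S2) = c *: (a.2 - y) + (S1 - S2).
  by lmod R V.
apply: le_trans (hnD H _ _) _; rewrite (hnZ H) (hnBC H a.2).
suff : `|\1_(a.1) r| * hn m (y - a.2) <= hn m (y - a.2) by lra.
by rewrite indicE; case: (_ \in _); rewrite /= ?normr1 ?mul1r // normr0 mul0r hn_ge0.
Qed.

Lemma In_cat (U : Type) (a : U) s1 s2 :
  List.In a (s1 ++ s2) -> List.In a s1 \/ List.In a s2.
Proof. by elim: s1 => [|b s1 IH] /=; [right|move=> [->|/IH [h|h]]; tauto]. Qed.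

Lemma sfun_sub s1 s2 : mset s1 -> mset s2 -> D2set s1 -> D2set s2 ->
  exists s, [/\ mset s, D2set s & forall r, sfun s r = sfun s1 r - sfun s2 r].
Proof.
move=> ms1 ms2 D1 D2.
have [s [ms Ds hs]] : exists s, [/\ mset s, D2set s & forall r, sfun s r = - sfun s2 r].
  rewrite /sfun; elim: s2 ms2 D2 => [_ _|a s2 IH ms2 D2].
    by exists [::]; split => // r; rewrite !big_nil oppr0.
  have [||s [ms Ds hs]] := IH.
  - by move=> b bs; apply: ms2; right.
  - by move=> b bs; apply: D2; right.
  exists ((a.1, - a.2) :: s); split.
  - by move=> b /= [<-|]; [exact: ms2 (or_introl erefl)|exact: ms].
  - move=> b /= [<-|]; last exact: Ds.
    have [x1 [x2 [h1 h2]]] := D2 a (or_introl erefl).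
    exists (- x1), (- x2); rewrite /= -(scaleN1r x1) -(scaleN1r x2) -(scaleN1r a.2).
    by split; exact: (grZ p_lin q_lin).
  - by move=> r; rewrite !big_cons hs /= opprD scalerN.
exists (s1 ++ s); split.
- by move=> a h; case: (In_cat h) => {}h; [exact: ms1|exact: ms].
- by move=> a h; case: (In_cat h) => {}h; [exact: D1|exact: Ds].
- by move=> r; rewrite -hs /sfun big_cat.
Qed.

Lemma linB i : (forall u v, p i (u - v) = p i u - p i v) *
  (forall u v, q i (u - v) = q i u - q i v).
Proof.
by split => u v; rewrite addrC -scaleN1r ?p_lin ?q_lin mulN1r addrC.
Qed.

Lemma lin_bd : forall i, exists C, 0 <= C /\
  forall u, `|p i u| <= C * hn m u /\ `|q i u| <= C * hn m u.
Proof.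
move=> i; have [Cp hp] := p_bd i; have [Cq hq] := q_bd i.
exists (`|Cp| + `|Cq|); split=> [|u]; first exact: addr_ge0.
split; first (apply: le_trans (hp u) _); last (apply: le_trans (hq u) _);
  apply: ler_wpM2r; rewrite ?hn_ge0 //; have := ler_norm Cp; have := ler_norm Cq;
  have := normr_ge0 Cp; have := normr_ge0 Cq; lra.
Qed.

Lemma ii_p_sfun i s : mset s -> ii (fun r => p i (sfun s r)).
Proof.
move=> ms; have [x px] := p_riesz i; have [h _] := sfun_m x ms.
by under [X in ii X]eq_fun do rewrite px.
Qed.

Lemma ii_p_good i F : good F -> ii (fun r => p i (F r)).
Proof.
move=> gF; have [x px] := p_riesz i.
apply: (@ii_dom _ (fun r => hn m x * hn m (F r))).
- by rewrite /meas; under [X in measurable_fun _ X]eq_fun do rewrite px; exact: good_m.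
- by apply: iiZ; exact: good_ii.
- by move=> r; rewrite px mulrC; exact: cauchy_schwarz.
Qed.

(** The a priori bound is known for constructed solutions only. A solution [W] is constructed for
    the difference of the data, and uniqueness identifies it with [U1 - U2]. *)
Lemma mild_simple_dist y1 y2 s1 s2 U1 U2 : dom2 y1 -> dom2 y2 ->
  mset s1 -> mset s2 -> D2set s1 -> D2set s2 ->
  mild y1 (sfun s1) U1 -> mild y2 (sfun s2) U2 ->
  forall t, hn m (U1 t - U2 t) <= hn m (y1 - y2) +
     iint (fun r => hn m (sfun s1 r - sfun s2 r)) 0 T.
Proof.
move=> dy1 dy2 ms1 ms2 D1 D2 [c1 k1 e1] [c2 k2 e2] t.
have [s [ms Ds sE]] := sfun_sub ms1 ms2 D1 D2.
have dy : dom2 (y1 - y2).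
  by rewrite addrC -scaleN1r; exact: dom2_lin.
have [W [[cW kW eW] bW]] := mild_simple dy ms Ds (ii_hn_sfun ms).
have z : forall t : R, 0 <= t <= T -> hn m ((U1 t - U2 t) - W t) = 0.
  apply: mild_unique; first by apply: hcontB => //; exact: hcontB.
  move=> i u uT; rewrite !linB e1 // e2 // eW // !linB.
  have [C [_ hC]] := lin_bd i.
  have iq U : hcont U -> ii (fun r => q i (U r)).
    move=> hU; apply: ii_continuous.
    by apply: (@hcont_lin U (q i) C) => // v; have [] := hC v.
  rewrite (eq_iint (f := fun r => q i (U1 r - U2 r - W r))
    (g := fun r => (q i (U1 r) - q i (U2 r)) - q i (W r))) => [|r _]; last by rewrite !linB.
  have i1 := iq _ c1; have i2 := iq _ c2; have i3 := iq _ cW.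
  rewrite !iintB //; last exact: iiB.
  rewrite (eq_iint (f := fun r => p i (sfun s r))
    (g := fun r => p i (sfun s1 r) - p i (sfun s2 r))) => [|r _]; last by rewrite sE linB.
  have j1 := ii_p_sfun i ms1; have j2 := ii_p_sfun i ms2.
  by rewrite iintB //; ring.
have tT := clamp_itv t T0.
rewrite -k1 -k2; apply: le_trans (hn_le H _ (W (clamp T t))) _.
rewrite z // add0r; apply: le_trans (bW _ tT) _; rewrite lerD2l.
rewrite le_eqVlt; apply/orP; left; apply/eqP.
by apply: eq_iint => r _; rewrite sE.
Qed.

Theorem mild_exists y F : good F -> exists U, mild y F U /\
  forall t, 0 <= t <= T -> hn m (U t) <= hn m y + iint (fun r => hn m (F r)) 0 T.
Proof.
move=> gF.
have eps0 k : 0 < k.+1%:R^-1 :> R by rewrite invr_gt0.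
have /choice[ys ysP] (k : nat) : exists z, dom2 z /\ hn m (z - y) < k.+1%:R^-1.
  have [z [z1 [z2 [h1 h2 h3]]]] :=
    gr_dom2_dense H p_lin q_lin q_bd p_inj gr_diss gr_range y (eps0 k).
  by exists z; split => //; exists z1, z2.
have /choice[ss ssP] (k : nat) : exists s, [/\ mset s, D2set s &
    iint (fun r => hn m (F r - sfun s r)) 0 T <= k.+1%:R^-1].
  have e2 : 0 < k.+1%:R^-1 / 2 :> R by rewrite divr_gt0.
  have [s ms hs] := good_approx gF e2.
  have eT : 0 < k.+1%:R^-1 / 2 / T :> R by rewrite divr_gt0.
  have [s' [ms' Ds' hs']] := sfun_dom2 ms eT.
  exists s'; split => //.
  apply: (@le_trans _ _ (iint (fun r => hn m (F r - sfun s r)) 0 T +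
      iint (fun=> k.+1%:R^-1 / 2 / T) 0 T)).
    rewrite -iintD; [|exact: ii_hnB_sfun|exact: ii_cst].
    apply: iint_le => [||r _]; [exact: ii_hnB_sfun|apply: iiD; [exact: ii_hnB_sfun|exact: ii_cst]|].
    by apply: le_trans (hnBD H (sfun s r) _ _) _; rewrite lerD2l.
  rewrite iint_cst ?(ltW T0) // subr0 mulrC divfK ?gt_eqF //.
  move: hs; set x := k.+1%:R^-1; lra.
have /choice[Us UsP] (k : nat) : exists U, mild (ys k) (sfun (ss k)) U /\
    forall t, 0 <= t <= T ->
      hn m (U t) <= hn m (ys k) + iint (fun r => hn m (sfun (ss k) r)) 0 T.
  have [ms Ds _] := ssP k; have [dy _] := ysP k.
  by apply: mild_simple => //; exact: ii_hn_sfun.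
(* Each of two approximations contributes [N.+1%:R^-1] through its initial value and as much through
   its force. *)
have c0 := cvgZ_harmonic (4 : R).
have cau t N j k : (N <= j)%N -> (N <= k)%N -> hn m (Us j t - Us k t) <= 4 * N.+1%:R^-1.
  move=> Nj Nk; have [ms1 D1 h1] := ssP j; have [ms2 D2 h2] := ssP k.
  have [dy1 g1] := ysP j; have [dy2 g2] := ysP k.
  have [m1 _] := UsP j; have [m2 _] := UsP k.
  apply: le_trans (mild_simple_dist dy1 dy2 ms1 ms2 D1 D2 m1 m2 t) _.
  have h3 : iint (fun r => hn m (sfun (ss j) r - sfun (ss k) r)) 0 T <=
     iint (fun r => hn m (F r - sfun (ss j) r)) 0 T +
     iint (fun r => hn m (F r - sfun (ss k) r)) 0 T.
    rewrite -iintD; try exact: ii_hnB_sfun.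
    apply: iint_le => [||r _].
    - have [s [ms _ sE]] := sfun_sub ms1 ms2 D1 D2.
      by under [X in ii X]eq_fun do rewrite -sE; exact: ii_hn_sfun.
    - by apply: iiD; exact: ii_hnB_sfun.
    - by rewrite (hnBC H (F r)); exact: hnBD.
  have := hnBD H y (ys j) (ys k); rewrite (hnBC H y).
  have : j.+1%:R^-1 <= N.+1%:R^-1 :> R by rewrite lef_pV2 ?posrE // ler_nat.
  have : k.+1%:R^-1 <= N.+1%:R^-1 :> R by rewrite lef_pV2 ?posrE // ler_nat.
  move: g1 g2 h1 h2 h3; move: (j.+1%:R^-1) (k.+1%:R^-1) (N.+1%:R^-1) => a b c; lra.
have /choice[L LP] (t : R) : exists l, forall k, hn m (Us k t - l) <= 4 * k.+1%:R^-1.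
  by have [l [_ h]] := hn_complete H c0 (cau t); exists l.
pose U t := L (clamp T t).
have cc t : clamp T (clamp T t) = clamp T t by rewrite clamp_id // clamp_itv.
have UU k t : hn m (Us k t - U t) <= 4 * k.+1%:R^-1.
  by have [[_ k1 _] _] := UsP k; rewrite -k1; exact: LP.
have hU : hcont U.
  move=> s; apply/cvgrPdist_lt => e e0.
  have e4 : 0 < e / 4 by lra.
  have /cvgrPdist_lt /(_ _ e4) [N _ /(_ N (leqnn N))] := c0.
  rewrite sub0r normrN ger0_norm ?mulr_ge0 // => hN.
  have [[cN _ _] _] := UsP N; have /cvgrPdist_lt /(_ _ e4) := cN s.
  apply: filterS => t; rewrite !sub0r !normrN !ger0_norm ?hn_ge0 // => h.
  apply: le_lt_trans (hnBD H (Us N t) _ _) _.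
  have := hnBD H (Us N s) (Us N t) (U s); have := UU N s; have := UU N t.
  rewrite (hnBC H (Us N t) (U t)); move: hN h; move: (N.+1%:R^-1) => x; lra.
have small (x D : R) : (forall k : nat, x <= D * k.+1%:R^-1) -> x <= 0.
  move=> xD; apply: (cvgr_ge_near (cvgZ_harmonic D)).
  by near=> k; exact: xD.
exists U; split; last first.
  (* Four parts come from the distance of [Us k] to the limit, one from the initial value and one
     from the force. *)
  move=> t tT; rewrite -subr_le0; apply: (small _ 6) => k.
  have [_ /(_ t tT) h1] := UsP k; have [_ g1] := ysP k; have [ms Ds h2] := ssP k.
  have := hn_le H (U t) (Us k t); rewrite (hnBC H) => h3; have h4 := UU k t.
  have h5 := hn_le H (ys k) y.
  have h6 : iint (fun r => hn m (sfun (ss k) r)) 0 T <=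
      iint (fun r => hn m (F r)) 0 T + iint (fun r => hn m (F r - sfun (ss k) r)) 0 T.
    rewrite -iintD; [|exact: good_ii|exact: ii_hnB_sfun].
    apply: iint_le => [||r _]; first exact: ii_hn_sfun.
      by apply: iiD; [exact: good_ii|exact: ii_hnB_sfun].
    by apply: le_trans (hn_le H _ (F r)) _; rewrite addrC (hnBC H).
  move: h1 g1 h2 h3 h4 h5 h6; move: (k.+1%:R^-1) => x; lra.
split=> [//|t|i t tT]; first by rewrite /U cc.
have [C [C0 hC]] := lin_bd i.
have iq W : hcont W -> ii (fun r => q i (W r)).
  move=> hW; apply: ii_continuous.
  by apply: (@hcont_lin W (q i) C) => // v; have [] := hC v.
apply/eqP; rewrite -subr_eq0 -normr_eq0 eq_le normr_ge0 andbT; apply/eqP/eqP.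
apply: (small _ (4 * C + C + T * (C * 4) + C)) => k.
have [[cU _ eU] _] := UsP k; have [_ g1] := ysP k; have [ms Ds h2] := ssP k.
have /andP[t0 tT'] := tT.
have -> : p i (U t) - (p i y + iint (fun r => q i (U r)) 0 t + iint (fun r => p i (F r)) 0 t) =
   p i (ys k - y) - p i (Us k t - U t) +
   iint (fun r => q i (Us k r - U r)) 0 t - iint (fun r => p i (F r - sfun (ss k) r)) 0 t.
  rewrite !linB eU //.
  rewrite (eq_iint (f := fun r => q i (Us k r - U r))
    (g := fun r => q i (Us k r) - q i (U r))) => [|r _]; last by rewrite linB.
  rewrite (eq_iint (f := fun r => p i (F r - _))
    (g := fun r => p i (F r) - p i (sfun (ss k) r))) => [|r _]; last by rewrite linB.
  have i1 := iq _ cU; have i2 := iq _ hU.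
  have i3 := ii_p_good i gF; have i4 := ii_p_sfun i ms.
  by rewrite !iintB //; ring.
have b1 : `|p i (ys k - y)| <= C * k.+1%:R^-1.
  by apply: le_trans (proj1 (hC _)) _; rewrite ler_wpM2l // ltW.
have b2 : `|p i (Us k t - U t)| <= C * (4 * k.+1%:R^-1).
  by apply: le_trans (proj1 (hC _)) _; rewrite ler_wpM2l.
have b3 : `|iint (fun r => q i (Us k r - U r)) 0 t| <= T * (C * (4 * k.+1%:R^-1)).
  apply: le_trans (iint_bound (e := C * (4 * k.+1%:R^-1)) _ t0 _) _.
  - by apply: (iq (fun r => Us k r - U r)); exact: hcontB.
  - by move=> r _; apply: le_trans (proj2 (hC _)) _; rewrite ler_wpM2l.
  - by rewrite subr0 ler_wpM2r // !mulr_ge0.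
have b4 : `|iint (fun r => p i (F r - sfun (ss k) r)) 0 t| <= C * k.+1%:R^-1.
  have ipd : ii (fun r => p i (F r - sfun (ss k) r)).
    under [X in ii X]eq_fun do rewrite linB.
    by apply: iiB; [exact: ii_p_good|exact: ii_p_sfun].
  apply: le_trans (iint_norm _ _ ipd) _.
  apply: (@le_trans _ _ (C * iint (fun r => hn m (F r - sfun (ss k) r)) 0 t)).
    rewrite -iintZ; last exact: ii_hnB_sfun.
    apply: iint_le => [||r _]; [exact: ii_norm|apply: iiZ; exact: ii_hnB_sfun|].
    exact: proj1 (hC _).
  apply: ler_wpM2l => //; apply: le_trans h2.
  by apply: iint_le_sub => //; [exact: ii_hnB_sfun|move=> r; exact: hn_ge0].
apply: le_trans (ler_normB _ _) _; apply: le_trans (lerD (ler_normD _ _) (lexx _)) _.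
apply: le_trans (lerD (lerD (ler_normB _ _) (lexx _)) (lexx _)) _.
move: b1 b2 b3 b4; move: (k.+1%:R^-1) => x; lra.
Unshelve. all: by end_near. Qed.

End Mild.

(** * Smooth functions *)

Section SmoothFunctions.
Context (R : realType) (V : normedModType R).
Implicit Types (f g : V -> R) (v x : V).

Definition smooth f := forall n, Ck n f.

Lemma Ck_pred n f : Ck n.+1 f -> Ck n f.
Proof.
elim: n f => [|n IH] f [cf df] //.
by split => // v; have [d1 d2] := df v; split => //; exact: IH.
Qed.

Lemma Ck_continuous n f : Ck n f -> continuous f.
Proof. by case: n => [|n] []. Qed.

Lemma CkD n f g : Ck n f -> Ck n g -> Ck n (fun x => f x + g x).
Proof.
elim: n f g => [|n IH] f g [cf df] [cg dg].
  by split => // x; apply: cvgD; [exact: cf|exact: cg].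
split=> [x|v]; first by apply: cvgD; [exact: cf|exact: cg].
have [f1 f2] := df v; have [g1 g2] := dg v; split => [x|]; first exact: derivableD.
have -> : (fun x => 'D_v (fun y => f y + g y) x) = (fun x => 'D_v f x + 'D_v g x).
  by apply/funext => x; exact: deriveD.
exact: IH.
Qed.

Lemma CkM n f g : Ck n f -> Ck n g -> Ck n (fun x => f x * g x).
Proof.
elim: n f g => [|n IH] f g Cf Cg; have [cf df] := Cf; have [cg dg] := Cg.
  by split => // x; apply: cvgM; [exact: cf|exact: cg].
split=> [x|v]; first by apply: cvgM; [exact: cf|exact: cg].
have [f1 f2] := df v; have [g1 g2] := dg v; split => [x|]; first exact: derivableM.
have -> : (fun x => 'D_v (fun y => f y * g y) x) =
    (fun x => f x * 'D_v g x + g x * 'D_v f x).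
  by apply/funext => x; exact: deriveM.
by apply: CkD; apply: IH => //; exact: Ck_pred.
Qed.

Lemma Ck_cst n (c : R) : Ck n (fun _ : V => c).
Proof.
elim: n c => [|n IH] c; first by split => // x; exact: cvg_cst.
split=> [x|v]; first exact: cvg_cst.
split=> [x|]; first exact: derivable_cst.
have -> : (fun x : V => 'D_v (fun=> c) x) = (fun=> 0) by apply/funext => x; exact: derive_cst.
exact: IH.
Qed.

Lemma CkV n f : (forall x, f x != 0) -> Ck n f -> Ck n (fun x => (f x)^-1).
Proof.
move=> f0; elim: n f f0 => [|n IH] f f0 Cf; have [cf df] := Cf.
  by split => // x; apply: cvgV; [exact: f0|exact: cf].
split=> [x|v]; first by apply: cvgV; [exact: f0|exact: cf].
have [f1 f2] := df v; split => [x|]; first exact: derivableV.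
have -> : (fun x => 'D_v (fun y => (f y)^-1) x) =
    (fun x => -1 * ((f x)^-1 * (f x)^-1 * 'D_v f x)).
  by apply/funext => x; rewrite deriveV //= /GRing.scale /= expr2 invfM; ring.
have Cv := IH _ f0 (Ck_pred Cf).
by apply: CkM; [exact: Ck_cst|apply: CkM => //; exact: CkM].
Qed.

(** The difference quotient in direction [v] is literally that of [h] in direction [l v], so
    iterated directional derivatives need no chain rule. *)
Lemma Ck_comp_linear (W : normedModType R) n (h : W -> R) (l : V -> W) (b : W) :
  (forall a u v, l (a *: u + v) = a *: l u + l v) -> continuous l ->
  Ck n h -> Ck n (fun x => h (l x + b)).
Proof.
move=> ll cl; elim: n h => [|n IH] h [ch dh].
  split=> // x; apply: (continuous_comp (f := fun y => l y + b)); last exact: ch.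
  by apply: cvgD; [exact: cl|exact: cvg_cst].
split=> [x|v].
  apply: (continuous_comp (f := fun y => l y + b)); last exact: ch.
  by apply: cvgD; [exact: cl|exact: cvg_cst].
have [h1 h2] := dh (l v).
have E x : (fun t : R => t^-1 *: (((fun y => h (l y + b)) \o shift x) (t *: v) -
     h (l x + b))) =
   (fun t : R => t^-1 *: ((h \o shift (l x + b)) (t *: l v) - h (l x + b))).
  by apply/funext => t /=; rewrite ll addrA.
split=> [x|].
  by rewrite /derivable E; exact: h1.
have -> : (fun x => 'D_v (fun y => h (l y + b)) x) =
    (fun x => (fun w => 'D_(l v) h w) (l x + b)).
  by apply/funext => x; rewrite /derive E.
exact: (IH (fun w => 'D_(l v) h w)).
Qed.

Lemma Ck_shift n f a : Ck n f -> Ck n (fun x => f (x + a)).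
Proof. by apply: (@Ck_comp_linear V n f id a) => // x; exact: cvg_id. Qed.

Lemma derive_shift f a v x : 'D_v (fun y => f (y + a)) x = 'D_v f (x + a).
Proof.
rewrite /derive (_ : (fun t : R => t^-1 *: (((fun y => f (y + a)) \o shift x) (t *: v) -
     f (x + a))) = (fun t : R => t^-1 *: ((f \o shift (x + a)) (t *: v) - f (x + a)))) //.
by apply/funext => t /=; rewrite addrA.
Qed.

Lemma smoothD f g : smooth f -> smooth g -> smooth (fun x => f x + g x).
Proof. by move=> h1 h2 n; exact: CkD. Qed.
Lemma smoothM f g : smooth f -> smooth g -> smooth (fun x => f x * g x).
Proof. by move=> h1 h2 n; exact: CkM. Qed.
Lemma smooth_cst (c : R) : smooth (fun=> c).
Proof. by move=> n; exact: Ck_cst. Qed.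
Lemma smooth_continuous f : smooth f -> continuous f.
Proof. by move=> h; exact: Ck_continuous (h 0%N). Qed.
Lemma smooth_derive f v : smooth f -> smooth (fun x => 'D_v f x).
Proof. by move=> h n; have [_ /(_ v) []] := h n.+1. Qed.
Lemma smooth_derivable f v x : smooth f -> derivable f x v.
Proof. by move=> h; have [_ /(_ v) [/(_ x)]] := h 1%N. Qed.
Lemma smooth_shift f a : smooth f -> smooth (fun x => f (x + a)).
Proof. by move=> h n; exact: Ck_shift. Qed.

End SmoothFunctions.

(** * A smooth step function *)

Section SmoothStep.
Context (R : realType).
Implicit Types (x t : R).

(** The powers of [x^-1] make the family stable under differentiation: the derivative of [flat n]
    combines [flat n.+2] and [flat n.+1], which gives smoothness by induction. *)
Definition flat (n : nat) (x : R) : R := if 0 < x then x^-1 ^+ n * expR (- x^-1) else 0.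

Lemma flat_ge0 n x : 0 <= flat n x.
Proof.
rewrite /flat; case: ifPn => // x0.
by rewrite mulr_ge0 ?exprn_ge0 ?invr_ge0 ?expR_ge0 // ltW.
Qed.

(** One term of the exponential series at [x^-1] beats the power; the two spare powers of [x] make
    the derivative at 0 vanish. *)
Lemma flat_le n x : 0 < x -> flat n x <= (n.+2)`!%:R * x ^+ 2.
Proof.
move=> x0; rewrite /flat x0 expRN.
have y0 : 0 < x^-1 by rewrite invr_gt0.
have := expR_ge1Dxn n.+1 (ltW y0); set y := x^-1 in y0 *.
have fp : 0 < (n.+2)`!%:R :> R by rewrite ltr0n fact_gt0.
move=> h; have h2 : y ^+ n.+2 / (n.+2)`!%:R <= expR y by lra.
rewrite ler_pdivrMr ?expR_gt0 // mulrAC.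
have -> : x ^+ 2 = (y ^+ 2)^-1 by rewrite /y exprVn invrK.
rewrite ler_pdivlMr ?exprn_gt0 // -exprD addn2 mulrC -ler_pdivrMr //.
Qed.

Lemma is_derive_flat n x v :
  is_derive x v (flat n) (v * (flat n.+2 x - n%:R * flat n.+1 x)).
Proof.
suff D1 : is_derive x 1 (flat n) (flat n.+2 x - n%:R * flat n.+1 x).
  have d : differentiable (flat n) x by apply/derivable1_diffP.
  apply: DeriveDef; first exact: diff_derivable.
  by rewrite deriveE // diff1E //= derive1E (derive_val (is_derive := D1)).
have [x0|x0|<-] := ltgtP 0 x.
- have e : \near x, x^-1 ^+ n * expR (- x^-1) = flat n x.
    near=> y; rewrite /flat ifT //; near: y; exact: lt_nbhsr.
  apply: (near_eq_is_derive e); rewrite /flat x0.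
  have xn : x != 0 by rewrite gt_eqF.
  have h1 : is_derive x 1 (fun y : R => y^-1) (- x ^- 2 *: 1).
    by apply: (is_deriveV (f := id)).
  have h2 : is_derive x 1 (fun y : R => y^-1 ^+ n) (n%:R * x^-1 ^+ n.-1 * (- x ^- 2)).
    have := is_deriveX n h1.
    by rewrite exprfctE /GRing.scale /= mulr1.
  have h3 : is_derive x 1 (fun y : R => expR (- y^-1)) (expR (- x^-1) * x ^- 2).
    have h4 : is_derive x 1 (fun y : R => - y^-1) (x ^- 2).
      have := is_deriveN h1; rewrite /GRing.scale /= mulr1 opprK //.
    have := is_derive1_comp (f := @expR R) (g := fun y : R => - y^-1) (is_derive_expR _) h4.
    by rewrite /GRing.scale /= mulrC.
  have := is_deriveM h2 h3.
  rewrite (_ : _ *: _ + _ *: _ =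
    x^-1 ^+ n.+2 * expR (- x^-1) - n%:R * (x^-1 ^+ n.+1 * expR (- x^-1))) //.
  rewrite /GRing.scale /=; case: n {e h2} => [|n] /=.
    by rewrite expr0 -exprVn; ring.
  by rewrite -!exprVn !exprS; ring.
- have e : \near x, (fun=> 0) x = flat n x.
    near=> y; rewrite /flat ifF //; apply/negbTE; rewrite -leNgt ltW //.
    by near: y; exact: lt_nbhsl.
  apply: (near_eq_is_derive e); rewrite /flat ifF; last by apply/negbTE; rewrite -leNgt ltW.
  by rewrite ifF ?mulr0 ?subrr; [exact: is_derive_cst|apply/negbTE; rewrite -leNgt ltW].
(* At the origin the difference quotient is at most a constant times [|t|], by [flat_le]. *)
- rewrite /flat ltxx mulr0 subrr.
  have c : (fun t : R => t^-1 *: ((flat n \o shift 0) (t *: (1 : R)) - flat n 0)) @ 0^' --> (0 : R).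
    have h : (fun t : R => (n.+2)`!%:R * `|t|) @ 0^' --> (0 : R).
      apply: cvg_within_filter.
      have : (fun t : R => (n.+2)`!%:R * `|t|) @ 0 --> ((n.+2)`!%:R * `|0 : R|).
        by apply: cvgM; [exact: cvg_cst|apply: cvg_norm; exact: cvg_id].
      by rewrite normr0 mulr0.
    apply/norm_cvg0P; apply: (squeeze_cvgr _ (cvg_cst 0) h); near=> t.
    rewrite normr_ge0 /= addr0 /GRing.scale /= mulr1 {2}/flat ltxx subr0 normrM.
    rewrite (ger0_norm (flat_ge0 _ _)) normfV.
    have [t0|t0] := ltP 0 t; last by rewrite /flat ltNge t0 mulr0 mulr_ge0.
    rewrite gtr0_norm // ler_pdivrMl // mulrCA -expr2; exact: flat_le.
  by apply: DeriveDef; [apply/cvg_ex; exists 0|exact/cvg_lim].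
Unshelve. all: by end_near. Qed.

Lemma flat_smooth n : smooth (flat n).
Proof.
have cont k : continuous (flat k).
  by move=> x; apply: differentiable_continuous; apply/derivable1_diffP;
    case: (is_derive_flat k x 1).
move=> m; elim: m n => [|m IH] n; first by split.
split=> [|v]; first exact: cont.
split=> [x|]; first by case: (is_derive_flat n x v).
have -> : (fun x => 'D_v (flat n) x) =
    (fun x => v * (flat n.+2 x + (- n%:R) * flat n.+1 x)).
  by apply/funext => x; rewrite (derive_val (is_derive := is_derive_flat n x v)) mulNr.
apply: CkM; first exact: Ck_cst.
by apply: CkD => //; apply: CkM => //; exact: Ck_cst.
Qed.

(** The classical smooth transition from 0 to 1 over the unit interval; the denominator is positive
    because [x] or [1 - x] is. *)
Definition step x : R := flat 0 x / (flat 0 x + flat 0 (1 - x)).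

Lemma step_den x : 0 < flat 0 x + flat 0 (1 - x).
Proof.
have pos y : 0 < y -> 0 < flat 0 y.
  by move=> y0; rewrite /flat y0 expr0 mul1r expR_gt0.
have [x0|x0] := ltP 0 x; first by rewrite ltr_wpDr ?flat_ge0 ?pos.
by rewrite ltr_wpDl ?flat_ge0 // pos //; lra.
Qed.

Lemma step_smooth : smooth step.
Proof.
move=> n; apply: CkM; first exact: flat_smooth.
apply: CkV => [x|]; first by rewrite gt_eqF ?step_den.
apply: CkD; first exact: flat_smooth.
have -> : (fun x => flat 0 (1 - x)) = (fun x => flat 0 (- x + 1)).
  by apply/funext => x; rewrite addrC.
apply: (@Ck_comp_linear _ _ _ n (flat 0) (fun x : R => - x) 1) => [a u v|x|].
- by rewrite opprD scalerN.
- by apply: cvgN; exact: cvg_id.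
- exact: flat_smooth.
Qed.

Lemma step_ge0 x : 0 <= step x.
Proof. by rewrite divr_ge0 ?flat_ge0 // ltW // step_den. Qed.
Lemma step_le1 x : step x <= 1.
Proof. by rewrite ler_pdivrMr ?step_den // mul1r lerDl flat_ge0. Qed.
Lemma step0 x : x <= 0 -> step x = 0.
Proof. by move=> x0; rewrite /step {1}/flat ltNge x0 mul0r. Qed.
Lemma step1 x : 1 <= x -> step x = 1.
Proof.
move=> x1; rewrite /step [X in _ + X]/flat ifF ?addr0 ?divff //.
  by have := step_den x; rewrite [X in _ + X]/flat ifF ?addr0 => [/gt_eqF ->//|];
    apply/negbTE; rewrite -leNgt; lra.
by apply/negbTE; rewrite -leNgt; lra.
Qed.

End SmoothStep.

(** * Square integrable functions *)

Lemma cvgr_le_near (R : realType) (u : nat -> R) (l a : R) :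
  u @ \oo --> l -> (\forall n \near \oo, u n <= a) -> l <= a.
Proof. by move=> ul h; apply: (ler_cvg_to ul (cvg_cst a)). Qed.

Section SquareIntegrable.
Context d (X : measurableType d) (R : realType) (mu : {measure set X -> \bar R}).
Implicit Types f g : X -> R.

Definition L1f f := mu.-integrable setT (EFin \o f).
Definition L2f f := measurable_fun [set: X] f /\ L1f (fun x => f x ^+ 2).
Definition rint f : R := \int[mu]_(x in setT) f x.

Lemma L1f_dom f g : measurable_fun setT f -> L1f g -> (forall x, `|f x| <= g x) -> L1f f.
Proof.
move=> mf ig fg; apply: (le_integrable _ _ _ ig) => //.
  exact/measurable_EFinP.
by move=> x _ /=; rewrite lee_fin; apply: le_trans (fg x) (ler_norm _).
Qed.

Lemma L1fD f g : L1f f -> L1f g -> L1f (fun x => f x + g x).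
Proof.
move=> hf hg; rewrite /L1f (_ : _ \o _ = (EFin \o f) \+ (EFin \o g))%E //.
exact: integrableD.
Qed.

Lemma L1fZ a f : L1f f -> L1f (fun x => a * f x).
Proof.
move=> hf; rewrite /L1f (_ : _ \o _ = (fun x => a%:E * (EFin \o f) x))%E //.
exact: integrableZl.
Qed.

Lemma L1fB f g : L1f f -> L1f g -> L1f (fun x => f x - g x).
Proof.
move=> hf hg; have := L1fD hf (L1fZ (-1) hg).
by under [X in L1f X -> _]eq_fun do rewrite mulN1r.
Qed.

Lemma L1f0 : L1f (fun=> 0). Proof. exact: integrable0. Qed.

Lemma L1f_norm f : L1f f -> L1f (fun x => `|f x|).
Proof. by move=> hf; have := integrable_abse hf. Qed.

Lemma L1f_meas f : L1f f -> measurable_fun setT f.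
Proof. by move=> /(measurable_int mu)/measurable_EFinP. Qed.

Lemma eq_rint f g : (forall x, f x = g x) -> rint f = rint g.
Proof. by move=> /funext ->. Qed.

Lemma rintD f g : L1f f -> L1f g -> rint (fun x => f x + g x) = rint f + rint g.
Proof. by move=> hf hg; exact: RintegralD. Qed.

Lemma rintB f g : L1f f -> L1f g -> rint (fun x => f x - g x) = rint f - rint g.
Proof. by move=> hf hg; exact: RintegralB. Qed.

Lemma rintZ a f : L1f f -> rint (fun x => a * f x) = a * rint f.
Proof. by move=> hf; exact: RintegralZl. Qed.

Lemma rint_le f g : L1f f -> L1f g -> (forall x, f x <= g x) -> rint f <= rint g.
Proof. by move=> hf hg h; apply: le_Rintegral. Qed.

Lemma rint_ge0 f : (forall x, 0 <= f x) -> 0 <= rint f.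
Proof. by move=> h; apply: Rintegral_ge0. Qed.

Lemma rintE f : L1f f -> (rint f)%:E = (\int[mu]_x (f x)%:E)%E.
Proof. by move=> hf; rewrite /rint /Rintegral fineK // integrable_fin_num. Qed.

Lemma rint_ae f g : measurable_fun setT f -> measurable_fun setT g ->
  (\forall x \ae mu, f x = g x) -> rint f = rint g.
Proof.
move=> mf mg fg; congr fine; apply: ae_eq_integral => //; try exact/measurable_EFinP.
by apply: filterS fg => x /= ->.
Qed.

Lemma L1f_sum (I : Type) (s : seq I) (F : I -> X -> R) :
  (forall i, L1f (F i)) -> L1f (fun x => \sum_(i <- s) F i x).
Proof.
move=> hF; elim: s => [|i s IH].
  by under [X in L1f X]eq_fun do rewrite big_nil; exact: L1f0.
by under [X in L1f X]eq_fun do rewrite big_cons; exact: L1fD.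
Qed.

Lemma rint_sum (I : Type) (s : seq I) (F : I -> X -> R) :
  (forall i, L1f (F i)) -> rint (fun x => \sum_(i <- s) F i x) = \sum_(i <- s) rint (F i).
Proof.
move=> hF; elim: s => [|i s IH].
  transitivity (0 * rint (fun _ : X => 0)); last by rewrite mul0r big_nil.
  by rewrite -(rintZ 0 L1f0); apply: eq_rint => x; rewrite big_nil mul0r.
rewrite big_cons -IH -rintD //; last exact: L1f_sum.
by apply: eq_rint => x; rewrite big_cons.
Qed.

Lemma L1f_mul f g : L2f f -> L2f g -> L1f (fun x => f x * g x).
Proof.
move=> [mf sf] [mg sg]; apply: L1f_dom (L1fD sf sg) _ => [|x].
  exact: measurable_funM.
rewrite normrM -[f x ^+ 2]real_normK ?num_real // -[g x ^+ 2]real_normK ?num_real //.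
have := sqr_ge0 (`|f x| - `|g x|); rewrite sqrrB.
by have := mulr_ge0 (normr_ge0 (f x)) (normr_ge0 (g x)); lra.
Qed.

Lemma L2fZ a f : L2f f -> L2f (fun x => a * f x).
Proof.
move=> [mf sf]; split; first exact: measurable_funM.
by under [X in L1f X]eq_fun do rewrite exprMn; exact: L1fZ.
Qed.

Lemma L2fD f g : L2f f -> L2f g -> L2f (fun x => f x + g x).
Proof.
move=> lf lg; have [mf sf] := lf; have [mg sg] := lg; split.
  exact: measurable_funD.
have -> : (fun x => (f x + g x) ^+ 2) =
    (fun x => (f x ^+ 2 + 2 * (f x * g x)) + g x ^+ 2).
  by apply/funext => x; ring.
by apply: L1fD => //; apply: L1fD => //; apply: L1fZ; exact: L1f_mul.
Qed.

Lemma L2f0 : L2f (fun=> 0).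
Proof.
split; first exact: measurable_cst.
by under [X in L1f X]eq_fun do rewrite expr0n; exact: L1f0.
Qed.

Lemma L2fB f g : L2f f -> L2f g -> L2f (fun x => f x - g x).
Proof.
move=> hf hg; have := L2fD hf (L2fZ (-1) hg).
by under [X in L2f X -> _]eq_fun do rewrite mulN1r.
Qed.

Lemma L2f_Lfun f : f \in Lfun mu 2%:E <-> L2f f.
Proof.
split=> [lf|[mf sf]].
  split; last exact: Lfun2_integrable_sqr.
  by move: lf; rewrite inE => /andP[] /[!inE].
rewrite inE; apply/andP; split; rewrite inE //= /finite_norm unlock /Lnorm.
rewrite poweR_lty //; case/integrableP: sf => _; apply: le_lt_trans.
rewrite le_eqVlt; apply/orP; left; apply/eqP; apply: eq_integral => x _ /=.
by rewrite powR_mulrn // normrX.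
Qed.

Lemma rdct (F : nat -> X -> R) f g : (forall n, measurable_fun setT (F n)) ->
  (forall x, F n x @[n --> \oo] --> f x) -> L1f g ->
  (forall n x, `|F n x| <= g x) ->
  L1f f /\ (fun n => rint (F n)) @ \oo --> rint f.
Proof.
move=> mF Ff ig Fg.
have mf : measurable_fun setT f by apply: (measurable_fun_cvg mF) => x _.
have fg x : `|f x| <= g x.
  have h : (fun n => `|F n x|) @ \oo --> `|f x| by apply: cvg_norm; exact: Ff.
  apply: (cvgr_le_near h).
  by near=> n; exact: Fg.
have lf : L1f f by exact: L1f_dom fg.
split => //; apply: fine_cvg.
have -> : (fine (\int[mu]_(x in setT) (f x)%:E))%:E = (\int[mu]_(x in setT) (f x)%:E)%E.
  by rewrite fineK // integrable_fin_num.
apply: (@dominated_cvg _ _ _ mu _ _ (fun n => EFin \o F n) (EFin \o f) (EFin \o g)) => //.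
- by move=> n; exact/measurable_EFinP.
- by move=> x _; apply: cvg_EFin; [near=> n|exact: Ff].
- by move=> n x _; rewrite /= lee_fin.
Unshelve. all: by end_near. Qed.

(* Riesz-Fischer: along a subsequence with [rint (d k)^2 <= 16^-k], the series
   [sum_k 4^k (d k)^2] is integrable, so [|d k| <= C 2^-k] almost everywhere. *)
Lemma L2f_fast (G : nat -> X -> R) : (forall n, L2f (G n)) ->
  (forall k, rint (fun x => (G k.+1 x - G k x) ^+ 2) <= 16^-1 ^+ k) ->
  exists2 g : X -> R, measurable_fun setT g & \forall x \ae mu, G k x @[k --> \oo] --> g x.
Proof.
move=> lG hG; pose D k x := G k.+1 x - G k x.
have lD k : L2f (D k) by exact: L2fB.
pose S : X -> \bar R := fun x => (\sum_(0 <= k <oo) (4 ^+ k * D k x ^+ 2)%:E)%E.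
have mD k : measurable_fun setT (fun x => (4 ^+ k * D k x ^+ 2)%:E).
  by apply/measurable_EFinP/measurable_funM => //; apply: measurable_funX; case: (lD k).
have D0 k x : (0 <= (4 ^+ k * D k x ^+ 2)%:E)%E.
  by rewrite lee_fin mulr_ge0 ?sqr_ge0 ?exprn_ge0.
have mS : measurable_fun setT S by apply: ge0_emeasurable_sum => // k x _ _; exact: D0.
have S0 x : (0 <= S x)%E by apply: nneseries_ge0 => k _ _; exact: D0.
have iS : mu.-integrable setT S.
  apply/integrableP; split => //.
  rewrite (eq_integral S) => [|x _]; last by rewrite gee0_abs.
  rewrite integral_nneseries //.
  have le k : (\int[mu]_x (4 ^+ k * D k x ^+ 2)%:E <= (1 / (4 ^+ k))%:E)%E.
    rewrite -rintE; last by apply: L1fZ; case: (lD k).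
    rewrite lee_fin rintZ; last by case: (lD k).
    rewrite ler_pdivlMr ?exprn_gt0 // mulrAC -exprMn.
    apply: le_trans (ler_wpM2l _ (hG k)) _; first by rewrite exprn_ge0.
    rewrite -exprMn (_ : 4 * 4 * 16^-1 = 1); last by field.
    by rewrite expr1n.
  apply: (@le_lt_trans _ _ (\sum_(0 <= k <oo) (1 / 4 ^+ k)%:E)%E).
    apply: lee_nneseries => k _; last exact: le.
    by move=> _; apply: integral_ge0 => x _; exact: D0.
  have h4 : series (geometric (1 : R) 4^-1) @ \oo --> (1 * (1 - 4^-1)^-1 : R).
    by apply: cvg_geometric_series; rewrite ger0_norm; lra.
  have e4 : (fun n => \sum_(0 <= k < n) (1 / 4 ^+ k : R)%:E)%E =
      (fun n => (series (geometric (1:R) 4^-1) n)%:E).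
    apply/funext => n; rewrite /series /= sumEFin; congr EFin.
    by apply: eq_bigr => k _; rewrite /geometric /= exprVn.
  have h5 : (fun n => (series (geometric (1:R) 4^-1) n)%:E) @ \oo --> (1 * (1 - 4^-1)^-1 : R)%:E.
    by apply: cvg_EFin h4; near=> n.
  by rewrite e4 (cvg_lim _ h5) // ltry.
have cvgG x : S x \is a fin_num -> cvgn (fun k => G k x).
  move=> Sf.
  have Dle k : `|D k x| <= Num.sqrt (fine (S x)) * 2^-1 ^+ k.
    have : ((4 ^+ k * D k x ^+ 2)%:E <= S x)%E.
      apply: le_trans (nneseries_lim_ge k.+1 _) => [|i _ _]; last exact: D0.
      rewrite big_nat_recr //= leeDr // sumEFin lee_fin.
      by apply: sumr_ge0 => i _; have := D0 i x; rewrite lee_fin.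
    move=> h'; have h : 4 ^+ k * D k x ^+ 2 <= fine (S x) by rewrite -lee_fin fineK.
    rewrite -(@ler_pXn2r _ 2) // ?nnegrE ?mulr_ge0 ?sqrtr_ge0 ?exprn_ge0 //.
    rewrite exprMn sqr_sqrtr ?fine_ge0 // real_normK ?num_real //.
    have -> : (2^-1 ^+ k) ^+ 2 = (4 ^+ k)^-1 :> R.
      by rewrite !exprVn -exprM mulnC exprM; congr ((_ ^+ k)^-1); ring.
    by rewrite ler_pdivlMr ?exprn_gt0 // mulrC.
  have cS : cvgn (series (fun k => D k x)).
    apply: normed_cvg.
    apply: (series_le_cvg _ _ Dle).
    - by move=> k; exact: normr_ge0.
    - by move=> k; rewrite mulr_ge0 ?sqrtr_ge0 ?exprn_ge0.
    - apply: is_cvg_geometric_series; rewrite ger0_norm; lra.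
  have -> : (fun k => G k x) = (fun k => G 0%N x + series (fun k => D k x) k).
    apply/funext => k; rewrite /series /= /D telescope_sumr //; ring.
  by apply: is_cvgD => //; exact: is_cvg_cst.
(* A measurable set of full measure. Off it the sequence is replaced by 0, so that the limit exists
   everywhere and is measurable. *)
pose A := [set x | S x \is a fin_num].
have mA : measurable A by rewrite -[A]setTI; exact: emeasurable_fin_num.
have hl x : (fun k => G k x * \1_A x) @ \oo --> lim ((fun k => G k x * \1_A x) @ \oo).
  rewrite indicE; have [/set_mem xA|xA] := boolP (x \in A).
    by under eq_fun do rewrite mulr1; exact: cvgG.
  by under eq_fun do rewrite mulr0; exact: is_cvg_cst.
exists (fun x => lim ((fun k => G k x * \1_A x) @ \oo)).
  apply: (@measurable_fun_cvg _ _ _ _ (fun k x => G k x * \1_A x)) => [k|x _]; last exact: hl.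
  by apply: measurable_funM; [case: (lG k)|exact/measurable_indicP].
have := integrable_ae measurableT iS; apply: filterS => x /(_ I) Sf.
have e : (fun k => G k x * \1_A x) = (fun k => G k x).
  by apply/funext => k; rewrite indicE mem_set ?mulr1.
by move: (hl x); rewrite e.
Unshelve. all: by end_near. Qed.

(** Fatou's lemma for the squares turns almost everywhere convergence into the L^2 estimate for the
    limit. *)
Lemma L2f_fatou (G : nat -> X -> R) (g f : X -> R) e : (forall n, L2f (G n)) -> L2f f ->
  measurable_fun setT g -> (\forall x \ae mu, G k x @[k --> \oo] --> g x) ->
  (\forall k \near \oo, rint (fun x => (f x - G k x) ^+ 2) <= e) ->
  L1f (fun x => (f x - g x) ^+ 2) /\ rint (fun x => (f x - g x) ^+ 2) <= e.
Proof.
move=> lG lf mg Gg he.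
have mfg : measurable_fun setT (fun x => (f x - g x) ^+ 2).
  by apply: measurable_funX; apply: measurable_funB => //; case: lf.
have mfG k : measurable_fun setT (fun x => ((f x - G k x) ^+ 2)%:E).
  apply/measurable_EFinP; apply: measurable_funX.
  by apply: measurable_funB; [case: lf|case: (lG k)].
have h : (\int[mu]_x ((f x - g x) ^+ 2)%:E <= e%:E)%E.
  have -> : (\int[mu]_x ((f x - g x) ^+ 2)%:E =
      \int[mu]_x limn_einf (fun k => ((f x - G k x) ^+ 2)%:E))%E.
    apply: ae_eq_integral => //; first exact/measurable_EFinP.
      rewrite /limn_einf; apply: measurableT_comp => //.
      by apply: measurable_fun_limn_esup => k; exact: measurableT_comp.
    apply: filterS Gg => x Gx _.
    have c : (fun k => ((f x - G k x) ^+ 2)%:E) @ \oo --> ((f x - g x) ^+ 2)%:E.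
      apply: cvg_EFin; first by near=> n.
      under eq_fun do rewrite /= expr2; rewrite expr2.
      by apply: cvgM; apply: cvgB => //; exact: cvg_cst.
    by rewrite (cvg_limn_einf_sup c).1.
  apply: le_trans (fatou mu measurableT mfG _) _.
    by move=> k x _; rewrite lee_fin sqr_ge0.
  rewrite limn_einf_lim; apply: lime_le; first exact: is_cvg_einfs.
  apply: filterS he => k hk.
  apply: (@le_trans _ _ (\int[mu]_x ((f x - G k x) ^+ 2)%:E)%E).
    by apply: ereal_inf_lbound; exists k => //=.
  by rewrite -rintE ?lee_fin //; exact: (L2fB lf (lG k)).2.
have L : L1f (fun x => (f x - g x) ^+ 2).
  apply/integrableP; split; first exact/measurable_EFinP.
  apply: le_lt_trans (_ : _ <= e%:E)%E _; last exact: ltry.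
  apply: le_trans h; rewrite le_eqVlt; apply/orP; left; apply/eqP.
  by apply: eq_integral => x _; rewrite gee0_abs // lee_fin sqr_ge0.
by split => //; rewrite -lee_fin rintE.
Unshelve. all: by end_near. Qed.

Lemma L2f_complete (G : nat -> X -> R) : (forall n, L2f (G n)) ->
  (forall e, 0 < e -> exists N, forall j k, (N <= j)%N -> (N <= k)%N ->
     rint (fun x => (G j x - G k x) ^+ 2) < e) ->
  exists2 g, L2f g & (fun n => rint (fun x => (G n x - g x) ^+ 2)) @ \oo --> (0 : R).
Proof.
move=> lG cG.
have p16 k : 0 < 16^-1 ^+ k :> R by rewrite exprn_gt0 // invr_gt0.
have /choice[N hN] (k : nat) := cG _ (p16 k).
(* Summing the moduli gives an index beyond every [N i] with [i <= k], whether or not [N]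
   increases. *)
pose phi k := (\sum_(i < k.+1) N i)%N.
have Nphi i k : (i <= k)%N -> (N i <= phi k)%N.
  move=> ik; have ik1 : (i < k.+1)%N by [].
  by rewrite /phi (bigD1 (Ordinal ik1)) //= leq_addr.
have [g mg Gg] : exists2 g : X -> R, measurable_fun setT g &
    \forall x \ae mu, G (phi k) x @[k --> \oo] --> g x.
  apply: L2f_fast => // k; apply/ltW/hN; exact: Nphi.
have est j n : (N j <= n)%N -> L1f (fun x => (G n x - g x) ^+ 2) /\
    rint (fun x => (G n x - g x) ^+ 2) <= 16^-1 ^+ j.
  move=> jn; apply: (@L2f_fatou (fun k => G (phi k))) => //.
  by near=> k; apply/ltW/hN => //; apply: Nphi; near: k; exact: nbhs_infty_ge.
have lg : L2f g.
  have [l1 _] := est 0%N (N 0%N) (leqnn _).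
  have l2 : L2f (fun x => G (N 0%N) x - g x).
    by split => //; apply: measurable_funB => //; case: (lG (N 0%N)).
  have := L2fB (lG (N 0%N)) l2.
  by under [X in L2f X -> _]eq_fun do rewrite opprB addrC subrK.
exists g => //; apply/cvgrPdist_le => e e0.
have h16 : (fun k => 16^-1 ^+ k : R) @ \oo --> (0 : R).
  by apply: cvg_expr; rewrite ger0_norm; lra.
have /cvgr0Pnorm_lt /(_ _ e0) [j _ /(_ j (leqnn j))] := h16.
rewrite ger0_norm ?(ltW (p16 j)) // => hj.
near=> n; rewrite sub0r normrN ger0_norm; last by apply: rint_ge0 => x; rewrite sqr_ge0.
have jn : (N j <= n)%N by near: n; exact: nbhs_infty_ge.
by apply: le_trans (est j n jn).2 (ltW hj).
Unshelve. all: by end_near. Qed.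

End SquareIntegrable.

(** * Lebesgue measure on R^3 and test functions *)

Lemma sigma_finite_prod d1 d2 (T1 : measurableType d1) (T2 : measurableType d2)
    (R : realType) (m1 : {sigma_finite_measure set T1 -> \bar R})
    (m2 : {sigma_finite_measure set T2 -> \bar R}) :
  sigma_finite setT (m1 \x m2)%E.
Proof.
have /sigma_finiteP[F [UF ndF Ffin]] := sigma_finiteT m1.
have /sigma_finiteP[G [UG ndG Gfin]] := sigma_finiteT m2.
exists (fun n => F n `*` G n) => [|k]; last first.
  have [mF Foo] := Ffin k; have [mG Goo] := Gfin k.
  split; first exact: measurableX.
  by rewrite product_measure1E // lte_mul_pinfty // ge0_fin_numE.
apply/seteqP; split => // -[x y] _.
have [i _ Fx] : (\bigcup_n F n) x by rewrite -UF.
have [j _ Gy] : (\bigcup_n G n) y by rewrite -UG.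
exists (maxn i j) => //; split => /=.
  by move: x Fx; exact/subsetPset/ndF/leq_maxl.
by move: y Gy; exact/subsetPset/ndG/leq_maxr.
Qed.

Definition prodsf d1 d2 (T1 : measurableType d1) (T2 : measurableType d2)
    (R : realType) (m1 : {sigma_finite_measure set T1 -> \bar R})
    (m2 : {sigma_finite_measure set T2 -> \bar R}) :=
  HB.pack_for {sigma_finite_measure set (T1 * T2)%type -> \bar R} (m1 \x m2)%E
    (Measure_isSigmaFinite.Build _ _ _ (m1 \x m2)%E (sigma_finite_prod m1 m2)).

(* [leb3], with its sigma-finiteness, as Fubini's theorem requires it *)
Definition leb3s (R : realType) : {sigma_finite_measure set (R3 R) -> \bar R} :=
  prodsf (prodsf (@lebesgue_measure R) (@lebesgue_measure R)) (@lebesgue_measure R).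

Section Space.
Context (R : realType).
Notation mR := (measurableTypeR R).
Implicit Types (A : set (R3 R)) (x a : R3 R).

Definition crd (i : 'I_3) x : R :=
  if i == 0 then x.1.1 else if i == 1 then x.1.2 else x.2.

Lemma ball3P x (e : R) y : ball x e y <->
  [/\ `|x.1.1 - y.1.1| < e, `|x.1.2 - y.1.2| < e & `|x.2 - y.2| < e].
Proof. by split=> [[[h1 h2] h3]|[h1 h2 h3]]; split. Qed.

Lemma measurable_ball3 x (e : R) : measurable (ball x e).
Proof.
have -> : ball x e = (ball x.1.1 e `*` ball x.1.2 e) `*` ball x.2 e.
  by apply/seteqP; split => y.
by apply: measurableX; [apply: measurableX|]; exact: measurable_ball.
Qed.

Definition rpt (q : rat * rat * rat) : R3 R := (ratr q.1.1, ratr q.1.2, ratr q.2).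
Definition rball (q : rat * rat * rat * nat) : set (R3 R) := ball (rpt q.1) q.2.+1%:R^-1.

(** The doubled radius leaves a closed cube around the rational ball inside [A], as the localization
    in [fundamental_lemma] requires. *)
Lemma rball_base A x : open A -> A x -> exists2 q, rball q x &
  ball (rpt q.1) (2 * q.2.+1%:R^-1) `<=` A.
Proof.
move=> oA Ax; have /nbhs_ballP[e /= e0 eA] := oA _ Ax.
have e3 : 0 < e / 3 by lra.
have /cvgr0Pnorm_lt /(_ _ e3) [n _ hn] := cvgZ_harmonic (1 : R).
have {hn} := hn n (leqnn n); rewrite mul1r ger0_norm // => hn.
have n0 : 0 < n.+1%:R^-1 :> R by rewrite invr_gt0.
have app (t : R) : exists q : rat, `|ratr q - t| < n.+1%:R^-1.
  have /rat_in_itvoo[q] : t - n.+1%:R^-1 < t + n.+1%:R^-1.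
    by move: n0; set d := n.+1%:R^-1; lra.
  rewrite in_itv /= => /andP[h1 h2]; exists q.
  by rewrite ltr_norml; move: h1 h2; set d := n.+1%:R^-1; move=> h1 h2; apply/andP; split; lra.
have [q1 h1] := app x.1.1; have [q2 h2] := app x.1.2; have [q3 h3] := app x.2.
exists (q1, q2, q3, n) => /=; first exact/ball3P.
move=> y /ball3P /= [k1 k2 k3]; apply: eA; apply/ball3P.
have tri (a b c : R) : `|b - a| < n.+1%:R^-1 -> `|b - c| < 2 * n.+1%:R^-1 -> `|a - c| < e.
  move=> ba bc; apply: le_lt_trans (ler_distD b a c) _; rewrite distrC.
  by move: ba bc hn; set d := n.+1%:R^-1; lra.
by split; [exact: tri h1 k1|exact: tri h2 k2|exact: tri h3 k3].
Qed.

Lemma countable_rball : countable [set: rat * rat * rat * nat].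
Proof. exact: countableP. Qed.

Lemma open_measurable3 A : open A -> measurable A.
Proof.
move=> oA.
have -> : A = \bigcup_(q : rat * rat * rat * nat)
    (if `[< rball q `<=` A >] then rball q else set0).
  apply/seteqP; split => [x Ax|x [q _]]; last by case: asboolP => // h /h.
  have [q qx qA] := rball_base oA Ax; exists q => //.
  rewrite ifT //; apply/asboolP => y qy; apply: qA; apply: le_ball qy.
  have : 0 <= q.2.+1%:R^-1 :> R by rewrite invr_ge0.
  by set d := q.2.+1%:R^-1; lra.
apply: countable_bigcupT_measurable; first exact: countable_rball.
by move=> q; case: ifP => _ //; exact: measurable_ball3.
Qed.

Lemma continuous_measurable3 (f : R3 R -> R) : continuous f -> measurable_fun setT f.
Proof.
move=> /continuousP cf; apply: (measurability _ (RGenOpens.measurableE R)).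
move=> _ [_ [a [b ->] <-]]; rewrite setTI; apply: open_measurable3.
exact/cf/interval_open.
Qed.

Lemma pt_cont : [/\ continuous (fun x : R3 R => x.1.1 : R),
  continuous (fun x : R3 R => x.1.2 : R) & continuous (fun x : R3 R => x.2 : R)].
Proof.
split=> x.
- by apply: (continuous_comp (f := fst)); [exact: cvg_fst|exact: cvg_fst].
- by apply: (continuous_comp (f := fst)); [exact: cvg_fst|exact: cvg_snd].
- exact: cvg_snd.
Qed.

Lemma crd_continuous i : continuous (crd i).
Proof.
have [h1 h2 h3] := pt_cont.
by rewrite /crd; case: (i == 0) => //; case: (i == 1).
Qed.

Definition obox (a b : R3 R) : set (R3 R) :=
  [set x | [/\ a.1.1 < x.1.1 < b.1.1, a.1.2 < x.1.2 < b.1.2 & a.2 < x.2 < b.2]].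

Lemma oboxE a b : obox a b = (`]a.1.1, b.1.1[ `*` `]a.1.2, b.1.2[) `*` `]a.2, b.2[.
Proof.
apply/seteqP; split => [x [h1 h2 h3]|x [[/= + +] +]] /=; rewrite !in_itv //=.
Qed.

Lemma measurable_obox a b : measurable (obox a b).
Proof. by rewrite oboxE; apply: measurableX => //; exact: measurableX. Qed.

Lemma leb3_setX (A B C : set mR) : measurable A -> measurable B -> measurable C ->
  leb3 R ((A `*` B) `*` C) =
    ((@lebesgue_measure R) A * (@lebesgue_measure R) B * (@lebesgue_measure R) C)%E.
Proof.
move=> mA mB mC.
apply: (etrans (@product_measure1E _ _ _ _ _
  (prodsf (@lebesgue_measure R) (@lebesgue_measure R)) (@lebesgue_measure R) _ _ _ mC)).
  exact: measurableX.
by congr (_ * _)%E; exact: product_measure1E.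
Qed.

Lemma obox_fin a b : (leb3 R (obox a b) < +oo)%E.
Proof.
rewrite oboxE; have fin (s t : R) : exists r : R, (0 <= r)%R /\
    (@lebesgue_measure R `]s, t[ = r%:E)%E.
  have h := lebesgue_measure_itv (`]s, t[ : interval R); rewrite /= lte_fin in h.
  exists (if s < t then t - s else 0); split; first by case: ifP => //; lra.
  by apply: (etrans h); case: ifP.
have [r1 [p1 e1]] := fin a.1.1 b.1.1; have [r2 [p2 e2]] := fin a.1.2 b.1.2.
have [r3 [p3 e3]] := fin a.2 b.2.
by rewrite leb3_setX // e1 e2 e3 -!EFinM ltry.
Qed.

Lemma obox_setI a b c d : exists e f, obox a b `&` obox c d = obox e f.
Proof.
exists (Num.max a.1.1 c.1.1, Num.max a.1.2 c.1.2, Num.max a.2 c.2).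
exists (Num.min b.1.1 d.1.1, Num.min b.1.2 d.1.2, Num.min b.2 d.2).
apply/seteqP; split => x; rewrite /obox /= !gt_max !lt_min.
  by move=> [[/andP[-> ->] /andP[-> ->] /andP[-> ->]] [/andP[-> ->] /andP[-> ->] /andP[-> ->]]].
by move=> [/andP[/andP[-> ->] /andP[-> ->]] /andP[/andP[-> ->] /andP[-> ->]] /andP[/andP[-> ->] /andP[-> ->]]].
Qed.

Definition boxes : set (set (R3 R)) := [set A | exists a b, A = obox a b].

Lemma measurable3_gen : (@measurable _ (R3 R)) = <<s boxes >>.
(* Boxes are stable under intersection, so this prepares Dynkin induction. A slab in one coordinate
   is a countable union of boxes, its free directions being exhausted by [n%:R]; slabs give the
   preimages of Borel sets under each coordinate. *)
Proof.
apply/seteqP; split; last first.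
  apply: smallest_sub; first exact: sigma_algebra_measurable.
  by move=> _ [a [b ->]]; exact: measurable_obox.
have big (t : R) (n : nat) : `|t| < n%:R -> - n%:R < t < n%:R by rewrite ltr_norml.
have arch (t : R) : exists n : nat, `|t| < n%:R.
  by exists (Num.truncn `|t|).+1; rewrite truncnS_gt.
have arch3 (u v w : R) : exists n : nat, [/\ - n%:R < u < n%:R, - n%:R < v < n%:R &
    - n%:R < w < n%:R].
  have [i hi] := arch u; have [j hj] := arch v; have [k hk] := arch w.
  exists (i + j + k)%N; split; apply: big.
  - by apply: lt_le_trans hi _; rewrite ler_nat -addnA leq_addr.
  - by apply: lt_le_trans hj _; rewrite ler_nat -addnA addnCA leq_addr.
  - by apply: lt_le_trans hk _; rewrite ler_nat leq_addl.
have slab (pr : R3 R -> R) : (forall a b : R, <<s boxes >> (pr @^-1` `]a, b[)) ->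
    forall B : set mR, measurable B -> <<s boxes >> (pr @^-1` B).
  move=> h B; rewrite (RGenOpens.measurableE R : @measurable _ mR = _).
  suff : <<s @RGenOpens.G R >> `<=` [set B | <<s boxes >> (pr @^-1` B)] by apply.
  apply: smallest_sub; last by move=> _ [a [b ->]]; exact: h.
  split.
  - by rewrite /= preimage_set0; exact: sigma_algebra0.
  - by move=> C /= hC; rewrite setTD preimage_setC; exact: sigma_algebraC.
  - by move=> F hF /=; rewrite preimage_bigcup; exact: sigma_algebra_bigcup.
have s1 : forall B : set mR, measurable B -> <<s boxes >> ((fun x : R3 R => x.1.1 : R) @^-1` B).
  apply: slab => a b.
  rewrite (_ : _ @^-1` _ = \bigcup_n obox (a, - n%:R, - n%:R) (b, n%:R, n%:R)).
    by apply: sigma_algebra_bigcup => n; apply: sub_sigma_algebra; do 2 eexists.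
  apply/seteqP; split => [x h|x [n _ [h _ _]]]; last by rewrite /= in_itv.
  move: h; rewrite /= in_itv /= => h.
  by have [n [h1 h2 h3]] := arch3 x.1.2 x.2 0; exists n.
have s2 : forall B : set mR, measurable B -> <<s boxes >> ((fun x : R3 R => x.1.2 : R) @^-1` B).
  apply: slab => a b.
  rewrite (_ : _ @^-1` _ = \bigcup_n obox (- n%:R, a, - n%:R) (n%:R, b, n%:R)).
    by apply: sigma_algebra_bigcup => n; apply: sub_sigma_algebra; do 2 eexists.
  apply/seteqP; split => [x h|x [n _ [_ h _]]]; last by rewrite /= in_itv.
  move: h; rewrite /= in_itv /= => h.
  by have [n [h1 h2 h3]] := arch3 x.1.1 x.2 0; exists n.
have s3 : forall B : set mR, measurable B -> <<s boxes >> ((fun x : R3 R => x.2 : R) @^-1` B).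
  apply: slab => a b.
  rewrite (_ : _ @^-1` _ = \bigcup_n obox (- n%:R, - n%:R, a) (n%:R, n%:R, b)).
    by apply: sigma_algebra_bigcup => n; apply: sub_sigma_algebra; do 2 eexists.
  apply/seteqP; split => [x h|x [n _ [_ _ h]]]; last by rewrite /= in_itv.
  move: h; rewrite /= in_itv /= => h.
  by have [n [h1 h2 h3]] := arch3 x.1.1 x.1.2 0; exists n.
apply: smallest_sub; first exact: smallest_sigma_algebra.
move=> _ [[B mB <-]|[B mB <-]]; rewrite setTI; last exact: s3.
suff : (@measurable _ (mR * mR)%type) `<=` [set B | <<s boxes >> ((fst : R3 R -> _) @^-1` B)].
  by apply.
apply: smallest_sub; last by move=> _ [[C mC <-]|[C mC <-]]; rewrite setTI; [exact: s1|exact: s2].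
split.
- by rewrite /= preimage_set0; exact: sigma_algebra0.
- by move=> C /= hC; rewrite setTD preimage_setC; exact: sigma_algebraC.
- by move=> F hF /=; rewrite preimage_bigcup; exact: sigma_algebra_bigcup.
Qed.

Lemma measurable_shift1 (a : R) : measurable_fun setT (fun t : mR => (t + a : mR)).
Proof. by apply: measurable_funD => //; exact: measurable_cst. Qed.

Lemma leb_shift (a : R) (A : set mR) : measurable A ->
  (@lebesgue_measure R) ((fun t : mR => (t + a : mR)) @^-1` A) = (@lebesgue_measure R) A.
Proof.
move=> mA.
have e : forall X, ocitv X -> (@lebesgue_measure R) X =
    pushforward (@lebesgue_measure R) (fun t : mR => (t + a : mR)) X.
  move=> _ [[u v] _ <-]; rewrite /pushforward /=.
  rewrite (_ : (fun t : R => t + a) @^-1` `]u, v] = `]u - a, v - a]%classic); last first.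
    by apply/seteqP; split => t /=; rewrite !in_itv /= => /andP[h1 h2]; apply/andP; split; lra.
  have h1 := lebesgue_measure_itv (`]u, v] : interval R).
  have h2 := lebesgue_measure_itv (`]u - a, v - a] : interval R).
  apply: (etrans h1); apply: (etrans _ (esym h2)); rewrite /= !lte_fin ltrD2r.
  by case: ifP => // _; congr EFin; lra.
have := @lebesgue_measure_unique R
  [the measure mR R of pushforward (@lebesgue_measure R) (fun t : mR => (t + a : mR))] e.
by move=> /(_ (measurable_shift1 a) A mA) ->.
Qed.

(** The pushforward agrees with the product measure on rectangles, hence everywhere by uniqueness.
    Two applications carry translation invariance from the line to space. *)
Lemma prod_preserving d1 d2 (T1 : measurableType d1) (T2 : measurableType d2)
    (m1 : {sigma_finite_measure set T1 -> \bar R})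
    (m2 : {sigma_finite_measure set T2 -> \bar R}) (f1 : T1 -> T1) (f2 : T2 -> T2) :
  measurable_fun setT f1 -> measurable_fun setT f2 ->
  (forall B : set T1, measurable B -> m1 (f1 @^-1` B) = m1 B) ->
  (forall B : set T2, measurable B -> m2 (f2 @^-1` B) = m2 B) ->
  forall B : set (T1 * T2), measurable B ->
  (m1 \x m2)%E ((fun u : T1 * T2 => (f1 u.1, f2 u.2)) @^-1` B) = (m1 \x m2)%E B.
Proof.
move=> mf1 mf2 p1 p2 A mA.
have mf : measurable_fun setT (fun x : T1 * T2 => (f1 x.1, f2 x.2)).
  apply/measurable_fun_pairP; split => /=.
  - by apply: (measurableT_comp mf1); exact: measurable_fst.
  - by apply: (measurableT_comp mf2); exact: measurable_snd.
have h := @product_measure_unique _ _ T1 T2 R m1 m2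
  [the measure _ R of pushforward (m1 \x m2)%E (fun x : T1 * T2 => (f1 x.1, f2 x.2))].
apply: (etrans _ (esym (h mf _ A mA))) => // B C mB mC.
rewrite /pushforward /=; transitivity ((m1 \x m2)%E ((f1 @^-1` B) `*` (f2 @^-1` C))).
  by [].
have mB' : measurable (f1 @^-1` B) by rewrite -[X in measurable X]setTI; exact: mf1.
have mC' : measurable (f2 @^-1` C) by rewrite -[X in measurable X]setTI; exact: mf2.
by apply: (etrans (product_measure1E m1 m2 mB' mC')); congr (_ * _)%E; [exact: p1|exact: p2].
Qed.

Lemma measurable_shift3 a : measurable_fun setT (fun x : R3 R => x + a).
Proof.
apply/measurable_fun_pairP; split => /=.
  apply: (measurableT_comp (f := fun y : mR * mR => (y.1 + a.1.1, y.2 + a.1.2))).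
    apply/measurable_fun_pairP; split => /=.
      by apply: (measurableT_comp (measurable_shift1 a.1.1)); exact: measurable_fst.
    by apply: (measurableT_comp (measurable_shift1 a.1.2)); exact: measurable_snd.
  exact: measurable_fst.
by apply: (measurableT_comp (measurable_shift1 a.2)); exact: measurable_snd.
Qed.

Lemma leb3_shift a A : measurable A -> leb3 R ((fun x : R3 R => x + a) @^-1` A) = leb3 R A.
Proof.
move=> mA.
pose g (y : mR * mR) : mR * mR := (y.1 + a.1.1, y.2 + a.1.2).
have mg : measurable_fun setT g.
  apply/measurable_fun_pairP; split => /=.
    by apply: (measurableT_comp (measurable_shift1 a.1.1)); exact: measurable_fst.
  by apply: (measurableT_comp (measurable_shift1 a.1.2)); exact: measurable_snd.
apply: (@prod_preserving _ _ _ _ (prodsf (@lebesgue_measure R) (@lebesgue_measure R))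
  (@lebesgue_measure R) g (fun t => t + a.2) mg (measurable_shift1 _)) => //.
  move=> B mB; apply: (@prod_preserving _ _ _ _ (@lebesgue_measure R) (@lebesgue_measure R)
    (fun t => t + a.1.1) (fun t => t + a.1.2)) => //.
  - exact: measurable_shift1.
  - exact: measurable_shift1.
  - exact: leb_shift.
  - exact: leb_shift.
exact: leb_shift.
Qed.

End Space.

(** * Linear subspaces as modules *)

Section Subspace.
Context (R : realType) (V : lmodType R).

(** The Hilbert space results quantify over a whole module. This makes a module of a set of
    representatives closed under linear combinations, such as the fields in [dom L2]. *)
Record subsp := Subsp { ss_pred : {pred V}; ss_closed : submod_closed ss_pred }.

HB.instance Definition _ (S : subsp) := GRing.isSubmodClosed.Build R V (ss_pred S) (ss_closed S).

Record sub_elt (S : subsp) := SubElt { sub_val :> V; _ : sub_val \in ss_pred S }.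

HB.instance Definition _ (S : subsp) := [isSub of sub_elt S for @sub_val S].
HB.instance Definition _ (S : subsp) := [Choice of sub_elt S by <:].
HB.instance Definition _ (S : subsp) := [SubChoice_isSubLmodule of sub_elt S by <:].

Lemma set_submod (P : set V) : P 0 -> (forall a u v, P u -> P v -> P (a *: u + v)) ->
  submod_closed (mem P).
Proof.
move=> P0 Pl; split; first exact: mem_set.
by move=> a u v /set_mem Pu /set_mem Pv; apply/mem_set/Pl.
Qed.

Definition set_subsp (P : set V) P0 Pl := Subsp (@set_submod P P0 Pl).

End Subspace.

(** * Integrals over space, translations and cubes *)

Section SpaceIntegral.
Context (R : realType).
Notation mR := (measurableTypeR R).
Implicit Types (x a : R3 R).

Notation L1 := (@L1f _ (R3 R) R (leb3 R)).
Notation L2r := (@L2f _ (R3 R) R (leb3 R)).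
Notation int3 := (@rint _ (R3 R) R (leb3 R)).

Lemma meas_shift (f : R3 R -> R) a : measurable_fun setT f -> measurable_fun setT (fun x => f (x + a)).
Proof. by move=> mf; apply: (measurableT_comp mf); exact: measurable_shift3. Qed.

Definition shift3 a (x : R3 R) : R3 R := x + a.

Lemma eint_pushforward_shift (f : R3 R -> \bar R) a :
  (\int[pushforward (leb3 R) (shift3 a)]_x f x = \int[leb3 R]_x f x)%E.
Proof.
have h (m' : {measure set (R3 R) -> \bar R}) : (forall A, measurable A -> m' A = leb3 R A) ->
    (\int[m']_x f x = \int[leb3 R]_x f x)%E.
  by move=> e; apply: (@eq_measure_integral _ _ _ setT (leb3 R) m') => A mA _; exact: e.
have := h [the measure _ R of pushforward (leb3 R) (shift3 a)].
by move=> /(_ (measurable_shift3 a)); apply => A mA; exact: leb3_shift.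
Qed.

Lemma eint_shift (f : R3 R -> \bar R) a : measurable_fun setT f -> (forall x, (0 <= f x)%E) ->
  (\int[leb3 R]_x f (x + a)%R = \int[leb3 R]_x f x)%E.
Proof.
move=> mf f0.
have := @ge0_integral_pushforward _ _ (R3 R) (R3 R) R _ (measurable_shift3 a) (leb3 R) setT f.
rewrite preimage_setT => h; apply: (etrans (esym (h measurableT mf (fun x _ => f0 x)))).
exact: (@eint_pushforward_shift f a).
Qed.

Lemma L1_shift f a : L1 f -> L1 (fun x => f (x + a)).
Proof.
move=> lf; have mf := L1f_meas lf; apply/integrableP; split.
  by apply/measurable_EFinP; exact: meas_shift.
case/integrableP: lf => _; apply: le_lt_trans.
rewrite le_eqVlt; apply/orP; left; apply/eqP.
apply: (@eint_shift (fun x => `|(f x)%:E|)%E) => [|x]; last exact: abse_ge0.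
by apply: measurableT_comp => //; exact/measurable_EFinP.
Qed.

Lemma int_shift f a : L1 f -> int3 (fun x => f (x + a)) = int3 f.
Proof.
move=> lf; have mf := L1f_meas lf.
have := @integral_pushforward _ _ (R3 R) (R3 R) R _ (measurable_shift3 a) (leb3 R) setT
  (EFin \o f).
rewrite preimage_setT => h; rewrite /rint /Rintegral; congr fine.
apply: (etrans (esym (h _ _ measurableT))).
- exact/measurable_EFinP.
- exact: (L1_shift a lf).
- exact: (@eint_pushforward_shift (EFin \o f) a).
Qed.

Lemma L2_shift f a : L2r f -> L2r (fun x => f (x + a)).
Proof. by move=> [mf sf]; split; [exact: meas_shift|exact: (L1_shift a sf)]. Qed.

Lemma oboxP (a b x : R3 R) : obox a b x <-> forall i, crd i a < crd i x < crd i b.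
Proof.
split=> [[h1 h2 h3] i|h]; first by rewrite /crd; case: (i == 0) => //; case: (i == 1).
by split; [exact: (h 0)|exact: (h 1)|exact: (h 2)].
Qed.

Definition cbox (a b : R3 R) : set (R3 R) :=
  [set x | forall i, crd i a <= crd i x <= crd i b].

Lemma compact_cbox a b : compact (cbox a b).
Proof.
rewrite (_ : cbox a b = (`[a.1.1, b.1.1] `*` `[a.1.2, b.1.2]) `*` `[a.2, b.2]).
  by apply: compact_setX; [apply: compact_setX|]; exact: segment_compact.
apply/seteqP; split=> [x h|x [[/= + +] +]]; rewrite ?in_itv /=.
  by split; [split|]; rewrite /= in_itv; [exact: (h 0)|exact: (h 1)|exact: (h 2)].
by move=> h1 h2 h3 i; rewrite /crd; case: (i == 0) => //; case: (i == 1).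
Qed.

Lemma crdD i x a : crd i (x + a) = crd i x + crd i a.
Proof. by rewrite /crd; case: (i == 0) => //; case: (i == 1). Qed.
Lemma crdZ i (t : R) x : crd i (t *: x) = t * crd i x.
Proof. by rewrite /crd; case: (i == 0) => //; case: (i == 1). Qed.
Lemma crdN i x : crd i (- x) = - crd i x.
Proof. by rewrite /crd; case: (i == 0) => //; case: (i == 1). Qed.
Lemma crd_diag i (r : R) : crd i ((r, r, r) : R3 R) = r.
Proof. by rewrite /crd; case: (i == 0) => //; case: (i == 1). Qed.

Definition cube (r : R) : set (R3 R) := obox (- r, - r, - r) (r, r, r).

Lemma cubeP r x : cube r x <-> forall i, `|crd i x| < r.
Proof.
split=> [/oboxP h i|h]; first by move: (h i); rewrite !crd_diag ltr_norml.
by apply/oboxP => i; rewrite !crd_diag -ltr_norml.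
Qed.

Lemma compact_cube (K : set (R3 R)) : compact K -> exists2 r : R, 0 < r & K `<=` cube r.
Proof.
move=> cK.
have b1 i : exists2 r : R, 0 < r & forall x, K x -> `|crd i x| < r.
  have : compact (crd i @` K).
    apply: continuous_compact cK; apply: continuous_subspaceT; exact: crd_continuous.
  move=> /compact_bounded [M [_ hM]]; exists (`|M| + 2) => [|x Kx].
    by have := normr_ge0 M; lra.
  apply: (@le_lt_trans _ _ (`|M| + 1)); last lra.
  by apply: hM; [have := ler_norm M; lra|exists x].
have [r0 p0 h0] := b1 0; have [r1 p1 h1] := b1 1; have [r2 p2 h2] := b1 2.
exists (r0 + r1 + r2); first by rewrite !addr_gt0.
move=> x Kx; split=> /=; rewrite -ltr_norml.
- by have := h0 _ Kx; rewrite [crd 0 x]/(x.1.1); lra.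
- by have := h1 _ Kx; rewrite [crd 1 x]/(x.1.2); lra.
- by have := h2 _ Kx; rewrite [crd 2 x]/(x.2); lra.
Qed.

Definition bsupp (f : R3 R -> R) := exists r : R, forall x, ~ cube r x -> f x = 0.

Lemma compact_bsupp (K : set (R3 R)) (f : R3 R -> R) : compact K ->
  (forall x, ~ K x -> f x = 0) -> bsupp f.
Proof.
by move=> /compact_cube[r _ Kr] Kf; exists r => x xr; apply: Kf => /Kr.
Qed.

Lemma L1_indic (A : set (R3 R)) : measurable A -> (leb3 R A < +oo)%E -> L1 (\1_A).
Proof.
move=> mA fA; apply/integrableP; split; first by apply/measurable_EFinP; exact: measurable_indic.
rewrite (eq_integral (fun x => (\1_A x)%:E)); last first.
  by move=> x _; rewrite /= ger0_norm // indicE.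
by rewrite (integral_indic _ measurableT mA) setIT.
Qed.

Lemma measurable_cube r : measurable (cube r). Proof. exact: measurable_obox. Qed.

Lemma L1_cube r : L1 (\1_(cube r)).
Proof. by apply: L1_indic; [exact: measurable_obox|exact: obox_fin]. Qed.

Lemma indic0N T (A : set T) (x : T) : ~ A x -> \1_A x = 0 :> R.
Proof. by move=> h; rewrite indicE memNset. Qed.
Lemma indic1T T (A : set T) (x : T) : A x -> \1_A x = 1 :> R.
Proof. by move=> h; rewrite indicE mem_set. Qed.

Lemma L1_bounded f (M : R) : measurable_fun setT f -> bsupp f -> (forall x, `|f x| <= M) -> L1 f.
Proof.
move=> mf [r hr] fM.
apply: L1f_dom mf (L1fZ M (L1_cube r)) _ => // x.
have [xr|xr] := pselect (cube r x); first by rewrite indic1T // mulr1.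
by rewrite indic0N // mulr0 hr ?normr0.
Qed.

Lemma cbound (f : R3 R -> R) (K : set (R3 R)) : continuous f -> compact K ->
  (forall x, ~ K x -> f x = 0) -> exists2 M, 0 <= M & forall x, `|f x| <= M.
Proof.
move=> cf cK fK.
have : compact (f @` K) by apply: continuous_compact cK; exact: continuous_subspaceT.
move=> /compact_bounded [M [_ hM]]; exists (`|M| + 1) => [|x]; first by have := normr_ge0 M; lra.
have [Kx|nK] := pselect (K x); last by rewrite fK // normr0; have := normr_ge0 M; lra.
by apply: hM; [have := ler_norm M; lra|exists x].
Qed.

(** * Test functions, difference quotients and integration by parts *)

Section TestFunctions.
Implicit Types (f g : R3 R -> R) (U : set (R3 R)) (v : R3 R).

Lemma test_smooth U f : test_fun U f -> smooth f. Proof. by case. Qed.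

Lemma test_bounded U f : test_fun U f -> exists2 M, 0 <= M & forall x, `|f x| <= M.
Proof. by move=> [sf [K [cK _ fK]]]; apply: cbound cK fK; exact: smooth_continuous. Qed.

Lemma test_bsupp U f : test_fun U f -> bsupp f.
Proof. by move=> [_ [K [cK _]]]; exact: compact_bsupp. Qed.

Lemma test_meas U f : test_fun U f -> measurable_fun setT f.
Proof. by move=> [sf _]; apply: continuous_measurable3; exact: smooth_continuous. Qed.

Lemma test_L1 U f : test_fun U f -> L1 f.
Proof.
move=> tf; have [M _ hM] := test_bounded tf.
by apply: (L1_bounded _ _ hM); [exact: test_meas tf|exact: test_bsupp tf].
Qed.

Lemma testM U f g : smooth f -> test_fun U g -> test_fun U (fun x => f x * g x).
Proof.
move=> sf [sg [K [cK KU gK]]]; split; first exact: smoothM.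
by exists K; split => // x /gK ->; rewrite mulr0.
Qed.

Lemma test_L2 U f : test_fun U f -> L2r f.
Proof.
move=> tf; split; first exact: test_meas tf.
by apply: (@test_L1 U); exact: (testM (test_smooth tf) tf).
Qed.

Lemma test_lin U (c : R) f g : test_fun U f -> test_fun U g -> test_fun U (fun x => c * f x + g x).
Proof.
move=> [sf [K [cK KU fK]]] [sg [K' [cK' KU' gK]]]; split.
  by apply: smoothD => //; apply: smoothM => //; exact: smooth_cst.
exists (K `|` K'); split; first exact: compactU.
  by move=> x [/KU|/KU'].
by move=> x /not_orP[h1 h2]; rewrite fK // gK // mulr0 addr0.
Qed.

Lemma test0 U : test_fun U (fun=> 0 : R).
Proof. by split; [exact: smooth_cst|exists set0; split => //; exact: compact0]. Qed.

Lemma test_sub U U' f : U `<=` U' -> test_fun U f -> test_fun U' f.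
Proof. by move=> UU' [sf [K [cK KU fK]]]; split => //; exists K; split => // x /KU /UU'. Qed.

Lemma derive_near0 f v x : (\forall y \near x, f y = 0) -> 'D_v f x = 0.
Proof.
move=> h; by rewrite (@near_eq_derive _ _ _ f (fun=> 0 : R) _ _ h) derive_cst.
Qed.

Lemma test_derive U f v : test_fun U f -> test_fun U (fun x => 'D_v f x).
Proof.
move=> [sf [K [cK KU fK]]]; split; first exact: smooth_derive.
exists K; split => // x nK; apply: derive_near0.
have : open (~` K) by apply: closed_openC; apply: compact_closed cK; exact: norm_hausdorff.
by move=> /(_ x nK); apply: filterS => y; exact: fK.
Qed.

Lemma derive_line f v x (t : R) : smooth f ->
  is_derive t (1 : R) (fun s : R => f (x + s *: v)) ('D_v f (x + t *: v)).
Proof.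
move=> sf; have df := @smooth_derivable _ _ f v (x + t *: v) sf.
have e : (fun h : R => h^-1 *: (f (x + (h *: 1 + t) *: v) - f (x + t *: v))) =
         (fun h : R => h^-1 *: (f (h *: v + (x + t *: v)) - f (x + t *: v))).
  apply/funext => h; congr (_ *: (f _ - _)).
  by rewrite [h *: 1]mulr1 scalerDl addrCA.
split; first by rewrite /derivable e.
by rewrite /derive e.
Qed.

Lemma mvt_line f v (M : R) x (t : R) : smooth f -> (forall y, `|'D_v f y| <= M) ->
  `|f (x + t *: v) - f x| <= M * `|t|.
Proof.
move=> sf hM.
have cf : continuous (fun s : R => f (x + s *: v)).
  move=> s; apply: differentiable_continuous; apply/derivable1_diffP.
  by have [] := derive_line v x s sf.
have M0 : 0 <= M by apply: le_trans (hM 0).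
have key (a b : R) : a <= b -> `|f (x + b *: v) - f (x + a *: v)| <= M * (b - a).
  rewrite le_eqVlt => /predU1P[->|ab]; first by rewrite subrr normr0 subrr mulr0.
  have [c _ ->] := MVT ab (fun s _ => derive_line v x s sf) (continuous_subspaceT cf).
  by rewrite normrM (@ger0_norm _ (b - a)) ?ler_wpM2r //; lra.
have [t0|t0] := leP 0 t.
  by have := key 0 t t0; rewrite scale0r addr0 subr0 (ger0_norm t0).
have := key t 0 (ltW t0); rewrite scale0r addr0 sub0r (ltr0_norm t0).
by rewrite distrC.
Qed.

Definition dquot f v (n : nat) x := n.+1%:R * (f (x + n.+1%:R^-1 *: v) - f x).

Lemma dquot_L1 U f v n : test_fun U f -> L1 (dquot f v n).
Proof.
move=> tf; apply: L1fZ; apply: L1fB; last exact: test_L1 tf.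
exact: (@L1_shift f _ (test_L1 tf)).
Qed.

(** Dominated convergence: the mean value theorem bounds the quotients by [M], and steps of length
    at most 1 enlarge the support by at most the size [c] of [v]. *)
Lemma dquot_cvg U f v g (C : R) : test_fun U f -> measurable_fun setT g ->
  (forall x, `|g x| <= C) ->
  (fun n => int3 (fun x => dquot f v n x * g x)) @ \oo --> int3 (fun x => 'D_v f x * g x).
Proof.
move=> tf mg gC; have [sf _] := tf; have [M M0 hM] := test_bounded (test_derive v tf).
have C0 : 0 <= C by apply: le_trans (gC 0).
have [r hr] := test_bsupp tf.
pose h n : R := n.+1%:R^-1; have h0 n : 0 < h n by rewrite invr_gt0.
have h1 n : h n <= 1 by rewrite invf_le1 // ler1n.
pose c := \sum_i `|crd i v|.
have Fl x : dquot f v n x * g x @[n --> \oo] --> 'D_v f x * g x.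
  apply: cvgM; last exact: cvg_cst.
  have df := @smooth_derivable _ _ f v x sf.
  have hh : h n @[n --> \oo] --> (0 : R)^'.
    move=> A hA; have h2 := cvgZ_harmonic (1 : R); have [N _ hN] := h2 _ hA.
    by exists N => // n /hN; rewrite /= mul1r; apply; exact: lt0r_neq0.
  have := cvg_comp _ _ hh df.
  rewrite (_ : _ \o h = (fun n => dquot f v n x)) //.
  by apply/funext => n /=; rewrite /dquot [h n *: v + x]addrC /h invrK.
have dom n x : `|dquot f v n x * g x| <= C * M * \1_(cube (`|r| + c)) x.
  rewrite /dquot -/(h n) (_ : n.+1%:R = (h n)^-1); last by rewrite /h invrK.
  rewrite !normrM ger0_norm; last by rewrite invr_ge0 ltW.
  have [xr|xr] := pselect (cube (`|r| + c) x).
    rewrite indic1T // mulr1 mulrC ler_pM // ?mulr_ge0 ?invr_ge0 ?(ltW (h0 n)) //.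
    rewrite ler_pdivrMl // mulrC.
    by have := mvt_line x (h n) sf hM; rewrite (ger0_norm (ltW (h0 n))).
  have xc : ~ cube r x by move=> /cubeP k; apply: xr; apply/cubeP => i; have := k i; have := ler_norm r;
     have : 0 <= c by [exact: sumr_ge0]; lra.
  rewrite indic0N // mulr0 (hr x) // (hr (x + _)) ?subrr ?normr0 ?mulr0 ?mul0r // => /cubeP k.
  apply: xr; apply/cubeP => i; have := k i; rewrite crdD crdZ => ki.
  have ci : `|crd i v| <= c by rewrite /c (bigD1 i) //= lerDl sumr_ge0.
  have : `|h n * crd i v| <= c.
    rewrite normrM (ger0_norm (ltW (h0 n))); apply: le_trans ci.
    by rewrite ler_piMl.
  have := ler_norm r; have := ler_normB (crd i x + h n * crd i v) (h n * crd i v).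
  by rewrite addrK; lra.
have mF n : measurable_fun setT (fun x => dquot f v n x * g x).
  exact: (measurable_funM (L1f_meas (dquot_L1 v n tf)) mg).
by have [] := rdct mF Fl (L1fZ (C * M) (L1_cube _)) dom.
Qed.

(** Translation invariance makes the integral of every difference quotient vanish. *)
Lemma int_derive0 U f v : test_fun U f -> int3 (fun x => 'D_v f x) = 0.
Proof.
move=> tf; have m1 : measurable_fun setT (fun _ : R3 R => 1 : R) by exact: measurable_cst.
have := @dquot_cvg U f v _ 1 tf m1 (fun=> ltac:(by rewrite normr1)).
have -> : (fun n => int3 (fun x => dquot f v n x * 1)) = fun=> 0.
  apply/funext => n; transitivity (int3 (dquot f v n)); first by apply: eq_rint => x; rewrite mulr1.
  have lf := test_L1 tf; have ls := @L1_shift f (n.+1%:R^-1 *: v) lf.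
  rewrite rintZ; last exact: L1fB.
  by rewrite rintB // int_shift // subrr mulr0.
rewrite (_ : int3 _ = int3 (fun x => 'D_v f x)); last by apply: eq_rint => x; rewrite mulr1.
by move=> k; apply: (cvg_unique _ k); [exact: norm_hausdorff|exact: cvg_cst].
Qed.

Lemma int_ibp U f g v : smooth f -> test_fun U g ->
  int3 (fun x => f x * 'D_v g x) = - int3 (fun x => 'D_v f x * g x).
Proof.
move=> sf tg; have [sg _] := tg; apply/eqP; rewrite -addr_eq0 -rintD; first last.
- by apply: (@test_L1 U); apply: testM tg; exact: smooth_derive.
- by apply: (@test_L1 U); apply: testM => //; exact: test_derive.
rewrite -[X in _ == X](int_derive0 v (testM sf tg)); apply/eqP; apply: eq_rint => x.
have [df dg] := (@smooth_derivable _ _ f v x sf, @smooth_derivable _ _ g v x sg).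
by rewrite (deriveM df dg) addrC /GRing.scale /= addrC [g x * _]mulrC.
Qed.

(* the weak form of the symmetry of second derivatives *)
Lemma int_derive_swap U f g v w : test_fun U f -> test_fun U g ->
  int3 (fun x => 'D_v f x * 'D_w g x) = int3 (fun x => 'D_w f x * 'D_v g x).
Proof.
move=> tf tg; have tdf := test_derive w tf; have tdg := test_derive w tg.
have [Mg _ hMg] := test_bounded tg; have [Md _ hMd] := test_bounded tdg.
have c1 := @dquot_cvg U f v _ _ tf (test_meas tdg) hMd.
have c2 := @dquot_cvg U _ v _ _ tdf (test_meas tg) hMg.
(* A difference quotient in direction [v] commutes with the derivative in direction [w]; the
   exchange is made before the limit. *)
have e n : int3 (fun x => dquot f v n x * 'D_w g x) = - int3 (fun x => dquot (fun y => 'D_w f y) v n x * g x).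
  have sf := test_smooth tf; pose b := n.+1%:R^-1 *: v.
  have sq : smooth (dquot f v n).
    apply: smoothM; first exact: smooth_cst.
    apply: (@smoothD _ _ (fun x => f (x + b)) (fun x => - f x)); first exact: smooth_shift.
    have -> : (fun x => - f x) = (fun x => -1 * f x) by apply/funext => x; rewrite mulN1r.
    by apply: smoothM => //; exact: smooth_cst.
  rewrite (int_ibp w sq tg); congr (- _); apply: eq_rint => x; congr (_ * _).
  have d1 := @smooth_derivable _ _ _ w x (smooth_shift b sf).
  have d2 := @smooth_derivable _ _ f w x sf.
  rewrite /dquot (_ : (fun x0 => _) = n.+1%:R *: ((fun y => f (y + b)) - f)) //.
  have d3 := derivableB d1 d2.
  by rewrite (deriveZ _ d3) (deriveB d1 d2) derive_shift.
have -> : int3 (fun x => 'D_v f x * 'D_w g x) = - int3 (fun x => 'D_v (fun y => 'D_w f y) x * g x).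
  apply: (cvg_unique _ c1); first exact: norm_hausdorff.
  by rewrite (funext e); exact: cvgN.
by rewrite -(int_ibp v (test_smooth tdf) tg).
Qed.

Lemma smooth_step_crd i (c b : R) : smooth (fun x : R3 R => step (c * crd i x + b)).
Proof.
move=> n; apply: (@Ck_comp_linear _ _ _ n (@step R) (fun x => c * crd i x) b).
- by move=> a u w; rewrite crdD crdZ mulrDr /GRing.scale /= mulrCA.
- by move=> x; apply: cvgM; [exact: cvg_cst|exact: crd_continuous].
- exact: step_smooth.
Qed.

(* smooth approximation from below of the indicator function of [obox a b] *)
Definition boxbump (c : R) (a b x : R3 R) : R :=
  \prod_(i < 3) (step (c * (crd i x - crd i a)) * step (c * (crd i b - crd i x))).

Lemma boxbump_smooth c a b : smooth (boxbump c a b).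
Proof.
have h i : smooth (fun x : R3 R => step (c * (crd i x - crd i a)) * step (c * (crd i b - crd i x))).
  apply: smoothM.
  - have -> : (fun x : R3 R => step (c * (crd i x - crd i a))) =
              (fun x => step (c * crd i x + - (c * crd i a))).
      by apply/funext => x; congr step; ring.
    exact: smooth_step_crd.
  - have -> : (fun x : R3 R => step (c * (crd i b - crd i x))) =
              (fun x => step (- c * crd i x + c * crd i b)).
      by apply/funext => x; congr step; ring.
    exact: smooth_step_crd.
have -> : boxbump c a b = (fun x => (fun x : R3 R => step (c * (crd 0 x - crd 0 a)) * step (c * (crd 0 b - crd 0 x))) x
   * ((fun x : R3 R => step (c * (crd 1 x - crd 1 a)) * step (c * (crd 1 b - crd 1 x))) x
   * (fun x : R3 R => step (c * (crd 2 x - crd 2 a)) * step (c * (crd 2 b - crd 2 x))) x)).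
  by apply/funext => x; rewrite /boxbump !big_ord_recl big_ord0 mulr1.
by apply: smoothM => //; exact: smoothM.
Qed.

Lemma boxbump_itv c a b x : 0 <= boxbump c a b x <= 1.
Proof.
rewrite /boxbump; apply/andP; split.
  by apply: prodr_ge0 => i _; rewrite mulr_ge0 ?step_ge0.
by apply: prodr_ile1 => i _; rewrite mulr_ge0 ?step_ge0 //= mulr_ile1 ?step_ge0 ?step_le1.
Qed.

Lemma boxbump0 c a b x : 0 < c -> ~ obox a b x -> boxbump c a b x = 0.
Proof.
move=> c0 h; suff [i hi] : exists i : 'I_3, crd i x <= crd i a \/ crd i b <= crd i x.
  rewrite /boxbump (bigD1 i) //= ; case: hi => hi.
    by rewrite [step (c * (crd i x - _))]step0 ?mul0r // pmulr_rle0 // subr_le0.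
  by rewrite [step (c * (crd i b - _))]step0 ?mulr0 ?mul0r // pmulr_rle0 // subr_le0.
apply: contrapT => /forallNP k; apply: h; apply/oboxP => i.
by have /not_orP[/negP + /negP] := k i; rewrite -!ltNge => -> ->.
Qed.

Lemma boxbump1 c a b x : (forall i, 1 <= c * (crd i x - crd i a) /\ 1 <= c * (crd i b - crd i x)) ->
  boxbump c a b x = 1.
Proof. by move=> h; rewrite /boxbump big1 // => i _; have [h1 h2] := h i; rewrite !step1 ?mulr1. Qed.

Lemma boxbump_test U c a b : 0 < c -> cbox a b `<=` U -> test_fun U (boxbump c a b).
Proof.
move=> c0 abU; split; first exact: boxbump_smooth.
exists (cbox a b); split => //; first exact: compact_cbox.
move=> x nx; apply: boxbump0 => // /oboxP h; apply: nx => i.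
by have /andP[/ltW -> /ltW ->] := h i.
Qed.

Lemma boxbump_cvg a b x : boxbump n%:R a b x @[n --> \oo] --> (\1_(obox a b) x : R).
Proof.
have [xab|xab] := pselect (obox a b x); last first.
  rewrite indic0N //; apply: cvg_near_cst; exists 1%N => // n /= n1.
  by rewrite boxbump0 // ltr0n.
rewrite indic1T //; apply: cvg_near_cst.
have h i : \forall n \near \oo, 1 <= n%:R * (crd i x - crd i a) /\ 1 <= n%:R * (crd i b - crd i x).
  have /oboxP /(_ i) /andP[h1 h2] := xab.
  have k (d : R) : 0 < d -> \forall n \near \oo, 1 <= n%:R * d.
    move=> d0; have := nbhs_infty_ger (d^-1); apply: filterS => n hn.
    have : d^-1 * d <= n%:R * d by rewrite ler_pM2r.
    by rewrite mulVf // lt0r_neq0.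
  have k1 : 0 < crd i x - crd i a by lra.
  have k2 : 0 < crd i b - crd i x by lra.
  exact: (filterI (k _ k1) (k _ k2)).
apply: (filterS _ (filterI (h 0) (filterI (h 1) (h 2)))) => n [g0 [g1 g2]].
apply: boxbump1 => i; case: i => -[|[|[|//]]] p.
- by rewrite (_ : Ordinal p = 0) //; exact: val_inj.
- by rewrite (_ : Ordinal p = 1) //; exact: val_inj.
- by rewrite (_ : Ordinal p = 2) //; exact: val_inj.
Qed.
End TestFunctions.
End SpaceIntegral.

(** * The fundamental lemma of the calculus of variations *)

Section FundamentalLemma.
Context (R : realType).
Implicit Types (x a : R3 R).

Notation L1 := (@L1f _ (R3 R) R (leb3 R)).
Notation L2r := (@L2f _ (R3 R) R (leb3 R)).
Notation int3 := (@rint _ (R3 R) R (leb3 R)).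

Lemma L1_mul_bounded (f g : R3 R -> R) (M : R) : L1 f -> measurable_fun setT g ->
  (forall x, `|g x| <= M) -> L1 (fun x => f x * g x).
Proof.
move=> lf mg gM; apply: L1f_dom (L1fZ M (L1f_norm lf)) _.
  exact: (measurable_funM (L1f_meas lf) mg).
by move=> x; rewrite normrM mulrC ler_wpM2r.
Qed.

Lemma indic_itv T (A : set T) (x : T) : 0 <= (\1_A x : R) <= 1.
Proof. by rewrite indicE; case: (x \in A); rewrite /= lexx ler01. Qed.

Lemma indicI T (A B : set T) (x : T) : \1_(A `&` B) x = \1_A x * \1_B x :> R.
Proof. by rewrite indicE in_setI !indicE -natrM mulnb. Qed.

Lemma int_obox0 (g : R3 R -> R) (U : set (R3 R)) a b : L1 g ->
  (forall phi, test_fun U phi -> int3 (fun x => g x * phi x) = 0) ->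
  cbox a b `<=` U -> int3 (fun x => g x * \1_(obox a b) x) = 0.
Proof.
move=> lg h abU.
pose F n x := g x * boxbump n.+1%:R a b x.
have tF n : test_fun U (boxbump n.+1%:R a b) by apply: boxbump_test => //; rewrite ltr0n.
have mF n : measurable_fun setT (F n).
  exact: (measurable_funM (L1f_meas lg) (test_meas (tF n))).
have Fl x : F n x @[n --> \oo] --> g x * \1_(obox a b) x.
  apply: cvgM; first exact: cvg_cst.
  by have := @boxbump_cvg R a b x; rewrite -cvg_shiftS.
have dF n x : `|F n x| <= `|g x|.
  rewrite normrM ler_piMr //; have /andP[h0 h1] := boxbump_itv n.+1%:R a b x.
  by rewrite ger0_norm.
have [_] := rdct mF Fl (L1f_norm lg) dF.
have -> : (fun n => int3 (F n)) = fun=> 0 by apply/funext => n; exact: h.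
by move=> k; apply: (cvg_unique _ k); [exact: norm_hausdorff|exact: cvg_cst].
Qed.

Lemma integral_indicM (g : R3 R -> R) (A : set (R3 R)) : L1 g -> measurable A ->
  (\int[leb3 R]_(x in A) (g x)%:E)%E = (int3 (fun x => g x * \1_A x))%:E.
Proof.
move=> lg mA; rewrite rintE; last first.
  apply: (@L1_mul_bounded _ _ 1 lg); first exact: measurable_indic.
  by move=> x; have /andP[h0 h1] := indic_itv A x; rewrite ger0_norm.
rewrite [LHS]integral_mkcond; congr (integral _ _ _); apply/funext => x.
rewrite patchE indicE.
by case: ifP => _; rewrite /= ?mulr1 ?mulr0.
Qed.

Lemma obox_sub (lo hi c d : R3 R) : exists2 ef : R3 R * R3 R,
  obox c d `&` obox lo hi = obox ef.1 ef.2 & cbox ef.1 ef.2 `<=` cbox lo hi.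
Proof.
exists ((Num.max c.1.1 lo.1.1, Num.max c.1.2 lo.1.2, Num.max c.2 lo.2),
        (Num.min d.1.1 hi.1.1, Num.min d.1.2 hi.1.2, Num.min d.2 hi.2)).
  apply/seteqP; split => x; rewrite /obox /= !gt_max !lt_min.
    by move=> [[/andP[-> ->] /andP[-> ->] /andP[-> ->]] [/andP[-> ->] /andP[-> ->] /andP[-> ->]]].
  by move=> [/andP[/andP[-> ->] /andP[-> ->]] /andP[/andP[-> ->] /andP[-> ->]] /andP[/andP[-> ->] /andP[-> ->]]].
move=> x hx i; have := hx i; rewrite /crd /=.
by case: (i == 0); [|case: (i == 1)]; rewrite ge_max le_min => /andP[/andP[_ ->] /andP[_ ->]].
Qed.

(** Countably many rational balls reduce the claim to a box whose closure lies in [U]. There [g]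
    integrates to 0 over every smaller box, as a limit of bump functions, and by Dynkin induction
    over every measurable subset. *)
Lemma fundamental_lemma (g : R3 R -> R) (U : set (R3 R)) : open U -> L1 g ->
  (forall phi, test_fun U phi -> int3 (fun x => g x * phi x) = 0) ->
  \forall x \ae leb3 R, U x -> g x = 0.
Proof.
move=> oU lg h.
suff loc (q : rat * rat * rat * nat) : ball (rpt R q.1) (2 * q.2.+1%:R^-1) `<=` U ->
    (leb3 R).-negligible [set x | rball q x /\ g x <> 0].
  have : (leb3 R).-negligible (\bigcup_(n : nat) (if unpickle n is Some q then
      [set x | [/\ ball (rpt R q.1) (2 * q.2.+1%:R^-1) `<=` U, rball q x & g x <> 0]] else set0)).
    apply: negligible_bigcup => n; case: unpickle => [q|]; last exact: negligible_set0.
    have [qU|qU] := pselect (ball (rpt R q.1) (2 * q.2.+1%:R^-1) `<=` U).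
      by apply: negligibleS (loc q qU) => x [].
    by apply: negligibleS (negligible_set0 _) => x [].
  apply: negligibleS => x /not_implyP[Ux gx].
  have [q qx qU] := rball_base oU Ux.
  exists (pickle q); first exact: I.
  by rewrite pickleK; exact: And3 qU qx gx.
move=> qU; pose e : R := q.2.+1%:R^-1; have e0 : 0 < e by rewrite invr_gt0.
pose lo : R3 R := rpt R q.1 - (e, e, e); pose hi : R3 R := rpt R q.1 + (e, e, e).
pose Q0 := obox lo hi.
have clo i : crd i lo = crd i (rpt R q.1) - e by rewrite crdD crdN crd_diag.
have chi i : crd i hi = crd i (rpt R q.1) + e by rewrite crdD crd_diag.
have Q0U : cbox lo hi `<=` U.
  move=> x hx; apply: qU; apply/ball3P.
  have k i : `|crd i (rpt R q.1) - crd i x| < 2 * e.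
    by have := hx i; rewrite clo chi ltr_norml => /andP[k1 k2]; apply/andP; split; lra.
  by split; [exact: (k 0)|exact: (k 1)|exact: (k 2)].
have rQ : rball q `<=` Q0.
  move=> x /ball3P[h1 h2 h3]; apply/oboxP => i; rewrite clo chi.
  have : `|crd i (rpt R q.1) - crd i x| < e by rewrite /crd; case: (i == 0) => //; case: (i == 1).
  by rewrite ltr_norml => /andP[k1 k2]; apply/andP; split; lra.
have mQ : measurable Q0 by exact: measurable_obox.
have sub := obox_sub lo hi.
have lgi (B : set (R3 R)) : measurable B -> L1 (fun x => g x * \1_B x).
  move=> mB; apply: (@L1_mul_bounded _ _ 1 lg); first exact: measurable_indic.
  by move=> x; have /andP[h0 h1] := indic_itv B x; rewrite ger0_norm.
have Q00 : int3 (fun x => g x * \1_Q0 x) = 0 by exact: int_obox0 h Q0U.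
pose P (B : set (R3 R)) := int3 (fun x => g x * \1_(B `&` Q0) x) = 0.
have PB : forall B : set (R3 R), <<s @boxes R >> B -> P B.
  apply: (@dynkin_induction _ _ (@boxes R) P (measurable3_gen R)).
  - by move=> _ _ [c [d ->]] [c' [d' ->]]; have [u [v ->]] := obox_setI c d c' d'; exists u, v.
  - by rewrite /P setTI.
  - move=> _ [c [d ->]]; have [ef e1 e2] := sub c d; rewrite /P e1.
    by apply: int_obox0 h _ => // x /e2 /Q0U.
  - move=> B mB PB; rewrite /P.
    transitivity (int3 (fun x => g x * \1_Q0 x - g x * \1_(B `&` Q0) x)); last first.
      by rewrite rintB ?Q00 ?PB ?subrr //; apply: lgi => //; exact: measurableI.
    apply: eq_rint => x; rewrite !indicI -mulrBr -[X in X - _]mul1r -mulrBl; congr (_ * (_ * _)).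
    by have [Bx|Bx] := pselect (B x); [rewrite indic0N ?indic1T ?subrr //; apply|
      rewrite (@indic0N _ _ B) // indic1T // subr0].
  - move=> F mF tF PF; rewrite /P setI_bigcupl.
    have mFQ n : measurable (F n `&` Q0) by exact: measurableI.
    apply: EFin_inj; rewrite -integral_indicM //; last exact: bigcup_measurable.
    rewrite integral_bigcup //.
    + by apply: eseries0 => n _ _; rewrite integral_indicM // PF.
    + by move=> i j _ _ [x [[Fi _] [Fj _]]]; apply: tF => //; exists x.
    + by apply: integrableS lg => //; exact: bigcup_measurable.
have lgQ : (leb3 R).-integrable Q0 (EFin \o g) by apply: integrableS lg.
have := @integral_ae_eq _ _ _ (leb3 R) Q0 mQ (cst 0%E) (EFin \o g) lgQ (measurable_cst _).
move=> /(_ _)[|N [mN N0 hN]].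
  move=> E EQ mE; rewrite integral0 integral_indicM //.
  by have := PB E; rewrite -measurable3_gen => /(_ mE); rewrite /P (setIidl EQ) => ->.
exists N; split => // x [qx gx]; apply: hN => /= k; apply: gx.
by have := k (rQ x qx); case.
Qed.

End FundamentalLemma.

(** * Density of test functions in L^2 *)

Section Convolution.
Context (R : realType).
Implicit Types (x a : R3 R) (f g u : R3 R -> R).

Notation L1 := (@L1f _ (R3 R) R (leb3 R)).
Notation L2r := (@L2f _ (R3 R) R (leb3 R)).
Notation int3 := (@rint _ (R3 R) R (leb3 R)).

Definition rL2 := set_subsp (@L2f0 _ (R3 R) R (leb3 R))
  (fun (c : R) (f g : R3 R -> R) (hf : L2r f) (hg : L2r g) => L2fD (L2fZ c hf) hg : L2r (c *: f + g)).

Definition rdot (f g : sub_elt rL2) : R := int3 (fun x => sub_val f x * sub_val g x).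

Lemma rL2P (f : sub_elt rL2) : L2r (sub_val f).
Proof. by have := valP f => /set_mem. Qed.

Definition rL2E f (hf : L2r f) : sub_elt rL2 := @SubElt _ _ rL2 f (mem_set hf).

Lemma rdot_hilbert : semi_hilbert rdot.
Proof.
split.
- move=> c u v w; rewrite /rdot -rintZ; last exact: L1f_mul (rL2P u) (rL2P w).
  rewrite -rintD; last 2 first.
  + by apply: L1fZ; exact: L1f_mul (rL2P u) (rL2P w).
  + exact: L1f_mul (rL2P v) (rL2P w).
  by apply: eq_rint => x; rewrite mulrA -mulrDl.
- by move=> u v; apply: eq_rint => x; rewrite mulrC.
- by move=> u; apply: rint_ge0 => x; rewrite -expr2 sqr_ge0.
- move=> u hu; have [||g lg gl] := @L2f_complete _ _ _ (leb3 R) (fun n => sub_val (u n)).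
  + by move=> n; exact: rL2P.
  + exact: hu.
  by exists (rL2E lg); exact: gl.
Qed.

Lemma int_cauchy_schwarz f g : L2r f -> L2r g ->
  `|int3 (fun x => f x * g x)| <=
    Num.sqrt (int3 (fun x => f x ^+ 2)) * Num.sqrt (int3 (fun x => g x ^+ 2)).
Proof. by move=> hf hg; exact: (cauchy_schwarz rdot_hilbert (rL2E hf) (rL2E hg)). Qed.

Lemma open_cube (r : R) : open (cube r).
Proof.
have [/continuousP c1 /continuousP c2 /continuousP c3] := pt_cont R.
rewrite (_ : cube r = ((fun x : R3 R => x.1.1 : R) @^-1` `](- r), r[ `&`
  (fun x : R3 R => x.1.2 : R) @^-1` `](- r), r[) `&` (fun x : R3 R => x.2 : R) @^-1` `](- r), r[).
  by apply: openI; [apply: openI; [exact: c1|exact: c2]|exact: c3].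
by rewrite /cube oboxE; apply/seteqP; split => x.
Qed.

Lemma L2_cube r : L2r (\1_(cube r)).
Proof.
split; first by apply: measurable_indic; exact: measurable_cube.
have -> : (fun x => \1_(cube r) x ^+ 2) = \1_(cube r) :> (R3 R -> R).
  by apply/funext => x; rewrite indicE; case: (x \in _); rewrite ?expr1n ?expr0n.
exact: L1_cube.
Qed.

(** A square integrable function becomes integrable after multiplication by the indicator of a cube;
    the cubes exhaust space. *)
Lemma fundamental_L2 (g : R3 R -> R) (U : set (R3 R)) : open U -> L2r g ->
  (forall phi, test_fun U phi -> int3 (fun x => g x * phi x) = 0) ->
  \forall x \ae leb3 R, U x -> g x = 0.
Proof.
move=> oU lg h.
have hn n : \forall x \ae leb3 R, (U `&` cube n%:R) x -> g x * \1_(cube n%:R) x = 0.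
  apply: fundamental_lemma.
  - by apply: openI => //; exact: open_cube.
  - exact: L1f_mul lg (L2_cube _).
  - move=> phi tp; rewrite -(h phi); last by apply: test_sub tp => x [].
    apply: eq_rint => x; have [xn|xn] := pselect (cube n%:R x); first by rewrite indic1T // mulr1.
    by have [_ [K [_ KU ->]]] := tp; rewrite ?mulr0 // => /KU[].
apply: filterS (ae_foralln hn) => x hx Ux.
have [r _ xr] := @compact_cube R [set x] (@compact_set1 _ x).
pose n := (Num.truncn r).+1.
pose y : R3 R := x; have xn : cube n%:R y.
  by apply: (proj2 (cubeP n%:R y)) => i; apply: lt_trans (truncnS_gt r); exact: (proj1 (cubeP r y) (xr y erefl)).
by have := hx n (conj Ux xn); rewrite indic1T // mulr1.
Qed.

(** By the fundamental lemma only null functions are orthogonal to all test functions, so density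
    follows from the projection argument of [dense_subspace]. *)
Lemma test_dense f (e : R) : L2r f -> 0 < e ->
  exists2 h, test_fun setT h & int3 (fun x => (h x - f x) ^+ 2) < e.
Proof.
move=> lf e0.
have dz z : (forall s, test_fun setT (sub_val s) -> rdot z s = 0) -> hn rdot z = 0.
  move=> hz; apply/(hn_eq0P rdot_hilbert); have lz := rL2P z.
  have z0 : \forall x \ae leb3 R, setT x -> sub_val z x = 0.
    apply: (fundamental_L2 openT lz) => phi tp; exact: (hz (rL2E (test_L2 tp)) tp).
  rewrite /rdot (rint_ae (g := fun=> 0)) //.
  + by rewrite /rint Rintegral_cst // mul0r.
  + exact: L1f_meas (L1f_mul lz lz).
  + by apply: filterS z0 => x -> //; rewrite mul0r.
have d0 : test_fun setT (sub_val (0 : sub_elt rL2)) by exact: test0.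
have dl c (u v : sub_elt rL2) : test_fun setT (sub_val u) -> test_fun setT (sub_val v) ->
  test_fun setT (sub_val (c *: u + v))
  by move=> hu hv; exact: (@test_lin R setT c (sub_val u) (sub_val v) hu hv).
have [s hs sl] := dense_subspace rdot_hilbert (S := [set h | test_fun setT (sub_val h)])
  d0 dl dz (rL2E lf).
move/cvgr0Pnorm_lt: sl => /(_ (Num.sqrt e)); rewrite sqrtr_gt0 => /(_ e0)[n _ hsn].
exists (sub_val (s n)); first exact: hs.
have := hsn n (leqnn n); rewrite ger0_norm ?hn_ge0 // => hs2.
have : hn rdot (s n - rL2E lf) ^+ 2 < e.
  by rewrite -[ltRHS]sqr_sqrtr ?ltW // ltr_pXn2r // nnegrE ?hn_ge0 ?sqrtr_ge0.
rewrite hn_sqr; last exact: rdot_hilbert.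
by apply: le_lt_trans; rewrite le_eqVlt; apply/orP; left; apply/eqP; apply: eq_rint => x; rewrite expr2.
Qed.

End Convolution.

(** * Weighted averages of translates *)

Section Kernel.
Context (R : realType).
Implicit Types (x a v : R3 R) (f g u rho : R3 R -> R).
Notation mR := (measurableTypeR R).

Notation L1 := (@L1f _ (R3 R) R (leb3 R)).
Notation L2r := (@L2f _ (R3 R) R (leb3 R)).
Notation int3 := (@rint _ (R3 R) R (leb3 R)).

Lemma measurable_shear (s : R) :
  measurable_fun setT (fun z : R3 R * R3 R => (z.2 + s *: z.1 : R3 R)).
Proof.
have m2 : measurable_fun setT (fun z : R3 R * R3 R => z.2) by exact: measurable_snd.
have m1 : measurable_fun setT (fun z : R3 R * R3 R => z.1) by exact: measurable_fst.
have cm (pr : R3 R -> mR) : measurable_fun setT pr ->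
    measurable_fun setT (fun z : R3 R * R3 R => (pr z.2 + s * pr z.1 : mR)).
  move=> mp; apply: measurable_funD; first exact: (measurableT_comp mp m2).
  apply: measurable_funM; first exact: measurable_cst.
  exact: (measurableT_comp mp m1).
have [c1 c2 c3] := pt_cont R.
apply/measurable_fun_pairP; split.
  apply/measurable_fun_pairP; split.
    exact: (cm (fun x : R3 R => x.1.1) (continuous_measurable3 c1)).
  exact: (cm (fun x : R3 R => x.1.2) (continuous_measurable3 c2)).
exact: (cm (fun x : R3 R => x.2) (continuous_measurable3 c3)).
Qed.

Lemma L2_norm f : L2r f -> L2r (fun x => `|f x|).
Proof.
move=> [mf sf]; split; first exact: measurableT_comp.
by under eq_fun do rewrite real_normK ?num_real //.
Qed.

Section Swap.
Context (rho u g : R3 R -> R) (s : R) (l1 : L1 rho) (lu : L2r u) (lg : L2r g).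
Hypothesis lru : forall x, L1 (fun a => rho a * u (x + s *: a)).

Let K (z : R3 R * R3 R) := rho z.1 * (u (z.2 + s *: z.1) * g z.2).

Let mK : measurable_fun setT K.
Proof.
apply: measurable_funM.
  by apply: (measurableT_comp (L1f_meas l1)); exact: measurable_fst.
apply: measurable_funM; first exact: (measurableT_comp lu.1 (measurable_shear s)).
by apply: (measurableT_comp lg.1); exact: measurable_snd.
Qed.

Let iug a : L1 (fun x => u (x + s *: a) * g x).
Proof. by apply: L1f_mul => //; exact: (L2_shift (s *: a) lu). Qed.

Let iK : (leb3s R \x leb3s R)%E.-integrable setT (EFin \o K).
Proof.
have meK : measurable_fun setT (EFin \o K) by exact/measurable_EFinP.
apply/integrable12ltyP => //.
pose C := Num.sqrt (int3 (fun x => u x ^+ 2)) * Num.sqrt (int3 (fun x => g x ^+ 2)).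
have lC : L1 (fun a => C * `|rho a|) by apply: L1fZ; exact: L1f_norm.
have maK : measurable_fun setT (fun z => `|(EFin \o K) z|%E).
  exact: measurableT_comp.
apply: (@le_lt_trans _ _ (\int[leb3 R]_a (C * `|rho a|)%:E)%E); last first.
  by rewrite -(rintE lC) ltry.
apply: ge0_le_integral => //.
- by move=> a _; apply: integral_ge0 => x _; exact: abse_ge0.
- exact: (measurable_fun_fubini_tonelli_F (fun z => `|(EFin \o K) z|%E) maK (fun z => abse_ge0 _)).
- by apply/measurable_EFinP; exact: L1f_meas lC.
move=> a _.
have i1 : L1 (fun x => `|rho a| * `|u (x + s *: a) * g x|).
  by apply: L1fZ; apply: L1f_norm; exact: iug.
rewrite (_ : (\int[_]_x _)%E = (int3 (fun x => `|rho a| * `|u (x + s *: a) * g x|))%:E).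
  rewrite lee_fin rintZ; last by apply: L1f_norm; exact: iug.
  rewrite mulrC ler_wpM2r //.
  have := int_cauchy_schwarz (L2_norm (L2_shift (s *: a) lu)) (L2_norm lg).
  have -> : int3 (fun x => `|u (x + s *: a)| ^+ 2) = int3 (fun x => u x ^+ 2).
    rewrite -(int_shift (s *: a) lu.2); apply: eq_rint => x; by rewrite real_normK ?num_real.
  have -> : int3 (fun x => `|g x| ^+ 2) = int3 (fun x => g x ^+ 2).
    by apply: eq_rint => x; rewrite real_normK ?num_real.
  apply: le_trans; apply: le_trans (ler_norm _).
  rewrite le_eqVlt; apply/orP; left; apply/eqP.
  by apply: eq_rint => x; rewrite normrM.
rewrite (rintE i1); congr (integral _ _ _); apply/funext => x /=.
by rewrite /K normrM.
Qed.

Let iK' : (leb3s R \x leb3s R)%E.-integrable setT (fun z => (EFin \o K) (z.2, z.1)).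
Proof.
have meK : measurable_fun setT (EFin \o K) by exact/measurable_EFinP.
have meK' : measurable_fun setT (fun z => (EFin \o K) (z.2, z.1)).
  have msw : measurable_fun setT (fun z : R3 R * R3 R => (z.2, z.1) : R3 R * R3 R).
    by apply/measurable_fun_pairP; split; [exact: measurable_snd|exact: measurable_fst].
  exact: (measurableT_comp meK msw).
apply: (proj2 (integrable21ltyP (leb3s R) (leb3s R) meK')).
exact: (proj1 (integrable12ltyP (leb3s R) (leb3s R) meK) iK).
Qed.

Let GE x : (\int[leb3 R]_a (EFin \o K) (a, x) = (int3 (fun a => rho a * u (x + s *: a)) * g x)%:E)%E.
Proof.
have i1 : L1 (fun a => g x * (rho a * u (x + s *: a))) by exact: L1fZ.
rewrite mulrC -rintZ // rintE //; congr (integral _ _ _); apply/funext => a /=.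
by rewrite /K; congr EFin; ring.
Qed.

Let FE a : (\int[leb3 R]_x (EFin \o K) (a, x) = (rho a * int3 (fun x => u (x + s *: a) * g x))%:E)%E.
Proof. by rewrite -rintZ // rintE //; exact: L1fZ. Qed.

Lemma kernel_L1r : L1 (fun x => int3 (fun a => rho a * u (x + s *: a)) * g x).
Proof.
have := integrable_fubini_F iK'.
rewrite /L1f (_ : fubini_F _ _ = EFin \o (fun x => int3 (fun a => rho a * u (x + s *: a)) * g x)) //.
by apply/funext => x; exact: GE.
Qed.

Lemma kernel_L1l : L1 (fun a => rho a * int3 (fun x => u (x + s *: a) * g x)).
Proof.
have := integrable_fubini_F iK.
rewrite /L1f (_ : fubini_F _ _ = EFin \o (fun a => rho a * int3 (fun x => u (x + s *: a) * g x))) //.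
by apply/funext => x; exact: FE.
Qed.

(** Fubini's theorem; Cauchy-Schwarz in [x] bounds the inner integral uniformly in [a]. The scale
    [s] is 1 for averages of translates and -1 after a change of variables. *)
Lemma kernel_swap : int3 (fun a => rho a * int3 (fun x => u (x + s *: a) * g x)) =
  int3 (fun x => int3 (fun a => rho a * u (x + s *: a)) * g x).
Proof.
apply: EFin_inj; rewrite (rintE kernel_L1l) (rintE kernel_L1r).
apply: (etrans _ (etrans (Fubini iK) _)); congr (integral _ _ _); apply/funext => z.
  exact: esym (FE z).
exact: GE.
Qed.
End Swap.

(** A correlation, with [x + a] in place of [x - a]: a weight supported among inward translations
    then evaluates [u] at inward shifts of [x]. *)
Definition conv rho u x : R := int3 (fun a => rho a * u (x + a)).

Lemma shiftL2 u x : L2r u -> L2r (fun a => u (x + a)).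
Proof.
by move=> /(L2_shift x); congr (L2r _); apply/funext => a; rewrite addrC.
Qed.

Lemma conv_int rho u g : L1 rho -> L2r rho -> L2r u -> L2r g ->
  [/\ L1 (fun a => rho a * int3 (fun x => u (x + a) * g x)),
      L1 (fun x => conv rho u x * g x) &
      int3 (fun x => conv rho u x * g x) = int3 (fun a => rho a * int3 (fun x => u (x + a) * g x))].
Proof.
move=> l1 lr lu lg.
have lru x : L1 (fun a => rho a * u (x + 1 *: a)).
  by under eq_fun do rewrite scale1r; exact: (L1f_mul lr (shiftL2 x lu)).
have e1 : (fun x => int3 (fun a => rho a * u (x + 1 *: a)) * g x) = (fun x => conv rho u x * g x).
  by apply/funext => x; congr (_ * _); apply: eq_rint => a; rewrite scale1r.
have e2 : (fun a => rho a * int3 (fun x => u (x + 1 *: a) * g x)) =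
    (fun a => rho a * int3 (fun x => u (x + a) * g x)).
  by apply/funext => a; rewrite scale1r.
split.
- by have := kernel_L1l 1 l1 lu lg; rewrite e2.
- by have := kernel_L1r l1 lu lg lru; rewrite e1.
- by have := kernel_swap l1 lu lg lru; rewrite e1 e2.
Qed.

Lemma conv_bounded rho u : L2r rho -> L2r u -> exists M, forall x, `|conv rho u x| <= M.
Proof.
move=> lr lu; exists (Num.sqrt (int3 (fun x => rho x ^+ 2)) * Num.sqrt (int3 (fun x => u x ^+ 2))).
move=> x; apply: le_trans (int_cauchy_schwarz lr (shiftL2 x lu)) _.
rewrite ler_wpM2l ?sqrtr_ge0 // ler_wsqrtr // le_eqVlt; apply/orP; left; apply/eqP.
rewrite -(int_shift x lu.2); apply: eq_rint => a; by rewrite addrC.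
Qed.

Lemma smooth_reflect f x : smooth f -> smooth (fun a => f (x + (-1 : R) *: a)).
Proof.
move=> sf n.
have -> : (fun a => f (x + (-1 : R) *: a)) = (fun a => f (((-1 : R) *: a) + x)).
  by apply/funext => a; rewrite addrC.
apply: (@Ck_comp_linear _ _ _ n f (fun a : R3 R => (-1 : R) *: a) x) => //.
- by move=> c a b; rewrite scalerDr !scalerA mulrC.
- exact: scaler_continuous.
Qed.

Lemma derive_reflect f x v a : smooth f ->
  'D_v (fun b => f (x + (-1 : R) *: b)) a = - 'D_v f (x + (-1 : R) *: a).
Proof.
move=> sf; have h1 := derive_line v a 0 (smooth_reflect x sf).
have h2 := derive_line v (x + (-1 : R) *: a) (- 0) sf.
have h3 : is_derive (0 : R) (1 : R) (-%R : R -> R) (-1).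
  by apply: is_derive_eq.
have h4 := is_derive1_comp (f := fun s : R => f ((x + (-1 : R) *: a) + s *: v)) (g := -%R) h2 h3.
have e : (fun s : R => f ((x + (-1 : R) *: a) + s *: v)) \o (-%R : R -> R) =
         (fun s : R => f (x + (-1 : R) *: (a + s *: v))).
  by apply/funext => s /=; congr f; rewrite scalerDr -addrA scalerA mulN1r.
rewrite e in h4.
have := @derive_val _ _ _ _ _ _ _ h4; rewrite (@derive_val _ _ _ _ _ _ _ h1).
by rewrite oppr0 !scale0r !addr0 mulrN1.
Qed.

(** A change of variables moves the translation from [u] to [phi]; after exchanging the integrals,
    the derivative of [phi] is a derivative in [a] up to sign and is integrated by parts onto [rho].
    The two signs cancel. *)
Lemma conv_ibp U rho u phi v : test_fun setT rho -> L2r u -> test_fun U phi ->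
  int3 (fun x => conv rho u x * 'D_v phi x) = int3 (fun x => conv (fun y => 'D_v rho y) u x * phi x).
Proof.
move=> tr lu tp.
have tdr := test_derive v tr; have tdp := test_derive v tp.
have [_ _ ->] := conv_int (test_L1 tr) (test_L2 tr) lu (test_L2 tdp).
have [_ _ ->] := conv_int (test_L1 tdr) (test_L2 tdr) lu (test_L2 tp).
have flip h a : L2r h -> int3 (fun x => u (x + a) * h x) = int3 (fun x => h (x + (-1 : R) *: a) * u x).
  move=> lh; have l1 : L1 (fun x => h (x + (-1 : R) *: a) * u x).
    exact: (L1f_mul (L2_shift ((-1 : R) *: a) lh) lu).
  rewrite -(int_shift a l1); apply: eq_rint => x.
  by rewrite scaleN1r addrK mulrC.
have lru r h x : test_fun setT r -> test_fun U h -> L1 (fun a => r a * h (x + (-1 : R) *: a)).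
  move=> tr' th; have [M _ hM] := test_bounded th.
  apply: (@L1_mul_bounded _ _ _ M (test_L1 tr')) => //.
  by apply: continuous_measurable3; apply: smooth_continuous; apply: smooth_reflect; exact: test_smooth th.
transitivity (int3 (fun a => rho a * int3 (fun x => 'D_v phi (x + (-1 : R) *: a) * u x))).
  by apply: eq_rint => a; rewrite flip //; exact: test_L2 tdp.
rewrite (kernel_swap (test_L1 tr) (test_L2 tdp) lu (fun x => lru _ _ x tr tdp)).
transitivity (int3 (fun a => 'D_v rho a * int3 (fun x => phi (x + (-1 : R) *: a) * u x))); last first.
  by apply: eq_rint => a; rewrite -flip //; exact: test_L2 tp.
rewrite (kernel_swap (test_L1 tdr) (test_L2 tp) lu (fun x => lru _ _ x tdr tp)).
apply: eq_rint => x; congr (_ * _).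
have := int_ibp v (smooth_reflect x (test_smooth tp)) tr.
move=> /(congr1 -%R); rewrite opprK => h.
transitivity (- int3 (fun y => 'D_v (fun b => phi (x + (-1 : R) *: b)) y * rho y)).
  rewrite -[RHS]mulN1r -rintZ; last first.
    apply: (@test_L1 _ setT); apply: testM tr; apply: smooth_derive; apply: smooth_reflect; exact: test_smooth tp.
  apply: eq_rint => a; rewrite derive_reflect; last exact: test_smooth tp.
  by rewrite mulN1r mulNr opprK mulrC.
rewrite -h opprK; apply: eq_rint => a; exact: mulrC.
Qed.

(** When [g] is a test function, the translation can be moved onto it and dominated convergence
    applies. Density handles general [g] with an error uniform in [n], since translations preserve
    the L^2 norm of [u]. *)
Lemma corr_seq u g (a : nat -> R3 R) : L2r u -> L2r g ->
  (forall n i, `|crd i (a n)| < n.+1%:R^-1) ->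
  (fun n => int3 (fun x => u (x + a n) * g x)) @ \oo --> int3 (fun x => u x * g x).
Proof.
move=> lu lg ha.
have a0 : a n @[n --> \oo] --> (0 : R3 R).
  apply/cvgrPdist_lt => e e0; have [N _ hN] := (cvgr0Pnorm_lt (fun n => n.+1%:R^-1 : R)).1 (@cvg_harmonic R) e e0.
  exists N => // n Nn; have := hN n Nn; rewrite ger0_norm // sub0r normrN => hn.
  have : ball (0 : R3 R) e (a n).
    apply/ball3P; split; rewrite sub0r normrN; apply: (lt_trans _ hn).
    - exact: (ha n 0).
    - exact: (ha n 1).
    - exact: (ha n 2).
  by rewrite -ball_normE /= sub0r normrN.
have small (t : R3 R -> R) : test_fun setT t ->
    (fun n => int3 (fun x => u (x + a n) * t x)) @ \oo --> int3 (fun x => u x * t x).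
  move=> tt; have [M M0 hM] := test_bounded tt; have [r hr] := test_bsupp tt.
  pose F n x := u x * t (x - a n).
  have -> : (fun n => int3 (fun x => u (x + a n) * t x)) = (fun n => int3 (F n)).
    apply/funext => n; have l1 : L1 (F n).
      exact: (L1f_mul lu (L2_shift (- a n) (test_L2 tt))).
    by rewrite -(int_shift (a n) l1); apply: eq_rint => x; rewrite /F addrK.
  have mF n : measurable_fun setT (F n).
    exact: (L1f_meas (L1f_mul lu (L2_shift (- a n) (test_L2 tt)))).
  have Fl x : F n x @[n --> \oo] --> u x * t x.
    apply: cvgM; first exact: cvg_cst.
    have ct := smooth_continuous (test_smooth tt).
    have : (x - a n) @[n --> \oo] --> x - 0 by apply: cvgB => //; exact: cvg_cst.
    rewrite subr0 => xa; exact: (cvg_comp _ _ xa (ct x)).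
  have dF n x : `|F n x| <= M * `|u x * \1_(cube (r + 1)) x|.
    have [xr|xr] := pselect (cube (r + 1) x).
      by rewrite indic1T // mulr1 normrM mulrC ler_wpM2r.
    rewrite indic0N // mulr0 normr0 mulr0 /F hr ?mulr0 ?normr0 // => /cubeP k.
    apply: xr; apply/cubeP => i; have := k i; rewrite crdD crdN => h1.
    have h2 := ha n i; have h3 : n.+1%:R^-1 <= 1 :> R by rewrite invf_le1 // ler1n.
    have := ler_normD (crd i x - crd i (a n)) (crd i (a n)); rewrite subrK.
    by move: h1 h2 h3; set d := n.+1%:R^-1; lra.
  by have [] := rdct mF Fl (L1fZ M (L1f_norm (L1f_mul lu (L2_cube _)))) dF.
apply/cvgrPdist_lt => e e0.
pose C := Num.sqrt (int3 (fun x => u x ^+ 2)); have C0 : 0 <= C by exact: sqrtr_ge0.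
pose d := e / (4 * (C + 1)); have d0 : 0 < d by rewrite divr_gt0 // mulr_gt0 //; lra.
have Cd : C * d <= e / 4.
  have : d * (4 * (C + 1)) = e by rewrite divfK // lt0r_neq0 // mulr_gt0 //; lra.
  by move: d0; lra.
have [t tt ht] := test_dense lg (exprn_gt0 2 d0).
have near_t b : `|int3 (fun x => u (x + b) * g x) - int3 (fun x => u (x + b) * t x)| <= e / 4.
  rewrite -rintB; last 2 first.
  - exact: (L1f_mul (L2_shift b lu) lg).
  - exact: (L1f_mul (L2_shift b lu) (test_L2 tt)).
  have -> : int3 (fun x => u (x + b) * g x - u (x + b) * t x) = int3 (fun x => u (x + b) * (g x - t x)).
    by apply: eq_rint => x; rewrite mulrBr.
  apply: le_trans (int_cauchy_schwarz (L2_shift b lu) (L2fB lg (test_L2 tt))) _.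
  rewrite (int_shift b lu.2); apply: le_trans Cd; rewrite ler_wpM2l //.
  rewrite -[leRHS](ger0_norm (ltW d0)) -sqrtr_sqr ler_wsqrtr //.
  apply: le_trans (ltW ht); rewrite le_eqVlt; apply/orP; left; apply/eqP.
  by apply: eq_rint => x; rewrite -sqrrN opprB.
have e4 : 0 < e / 4 by lra.
have [N _ hN] := (cvgrPdist_lt _ _).1 (small t tt) (e / 4) e4.
exists N => // n Nn; have h1 := hN n Nn; have h2 := near_t (a n).
have := near_t 0.
have -> : int3 (fun x => u (x + 0) * g x) = int3 (fun x => u x * g x).
  by apply: eq_rint => x; rewrite addr0.
have -> : int3 (fun x => u (x + 0) * t x) = int3 (fun x => u x * t x).
  by apply: eq_rint => x; rewrite addr0.
move: h1 h2; rewrite !ltr_norml !ler_norml.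
move: (int3 (fun x => u x * t x)) (int3 (fun x => u (x + a n) * t x)).
move: (int3 (fun x => u (x + a n) * g x)) (int3 (fun x => u x * g x)).
clear -e0 => p1 p2 p3 p4.
move=> /andP[? ?] /andP[? ?] /andP[? ?]; apply/andP; split; lra.
Qed.

End Kernel.

(** * Square integrable fields and weak curls *)

Lemma cvgr_sum (R : realType) (I : Type) (s : seq I) (F : nat -> I -> R) (l : I -> R) :
  (forall i, (fun n => F n i) @ \oo --> l i) ->
  (fun n => \sum_(i <- s) F n i) @ \oo --> \sum_(i <- s) l i.
Proof.
move=> h; elim: s => [|i s IH].
  by rewrite big_nil; under eq_fun do rewrite big_nil; exact: cvg_cst.
by rewrite big_cons; under eq_fun do rewrite big_cons; exact: cvgD.
Qed.

Section FieldsOnDomain.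
Context (R : realType) (Omega : set (R3 R)) (oO : open Omega) (rO : R) (bO : Omega `<=` cube rO).
Implicit Types (u v w : vfield R) (f g : R3 R -> R) (i j : 'I_3).

Notation L1 := (@L1f _ (R3 R) R (leb3 R)).
Notation L2r := (@L2f _ (R3 R) R (leb3 R)).
Notation int3 := (@rint _ (R3 R) R (leb3 R)).
Notation L2 := (L2 Omega).

(** Extension by zero turns integrals over [Omega] into integrals over space, where translations
    act. *)
Definition zx u i : R3 R -> R := (fun x => u x i 0) \_ Omega.

Lemma mO : measurable Omega. Proof. exact: open_measurable3. Qed.

Lemma sqintP g : sqint Omega g <-> L2r (g \_ Omega).
Proof. exact: L2f_Lfun. Qed.

Lemma domP u : dom L2 u <-> forall i, L2r (zx u i).
Proof. by split=> h i; apply/sqintP; exact: h. Qed.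

Lemma zxE u i x : Omega x -> zx u i x = u x i 0.
Proof. by move=> Ox; rewrite /zx patchE mem_set. Qed.
Lemma zx0 u i x : ~ Omega x -> zx u i x = 0.
Proof. by move=> Ox; rewrite /zx patchE memNset. Qed.

Lemma zxD (a : R) u v i x : zx (a *: u + v) i x = a * zx u i x + zx v i x.
Proof.
have [Ox|Ox] := pselect (Omega x); last by rewrite !zx0 // mulr0 addr0.
by rewrite !zxE // /GRing.add /GRing.scale /= !mxE.
Qed.

Lemma L2_mulb f g (C : R) : L2r f -> measurable_fun setT g -> (forall x, `|g x| <= C) ->
  L2r (fun x => f x * g x).
Proof.
move=> [mf sf] mg gC; have mfg := measurable_funM mf mg.
split=> //; apply: (L1f_dom _ (L1fZ (C ^+ 2) sf)); first exact: measurable_funX.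
move=> x; rewrite exprMn normrM ger0_norm ?sqr_ge0 // ger0_norm ?sqr_ge0 // mulrC.
rewrite ler_wpM2r ?sqr_ge0 // -(real_normK (num_real (g x))) lerXn2r ?nnegrE //.
exact: le_trans (gC x).
Qed.

Lemma L2_patch f : L2r f -> L2r (f \_ Omega).
Proof.
move=> lf; rewrite (_ : f \_ Omega = (fun x => f x * \1_Omega x)).
  apply: (@L2_mulb _ _ 1) => //; first by apply: measurable_indic; exact: mO.
  by move=> x; have /andP[h0 h1] := indic_itv R Omega x; rewrite ger0_norm.
by apply/funext => x; rewrite patchE indicE; case: ifP; rewrite ?mulr1 ?mulr0.
Qed.

Definition ip3 (f g : 'I_3 -> R3 R -> R) : R := \sum_i int3 (fun x => f i x * g i x).

Lemma ipE u v : dom L2 u -> dom L2 v -> ip Omega u v = ip3 (zx u) (zx v).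
Proof.
move=> /domP lu /domP lv; rewrite /ip Rintegral_mkcond.
transitivity (int3 (fun x => \sum_i zx u i x * zx v i x)).
  apply: eq_rint => x; rewrite patchE; case: ifPn => [/set_mem Ox|/negP Ox].
    by apply: eq_bigr => i _; rewrite !zxE.
  by rewrite big1 // => i _; rewrite zx0 ?mul0r // => Ox'; apply: Ox; rewrite mem_set.
by rewrite rint_sum // => i; exact: L1f_mul.
Qed.

Lemma dom0 : dom L2 (0 : vfield R).
Proof.
apply/domP => i; rewrite (_ : zx 0 i = fun=> 0); first exact: L2f0.
by apply/funext => x; have [h|h] := pselect (Omega x); [rewrite zxE // mxE|rewrite zx0].
Qed.

Lemma domD (a : R) u v : dom L2 u -> dom L2 v -> dom L2 (a *: u + v).
Proof.
move=> /domP lu /domP lv; apply/domP => i.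
by rewrite (_ : zx _ i = fun x => a * zx u i x + zx v i x) ?(funext (zxD a u v i)) //; apply: L2fD => //; exact: L2fZ.
Qed.

Definition VL2 := set_subsp dom0 domD.
Definition mip (u v : sub_elt VL2) : R := ip Omega (sub_val u) (sub_val v).
Lemma VL2P (u : sub_elt VL2) : dom L2 (sub_val u).
Proof. by have := valP u => /set_mem. Qed.
Definition mkV u (hu : dom L2 u) : sub_elt VL2 := @SubElt _ _ VL2 u (mem_set hu).

Lemma ip_sym u v : ip Omega u v = ip Omega v u.
Proof.
by apply: eq_Rintegral => x _; apply: eq_bigr => i _; exact: mulrC.
Qed.

Lemma ip_lin (a : R) u v w : dom L2 u -> dom L2 v -> dom L2 w ->
  ip Omega (a *: u + v) w = a * ip Omega u w + ip Omega v w.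
Proof.
move=> hu hv hw; rewrite !ipE //; last exact: domD.
rewrite /ip3 mulr_sumr -big_split; apply: eq_bigr => i _ /=.
move/domP: hu => /(_ i) hu; move/domP: hv => /(_ i) hv; move/domP: hw => /(_ i) hw.
rewrite -rintZ; last exact: L1f_mul.
rewrite -rintD; [|by apply: L1fZ; exact: L1f_mul|exact: L1f_mul].
by apply: eq_rint => x; rewrite zxD mulrDl mulrA.
Qed.

Lemma ip_ge0 u : 0 <= ip Omega u u.
Proof. by apply: Rintegral_ge0 => x _; apply: sumr_ge0 => i _; rewrite -expr2 sqr_ge0. Qed.

Lemma mip_hilbert : semi_hilbert mip.
Proof.
split.
- by move=> a u v w; apply: ip_lin; exact: VL2P.
- by move=> u v; exact: ip_sym.
- by move=> u; exact: ip_ge0.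
move=> u hu.
have zB (j k : nat) i x : zx (sub_val (u j - u k)) i x = zx (sub_val (u j)) i x - zx (sub_val (u k)) i x.
  have [h|h] := pselect (Omega x); last by rewrite !zx0 // subr0.
  by rewrite !zxE //= !mxE.
have cmp i : exists g : R3 R -> R, L2r g /\
    (fun n => int3 (fun x => (zx (sub_val (u n)) i x - g x) ^+ 2)) @ \oo --> (0 : R).
  have [||g lg gl] := @L2f_complete _ _ _ (leb3 R) (fun n => zx (sub_val (u n)) i); last by exists g.
    by move=> n; have /domP := VL2P (u n).
  move=> e /hu[N hN]; exists N => j k Nj Nk; apply: le_lt_trans (hN j k Nj Nk).
  rewrite /mip (ipE (VL2P _) (VL2P _)) /ip3 (bigD1 i) //=.
  apply: (@le_trans _ _ (int3 (fun x => zx (sub_val (u j - u k)) i x * zx (sub_val (u j - u k)) i x))).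
    by rewrite le_eqVlt; apply/orP; left; apply/eqP; apply: eq_rint => x; rewrite (zB j k i x) expr2.
  by rewrite lerDl; apply: sumr_ge0 => i' _; apply: rint_ge0 => x; rewrite -expr2 sqr_ge0.
have [g hg] := choice cmp.
pose l : vfield R := fun x => \col_i g i x.
have zl i : zx l i = (g i) \_ Omega.
  by apply/funext => x; rewrite /zx !patchE; case: ifP => // _; rewrite mxE.
have dl : dom L2 l by apply/domP => i; rewrite zl; apply: L2_patch; exact: (hg i).1.
exists (mkV dl).
apply: (@cvgr0_le R _ (fun n => \sum_i int3 (fun x => (zx (sub_val (u n)) i x - g i x) ^+ 2))).
  move=> n; rewrite ip_ge0 /mip (ipE (VL2P _) (VL2P _)) /=; apply: ler_sum => i _.
  have hu' := (proj1 (domP _) (VL2P (u n))) i.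
  apply: rint_le.
  - by apply: L1f_mul; exact: (proj1 (domP _) (VL2P (u n - mkV dl))).
  - exact: (L2fB hu' (hg i).1).2.
  move=> x; have [h|h] := pselect (Omega x); last by rewrite !zx0 // mulr0 sqr_ge0.
  by rewrite !zxE //= !mxE -expr2.
rewrite -[X in _ --> X](@big1 _ _ +%R _ (index_enum 'I_3) xpredT (fun=> 0)) //.
by apply: cvgr_sum => i; exact: (hg i).2.
Qed.

Lemma nrmE u : nrm L2 u = Num.sqrt (ip Omega u u). Proof. by []. Qed.

Lemma nrm_sqr u : nrm L2 u ^+ 2 = ip Omega u u.
Proof. by rewrite nrmE sqr_sqrtr // ip_ge0. Qed.

Lemma nrm_ge0 u : 0 <= nrm L2 u. Proof. exact: sqrtr_ge0. Qed.

Lemma ip_cs u v : dom L2 u -> dom L2 v -> `|ip Omega u v| <= nrm L2 u * nrm L2 v.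
Proof. by move=> hu hv; exact: (cauchy_schwarz mip_hilbert (mkV hu) (mkV hv)). Qed.

Lemma ip0l v : dom L2 v -> ip Omega 0 v = 0.
Proof. by move=> hv; exact: (sh0l mip_hilbert (mkV hv)). Qed.

Lemma ip_null u v : dom L2 u -> dom L2 v -> nrm L2 u = 0 -> ip Omega u v = 0.
Proof. by move=> hu hv h; exact: (hn_null_l mip_hilbert (u := mkV hu) (mkV hv) h). Qed.

Section TestFields.

Lemma zx_test u i : test_vfield Omega u -> zx u i = (fun x => u x i 0).
Proof.
move=> tu; apply/funext => x; have [h|h] := pselect (Omega x); first by rewrite zxE.
by rewrite zx0 //; have [_ [K [_ KO ->]]] := tu i => // /KO.
Qed.

Lemma test_dom u : test_vfield Omega u -> dom L2 u.
Proof. by move=> tu; apply/domP => i; rewrite zx_test //; exact: test_L2 (tu i). Qed.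

Definition monof i f : vfield R := fun x => \col_j (if j == i then f x else 0).

Lemma monof_test i f : test_fun Omega f -> test_vfield Omega (monof i f).
Proof.
move=> tf j; rewrite /monof; have [e|e] := eqVneq j i.
  by rewrite (_ : (fun _ => _) = f) //; apply/funext => x; rewrite mxE e eqxx.
rewrite (_ : (fun _ => _) = fun=> 0); first exact: test0.
by apply/funext => x; rewrite mxE (negPf e).
Qed.

Lemma ip_monof u i f : dom L2 u -> test_fun Omega f ->
  ip Omega u (monof i f) = int3 (fun x => zx u i x * f x).
Proof.
move=> hu tf; have tm := monof_test i tf; rewrite (ipE hu (test_dom tm)) /ip3 (bigD1 i) //=.
rewrite (zx_test i tm) big1 => [|j ji].
  by rewrite addr0; apply: eq_rint => x; rewrite mxE eqxx.
transitivity (int3 (fun=> 0)); last by rewrite /rint Rintegral_cst // mul0r.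
by apply: eq_rint => x; rewrite (zx_test j tm) mxE (negPf ji) mulr0.
Qed.

Lemma test_total u : dom L2 u -> (forall phi, test_vfield Omega phi -> ip Omega u phi = 0) ->
  nrm L2 u = 0.
Proof.
move=> hu h; rewrite nrmE (ipE hu hu) /ip3 big1 ?sqrtr0 // => i _.
have /domP /(_ i) lu := hu.
have z0 : \forall x \ae leb3 R, Omega x -> zx u i x = 0.
  apply: (fundamental_L2 oO lu) => f tf; rewrite -ip_monof //.
  by apply: h; exact: monof_test.
rewrite (rint_ae (g := fun=> 0)).
- by rewrite /rint Rintegral_cst // mul0r.
- exact: L1f_meas (L1f_mul lu lu).
- exact: measurable_cst.
apply: filterS z0 => x hx; have [h'|h'] := pselect (Omega x); first by rewrite hx // mul0r.
by rewrite zx0 // mul0r.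
Qed.

Lemma curl_smooth_test u : test_vfield Omega u -> test_vfield Omega (curl_smooth u).
Proof.
move=> tu i; rewrite (_ : (fun _ => _) = (fun x => -1 * 'D_(axis R (i - 1)) (fun y => u y (i + 1) 0) x +
   'D_(axis R (i + 1)) (fun y => u y (i - 1) 0) x)).
  by apply: test_lin; exact: test_derive.
by apply/funext => x; rewrite mxE addrC mulN1r.
Qed.

End TestFields.
End FieldsOnDomain.

Lemma sum3 (R : nmodType) (F : 'I_3 -> R) : \sum_i F i = F 0 + F 1 + F 2.
Proof.
rewrite !big_ord_recl big_ord0 addr0 addrA.
by congr (_ + F _ + F _); exact: val_inj.
Qed.

Lemma ord3 : (((0 + 1 : 'I_3)%R = 1%R) * ((1 + 1 : 'I_3)%R = 2%R) * ((2 + 1 : 'I_3)%R = 0%R) *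
  ((0 - 1 : 'I_3)%R = 2%R) * ((1 - 1 : 'I_3)%R = 0%R) * ((2 - 1 : 'I_3)%R = 1%R))%type.
Proof. by do ! split; exact: val_inj. Qed.

(** * The spaces H(curl) and H0(curl) *)

Section CurlSpaces.
Context (R : realType) (Omega : set (R3 R)) (oO : open Omega) (rO : R) (bO : Omega `<=` cube rO).
Implicit Types (u v w : vfield R) (f g : R3 R -> R) (i j k : 'I_3).

Notation L1 := (@L1f _ (R3 R) R (leb3 R)).
Notation L2r := (@L2f _ (R3 R) R (leb3 R)).
Notation int3 := (@rint _ (R3 R) R (leb3 R)).
Notation L2 := (L2 Omega).
Notation Hcurl := (Hcurl Omega).
Notation H0curl := (H0curl Omega).
Notation ip := (ip Omega).
Notation curl := (curl Omega).
Notation weak_curl := (weak_curl Omega).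
Notation zx := (zx Omega).

(** Without a weak curl the default value 0 of [xget] is taken, so [curl v] is square integrable for
    every [v]; this removes many side conditions. *)
Lemma curl_spec v : dom L2 (curl v) /\ (dom Hcurl v -> weak_curl v (curl v)).
Proof.
rewrite /curl; have [[w hw]|nw] := pselect (exists w, dom L2 w /\ weak_curl v w).
  have [h1 h2] := @xgetPex _ 0 [set w | dom L2 w /\ weak_curl v w] (ex_intro _ w hw).
  by split.
rewrite xgetPN; last by move=> w hw; apply: nw; exists w.
by split; [exact: dom0|case=> _ h; case: nw].
Qed.

Local Opaque Defs.ip Defs.curl.

Lemma dom_curl v : dom L2 (curl v). Proof. by case: (curl_spec v). Qed.
Lemma curlP v : dom Hcurl v -> weak_curl v (curl v). Proof. by case: (curl_spec v). Qed.

Lemma ip_linr (a : R) u v w : dom L2 u -> dom L2 v -> dom L2 w ->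
  ip w (a *: u + v) = a * ip w u + ip w v.
Proof. by move=> hu hv hw; rewrite !(ip_sym _ w) ip_lin. Qed.

Lemma ip_eqP u v : dom L2 u -> dom L2 v ->
  (forall phi, test_vfield Omega phi -> ip u phi = ip v phi) ->
  nrm L2 (u - v) = 0 /\ forall w, dom L2 w -> ip u w = ip v w.
Proof.
move=> hu hv h; have -> : u - v = (-1) *: v + u by rewrite scaleN1r addrC.
have hd := domD (-1) hv hu.
have n0 : nrm L2 ((-1) *: v + u) = 0.
  apply: test_total => // phi tp; have dp := test_dom tp.
  by rewrite ip_lin // h // mulN1r addNr.
split=> // w hw; have := ip_null oO hd hw n0; rewrite ip_lin // mulN1r.
by move/eqP; rewrite addrC subr_eq0 => /eqP.
Qed.

Lemma domB u v : dom L2 u -> dom L2 v -> dom L2 (u - v).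
Proof. by move=> hu hv; rewrite addrC -scaleN1r; exact: domD. Qed.

Lemma ipB u v w : dom L2 u -> dom L2 v -> dom L2 w -> ip (u - v) w = ip u w - ip v w.
Proof. by move=> hu hv hw; rewrite addrC -scaleN1r ip_lin // mulN1r addrC. Qed.

Lemma ip_ext u v : dom L2 u -> dom L2 v -> (forall w, dom L2 w -> ip u w = ip v w) ->
  nrm L2 u = nrm L2 v.
Proof. by move=> hu hv h; rewrite !nrmE (h u hu) (ip_sym _ v) (h v hv). Qed.

Lemma wc_uniq v w w' : dom L2 w -> dom L2 w' -> weak_curl v w -> weak_curl v w' ->
  nrm L2 (w - w') = 0 /\ forall u, dom L2 u -> ip w u = ip w' u.
Proof. by move=> hw hw' h h'; apply: ip_eqP => // phi tp; rewrite -h // h'. Qed.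

Lemma wc_Hcurl v w : dom L2 v -> dom L2 w -> weak_curl v w -> dom Hcurl v.
Proof. by move=> hv hw h; split=> //; exists w. Qed.

Lemma curl_eq v w u : dom L2 v -> dom L2 w -> weak_curl v w -> dom L2 u ->
  ip (curl v) u = ip w u.
Proof.
move=> hv hw h hu; apply: (wc_uniq (dom_curl v) hw (curlP _) h).2 => //.
exact: wc_Hcurl hv hw h.
Qed.

Lemma wc_lin (a : R) v v' w w' : dom L2 v -> dom L2 v' -> dom L2 w -> dom L2 w' ->
  weak_curl v w -> weak_curl v' w' -> weak_curl (a *: v + v') (a *: w + w').
Proof.
move=> hv hv' hw hw' h h' phi tp; have dp := test_dom tp.
have dc := test_dom (curl_smooth_test tp).
by rewrite !ip_lin // h // h'.
Qed.

Lemma Hcurl_dom v : dom Hcurl v -> dom L2 v. Proof. by case. Qed.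

Lemma Hcurl0 : dom Hcurl (0 : vfield R).
Proof.
apply: (@wc_Hcurl _ 0); [exact: dom0|exact: dom0|].
by move=> phi tp; rewrite !ip0l //; [exact: test_dom|exact: test_dom (curl_smooth_test tp)].
Qed.

Lemma Hcurl_lin (a : R) u v : dom Hcurl u -> dom Hcurl v -> dom Hcurl (a *: u + v).
Proof.
move=> hu hv; apply: (@wc_Hcurl _ (a *: curl u + curl v)).
- by apply: domD => //; exact: Hcurl_dom.
- by apply: domD => //; exact: dom_curl.
- by apply: wc_lin; try exact: dom_curl; try exact: curlP; exact: Hcurl_dom.
Qed.

Lemma curl_lin (a : R) u v w : dom Hcurl u -> dom Hcurl v -> dom L2 w ->
  ip (curl (a *: u + v)) w = a * ip (curl u) w + ip (curl v) w.
Proof.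
move=> hu hv hw; rewrite (@curl_eq _ (a *: curl u + curl v)) //.
- by rewrite ip_lin //; exact: dom_curl.
- by apply: domD => //; exact: Hcurl_dom.
- by apply: domD => //; exact: dom_curl.
- by apply: wc_lin; try exact: dom_curl; try exact: curlP; exact: Hcurl_dom.
Qed.

Lemma trace_lin (a : R) u v w : dom Hcurl u -> dom Hcurl v -> dom L2 w ->
  tangential_trace Omega (a *: u + v) w = a * tangential_trace Omega u w + tangential_trace Omega v w.
Proof.
move=> hu hv hw; have [[du dv] dc] := (Hcurl_dom hu, Hcurl_dom hv, dom_curl w).
rewrite /tangential_trace curl_lin // ip_lin //.
by move: (ip u _) (ip v _) (ip (curl u) _) (ip (curl v) _) => ? ? ? ?; ring.
Qed.

Lemma H1_dom u : H1_vfield Omega u -> dom L2 u.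
Proof. by move=> h i; case: (h i). Qed.

Lemma H0curl0 : dom H0curl (0 : vfield R).
Proof.
split=> [|w hw]; first exact: Hcurl0.
have := @trace_lin 1 0 0 w Hcurl0 Hcurl0 (H1_dom hw); rewrite scale1r addr0 mul1r.
by move=> /esym/eqP; rewrite -subr_eq0 addrK => /eqP.
Qed.

Lemma H0curl_lin (a : R) u v : dom H0curl u -> dom H0curl v -> dom H0curl (a *: u + v).
Proof.
move=> [hu tu] [hv tv]; split=> [|w hw]; first exact: Hcurl_lin.
by rewrite trace_lin ?tu ?tv ?mulr0 ?addr0 //; exact: H1_dom.
Qed.

Lemma L2_ip_cvg (s : nat -> vfield R) u v : (forall n, dom L2 (s n)) -> dom L2 u -> dom L2 v ->
  (fun n => nrm L2 (s n - u)) @ \oo --> (0 : R) -> (fun n => ip (s n) v) @ \oo --> ip u v.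
Proof.
move=> hs hu hv h.
have := sh_cvg (mip_hilbert oO) (u := fun n => mkV (hs n)) (l := mkV hu) (w := mkV hv) h.
by apply.
Qed.

Lemma wc_closed (s c : nat -> vfield R) v w :
  (forall n, dom L2 (s n)) -> (forall n, dom L2 (c n)) -> dom L2 v -> dom L2 w ->
  (forall n, weak_curl (s n) (c n)) -> (fun n => nrm L2 (s n - v)) @ \oo --> (0 : R) ->
  (fun n => nrm L2 (c n - w)) @ \oo --> (0 : R) -> weak_curl v w.
Proof.
move=> hs hc hv hw h sv cw phi tp.
have h1 := L2_ip_cvg hs hv (test_dom (curl_smooth_test tp)) sv.
have h2 := L2_ip_cvg hc hw (test_dom tp) cw.
apply: (cvg_unique _ h1); first exact: norm_hausdorff.
by rewrite (_ : (fun n => _) = (fun n => ip (c n) phi)) //; apply/funext => n; exact: h.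
Qed.

Definition hc u v := ip u v + ip (curl u) (curl v).

Lemma hc_nrm u : nrm Hcurl u = Num.sqrt (hc u u).
Proof. by rewrite /= !sqr_sqrtr ?ip_ge0. Qed.

Lemma nrm_le_Hcurl u : nrm L2 u <= nrm Hcurl u.
Proof. by rewrite hc_nrm ler_wsqrtr // lerDl ip_ge0. Qed.

Lemma nrm_curl_le u : nrm L2 (curl u) <= nrm Hcurl u.
Proof. by rewrite hc_nrm ler_wsqrtr // lerDr ip_ge0. Qed.

Lemma HcurlB u v : dom Hcurl u -> dom Hcurl v -> dom Hcurl (u - v).
Proof. by move=> hu hv; rewrite addrC -scaleN1r; exact: Hcurl_lin. Qed.

Lemma curlB u v w : dom Hcurl u -> dom Hcurl v -> dom L2 w ->
  ip (curl (u - v)) w = ip (curl u) w - ip (curl v) w.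
Proof. by move=> hu hv hw; rewrite addrC -scaleN1r curl_lin // mulN1r addrC. Qed.

Lemma nrm_curlB u v : dom Hcurl u -> dom Hcurl v ->
  nrm L2 (curl u - curl v) = nrm L2 (curl (u - v)).
Proof.
move=> hu hv; have [du dv] := (dom_curl u, dom_curl v); have dd := domB du dv.
apply: (ip_ext dd (dom_curl (u - v))) => w hw.
by rewrite (ipB du dv hw) (curlB hu hv hw).
Qed.

(** The weak curl is a closed operator: the fields and their curls converge separately in L^2, and
    the defining identity passes to the limit. *)
Lemma curl_complete (s : nat -> vfield R) : (forall n, dom Hcurl (s n)) ->
  (forall e, 0 < e -> exists N, forall j k : nat, (N <= j)%N -> (N <= k)%N ->
     hc (s j - s k) (s j - s k) < e) ->
  exists l : vfield R, [/\ dom Hcurl l, (fun n => nrm L2 (s n - l)) @ \oo --> (0 : R),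
     (fun n => nrm L2 (curl (s n) - curl l)) @ \oo --> (0 : R) &
     (fun n => hc (s n - l) (s n - l)) @ \oo --> (0 : R)].
Proof.
move=> hs hC; have hs2 n := Hcurl_dom (hs n).
have [|[l Pl] hl] := sh_complete (mip_hilbert oO) (u := fun n => mkV (hs2 n)).
  move=> e /hC[N hN]; exists N => j k Nj Nk; apply: le_lt_trans (hN j k Nj Nk).
  by rewrite lerDl ip_ge0.
have [|[w Pw] hw] := sh_complete (mip_hilbert oO) (u := fun n => mkV (dom_curl (s n))).
  move=> e /hC[N hN]; exists N => j k Nj Nk; apply: le_lt_trans (hN j k Nj Nk).
  rewrite /mip /= -nrm_sqr nrm_curlB // nrm_sqr.
  by rewrite lerDr ip_ge0.
have dl : dom L2 l by exact: set_mem Pl.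
have dw : dom L2 w by exact: set_mem Pw.
have nl : (fun n => nrm L2 (s n - l)) @ \oo --> (0 : R) by exact: cvg_sqrt0 hl.
have nw : (fun n => nrm L2 (curl (s n) - w)) @ \oo --> (0 : R) by exact: cvg_sqrt0 hw.
have wlw : weak_curl l w.
  by apply: (wc_closed hs2 (fun n => dom_curl (s n)) dl dw _ nl nw) => n; exact: curlP.
have hcl := wc_Hcurl dl dw wlw.
have nw2 : (fun n => nrm L2 (curl (s n) - curl l)) @ \oo --> (0 : R).
  rewrite (_ : (fun n => _) = (fun n => nrm L2 (curl (s n) - w))) //; apply/funext => n.
  have [_ e] := wc_uniq (dom_curl l) dw (curlP hcl) wlw.
  have [dc dcl] := (dom_curl (s n), dom_curl l).
  by apply: (ip_ext (domB dc dcl) (domB dc dw)) => z hz; rewrite !ipB // e.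
exists l; split; [exact: hcl|exact: nl|exact: nw2|].
rewrite (_ : (fun n => _) = (fun n => nrm L2 (s n - l) * nrm L2 (s n - l) +
    nrm L2 (curl (s n) - curl l) * nrm L2 (curl (s n) - curl l))); last first.
  by apply/funext => n; rewrite /hc -!nrm_sqr -nrm_curlB // !expr2.
by have := cvgD (cvgM nl nl) (cvgM nw2 nw2); rewrite mulr0 addr0; apply.
Qed.

Section Components.

(** Common to H^1 fields and test fields: weak first derivatives of the components assemble into a
    weak curl, after a cyclic shift of the summation index. *)
Lemma wc_components v (d : 'I_3 -> 'I_3 -> R3 R -> R) : dom L2 v ->
  (forall k j, L2r (d k j \_ Omega)) ->
  (forall k j phi, test_fun Omega phi ->
     int3 (fun x => zx v j x * 'D_(axis R k) phi x) = - int3 (fun x => (d k j \_ Omega) x * phi x)) ->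
  dom L2 (fun x => \col_i (d (i + 1) (i - 1) x - d (i - 1) (i + 1) x)) /\
  weak_curl v (fun x => \col_i (d (i + 1) (i - 1) x - d (i - 1) (i + 1) x)).
Proof.
move=> hv ld hd; set w := fun x => _.
have zw i : zx w i = (fun x => (d (i + 1) (i - 1) \_ Omega) x - (d (i - 1) (i + 1) \_ Omega) x).
  apply/funext => x; rewrite /zx !patchE; case: ifP => _; last by rewrite subr0.
  by rewrite /w mxE.
have hw : dom L2 w by apply/domP => i; rewrite zw; exact: L2fB.
split=> // phi tp; have tc := curl_smooth_test tp.
rewrite (ipE hv (test_dom tc)) (ipE hw (test_dom tp)) /ip3.
pose A k j l := int3 (fun x => (d k j \_ Omega) x * phi x l 0).
have l1 i k j : L1 (fun x => zx v i x * 'D_(axis R k) (fun y => phi y j 0) x).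
  by apply: L1f_mul; [exact: (proj1 (domP _ _) hv)|exact: test_L2 (test_derive _ (tp j))].
have l2 k j l : L1 (fun x => (d k j \_ Omega) x * phi x l 0).
  by apply: L1f_mul => //; exact: test_L2 (tp l).
have e1 i : int3 (fun x => zx v i x * zx (curl_smooth phi) i x) =
    - A (i + 1) i (i - 1) + A (i - 1) i (i + 1).
  rewrite (zx_test i tc).
  transitivity (int3 (fun x => zx v i x * 'D_(axis R (i + 1)) (fun y => phi y (i - 1) 0) x -
      zx v i x * 'D_(axis R (i - 1)) (fun y => phi y (i + 1) 0) x)).
    by apply: eq_rint => x; rewrite mxE mulrBr.
  by rewrite rintB // !hd // opprK.
have e2 i : int3 (fun x => zx w i x * zx phi i x) = A (i + 1) (i - 1) i - A (i - 1) (i + 1) i.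
  rewrite (zx_test i tp) /A -rintB //; apply: eq_rint => x; by rewrite zw mulrBl.
under eq_bigr do rewrite e1; under [RHS]eq_bigr do rewrite e2.
rewrite !sum3 !ord3; ring.
Qed.

Lemma zx_derive v j k phi : test_fun Omega phi ->
  \int[leb3 R]_(x in Omega) (v x j 0 * 'D_(axis R k) phi x) =
  int3 (fun x => zx v j x * 'D_(axis R k) phi x).
Proof.
move=> tp; rewrite Rintegral_mkcond; apply: eq_rint => x; rewrite /zx !patchE.
by case: ifP => //; rewrite mul0r.
Qed.

Lemma H1_curl u : H1_vfield Omega u -> dom Hcurl u.
Proof.
move=> hu; have du := H1_dom hu.
have cmp (kj : 'I_3 * 'I_3) : exists d : R3 R -> R, sqint Omega d /\
    forall phi, test_fun Omega phi -> \int[leb3 R]_(x in Omega) (u x kj.2 0 * 'D_(axis R kj.1) phi x)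
      = - \int[leb3 R]_(x in Omega) (d x * phi x).
  by have [_ /(_ kj.1)] := hu kj.2.
have [d hd] := choice cmp.
have [||h1 h2] := @wc_components u (fun k j => d (k, j)) du.
- by move=> k j; apply/sqintP; exact: (hd (k, j)).1.
- move=> k j phi tp; rewrite -zx_derive // (hd (k, j)).2 // Rintegral_mkcond; congr (- _).
  by apply: eq_rint => x; rewrite !patchE; case: ifP => //; rewrite mul0r.
exact: wc_Hcurl du h1 h2.
Qed.

Lemma test_wc phi : test_vfield Omega phi -> weak_curl phi (curl_smooth phi).
Proof.
move=> tp; have dp := test_dom tp.
have pd k j : ('D_(axis R k) (fun y => phi y j 0)) \_ Omega = 'D_(axis R k) (fun y => phi y j 0).
  have [_ [K [_ KO h]]] := test_derive (axis R k) (tp j).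
  apply/funext => x; rewrite patchE; case: ifPn => // /negP nx.
  by rewrite h // => /KO Ox; apply: nx; rewrite mem_set.
have [||_ h2] := @wc_components phi (fun k j => 'D_(axis R k) (fun y => phi y j 0)) dp.
- by move=> k j; rewrite pd; exact: test_L2 (test_derive _ (tp j)).
- move=> k j psi tpsi; rewrite pd (zx_test j tp); exact: (int_ibp _ (test_smooth (tp j)) tpsi).
exact: h2.
Qed.

Lemma test_H0curl phi : test_vfield Omega phi -> dom H0curl phi.
Proof.
move=> tp; have dp := test_dom tp; have dc := test_dom (curl_smooth_test tp).
split=> [|u hu]; first exact: wc_Hcurl dp dc (test_wc tp).
rewrite /tangential_trace (curl_eq dp dc (test_wc tp) (H1_dom hu)).
by rewrite (ip_sym _ _ u) (ip_sym _ phi) (curlP (H1_curl hu) tp) subrr.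
Qed.

Lemma grad_test chi : test_fun Omega chi -> test_vfield Omega (grad_smooth chi).
Proof.
move=> tc i; rewrite (_ : (fun _ => _) = 'D_(axis R i) chi); first exact: test_derive.
by apply/funext => x; rewrite mxE.
Qed.

(** The six second-order terms cancel in pairs by the weak symmetry [int_derive_swap]. These
    gradients are the test fields that detect the divergence of the magnetic field. *)
Lemma curl_grad chi : test_fun Omega chi -> dom Hcurl (grad_smooth chi) /\
  forall u, dom L2 u -> ip (curl (grad_smooth chi)) u = 0.
Proof.
move=> tc; have tg := grad_test tc; have dg := test_dom tg.
have [hg _] := test_H0curl tg; split=> // u du.
rewrite (@curl_eq _ 0) //; [exact: ip0l|exact: dom0|move=> phi tp].
rewrite (ip0l oO (test_dom tp)) (ipE dg (test_dom (curl_smooth_test tp))) /ip3.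
pose B i k j := int3 (fun x => 'D_(axis R i) chi x * 'D_(axis R k) (fun y => phi y j 0) x).
have Bs i k j : B i k j = B k i j by exact: int_derive_swap tc (tp j).
have l1 i k j : L1 (fun x => 'D_(axis R i) chi x * 'D_(axis R k) (fun y => phi y j 0) x).
  by apply: L1f_mul; [exact: test_L2 (test_derive _ tc)|exact: test_L2 (test_derive _ (tp j))].
transitivity (\sum_i (B i (i + 1) (i - 1) - B i (i - 1) (i + 1))).
  apply: eq_bigr => i _; rewrite (zx_test i tg) (zx_test i (curl_smooth_test tp)) /B -rintB //.
  by apply: eq_rint => x; rewrite !mxE mulrBr.
clearbody B; rewrite sum3 !ord3 (Bs 1 0) (Bs 2 0) (Bs 2 1).
by move: (B 0 1 2) (B 0 2 1) (B 1 2 0) => ? ? ?; ring.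
Qed.

End Components.
End CurlSpaces.

(** * Green's formula *)

Section Green.
Context (R : realType) (Omega : set (R3 R)) (oO : open Omega) (rO : R) (bO : Omega `<=` cube rO).
Implicit Types (u v w : vfield R) (i j k : 'I_3).

Notation L1 := (@L1f _ (R3 R) R (leb3 R)).
Notation L2r := (@L2f _ (R3 R) R (leb3 R)).
Notation int3 := (@rint _ (R3 R) R (leb3 R)).
Notation L2 := (L2 Omega).
Notation Hcurl := (Hcurl Omega).
Notation H0curl := (H0curl Omega).
Notation ip := (ip Omega).
Notation curl := (curl Omega).
Notation weak_curl := (weak_curl Omega).
Notation zx := (zx Omega).
Local Opaque Defs.ip Defs.curl.

Lemma L2_indicO : L2r (\1_Omega).
Proof.
rewrite (_ : \1_Omega = (\1_(cube rO) : R3 R -> R) \_ Omega); first by apply: L2_patch => //; exact: L2_cube.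
by apply/funext => x; rewrite patchE !indicE; case: ifP => // /set_mem /bO h; rewrite mem_set.
Qed.

(** The condition concerns only points landing in [K]: outside [K] the cutoff function vanishes and
    nothing has to be controlled. *)
Definition inward (K : set (R3 R)) : set (R3 R) :=
  [set a | forall x : R3 R, Omega x -> K (x + a) -> Omega (x + a)].

Lemma inward0 K : inward K 0.
Proof. by move=> x; rewrite addr0. Qed.

(** * Cutoff fields averaged over inward translations *)

Section Cutoff.
Context (chi : R3 R -> R) (K : set (R3 R)) (schi : smooth chi) (cK : compact K)
  (chiK : forall x, ~ K x -> chi x = 0).
Context (phi : vfield R) (hphi : dom Hcurl phi).

Let tchi : test_fun setT chi. Proof. by split => //; exists K. Qed.

(** [U] is the zero extension of the product of [chi] and [phi], and [W] that of its curl, [chi]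
    times the curl of [phi] plus the cross product of the gradient of [chi] with [phi]. *)
Let U i x : R := zx phi i x * chi x.
Let W i x : R := zx (curl phi) i x * chi x +
  (zx phi (i - 1) x * 'D_(axis R (i + 1)) chi x - zx phi (i + 1) x * 'D_(axis R (i - 1)) chi x).

Let lphi i : L2r (zx phi i). Proof. exact: (proj1 (domP _ _) (Hcurl_dom hphi)). Qed.
Let lcphi i : L2r (zx (curl phi) i). Proof. exact: (proj1 (domP _ _) (dom_curl Omega phi)). Qed.
Let lmt f g : L2r f -> test_fun setT g -> L2r (fun x => f x * g x).
Proof.
by move=> lf tg; have [M _ hM] := test_bounded tg; apply: L2_mulb hM => //; exact: test_meas tg.
Qed.

Let lU i : L2r (U i). Proof. exact: lmt. Qed.
Let lW i : L2r (W i).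
Proof.
by apply: L2fD; [|apply: L2fB]; apply: lmt => //; exact: test_derive.
Qed.

(** The zero extension jumps across the boundary, but for [x] in [Omega] and inward [a] the point
    [x + a] meets the support of [chi] only inside [Omega], so the jump is not seen. Formally, [chi]
    times the translate of [psi] is a test field on [Omega]. *)
Lemma cutoff_local a psi : inward K a -> test_vfield Omega psi ->
  \sum_i int3 (fun x => U i (x + a) * curl_smooth psi x i 0) =
  \sum_i int3 (fun x => W i (x + a) * psi x i 0).
Proof.
move=> ga tpsi.
pose s i (y : R3 R) := psi (y - a) i 0.
pose th : vfield R := fun y => \col_i (chi y * s i y).
have ss i : smooth (s i) by exact: (smooth_shift (- a) (test_smooth (tpsi i))).
have the i : (fun y => th y i 0) = (fun y => chi y * s i y) by apply/funext => y; rewrite mxE.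
have tth : test_vfield Omega th.
  move=> i; rewrite the; split; first exact: smoothM.
  have [_ [Ki [cKi KiO hKi]]] := tpsi i.
  exists (K `&` ((fun y : R3 R => y - a) @^-1` Ki)); split.
  - apply: compact_closedI => //; apply: preimage_closed.
      by move=> y _; apply: (@continuousB _ _ _ id (fun=> a)); [exact: cvg_id|exact: cvg_cst].
    by apply: compact_closed cKi; exact: norm_hausdorff.
  - move=> y [Ky Kiy]; have := ga (y - a) (KiO _ Kiy); rewrite subrK; exact.
  - move=> y /not_andP[/chiK ->|h]; first by rewrite mul0r.
    by rewrite /s hKi ?mulr0.
have ls i : L2r (s i) by exact: (L2_shift (- a) (test_L2 (tpsi i))).
have lds i k : L2r (fun y => 'D_(axis R k) (fun z => psi z i 0) (y - a)).
  exact: (L2_shift (- a) (test_L2 (test_derive _ (tpsi i)))).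
have sh (f g : R3 R -> R) : L2r f -> L2r g -> int3 (fun x => f (x + a) * g x) = int3 (fun y => f y * g (y - a)).
  move=> lf lg; have l1 := L1f_mul lf (L2_shift (- a) lg).
  by rewrite -(int_shift a l1); apply: eq_rint => x; rewrite addrK.
have tcp := curl_smooth_test tpsi.
under eq_bigr => i _ do rewrite (sh _ _ (lU i) (test_L2 (tcp i))).
under [RHS]eq_bigr => i _ do rewrite (sh _ _ (lW i) (test_L2 (tpsi i))).
have := curlP hphi tth.
rewrite (ipE (Hcurl_dom hphi) (test_dom (curl_smooth_test tth))) (ipE (dom_curl _ _) (test_dom tth)).
pose P i k j := int3 (fun y => zx phi i y * 'D_(axis R k) chi y * s j y).
have lP i k j : L1 (fun y => zx phi i y * 'D_(axis R k) chi y * s j y).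
  by apply: L1f_mul => //; apply: lmt => //; exact: test_derive.
have dth k j y : 'D_(axis R k) (fun z => th z j 0) y =
    chi y * 'D_(axis R k) (fun z => psi z j 0) (y - a) + 'D_(axis R k) chi y * s j y.
  have d1 := @smooth_derivable _ _ chi (axis R k) y schi.
  have d2 := @smooth_derivable _ _ (s j) (axis R k) y (ss j).
  by rewrite the (deriveM d1 d2) /s (derive_shift (fun z => psi z j 0)) [X in _ + X]mulrC.
pose Z i := int3 (fun y => U i y * curl_smooth psi (y - a) i 0).
have lZ i : L1 (fun y => U i y * curl_smooth psi (y - a) i 0).
  by apply: L1f_mul => //; exact: (L2_shift (- a) (test_L2 (tcp i))).
have e1 i : int3 (fun x => zx phi i x * zx (curl_smooth th) i x) = Z i + (P i (i + 1) (i - 1) - P i (i - 1) (i + 1)).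
  rewrite (zx_test i (curl_smooth_test tth)) /Z /P -rintB // -rintD //; last exact: L1fB.
  by apply: eq_rint => y; rewrite !mxE !dth /U; ring.
pose C i := int3 (fun y => zx (curl phi) i y * chi y * s i y).
have lC i : L1 (fun y => zx (curl phi) i y * chi y * s i y) by apply: L1f_mul => //; exact: lmt.
have e2 i : int3 (fun x => zx (curl phi) i x * zx th i x) = C i.
  by rewrite (zx_test i tth) /C; apply: eq_rint => y; rewrite mxE mulrA.
have e3 i : int3 (fun y => W i y * psi (y - a) i 0) = C i + (P (i - 1) (i + 1) i - P (i + 1) (i - 1) i).
  rewrite /C /P -rintB // -rintD //; last exact: L1fB.
  by apply: eq_rint => y; rewrite /W -/(s i y); ring.
rewrite (_ : ip3 _ _ = \sum_i (Z i + (P i (i + 1) (i - 1) - P i (i - 1) (i + 1)))); last first.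
  by apply: eq_bigr => i _; exact: e1.
rewrite (_ : ip3 _ _ = \sum_i C i); last by apply: eq_bigr => i _; exact: e2.
rewrite (_ : \sum_i int3 (fun y => W i y * psi (y - a) i 0) =
  \sum_i (C i + (P (i - 1) (i + 1) i - P (i + 1) (i - 1) i))); last by apply: eq_bigr => i _; exact: e3.
rewrite -[X in _ -> X = _]/(\sum_i Z i); clearbody Z P C.
rewrite !sum3 !ord3.
move: (Z 0) (Z 1) (Z 2) (C 0) (C 1) (C 2) (P 0 1 2) (P 0 2 1) (P 1 2 0) (P 1 0 2) (P 2 0 1) (P 2 1 0).
by move=> z0 z1 z2 c0 c1 c2 p1 p2 p3 p4 p5 p6 h; lra.
Qed.

Definition cutoff : vfield R := fun x => chi x *: phi x.
Let Wf : vfield R := fun x => \col_i W i x.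

Lemma zx_cutoff i : zx cutoff i = U i.
Proof.
apply/funext => x; have [h|h] := pselect (Omega x); last by rewrite /U !zx0 // mul0r.
by rewrite /U !zxE // mxE mulrC.
Qed.

Let zW i : zx Wf i = W i.
Proof.
apply/funext => x; have [h|h] := pselect (Omega x); first by rewrite zxE // mxE.
by rewrite /W !zx0 // !mul0r subrr addr0.
Qed.

Lemma dom_cutoff : dom L2 cutoff.
Proof. by apply/domP => i; rewrite zx_cutoff. Qed.
Let dW : dom L2 Wf. Proof. by apply/domP => i; rewrite zW. Qed.

Let wcW : weak_curl cutoff Wf.
Proof.
move=> psi tp; have tc := curl_smooth_test tp.
rewrite (ipE dom_cutoff (test_dom tc)) (ipE dW (test_dom tp)) /ip3.
have := cutoff_local (@inward0 K) tp.
under eq_bigr do under eq_fun do rewrite addr0.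
under [in X in _ = X -> _]eq_bigr do under eq_fun do rewrite addr0.
move=> h; transitivity (\sum_i int3 (fun x => U i x * curl_smooth psi x i 0)).
  by apply: eq_bigr => i _; rewrite zx_cutoff (zx_test i tc).
by rewrite h; apply: eq_bigr => i _; rewrite zW (zx_test i tp).
Qed.

Lemma cutoff_Hcurl : dom Hcurl cutoff.
Proof. exact: wc_Hcurl dom_cutoff dW wcW. Qed.

Section Mollify.
Context (rho : R3 R -> R) (N : set (R3 R)) (trho : test_fun N rho) (hN : N `<=` inward K).

Let trho' : test_fun setT rho. Proof. exact: test_sub trho. Qed.

Lemma conv_L2 (r u : R3 R -> R) : test_fun setT r -> L2r u -> L2r ((conv r u) \_ Omega).
Proof.
move=> tr lu; have [M hM] := conv_bounded (test_L2 tr) lu.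
have [_ l1 _] := conv_int (test_L1 tr) (test_L2 tr) lu L2_indicO.
have e : (conv r u) \_ Omega = (fun x => conv r u x * \1_Omega x).
  by apply/funext => x; rewrite patchE indicE; case: ifP; rewrite ?mulr1 ?mulr0.
have mc : measurable_fun setT ((conv r u) \_ Omega) by rewrite e; exact: L1f_meas l1.
have M0 : 0 <= M by apply: le_trans (hM 0).
have bc x : `|((conv r u) \_ Omega) x| <= M.
  by rewrite patchE; case: ifP => _; rewrite ?normr0.
split=> //; apply: (@L1_bounded _ _ (M ^+ 2)).
- exact: measurable_funX.
- exists rO => x nx; rewrite patchE memNset ?expr0n // => /bO; exact: nx.
- by move=> x; rewrite normrX lerXn2r ?nnegrE.
Qed.

Let mv (F : 'I_3 -> R3 R -> R) : vfield R := fun x => \col_i conv rho (F i) x.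
Let zmv F i : zx (mv F) i = (conv rho (F i)) \_ Omega.
Proof. by apply/funext => x; rewrite /zx !patchE; case: ifP => // _; rewrite mxE. Qed.

Let dmv F : (forall i, L2r (F i)) -> dom L2 (mv F).
Proof. by move=> lF; apply/domP => i; rewrite zmv; exact: conv_L2. Qed.

Let int_patch (f g : R3 R -> R) : (forall x, ~ Omega x -> g x = 0) ->
  int3 (fun x => (f \_ Omega) x * g x) = int3 (fun x => f x * g x).
Proof.
move=> g0; apply: eq_rint => x; rewrite patchE; case: ifPn => // /negP nx.
by rewrite g0 ?mulr0 // => Ox; apply: nx; rewrite mem_set.
Qed.

Let off (g : R3 R -> R) : test_fun Omega g -> forall x, ~ Omega x -> g x = 0.
Proof. by move=> [_ [K' [_ KO h]]] x nx; apply: h => /KO. Qed.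

(** The derivatives fall on the weight [rho], so the averaged field is regular up to the
    boundary. *)
Let mvH1 : H1_vfield Omega (mv U).
Proof.
move=> i; split; first by apply/sqintP; rewrite -/(zx (mv U) i) zmv; exact: conv_L2.
move=> k; exists (fun x => - conv (fun y => 'D_(axis R k) rho y) (U i) x).
have e : (fun x => - conv (fun y => 'D_(axis R k) rho y) (U i) x) \_ Omega =
    (fun x => -1 * ((conv (fun y => 'D_(axis R k) rho y) (U i)) \_ Omega) x).
  by apply/funext => x; rewrite !patchE; case: ifP; rewrite ?mulN1r ?oppr0.
have lc : L2r ((conv (fun y => 'D_(axis R k) rho y) (U i)) \_ Omega).
  by apply: conv_L2 => //; exact: test_derive.
split; first by apply/sqintP; rewrite e; exact: L2fZ.
move=> psi tp; rewrite (zx_derive _ _ _ tp) zmv int_patch; last exact: off (test_derive _ tp).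
rewrite (conv_ibp _ trho' (lU i) tp) Rintegral_mkcond.
rewrite -[RHS]mulN1r -rintZ.
  transitivity (int3 (fun x => ((conv (fun y => 'D_(axis R k) rho y) (U i)) \_ Omega) x * psi x)).
    by rewrite int_patch //; exact: off.
  apply: eq_rint => x; rewrite !patchE; case: ifP => _; last by rewrite mulr0 mul0r.
  by rewrite mulN1r mulNr opprK.
rewrite (_ : _ \_ _ = (fun x => -1 * (((conv (fun y => 'D_(axis R k) rho y) (U i)) \_ Omega) x * psi x))).
  by apply: L1fZ; apply: L1f_mul => //; exact: test_L2 tp.
by apply/funext => x; rewrite !patchE; case: ifP => _; rewrite ?mul0r ?mulr0 // mulN1r mulNr.
Qed.

Let sum_conv (F : 'I_3 -> R3 R -> R) (g : 'I_3 -> R3 R -> R) :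
  (forall i, L2r (F i)) -> (forall i, L2r (g i)) -> (forall i x, ~ Omega x -> g i x = 0) ->
  L1 (fun a => rho a * \sum_i int3 (fun x => F i (x + a) * g i x)) /\
  \sum_i int3 (fun x => zx (mv F) i x * g i x) =
  int3 (fun a => rho a * \sum_i int3 (fun x => F i (x + a) * g i x)).
Proof.
move=> lF lg g0.
have h i := conv_int (test_L1 trho') (test_L2 trho') (lF i) (lg i).
have e : (fun a => rho a * \sum_i int3 (fun x => F i (x + a) * g i x)) =
    (fun a => \sum_i rho a * int3 (fun x => F i (x + a) * g i x)).
  by apply/funext => a; rewrite mulr_sumr.
have lh i : L1 (fun a => rho a * int3 (fun x => F i (x + a) * g i x)) by case: (h i).
rewrite e; split; first exact: L1f_sum.
rewrite rint_sum //; apply: eq_bigr => i _; rewrite zmv int_patch; last exact: g0.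
by case: (h i).
Qed.

Let mvwc : weak_curl (mv U) (mv W).
Proof.
move=> psi tp; have tc := curl_smooth_test tp.
rewrite (ipE (dmv lU) (test_dom tc)) (ipE (dmv lW) (test_dom tp)) /ip3.
under eq_bigr => i _ do rewrite (zx_test i tc); under [RHS]eq_bigr => i _ do rewrite (zx_test i tp).
have [_ ->] := sum_conv lU (fun i => test_L2 (tc i)) (fun i => off (tc i)).
have [_ ->] := sum_conv lW (fun i => test_L2 (tp i)) (fun i => off (tp i)).
apply: eq_rint => a; have [Na|Na] := pselect (N a).
  by rewrite cutoff_local //; exact: hN.
by have [_ [K' [_ KN h]]] := trho; rewrite h ?mul0r // => /KN.
Qed.

(** The average of [U] is an H^1 field whose curl is the average of [W], so it may be paired with
    the trace of [E]. Hence the defect [A] of Green's formula, as a function of the translation,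
    integrates to 0 against every weight supported among inward translations. *)
Lemma mollified_trace E : dom H0curl E ->
  let A a := \sum_i int3 (fun x => W i (x + a) * zx E i x) -
             \sum_i int3 (fun x => U i (x + a) * zx (curl E) i x) in
  L1 (fun a => rho a * A a) /\ int3 (fun a => rho a * A a) = 0.
Proof.
move=> [hE tE] A; have dE := Hcurl_dom hE; have dc := dom_curl Omega E.
have lE := proj1 (domP _ _) dE; have lc := proj1 (domP _ _) dc.
have [l1 e1] := sum_conv lW lE (fun i x => zx0 E i (x := x)).
have [l2 e2] := sum_conv lU lc (fun i x => zx0 (curl E) i (x := x)).
have e : (fun a => rho a * A a) = (fun a => rho a * \sum_i int3 (fun x => W i (x + a) * zx E i x) -
   rho a * \sum_i int3 (fun x => U i (x + a) * zx (curl E) i x)).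
  by apply/funext => a; rewrite mulrBr.
rewrite e; split; first exact: L1fB.
rewrite rintB // -e1 -e2; have := tE _ mvH1; rewrite /tangential_trace.
rewrite (ip_sym _ E) (curl_eq oO (dmv lU) (dmv lW) mvwc dE) (ip_sym _ (curl E)).
by rewrite (ipE (dmv lW) dE) (ipE (dmv lU) dc).
Qed.
End Mollify.

(* small boxes of inward translations, arbitrarily close to 0 *)
Definition has_cone := forall n : nat, exists lo hi : R3 R,
  [/\ forall i, crd i lo < crd i hi, cbox lo hi `<=` cube n.+1%:R^-1 & cbox lo hi `<=` inward K].

Lemma obox_pos (lo hi : R3 R) : (forall i, crd i lo < crd i hi) -> leb3 R (obox lo hi) <> 0%E.
Proof.
move=> h; rewrite oboxE leb3_setX //.
have pos (s t : R) : s < t -> exists2 r : R, 0 < r & (@lebesgue_measure R `]s, t[ = r%:E)%E.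
  move=> st; exists (t - s); first by rewrite subr_gt0.
  by apply: (etrans (lebesgue_measure_itv (`]s, t[ : interval R))); rewrite /= lte_fin st.
have [r1 p1 e1] := pos _ _ (h 0); have [r2 p2 e2] := pos _ _ (h 1); have [r3 p3 e3] := pos _ _ (h 2).
rewrite e1 e2 e3 -!EFinM => -[/eqP]; apply/negP; rewrite gt_eqF // !mulr_gt0 //.
Qed.

(** The defect vanishes almost everywhere on boxes of inward translations; these have positive
    measure and come arbitrarily close to 0. Weak continuity of translations carries its zeros to
    the translation 0. *)
Lemma cutoff_green E : has_cone -> dom H0curl E -> ip E (curl cutoff) = ip (curl E) cutoff.
Proof.
move=> hc hE; have dE := Hcurl_dom hE.1; have dc := dom_curl Omega E.
pose A a := \sum_i int3 (fun x => W i (x + a) * zx E i x) -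
             \sum_i int3 (fun x => U i (x + a) * zx (curl E) i x).
have ex n : exists a, (forall i, `|crd i a| < n.+1%:R^-1) /\ A a = 0.
  have [lo [hi [lohi cn ci]]] := hc n; apply: contrapT => none.
  have nz a : obox lo hi a -> A a <> 0.
    move=> ha Aa; apply: none; exists a; split => //; apply/cubeP; apply: cn => i.
    by have /oboxP /(_ i) /andP[/ltW -> /ltW ->] := ha.
  pose b (m : nat) := boxbump m.+1%:R lo hi.
  have tb m : test_fun (cbox lo hi) (b m) by apply: boxbump_test.
  (* Integrability is known for the product of the defect with a weight, not for the defect alone;
     hence the factors [b m], which increase to 1 on the box. *)
  have ae0 m : \forall a \ae leb3 R, setT a -> b m a * A a = 0.
    apply: (fundamental_lemma openT); first exact: (mollified_trace (tb m) ci hE).1.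
    move=> f tf; have tbf : test_fun (cbox lo hi) (fun x => f x * b m x).
      exact: testM (test_smooth tf) (tb m).
    rewrite -[RHS](mollified_trace tbf ci hE).2; apply: eq_rint => a.
    by rewrite -/(A a) [f a * _]mulrC mulrAC.
  have : (leb3 R).-negligible (obox lo hi).
    apply: negligibleS (ae_foralln ae0) => a ha /= h0.
    have b0 : (fun m => boxbump m.+1%:R lo hi a) = fun=> 0.
      by apply/funext => m; have /eqP := h0 m I; rewrite mulf_eq0 => /orP[/eqP//|/eqP /(nz a ha)].
    have := @boxbump_cvg R lo hi a; rewrite -cvg_shiftS b0 indic1T // => h1.
    have : (0 : R) = 1 by apply: (cvg_unique _ _ h1); [exact: norm_hausdorff|exact: cvg_cst].
    by move/eqP; rewrite eq_sym oner_eq0.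
  move=> ng; apply: (@obox_pos lo hi lohi).
  exact: (proj1 (negligibleP (leb3 R) (measurable_obox lo hi)) ng).
have [a ha] := choice ex.
have A0 : \sum_i int3 (fun x => W i x * zx E i x) - \sum_i int3 (fun x => U i x * zx (curl E) i x) = 0.
  have lim : (fun n => A (a n)) @ \oo -->
      \sum_i int3 (fun x => W i x * zx E i x) - \sum_i int3 (fun x => U i x * zx (curl E) i x).
    apply: cvgB; apply: cvgr_sum => i; apply: corr_seq => //; try by move=> n; case: (ha n).
      exact: (proj1 (domP _ _) dE).
    exact: (proj1 (domP _ _) dc).
  apply: (cvg_unique _ lim); first exact: norm_hausdorff.
  by rewrite (_ : (fun n => A (a n)) = fun=> 0); [exact: cvg_cst|apply/funext => n; case: (ha n)].
rewrite (ip_sym _ E) (curl_eq oO dom_cutoff dW wcW dE) (ip_sym _ (curl E)).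
rewrite (ipE dW dE) (ipE dom_cutoff dc) /ip3.
under eq_bigr => i _ do rewrite zW; under [RHS]eq_bigr => i _ do rewrite zx_cutoff.
by apply/eqP; rewrite -subr_eq0 A0.
Qed.
End Cutoff.
End Green.

(** * Localization and inward translations near the boundary *)

Section Domain.
Context (R : realType) (Omega : set (R3 R)) (oO : open Omega) (rO : R) (bO : Omega `<=` cube rO).
Implicit Types (u v w : vfield R) (i j k : 'I_3).
Notation L2 := (L2 Omega).
Notation Hcurl := (Hcurl Omega).
Notation H0curl := (H0curl Omega).
Notation ip := (ip Omega).
Notation curl := (curl Omega).
Local Opaque Defs.ip Defs.curl.

Definition green_pair E v := ip E (curl v) = ip (curl E) v.

Definition good_cutoff (chi : R3 R -> R) := smooth chi /\ exists K : set (R3 R),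
  [/\ compact K, forall x, ~ K x -> chi x = 0 & has_cone Omega K].

(* phi = chi phi + (1 - chi) phi, one cutoff function at a time, until nothing is left *)
Lemma green_cutoffs E (I : eqType) (chi : I -> R3 R -> R) (s : seq I) : dom H0curl E ->
  (forall c, c \in s -> good_cutoff (chi c)) ->
  forall v, dom Hcurl v ->
  (forall x, Omega x -> v x = 0 \/ exists2 c, c \in s & chi c x = 1) -> green_pair E v.
Proof.
move=> hE; have dE := Hcurl_dom hE.1; have dc := dom_curl Omega E.
elim: s => [|c0 s IH] hs v hv cov; have dv := Hcurl_dom hv.
  have v0 x : Omega x -> v x = 0 by by move=> /cov[//|[? ]].
  have z w : dom L2 w -> ip v w = 0.
    move=> dw; rewrite (ipE dv dw) /ip3 big1 // => i _.
    rewrite /rint (eq_Rintegral _ (g := fun=> 0)); first by rewrite Rintegral_cst // mul0r.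
    move=> x _; have [h|h] := pselect (Omega x); last by rewrite !zx0 // mul0r.
    by rewrite zxE // v0 // mxE mul0r.
  have wc0 : weak_curl Omega v 0.
    by move=> phi tp; rewrite (z _ (test_dom (curl_smooth_test tp))) (ip0l oO (test_dom tp)).
  rewrite /green_pair (ip_sym _ E) (curl_eq oO dv (dom0 Omega) wc0 dE) (ip0l oO dE).
  by rewrite (ip_sym _ (curl E)) z.
have [schi [K [cK hK hc]]] := hs c0 (mem_head _ _).
have h1 := cutoff_green oO bO schi cK hK hv hc hE.
have hcut := cutoff_Hcurl schi cK hK hv.
have dcut := Hcurl_dom hcut.
have e : v = 1 *: cutoff (chi c0) v + (v - cutoff (chi c0) v) by rewrite scale1r addrC subrK.
have hr := HcurlB hv hcut.
have h2 : green_pair E (v - cutoff (chi c0) v).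
  apply: IH => //; first by move=> c hcs; apply: hs; rewrite in_cons hcs orbT.
  move=> x /cov[vx|[c]].
    left; have -> : (v - cutoff (chi c0) v) x = v x - chi c0 x *: v x by [].
    by rewrite vx scaler0 subr0.
  rewrite in_cons => /predU1P[-> cx|cs cx]; last by right; exists c.
  left; have -> : (v - cutoff (chi c0) v) x = v x - chi c0 x *: v x by [].
  by rewrite cx scale1r subrr.
rewrite /green_pair e (ip_sym _ E) curl_lin // (ip_sym _ (curl E)) ip_lin //; last exact: Hcurl_dom.
by rewrite !(ip_sym _ _ E) h1 h2 !(ip_sym _ _ (curl E)).
Qed.

Definition nbox (x0 : R3 R) (d : R) : set (R3 R) := cbox (x0 - (d, d, d)) (x0 + (d, d, d)).

Lemma nboxP x0 d x : nbox x0 d x <-> forall i, `|crd i (x - x0)| <= d.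
Proof.
split=> h i; have := h i; rewrite !crdD !crdN !crd_diag ler_norml => /andP[h1 h2];
  by apply/andP; split; lra.
Qed.

(** The box is chosen inside [Omega], so every translation qualifies. *)
Lemma inward_interior x0 : Omega x0 -> exists2 d, 0 < d & has_cone Omega (nbox x0 d).
Proof.
move=> Ox; have /nbhs_ballP[e /= e0 eO] := oO Ox.
exists (e / 2); first lra.
move=> n; pose t : R := n.+1%:R^-1 / 2; have t0 : 0 < t by rewrite divr_gt0 ?invr_gt0.
exists (- (t, t, t)), (t, t, t); split=> [i|x h|a _ x _ hx].
- by rewrite crdN crd_diag; lra.
- apply/cubeP => i; have := h i; rewrite crdN crd_diag -ler_norml => /le_lt_trans; apply.
  by rewrite /t; have : 0 < n.+1%:R^-1 :> R by [rewrite invr_gt0]; move: (n.+1%:R^-1) => q; lra.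
- apply: eO; apply/ball3P; have /nboxP k := hx.
  have lt i : `|crd i x0 - crd i (x + a)| < e.
    by have := k i; rewrite crdD crdN distrC; lra.
  by split; [exact: (lt 0)|exact: (lt 1)|exact: (lt 2)].
Qed.

Definition colv (x : R3 R) : 'cV[R]_3 := \col_i crd i x.
Lemma colvK x : col_point (colv x) = x.
Proof. by rewrite /col_point !mxE; case: x => -[]. Qed.

(** The translations are close to a small multiple [c] of the vertical axis of the chart. A
    perturbation by [eta] costs at most [3 * eta] in height and lets the graph rise by at most
    [L' * (3 * eta)], together the height [t] of [c]. *)
Lemma inward_boundary x0 : (exists (Q : 'M[R]_3) (gamma : R * R -> R) (r h L : R),
     [/\ Q^T *m Q = 1%:M, 0 < r, 0 < h, L.-lipschitz gamma &
      forall y : 'cV[R]_3, `|y 0 0| < r -> `|y 1 0| < r -> `|y 2 0| < h ->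
        Omega (x0 + col_point (Q *m y)) <-> gamma (y 0 0, y 1 0) < y 2 0]) ->
  exists2 d, 0 < d & has_cone Omega (nbox x0 d).
Proof.
clear oO rO bO; move=> [Q [gamma [r [h [L [QQ r0 h0 Lg chart]]]]]].
have QQ' : Q *m Q^T = 1%:M by exact: mulmx1C.
have Q1 i j : `|Q i j| <= 1.
  have := congr1 (fun M : 'M[R]_3 => M j j) QQ; rewrite !mxE eqxx => e.
  rewrite -(@ler_pXn2r _ 2) ?nnegrE // expr1n real_normK ?num_real // -[leRHS]e (bigD1 i) //= !mxE -expr2.
  by rewrite lerDl sumr_ge0 // => k _; rewrite !mxE -expr2 sqr_ge0.
pose f (x : R3 R) := Q^T *m colv x.
have fE x : x = col_point (Q *m f x) by rewrite /f mulmxA QQ' mul1mx colvK.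
have fD x a : f (x + a) = f x + f a.
  by rewrite /f -mulmxDr; congr (_ *m _); apply/colP => i; rewrite !mxE crdD.
have fb x d : (forall i, `|crd i x| <= d) -> forall i, `|f x i 0| <= 3 * d.
  move=> hd i; rewrite mxE sum3 !mxE.
  have b j : `|Q j i * crd j x| <= d.
    by rewrite normrM; apply: le_trans (hd j); rewrite ler_piMl.
  have := b 0; have := b 1; have := b 2; rewrite !ler_norml.
  by move=> /andP[? ?] /andP[? ?] /andP[? ?]; apply/andP; split; lra.
pose m := Num.min r h; have m0 : 0 < m by rewrite lt_min r0.
have [mr mh] : m <= r /\ m <= h by rewrite /m !ge_min !lexx orbT.
(* Before and after the translation the point is within [2 * d] of [x0] in each coordinate. The
   change of frame costs a factor 3, and [6 * d] is less than [m]. *)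
pose d := m / 8; have d0 : 0 < d by rewrite /d; lra.
pose L' := `|L| + 1; have L0 : 0 < L' by rewrite /L'; have := normr_ge0 L; lra.
exists d => // n.
(* With [t] a third of [tau] and [eta <= t], all translations of the box stay below [tau]. *)
pose tau := Num.min n.+1%:R^-1 d; have tau0 : 0 < tau by rewrite lt_min d0 andbT invr_gt0 ltr0n.
have [tn td] : tau <= n.+1%:R^-1 /\ tau <= d by rewrite /tau !ge_min !lexx orbT.
pose t := tau / 3; have t0 : 0 < t by rewrite /t; lra.
(* The largest perturbation for which the graph cannot catch up with the vertical shift. *)
pose eta := t / (3 * (L' + 1)).
have etaE : eta * (3 * (L' + 1)) = t by rewrite /eta divfK // lt0r_neq0 //; lra.
have eta0 : 0 < eta by rewrite divr_gt0 //; lra.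
have etat : eta <= t by rewrite -etaE ler_peMr ?ltW //; lra.
pose c : R3 R := col_point (Q *m (t *: delta_mx 2 0)).
have fc : f c = t *: delta_mx 2 0.
  by rewrite /f /c (_ : colv _ = Q *m (t *: delta_mx 2 0)) ?mulmxA ?QQ ?mul1mx //; apply/colP => i; rewrite mxE; case: i => -[|[|[|//]]] p; rewrite /crd /=; congr (fun_of_matrix _ _ _); exact: val_inj.
have cb i : `|crd i c| <= t.
  have -> : crd i c = (Q *m (t *: (delta_mx 2 0 : 'cV[R]_3))) i 0.
    by rewrite /c; case: i => -[|[|[|//]]] p; rewrite /crd /=; congr (fun_of_matrix _ _ _); exact: val_inj.
  rewrite -scalemxAr mxE mxE (bigD1 2) //= big1 => [|k k2]; last by rewrite mxE (negPf k2) mulr0.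
  by rewrite mxE !eqxx mulr1 addr0 normrM gtr0_norm // ler_piMr // ltW.
exists (c - (eta, eta, eta)), (c + (eta, eta, eta)).
have near a : cbox (c - (eta, eta, eta)) (c + (eta, eta, eta)) a -> forall i, `|crd i (a - c)| <= eta.
  by move=> /(nboxP c eta a).
have small a : cbox (c - (eta, eta, eta)) (c + (eta, eta, eta)) a -> forall i, `|crd i a| < tau.
  move=> /near k i; have := k i; have := cb i; rewrite crdD crdN !ler_norml ltr_norml.
  by move=> /andP[? ?] /andP[? ?]; have tE : tau = 3 * t by [rewrite /t; lra]; apply/andP; split; lra.
split=> [i|a /small k|a ha x Ox hx].
- by rewrite !crdD crdN crd_diag; lra.
- by apply/cubeP => i; exact: lt_le_trans (k i) tn.
have sa := small a ha; have na := near a ha.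
pose y := f (x - x0); pose b := f a.
have hxa : f (x + a - x0) = y + b by rewrite /y /b -fD addrAC.
have yb i : `|y i 0| < m.
  have : forall i, `|crd i (x - x0)| <= 2 * d.
    move=> j; have /nboxP /(_ j) := hx; have := sa j.
    by rewrite !crdD !crdN ltr_norml !ler_norml => /andP[? ?] /andP[? ?]; apply/andP; split; lra.
  move=> /fb /(_ i); rewrite -/y => k; apply: (le_lt_trans k); rewrite /d; lra.
have yab i : `|(y + b) i 0| < m.
  rewrite -hxa; have /nboxP /fb /(_ i) k := hx; apply: (le_lt_trans k); rewrite /d; lra.
have bE : b = t *: delta_mx 2 0 + f (a - c) by rewrite -fc -fD addrC subrK.
have fac := fb _ _ na.
have b0 : `|b 0 0| <= 3 * eta by rewrite bE !mxE /= mulr0 add0r; have := fac 0; rewrite mxE.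
have b1 : `|b 1 0| <= 3 * eta by rewrite bE !mxE /= mulr0 add0r; have := fac 1; rewrite mxE.
have b2 : t - 3 * eta <= b 2 0.
  have := fac 2; rewrite ler_norml => /andP[k _].
  by move: k; rewrite bE !mxE !eqxx /= mulr1; lra.
have xE : x = x0 + col_point (Q *m y) by rewrite -fE addrC subrK.
have xaE : x + a = x0 + col_point (Q *m (y + b)) by rewrite -hxa -fE [RHS]addrC subrK.
have gx : gamma (y 0 0, y 1 0) < y 2 0.
  by apply/chart; rewrite -?xE //; [exact: lt_le_trans (yb 0) mr|exact: lt_le_trans (yb 1) mr|exact: lt_le_trans (yb 2) mh].
rewrite xaE; apply/chart; [exact: lt_le_trans (yab 0) mr|exact: lt_le_trans (yab 1) mr|exact: lt_le_trans (yab 2) mh|].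
have := Lg ((((y + b) 0 0, (y + b) 1 0), (y 0 0, y 1 0))) (conj I I).
rewrite /= => hl.
have hl2 : `|gamma ((y + b) 0 0, (y + b) 1 0) - gamma (y 0 0, y 1 0)| <= L' * (3 * eta).
  apply: (le_trans hl); apply: (@le_trans _ _ (L' * `|((y + b) 0 0, (y + b) 1 0) - (y 0 0, y 1 0) : R * R|)).
    by rewrite ler_wpM2r // /L'; have := ler_norm L; lra.
  apply: ler_wpM2l; first exact: ltW.
  have -> : ((y + b) 0 0, (y + b) 1 0) - (y 0 0, y 1 0) = (b 0 0, b 1 0) :> R * R.
    by congr pair; rewrite /= mxE addrC addKr.
  by rewrite prod_normE /= ge_max b0 b1.
have : gamma ((y + b) 0 0, (y + b) 1 0) <= gamma (y 0 0, y 1 0) + L' * (3 * eta).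
  by move: hl2; rewrite ler_norml => /andP[_]; lra.
rewrite [(y + b) 2 0]mxE; move: (gamma ((y + b) 0 0, (y + b) 1 0)) => g1; lra.
Qed.

Definition bumpat (x0 : R3 R) (d : R) := boxbump (2 / d) (x0 - (d, d, d)) (x0 + (d, d, d)).

Lemma bumpat1 x0 d x : 0 < d -> nbox x0 (d / 2) x -> bumpat x0 d x = 1.
Proof.
move=> d0 /nboxP h; apply: boxbump1 => i; have := h i.
rewrite !crdD !crdN crd_diag ler_norml => /andP[h1 h2].
by split; rewrite mulrAC ler_pdivlMr //; lra.
Qed.

End Domain.

(** * Green's formula on a bounded Lipschitz domain *)

Section LipschitzDomain.
Context (R : realType) (Omega : set (R3 R)) (lip : bounded_Lipschitz_domain Omega).

Lemma lip_open : open Omega. Proof. by case: lip. Qed.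

Lemma lip_bounded : exists r : R, Omega `<=` cube r.
Proof.
have [_ _ _ [M [_ hM]] _] := lip; exists (`|M| + 2) => x Ox.
have nx : `|x| <= `|M| + 1 by apply: hM => //; have := ler_norm M; lra.
have : ball (0 : R3 R) (`|M| + 2) x.
  by rewrite -ball_normE /= sub0r normrN; lra.
move=> /ball3P[h1 h2 h3]; apply/cubeP => i.
rewrite -[crd i x]opprK normrN -sub0r /crd.
by case: (i == 0); [exact: h1|case: (i == 1); [exact: h2|exact: h3]].
Qed.

(** The closure of [Omega] is compact, so finitely many half-size boxes on which the cutoff
    functions equal 1 cover it; [green_cutoffs] then exhausts [v]. *)
Lemma green (E v : vfield R) : dom (H0curl Omega) E -> dom (Hcurl Omega) v ->
  ip Omega E (curl Omega v) = ip Omega (curl Omega E) v.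
Proof.
move=> hE hv; have oO := lip_open; have [r bO] := lip_bounded.
have [_ _ _ _ bd] := lip.
have cone x0 : exists d, closure Omega x0 -> 0 < d /\ has_cone Omega (nbox x0 d).
  have [c0|c0] := pselect (closure Omega x0); last by exists 0.
  have [in0|out0] := pselect (Omega x0).
    by have [d d0 hd] := inward_interior oO in0; exists d.
  have [d d0 hd] := inward_boundary (bd x0 (conj c0 out0)); by exists d.
have [d hd] := choice cone.
have cO : compact (closure Omega).
  have cc := @compact_cbox R (- r, - r, - r) (r, r, r) : compact (cbox (- r, - r, - r) (r, r, r) : set (R3 R)).
  apply: (subclosed_compact _ cc); first exact: closed_closure.
  have cl : closed (cbox (- r, - r, - r) (r, r, r) : set (R3 R)).
    by apply: compact_closed cc; exact: norm_hausdorff.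
  rewrite [X in _ `<=` X](proj1 (closure_id _) cl); apply: closure_subset => x /bO /cubeP h i.
  by rewrite !crd_diag -ler_norml ltW.
pose B (x0 : R3 R) : set (R3 R) := (fun x : R3 R => x - x0) @^-1` cube (d x0 / 2).
have oB (x0 : R3 R) : open (B x0).
  have : continuous (fun x : R3 R => x - x0).
    by move=> y; apply: (@continuousB _ _ _ id (fun=> x0)); [exact: cvg_id|exact: cvg_cst].
  by move=> /continuousP; apply; exact: open_cube.
have cB x0 : closure Omega x0 -> B x0 x0.
  move=> /hd[d0 _]; apply/cubeP => i; rewrite subrr.
  by rewrite (_ : crd i 0 = 0) ?normr0 ?divr_gt0 // /crd; case: (i == 0) => //; case: (i == 1).
have [s hs] : exists s : seq (R3 R), forall x, closure Omega x ->
    exists2 x0, x0 \in s & closure Omega x0 /\ B x0 x.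
  (* The finite subcover comes from the near-covering form of compactness, for the filter of lists
     containing a given list. *)
  pose F : set_system (seq (R3 R)) := [set S : set (seq (R3 R)) | exists s0 : seq (R3 R),
    forall s : seq (R3 R), {subset s0 <= s} -> S s].
  have FF : Filter F.
    split; first by exists [::].
    - move=> P P' [s1 h1] [s2 h2]; exists (s1 ++ s2) => s h; split.
        by apply: h1 => x xs; apply: h; rewrite mem_cat xs.
      by apply: h2 => x xs; apply: h; rewrite mem_cat xs orbT.
    - by move=> P P' PP' [s1 h1]; exists s1 => s /h1 /PP'.
  move/compact_near_coveringP: cO => /(_ _ F (fun s x => exists2 x0, x0 \in s & closure Omega x0 /\ B x0 x) FF).
  case=> [x cx|s0 /(_ s0)]; last by move=> h; exists s0 => x cx; apply: h => //.
  exists (B x, [set s : seq (R3 R) | x \in s]).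
    split; first by apply: open_nbhs_nbhs; split; [exact: oB|exact: cB].
    by exists [:: x] => s; apply; rewrite mem_seq1.
  by move=> [y s] /= [By xs]; exists x.
have gs x0 : x0 \in [seq x <- s | `[< closure Omega x >]] -> 0 < d x0 /\ has_cone Omega (nbox x0 (d x0)).
  by rewrite mem_filter => /andP[/asboolP /hd].
apply: (@green_cutoffs R Omega oO r bO E (R3 R) (fun x0 => bumpat x0 (d x0)) [seq x <- s | `[< closure Omega x >]]) => //.
- move=> x0 /gs[d0 hc]; split; first exact: boxbump_smooth.
  exists (nbox x0 (d x0)); split => //; first exact: compact_cbox.
  move=> x nx; apply: boxbump0; first by rewrite divr_gt0.
  by move=> /oboxP h; apply: nx => i; have /andP[/ltW -> /ltW ->] := h i.
- move=> x /subset_closure cx; have [x0 x0s [c0 Bx]] := hs x cx; right.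
  have x0s' : x0 \in [seq x <- s | `[< closure Omega x >]] by rewrite mem_filter x0s andbT; apply/asboolP.
  exists x0 => //; have [d0 _] := gs x0 x0s'.
  apply: bumpat1 => //; apply/nboxP => i; apply: ltW; move: i; exact/cubeP.
Qed.
End LipschitzDomain.

(** * Multiplication by tensor fields *)

(** A pointwise limit of continuous functions, also at 0, where the inverse is 0 by convention. *)
Lemma measurable_invr (R : realType) : measurable_fun setT (fun t : measurableTypeR R => (t^-1 : measurableTypeR R)).
Proof.
pose f (n : nat) (t : R) : R := t / (t * t + n.+1%:R^-1).
have den (n : nat) (t : R) : t * t + n.+1%:R^-1 != 0.
  by rewrite gt_eqF // ltr_wpDl ?invr_gt0 // -expr2 sqr_ge0.
apply: (@measurable_fun_cvg _ _ _ setT f).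
- move=> n; apply: continuous_measurable_fun => t; apply: cvgM; first exact: cvg_id.
  apply: cvgV => //; apply: cvgD; last exact: cvg_cst.
  by apply: cvgM; exact: cvg_id.
- move=> t _; have [->|t0] := eqVneq t 0.
    by rewrite invr0 (_ : (fun n => _) = fun=> 0); [exact: cvg_cst|apply/funext => n; rewrite /f mul0r].
  rewrite (_ : t^-1 = t / (t * t + 0)); last by rewrite addr0 invfM mulrA mulfV // mul1r.
  apply: cvgM; first exact: cvg_cst.
  apply: cvgV; first by rewrite addr0 mulf_neq0.
  apply: cvgD; [exact: cvg_cst|].
  by have := @cvgZ_harmonic R 1; under eq_fun do rewrite mul1r.
Qed.

Section Multipliers.
Context (R : realType) (Omega : set (R3 R)) (oO : open Omega).
Implicit Types (u v w : vfield R) (i j k : 'I_3).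
Notation L1 := (@L1f _ (R3 R) R (leb3 R)).
Notation L2r := (@L2f _ (R3 R) R (leb3 R)).
Notation int3 := (@rint _ (R3 R) R (leb3 R)).
Notation L2 := (L2 Omega).
Notation ip := (ip Omega).
Notation zx := (zx Omega).
Notation mulf := Defs.mulf.
Notation invf := Defs.invf.
Local Opaque Defs.ip.

Lemma dotpE (a b : 'cV[R]_3) : dotp a b = (a^T *m b) 0 0.
Proof. by rewrite mxE; apply: eq_bigr => i _; rewrite mxE. Qed.

Lemma dotpC (a b : 'cV[R]_3) : dotp a b = dotp b a.
Proof. by apply: eq_bigr => i _; exact: mulrC. Qed.

Lemma dotp_mulmx (M : 'M[R]_3) a b : dotp (M *m a) b = dotp a (M^T *m b).
Proof. by rewrite !dotpE trmx_mul mulmxA. Qed.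

Lemma dotp_ge0 (a : 'cV[R]_3) : 0 <= dotp a a.
Proof. by apply: sumr_ge0 => i _; rewrite -expr2 sqr_ge0. Qed.

Lemma dotp_comp (a : 'cV[R]_3) i : (a i 0) ^+ 2 <= dotp a a.
Proof. by rewrite /dotp (bigD1 i) //= -expr2 lerDl sumr_ge0 // => j _; rewrite -expr2 sqr_ge0. Qed.

Lemma dotp_am (c : R) (a b : 'cV[R]_3) : 0 < c -> 2 * dotp a b <= c * dotp a a + dotp b b / c.
Proof.
move=> c0; rewrite /dotp !mulr_sumr mulr_suml -big_split; apply: ler_sum => i _ /=.
have : 0 <= (c * a i 0 - b i 0) ^+ 2 / c by rewrite divr_ge0 ?sqr_ge0 ?ltW.
rewrite (_ : _ / c = c * (a i 0 * a i 0) + b i 0 * b i 0 / c - 2 * (a i 0 * b i 0)).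
  by lra.
by field; rewrite lt0r_neq0.
Qed.

Definition dotz u v (x : R3 R) : R := \sum_i zx u i x * zx v i x.

Lemma dotz_in u v x : Omega x -> dotz u v x = dotp (u x) (v x).
Proof. by move=> Ox; apply: eq_bigr => i _; rewrite !zxE. Qed.
Lemma dotz_out u v x : ~ Omega x -> dotz u v x = 0.
Proof. by move=> Ox; rewrite /dotz big1 // => i _; rewrite zx0 // mul0r. Qed.

Lemma dotz_L1 u v : dom L2 u -> dom L2 v -> L1 (dotz u v).
Proof. by move=> /domP lu /domP lv; apply: L1f_sum => i; exact: L1f_mul. Qed.

Lemma ip_dotz u v : dom L2 u -> dom L2 v -> ip u v = int3 (dotz u v).
Proof.
by move=> hu hv; rewrite ipE // /ip3 -rint_sum // => i; apply: L1f_mul; apply: (proj1 (domP _ _)).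
Qed.

Lemma rint_le_ae (f g : R3 R -> R) : L1 f -> L1 g -> (\forall x \ae leb3 R, f x <= g x) ->
  int3 f <= int3 g.
Proof.
move=> lf lg fg; have [mf mg] := (L1f_meas lf, L1f_meas lg).
have mm : measurable_fun setT (f \min g) by exact: measurable_minr.
have lm : L1 (f \min g).
  apply: L1f_dom mm (L1fD (L1f_norm lf) (L1f_norm lg)) _ => x /=; rewrite /Num.min.
  by case: ifP => _; [rewrite lerDl|rewrite lerDr].
rewrite (rint_ae (g := f \min g)) //; last first.
  by apply: filterS fg => x /= h; apply/esym/min_idPl.
by apply: rint_le => // x /=; rewrite ge_min lexx orbT.
Qed.

Lemma L2_mulae (f g : R3 R -> R) (C : R) : L2r f -> measurable_fun setT g ->
  (\forall x \ae leb3 R, `|g x| <= C) -> L2r (fun x => f x * g x).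
Proof.
move=> [mf sf] mg gC; have mfg := measurable_funM mf mg.
have m2 : measurable_fun setT (fun x => (f x * g x) ^+ 2) by exact: measurable_funX.
split=> //; apply/integrableP; split; first exact/measurable_EFinP.
have l2 := L1fZ (C ^+ 2) sf.
apply: (@le_lt_trans _ _ (\int[leb3 R]_x (C ^+ 2 * f x ^+ 2)%:E)%E); last first.
  by rewrite -(rintE l2) ltry.
apply: ae_ge0_le_integral => //.
- by apply: measurableT_comp => //; exact/measurable_EFinP.
- by move=> x _; rewrite lee_fin mulr_ge0 // sqr_ge0.
- by apply/measurable_EFinP; exact: L1f_meas l2.
apply: filterS gC => x hx _ /=; rewrite lee_fin ger0_norm ?sqr_ge0 // exprMn mulrC.
rewrite ler_wpM2r ?sqr_ge0 // -(real_normK (num_real (g x))) lerXn2r ?nnegrE //.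
exact: le_trans hx.
Qed.

Lemma mulf_lin (A : mfield R) (a : R) u v : mulf A (a *: u + v) = a *: mulf A u + mulf A v.
Proof.
apply/funext => x; rewrite /mulf (_ : (a *: u + v) x = a *: u x + v x) //.
by rewrite mulmxDr -scalemxAr.
Qed.

Section LinfMultiplier.
Context (A : mfield R) (lA : Linf_mfield Omega A).

Let zA i j : R3 R -> R := (fun x => A x i j) \_ Omega.

Let mzA i j : measurable_fun setT (zA i j).
Proof.
have [mA _] := lA i j; apply/(measurable_restrict _ (mO oO) measurableT).
by rewrite setTI.
Qed.

Lemma mfield_bound : exists M : R, 0 <= M /\
  \forall x \ae leb3 R, Omega x -> forall i j, `|A x i j| <= M.
Proof.
have bd (ij : 'I_3 * 'I_3) : exists M : R, \forall x \ae leb3 R, Omega x -> `|A x ij.1 ij.2| <= M.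
  by have [_ [M hM]] := lA ij.1 ij.2; exists M.
have [M hM] := choice bd.
exists (\sum_i \sum_j `|M (i, j)|); split; first by apply: sumr_ge0 => i _; exact: sumr_ge0.
have all2 : \forall x \ae leb3 R, forall i j, Omega x -> `|A x i j| <= M (i, j).
  apply: filter_forall => i; apply: filter_forall => j; exact: (hM (i, j)).
apply: filterS all2 => x hx Ox i j; apply: le_trans (hx i j Ox) _.
apply: le_trans (ler_norm _) _; rewrite (bigD1 i) //= (bigD1 j) //= -addrA lerDl addr_ge0 //.
  exact: sumr_ge0.
by apply: sumr_ge0 => k _; exact: sumr_ge0.
Qed.

Lemma zx_mulf u i : zx (mulf A u) i = (fun x => \sum_j zx u j x * zA i j x).
Proof.
apply/funext => x; have [h|h] := pselect (Omega x).
  rewrite zxE // mxE; apply: eq_bigr => j _; rewrite zxE // mulrC.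
  by rewrite /zA patchE mem_set.
by rewrite zx0 // big1 // => j _; rewrite zx0 // mul0r.
Qed.

Lemma dom_mulf u : dom L2 u -> dom L2 (mulf A u).
Proof.
move=> /domP lu; have [M [M0 hM]] := mfield_bound; apply/domP => i; rewrite zx_mulf.
have l j : L2r (fun x => zx u j x * zA i j x).
  apply: (@L2_mulae _ _ M) => //; apply: filterS hM => x hx.
  by rewrite /zA patchE; case: ifP => [/set_mem h|_]; [exact: hx|rewrite normr0].
rewrite (_ : (fun _ => _) = (fun x => 1 * (zx u 0 x * zA i 0 x) + (1 * (zx u 1 x * zA i 1 x) + zx u 2 x * zA i 2 x))).
  by do 2 ! (apply: L2fD; first exact: L2fZ).
by apply/funext => x; rewrite sum3 !mul1r addrA.
Qed.

(** Each component of the product costs [3 * M ^+ 2] by the inequality between the square of a sum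
    and the sum of squares; the three components give the square of [3 * M]. *)
Lemma mulf_bound : exists C : R, 0 <= C /\ forall u, dom L2 u -> nrm L2 (mulf A u) <= C * nrm L2 u.
Proof.
have [M [M0 hM]] := mfield_bound; exists (3 * M); split=> [|u hu]; first by rewrite mulr_ge0.
rewrite -[leRHS]ger0_norm ?mulr_ge0 ?sqrtr_ge0 // -sqrtr_sqr nrmE ler_wsqrtr //.
have du := dom_mulf hu; have [l1 l2] := (dotz_L1 hu hu, dotz_L1 du du).
rewrite exprMn nrm_sqr (ip_dotz du du) (ip_dotz hu hu) -(rintZ _ l1).
apply: rint_le_ae => //; first exact: L1fZ.
apply: filterS hM => x hx; have [h|h] := pselect (Omega x); last by rewrite !dotz_out // mulr0.
rewrite !dotz_in // /dotp; have b := hx h.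
have comp i : (mulf A u x) i 0 * (mulf A u x) i 0 <= 3 * M ^+ 2 * dotp (u x) (u x).
  rewrite mxE sum3; have s (p q r : R) : (p + q + r) * (p + q + r) <= 3 * (p ^+ 2 + q ^+ 2 + r ^+ 2).
    by have := sqr_ge0 (p - q); have := sqr_ge0 (q - r); have := sqr_ge0 (p - r); lra.
  apply: le_trans (s _ _ _) _; rewrite -mulrA ler_wpM2l // /dotp sum3 !mulrDr.
  have e j : (A x i j * u x j 0) ^+ 2 <= M ^+ 2 * (u x j 0 * u x j 0).
    rewrite exprMn -expr2 ler_wpM2r ?sqr_ge0 //.
    by rewrite -(real_normK (num_real (A x i j))) lerXn2r ?nnegrE.
  by rewrite !lerD.
rewrite [leLHS]sum3; have := comp 0; have := comp 1; have := comp 2.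
rewrite -/(dotp (u x) (u x)) exprMn -mulrA.
by move: (M ^+ 2) (dotp (u x) (u x)) => m d; move=> ? ? ?; lra.
Qed.

Lemma mulf_sym u v : symmetric_mfield Omega A -> dom L2 u -> dom L2 v ->
  ip (mulf A u) v = ip u (mulf A v).
Proof.
move=> sA hu hv; have [du dv] := (dom_mulf hu, dom_mulf hv).
rewrite (ip_dotz du hv) (ip_dotz hu dv); apply: rint_ae.
- exact: L1f_meas (dotz_L1 du hv).
- exact: L1f_meas (dotz_L1 hu dv).
apply: filterS sA => x hx; have [h|h] := pselect (Omega x); last by rewrite !dotz_out.
by rewrite !dotz_in // /mulf dotp_mulmx hx.
Qed.

Lemma mulf_coercive (c : R) u : bounded_below_mfield Omega c A -> dom L2 u ->
  c * ip u u <= ip (mulf A u) u.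
Proof.
move=> cA hu; have du := dom_mulf hu; have [l1 l2] := (dotz_L1 hu hu, dotz_L1 du hu).
rewrite (ip_dotz du hu) (ip_dotz hu hu) -(rintZ _ l1).
apply: rint_le_ae => //; first exact: L1fZ.
apply: filterS cA => x hx; have [h|h] := pselect (Omega x); last by rewrite !dotz_out // mulr0.
by rewrite !dotz_in // [leRHS]dotpC; exact: hx.
Qed.
End LinfMultiplier.

(** Stated for every size because the inverse also involves the minors. *)
Lemma measurable_det n (M : R3 R -> 'M[R]_n) : (forall a b, measurable_fun Omega (fun x => M x a b)) ->
  measurable_fun Omega (fun x => \det (M x)).
Proof.
move=> hM; rewrite /determinant; apply: measurable_sum => s; apply: measurable_funM.
  exact: measurable_cst.
by apply: measurable_prod => a _; exact: hM.
Qed.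

Section LinfForm.
Context (A : mfield R) (lA : Linf_mfield Omega A).

Lemma form_lin (a : R) u v w : dom L2 u -> dom L2 v -> dom L2 w ->
  ip (mulf A (a *: u + v)) w = a * ip (mulf A u) w + ip (mulf A v) w.
Proof.
by move=> hu hv hw; rewrite mulf_lin (ip_lin _ (dom_mulf lA hu) (dom_mulf lA hv) hw).
Qed.

Lemma form_bound : exists2 C : R, 0 <= C &
  forall u v, dom L2 u -> dom L2 v -> `|ip (mulf A u) v| <= C * nrm L2 u * nrm L2 v.
Proof.
have [C [C0 hC]] := mulf_bound lA; exists C => // u v hu hv.
apply: le_trans (ip_cs oO (dom_mulf lA hu) hv) _.
by apply: ler_wpM2r; [exact: nrm_ge0|exact: hC].
Qed.
End LinfForm.

(** * The inverse of a coercive tensor field *)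

Section Inverse.
Context (A : mfield R) (c : R) (c0 : 0 < c) (lA : Linf_mfield Omega A) (sA : symmetric_mfield Omega A)
  (cA : bounded_below_mfield Omega c A).

Lemma pd_unit (M : 'M[R]_3) : (forall xi : 'cV[R]_3, c * dotp xi xi <= dotp xi (M *m xi)) ->
  M \in unitmx.
Proof.
move=> h; rewrite unitmxE unitfE; apply/negP => /det0P[v v0 vM].
have := h v^T; rewrite [leRHS]dotpE trmxK mulmxA vM mul0mx mxE.
rewrite pmulr_rle0 // => d0; case/negP: v0; apply/eqP/rowP => i; rewrite mxE.
have := le_trans (dotp_comp v^T i) d0; rewrite mxE => h2.
by apply/eqP; rewrite -sqrf_eq0 eq_le h2 sqr_ge0.
Qed.

(** For [xi] the preimage of [eta], coercivity bounds [c * dotp xi xi] by [dotp xi eta], and Young's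
    inequality absorbs half of it. *)
Lemma pd_inv_bound (M : 'M[R]_3) : (forall xi : 'cV[R]_3, c * dotp xi xi <= dotp xi (M *m xi)) ->
  forall eta : 'cV[R]_3, dotp (invmx M *m eta) (invmx M *m eta) <= dotp eta eta / c ^+ 2.
Proof.
move=> h eta; have uM := pd_unit h; set xi := invmx M *m eta.
have e : M *m xi = eta by rewrite /xi mulmxA mulmxV // mul1mx.
have h1 := h xi; rewrite e in h1; have := dotp_am xi eta c0.
have -> : dotp eta eta / c ^+ 2 = (dotp eta eta / c) / c by field; rewrite lt0r_neq0.
rewrite ler_pdivlMr // => h2; lra.
Qed.

Lemma invf_Linf : Linf_mfield Omega (invf A).
Proof.
move=> i j; split; last first.
  exists (c^-1); apply: filterS cA => x hx Ox; have h := pd_inv_bound (hx Ox) (delta_mx j 0).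
  have e : (invmx (A x) *m (delta_mx j 0 : 'cV[R]_3)) i 0 = invf A x i j by rewrite -colE mxE.
  have := le_trans (dotp_comp _ i) h; rewrite e.
  have -> : dotp (delta_mx j 0 : 'cV[R]_3) (delta_mx j 0) = 1.
    rewrite /dotp (bigD1 j) //= big1 => [|k kj]; first by rewrite !mxE !eqxx mulr1 addr0.
    by rewrite !mxE (negPf kj) mul0r.
  rewrite mul1r -exprVn => h2.
  by rewrite -(@ler_pXn2r _ 2) ?nnegrE ?invr_ge0 ?(ltW c0) // real_normK ?num_real.
have mA i' j' : measurable_fun Omega (fun x => A x i' j') by case: (lA i' j').
have mdet := measurable_det mA.
(* [invmx] returns its argument on singular matrices, so measurability is shown on the two cases of
   the determinant. *)
rewrite (_ : (fun x => _) = (fun x => if \det (A x) == 0 then A x i j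
    else (\det (A x))^-1 * cofactor (A x) j i)); last first.
  apply/funext => x; rewrite /invf /invmx unitmxE unitfE.
  by case: eqP => //= _; rewrite !mxE.
have mt : measurable_fun Omega (fun x => \det (A x) == 0).
  by apply: measurable_fun_eqr => //; exact: measurable_cst.
apply: measurable_fun_if => //; first exact: mO.
  by apply: measurable_funS (mA i j); [exact: mO|move=> x []].
suff mc : measurable_fun Omega (fun x => (\det (A x))^-1 * cofactor (A x) j i).
  by apply: measurable_funS mc; [exact: mO|move=> x []].
apply: measurable_funM; first exact: (measurableT_comp (@measurable_invr R) mdet).
rewrite /cofactor; apply: measurable_funM; first exact: measurable_cst.
by apply: measurable_det => i' j'; under eq_fun do rewrite !mxE; exact: mA.
Qed.

Lemma invf_sym : symmetric_mfield Omega (invf A).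
Proof. by apply: filterS sA => x hx Ox; rewrite /invf trmx_inv hx. Qed.

(** With [xi] the preimage of [eta], the form of the inverse at [eta] is that of [A x] at [xi],
    while [eta] is bounded by [xi]. The 1 in [K] avoids dividing by 0. *)
Lemma invf_below : exists2 c' : R, 0 < c' & bounded_below_mfield Omega c' (invf A).
Proof.
have [M [M0 hM]] := mfield_bound lA; pose K := 9 * M ^+ 2 + 1.
have K0 : 0 < K by rewrite ltr_wpDl // mulr_ge0 // sqr_ge0.
exists (c / K); first by rewrite divr_gt0.
apply: filterS2 cA hM => x hx bx Ox eta; have h := hx Ox; have b := bx Ox.
have uM := pd_unit h; rewrite /invf; set xi := invmx (A x) *m eta.
have e : A x *m xi = eta by rewrite /xi mulmxA mulmxV // mul1mx.
apply: (@le_trans _ _ (c * dotp xi xi)); last by have := h xi; rewrite e dotpC.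
have comp i : (A x *m xi) i 0 * (A x *m xi) i 0 <= 3 * M ^+ 2 * dotp xi xi.
  rewrite mxE sum3; have s (p q r : R) : (p + q + r) * (p + q + r) <= 3 * (p ^+ 2 + q ^+ 2 + r ^+ 2).
    by have := sqr_ge0 (p - q); have := sqr_ge0 (q - r); have := sqr_ge0 (p - r); lra.
  apply: le_trans (s _ _ _) _; rewrite -mulrA ler_wpM2l // /dotp sum3 !mulrDr.
  have e' j : (A x i j * xi j 0) ^+ 2 <= M ^+ 2 * (xi j 0 * xi j 0).
    rewrite exprMn -expr2 ler_wpM2r ?sqr_ge0 //.
    by rewrite -(real_normK (num_real (A x i j))) lerXn2r ?nnegrE.
  by rewrite !lerD.
rewrite mulrAC ler_pdivrMr // -mulrA ler_pM2l //.
have : dotp eta eta <= 9 * M ^+ 2 * dotp xi xi.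
  rewrite -e [dotp (_ *m _) _]sum3; have := comp 0; have := comp 1; have := comp 2.
  by rewrite -!mulrA; move: (M ^+ 2 * dotp xi xi) => d ? ? ?; lra.
have := dotp_ge0 xi; rewrite /K; lra.
Qed.

Lemma mulf_invf u v : dom L2 u -> dom L2 v -> ip (mulf A (mulf (invf A) u)) v = ip u v.
Proof.
move=> hu hv; have di := dom_mulf invf_Linf hu.
have dm := dom_mulf lA di.
rewrite (ip_dotz dm hv) (ip_dotz hu hv); apply: rint_ae.
- exact: L1f_meas (dotz_L1 dm hv).
- exact: L1f_meas (dotz_L1 hu hv).
apply: filterS cA => x hx; have [h|h] := pselect (Omega x); last by rewrite !dotz_out.
by rewrite !dotz_in // /mulf /invf mulmxA mulmxV ?mul1mx //; exact: pd_unit (hx h).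
Qed.
End Inverse.
End Multipliers.

(** * The Maxwell operator *)

Lemma bound2 (R : realType) (x a p K h : R) : x <= a * p -> 0 <= p -> a <= K * h -> x <= K * p * h.
Proof. by move=> xa p0 aK; have := ler_wpM2r p0 aK; lra. Qed.

Lemma bound3 (R : realType) (x c a p K h : R) : x <= c * a * p -> 0 <= c -> 0 <= p ->
  a <= K * h -> x <= c * K * p * h.
Proof. by move=> xa c0 p0 aK; have := ler_wpM2l (mulr_ge0 c0 p0) aK; lra. Qed.

Section MaxwellOperator.
Context (R : realType) (Omega : set (R3 R)) (lip : bounded_Lipschitz_domain Omega).
Context (eps mu sigma : mfield R) (eps0 mu0 : R) (heps0 : 0 < eps0) (hmu0 : 0 < mu0).
Context (heps : Linf_mfield Omega eps) (hmu : Linf_mfield Omega mu) (hsigma : Linf_mfield Omega sigma).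
Context (seps : symmetric_mfield Omega eps) (smu : symmetric_mfield Omega mu)
  (ssigma : symmetric_mfield Omega sigma).
Context (ceps : bounded_below_mfield Omega eps0 eps) (cmu : bounded_below_mfield Omega mu0 mu)
  (psigma : bounded_below_mfield Omega 0 sigma).
Notation L2 := (L2 Omega).
Notation Hcurl := (Hcurl Omega).
Notation H0curl := (H0curl Omega).
Notation ip := (ip Omega).
Notation curl := (curl Omega).
Notation mulf := Defs.mulf.
Notation imu := (Defs.invf mu).
Local Opaque Defs.ip Defs.curl.

Let oO := lip_open lip.
Let limu : Linf_mfield Omega imu. Proof. exact: (invf_Linf oO hmu0 hmu cmu). Qed.
Let simu : symmetric_mfield Omega imu. Proof. exact: (invf_sym smu). Qed.

Lemma ip_eq0 u v : dom L2 u -> dom L2 v -> nrm L2 u = 0 -> ip v u = 0.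
Proof. by move=> hu hv h; rewrite ip_sym; exact: (ip_null oO hu hv h). Qed.

(** * The elliptic problem of one implicit step *)

Section ImplicitStep.
Context (h : R) (h0 : 0 < h).

Definition H0sub := set_subsp (H0curl0 oO) (H0curl_lin oO).
Lemma H0P (u : sub_elt H0sub) : dom H0curl (sub_val u).
Proof. by have := valP u => /set_mem. Qed.
Let H0c (u : sub_elt H0sub) : dom Hcurl (sub_val u). Proof. exact: (H0P u).1. Qed.
Let H02 (u : sub_elt H0sub) : dom L2 (sub_val u). Proof. exact: Hcurl_dom (H0c u). Qed.

(** What remains for the electric field when the magnetic field, [F2] minus [h] times the curl of
    [u], is eliminated from the implicit step. *)
Definition stepform (u v : vfield R) : R :=
  ip (mulf eps u) v + h * ip (mulf sigma u) v + h ^+ 2 * ip (mulf imu (curl u)) (curl v).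

Lemma form_curl_lin (a : R) u v w : dom Hcurl u -> dom Hcurl v -> dom L2 w ->
  ip (mulf imu (curl (a *: u + v))) w = a * ip (mulf imu (curl u)) w + ip (mulf imu (curl v)) w.
Proof.
move=> hu hv hw; have dw := dom_mulf oO limu hw.
rewrite !(mulf_sym oO limu simu) //; try exact: dom_curl.
by rewrite (curl_lin oO).
Qed.

Lemma stepform_coercive : exists2 c : R, 0 < c & forall u, dom Hcurl u -> c * hc Omega u u <= stepform u u.
Proof.
have [c' c'0 hc'] := invf_below hmu0 hmu cmu.
pose c := Num.min eps0 (h ^+ 2 * c').
have [ce cm] : c <= eps0 /\ c <= h ^+ 2 * c' by rewrite /c !ge_min !lexx orbT.
exists c; first by rewrite lt_min heps0 mulr_gt0 // exprn_gt0.
move=> u hu; have du := Hcurl_dom hu; have dc := dom_curl Omega u.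
have h1 := mulf_coercive oO heps ceps du; have h2 := mulf_coercive oO hsigma psigma du.
have h3 := mulf_coercive oO limu hc' dc.
rewrite /hc /stepform mulrDr; apply: lerD.
  apply: (@le_trans _ _ (ip (mulf eps u) u)).
    by apply: le_trans h1; rewrite ler_wpM2r ?ip_ge0.
  by rewrite lerDl mulr_ge0 ?(ltW h0) // -(mul0r (ip u u)).
apply: (@le_trans _ _ (h ^+ 2 * (c' * ip (curl u) (curl u)))).
  by rewrite mulrA ler_wpM2r ?ip_ge0.
by rewrite ler_wpM2l // sqr_ge0.
Qed.

Lemma stepform_bounded : exists2 C : R, 0 <= C & forall u, dom Hcurl u -> stepform u u <= C * hc Omega u u.
Proof.
have [C1 C10 h1] := form_bound oO heps; have [C2 C20 h2] := form_bound oO hsigma.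
have [C3 C30 h3] := form_bound oO limu.
exists (C1 + h * C2 + h ^+ 2 * C3).
  by rewrite !addr_ge0 // mulr_ge0 ?sqr_ge0 ?(ltW h0).
move=> u hu; have du := Hcurl_dom hu; have dc := dom_curl Omega u.
have k1 := le_trans (ler_norm _) (h1 u u du du); have k2 := le_trans (ler_norm _) (h2 u u du du).
have k3 := le_trans (ler_norm _) (h3 _ _ dc dc).
move: k1 k2 k3; rewrite -!mulrA -!expr2 !nrm_sqr => k1 k2 k3.
have [g1 g2] : 0 <= ip u u /\ 0 <= ip (curl u) (curl u) by rewrite !ip_ge0.
have q2 : h * ip (mulf sigma u) u <= h * (C2 * ip u u) by rewrite ler_wpM2l ?(ltW h0).
have q3 : h ^+ 2 * ip (mulf imu (curl u)) (curl u) <= h ^+ 2 * (C3 * ip (curl u) (curl u)).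
  by rewrite ler_wpM2l ?sqr_ge0.
have r1 : 0 <= C1 * ip (curl u) (curl u) by rewrite mulr_ge0.
have r2 : 0 <= h * (C2 * ip (curl u) (curl u)) by rewrite mulr_ge0 ?(ltW h0) // mulr_ge0.
have r3 : 0 <= h ^+ 2 * (C3 * ip u u) by rewrite mulr_ge0 ?sqr_ge0 // mulr_ge0.
rewrite /stepform /hc; move: k1 q2 q3 r1 r2 r3 => {k2 k3 h1 h2 h3 g1 g2}.
move: (ip (mulf eps u) u) (ip (mulf sigma u) u) (ip (mulf imu (curl u)) (curl u)).
by move: (ip u u) (ip (curl u) (curl u)) => a1 a2 a3 a4 a5; lra.
Qed.

(** The form is equivalent to the H(curl) product, so completeness is that of H(curl) together with
    closedness of H0(curl): the pairing with each H^1 field passes to the limit. *)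
Lemma stepform_hilbert : semi_hilbert (fun u v : sub_elt H0sub => stepform (sub_val u) (sub_val v)).
Proof.
have [c c0 hcoer] := stepform_coercive; have [C C0 hC] := stepform_bounded.
split.
- move=> a u v w; have [[du dv] dw] := (H02 u, H02 v, H02 w).
  have e : sub_val (a *: u + v) = a *: sub_val u + sub_val v by [].
  rewrite /stepform e (form_lin oO heps) // (form_lin oO hsigma) // form_curl_lin //; last exact: dom_curl.
  by move: (ip (mulf eps _) _) (ip (mulf eps _) _) (ip (mulf sigma _) _) (ip (mulf sigma _) _)
    (ip (mulf imu _) _) (ip (mulf imu _) _) => ? ? ? ? ? ?; ring.
- move=> u v; rewrite /stepform (mulf_sym oO heps seps (H02 u) (H02 v)) (mulf_sym oO hsigma ssigma (H02 u) (H02 v)).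
  rewrite (mulf_sym oO limu simu (dom_curl _ _) (dom_curl _ _)).
  by rewrite (ip_sym _ (sub_val u)) (ip_sym _ (sub_val u) (mulf sigma _)) (ip_sym _ (curl (sub_val u))).
- move=> u; apply: le_trans (hcoer _ (H0c u)); by rewrite mulr_ge0 ?(ltW c0) // addr_ge0 ?ip_ge0.
- move=> u hu.
  have [|l [hl1 hl2 hl3 hl4]] := curl_complete oO (fun n => H0c (u n)).
    move=> e e0; have [N hN] := hu (c * e) (mulr_gt0 c0 e0); exists N => j k Nj Nk.
    have := le_lt_trans (hcoer _ (H0c (u j - u k))) (hN j k Nj Nk).
    by rewrite ltr_pM2l.
  have Hl : dom H0curl l.
    split=> // w hw; have hcw := H1_curl hw; have dw := Hcurl_dom hcw.
    have k1 := L2_ip_cvg oO (fun n => H02 (u n)) (Hcurl_dom hl1) (dom_curl Omega w) hl2.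
    have k2 := L2_ip_cvg oO (fun n => dom_curl Omega (sub_val (u n))) (dom_curl Omega l) dw hl3.
    have k3 : (fun n => ip (sub_val (u n)) (curl w) - ip (curl (sub_val (u n))) w) @ \oo -->
        ip l (curl w) - ip (curl l) w by exact: cvgB.
    rewrite /tangential_trace.
    apply: (cvg_unique _ k3); first exact: norm_hausdorff.
    rewrite (_ : (fun n => _) = fun=> 0); first exact: cvg_cst.
    by apply/funext => n; exact: (H0P (u n)).2.
  exists (@SubElt _ _ H0sub l (mem_set Hl)).
  apply: (@cvgr0_le _ _ (fun n => C * hc Omega (sub_val (u n) - l) (sub_val (u n) - l))).
    move=> n; have hn' := HcurlB (H0c (u n)) hl1.
    apply/andP; split; last exact: hC.
    by apply: le_trans (hcoer _ hn'); rewrite mulr_ge0 ?(ltW c0) // addr_ge0 ?ip_ge0.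
  by rewrite -[X in _ --> X](mulr0 C); apply: cvgM; [exact: cvg_cst|exact: hl4].
Qed.

Lemma implicit_step F1 F2 : dom L2 F1 -> dom L2 F2 -> exists2 u, dom H0curl u &
  forall psi, dom H0curl psi ->
    stepform u psi = ip (mulf eps F1) psi + h * ip (mulf imu F2) (curl psi).
Proof.
move=> d1 d2; have [c c0 hcoer] := stepform_coercive.
have [C1 C10 h1] := form_bound oO heps; have [C3 C30 h3] := form_bound oO limu.
have SH := stepform_hilbert; set a := (fun _ _ => _) in SH.
pose l (psi : sub_elt H0sub) := ip (mulf eps F1) (sub_val psi) + h * ip (mulf imu F2) (curl (sub_val psi)).
have dF1 := dom_mulf oO heps d1; have dF2 := dom_mulf oO limu d2.
have ll b u v : l (b *: u + v) = b * l u + l v.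
  have e : sub_val (b *: u + v) = b *: sub_val u + sub_val v by [].
  rewrite /l e (ip_linr _ (H02 u) (H02 v) dF1) ![ip (mulf imu F2) _]ip_sym (curl_lin oO _ (H0c u) (H0c v) dF2).
  by move: (ip _ _) (ip _ _) (ip _ _) (ip _ _) => ? ? ? ?; ring.
pose K := (C1 * nrm L2 F1 + h * (C3 * nrm L2 F2)) / Num.sqrt c.
have sc : 0 < Num.sqrt c by rewrite sqrtr_gt0.
have lb u : `|l u| <= K * hn a u.
  have nh : Num.sqrt c * nrm Hcurl (sub_val u) <= hn a u.
    rewrite hc_nrm -sqrtrM ?(ltW c0) // /hn ler_wsqrtr //; exact: hcoer (H0c u).
  have k1 := h1 _ _ d1 (H02 u); have k2 := h3 _ _ d2 (dom_curl Omega (sub_val u)).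
  have n1 := nrm_le_Hcurl Omega (sub_val u); have n2 := nrm_curl_le Omega (sub_val u).
  have F10 := nrm_ge0 Omega F1; have F20 := nrm_ge0 Omega F2.
  apply: (@le_trans _ _ ((C1 * nrm L2 F1 + h * (C3 * nrm L2 F2)) * nrm Hcurl (sub_val u))).
    apply: le_trans (ler_normD _ _) _; rewrite mulrDl lerD //.
      by apply: le_trans k1 _; rewrite ler_wpM2l ?mulr_ge0.
    rewrite normrM gtr0_norm // -mulrA ler_wpM2l ?(ltW h0) //.
    by apply: le_trans k2 _; rewrite ler_wpM2l ?mulr_ge0.
  rewrite /K mulrAC -mulrA ler_wpM2l ?addr_ge0 ?mulr_ge0 ?(ltW h0) //.
  by rewrite ler_pdivlMr // mulrC.
have [u hu] := riesz SH ll lb.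
by exists (sub_val u) => [|psi hpsi]; [exact: H0P|exact: (hu (@SubElt _ _ H0sub psi (mem_set hpsi)))].
Qed.
End ImplicitStep.

(** * The energy space and the generator *)

Definition state_space := (sub_elt (VL2 Omega) * sub_elt (VL2 Omega))%type.
Implicit Types U W : state_space.
Let L2P (u : sub_elt (VL2 Omega)) : dom L2 (sub_val u). Proof. exact: VL2P. Qed.

Definition energy U W : R :=
  ip (mulf eps (sub_val U.1)) (sub_val W.1) + ip (mulf imu (sub_val U.2)) (sub_val W.2).

Definition sqn W : R := ip (sub_val W.1) (sub_val W.1) + ip (sub_val W.2) (sub_val W.2).

Lemma sqn_ge0 W : 0 <= sqn W. Proof. by rewrite addr_ge0 ?ip_ge0. Qed.

Lemma energy_equiv : exists c C : R, [/\ 0 < c, 0 < C & forall W, c * sqn W <= energy W W <= C * sqn W].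
Proof.
have [c' c'0 hc'] := invf_below hmu0 hmu cmu.
have [C1 C10 h1] := form_bound oO heps; have [C3 C30 h3] := form_bound oO limu.
pose c := Num.min eps0 c'; have [ce cm] : c <= eps0 /\ c <= c' by rewrite /c !ge_min !lexx orbT.
exists c, (C1 + C3 + 1); split; [by rewrite lt_min heps0|by rewrite ltr_wpDl // addr_ge0|move=> W].
have k1 := mulf_coercive oO heps ceps (L2P W.1); have k2 := mulf_coercive oO limu hc' (L2P W.2).
have k3 := le_trans (ler_norm _) (h1 _ _ (L2P W.1) (L2P W.1)).
have k4 := le_trans (ler_norm _) (h3 _ _ (L2P W.2) (L2P W.2)).
move: k3 k4; rewrite -!mulrA -!expr2 !nrm_sqr /energy /sqn => k3 k4.
have g1 := ip_ge0 Omega (sub_val W.1); have g2 := ip_ge0 Omega (sub_val W.2).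
have r1 : c * ip (sub_val W.1) (sub_val W.1) <= eps0 * ip (sub_val W.1) (sub_val W.1) by rewrite ler_wpM2r.
have r2 : c * ip (sub_val W.2) (sub_val W.2) <= c' * ip (sub_val W.2) (sub_val W.2) by rewrite ler_wpM2r.
have r3 := mulr_ge0 C10 g2; have r4 := mulr_ge0 C30 g1.
move: k1 k2 k3 k4 g1 g2 r1 r2 r3 r4; clear.
move: (ip (mulf eps _) _) (ip (mulf imu _) _) (ip (sub_val W.1) _) (ip (sub_val W.2) _) => a b d e.
by move=> *; apply/andP; split; lra.
Qed.

Lemma energy_hilbert : semi_hilbert energy.
Proof.
have [c [C [c0 C0 heq]]] := energy_equiv; split.
- move=> a u v w; rewrite /energy.
  have [e1 e2] : sub_val (a *: u + v).1 = a *: sub_val u.1 + sub_val v.1 /\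
    sub_val (a *: u + v).2 = a *: sub_val u.2 + sub_val v.2 by [].
  rewrite e1 e2 (form_lin oO heps) // (form_lin oO limu) //.
  by move: (ip _ _) (ip _ _) (ip _ _) (ip _ _) => ? ? ? ?; ring.
- move=> u v; rewrite /energy (mulf_sym oO heps seps) // (mulf_sym oO limu simu) //.
  by rewrite (ip_sym _ (sub_val u.1)) (ip_sym _ (sub_val u.2)).
- by move=> u; have /andP[h _] := heq u; apply: le_trans h; rewrite mulr_ge0 ?(ltW c0) // sqn_ge0.
- move=> u hu.
  have sub j k : sqn (u j - u k) <= energy (u j - u k) (u j - u k) / c.
    by rewrite ler_pdivlMr // mulrC; case/andP: (heq (u j - u k)).
  have cau e : 0 < e -> exists N, forall j k, (N <= j)%N -> (N <= k)%N -> sqn (u j - u k) < e.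
    move=> e0; have [N hN] := hu (c * e) (mulr_gt0 c0 e0); exists N => j k Nj Nk.
    by apply: le_lt_trans (sub j k) _; rewrite ltr_pdivrMr // mulrC; exact: hN.
  have [|l1 hl1] := sh_complete (mip_hilbert oO) (u := fun n => (u n).1).
    move=> e /cau[N hN]; exists N => j k Nj Nk; apply: le_lt_trans (hN j k Nj Nk).
    by rewrite /sqn lerDl ip_ge0.
  have [|l2 hl2] := sh_complete (mip_hilbert oO) (u := fun n => (u n).2).
    move=> e /cau[N hN]; exists N => j k Nj Nk; apply: le_lt_trans (hN j k Nj Nk).
    by rewrite /sqn lerDr ip_ge0.
  exists (l1, l2); apply: (@cvgr0_le _ _ (fun n => C * sqn (u n - (l1, l2)))).
    move=> n; have /andP[k1 ->] := heq (u n - (l1, l2)); rewrite andbT.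
    by apply: le_trans k1; rewrite mulr_ge0 ?(ltW c0) // sqn_ge0.
  have h12 : (fun n => sqn (u n - (l1, l2))) @ \oo --> (0 : R).
    by rewrite -[X in _ --> X]addr0; apply: cvgD; [exact: hl1|exact: hl2].
  by rewrite -[X in _ --> X](mulr0 C); apply: cvgM; [exact: cvg_cst|exact: h12].
Qed.

(** One index carries the tests of both equations; each equation is recovered by taking the other
    field to be 0. *)
Definition tests := ({psi : vfield R | dom H0curl psi} * {phi : vfield R | dom Hcurl phi})%type.
Implicit Types i : tests.

Definition mass i W : R :=
  ip (mulf eps (sub_val W.1)) (proj1_sig i.1) + ip (sub_val W.2) (proj1_sig i.2).

Definition stiff i W : R :=
  - ip (mulf sigma (sub_val W.1)) (proj1_sig i.1) + ip (mulf imu (sub_val W.2)) (curl (proj1_sig i.1))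
  - ip (sub_val W.1) (curl (proj1_sig i.2)).

Let dpsi i : dom Hcurl (proj1_sig i.1). Proof. by case: i => -[psi []]. Qed.
Let dpsi2 i : dom L2 (proj1_sig i.1). Proof. exact: Hcurl_dom (dpsi i). Qed.
Let dphi i : dom Hcurl (proj1_sig i.2). Proof. by case: i => ? [phi]. Qed.
Let dphi2 i : dom L2 (proj1_sig i.2). Proof. exact: Hcurl_dom (dphi i). Qed.

Lemma mass_lin i (a : R) U W : mass i (a *: U + W) = a * mass i U + mass i W.
Proof.
have [e1 e2] : sub_val (a *: U + W).1 = a *: sub_val U.1 + sub_val W.1 /\
    sub_val (a *: U + W).2 = a *: sub_val U.2 + sub_val W.2 by [].
rewrite /mass e1 e2 (form_lin oO heps _ (L2P U.1) (L2P W.1) (dpsi2 i)).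
rewrite (ip_lin _ (L2P U.2) (L2P W.2) (dphi2 i)).
by move: (ip _ _) (ip _ _) (ip _ _) (ip _ _) => ? ? ? ?; ring.
Qed.

Lemma stiff_lin i (a : R) U W : stiff i (a *: U + W) = a * stiff i U + stiff i W.
Proof.
have [e1 e2] : sub_val (a *: U + W).1 = a *: sub_val U.1 + sub_val W.1 /\
    sub_val (a *: U + W).2 = a *: sub_val U.2 + sub_val W.2 by [].
rewrite /stiff e1 e2 (form_lin oO hsigma _ (L2P U.1) (L2P W.1) (dpsi2 i)).
rewrite (ip_lin _ (L2P U.1) (L2P W.1) (dom_curl _ _)).
rewrite (form_lin oO limu _ (L2P U.2) (L2P W.2) (dom_curl _ _)).
by move: (ip _ _) (ip _ _) (ip _ _) (ip _ _) (ip _ _) (ip _ _) => ? ? ? ? ? ?; ring.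
Qed.

Lemma nrm_energy : exists2 C : R, 0 < C & forall W,
  nrm L2 (sub_val W.1) <= C * hn energy W /\ nrm L2 (sub_val W.2) <= C * hn energy W.
Proof.
have [c [C [c0 _ heq]]] := energy_equiv; exists (Num.sqrt c^-1); first by rewrite sqrtr_gt0 invr_gt0.
move=> W; have /andP[h _] := heq W; have k : sqn W <= c^-1 * energy W W.
  by rewrite ler_pdivlMl.
rewrite !nrmE /hn -sqrtrM ?invr_ge0 ?(ltW c0) //; split; rewrite ler_wsqrtr //; apply: le_trans k.
  by rewrite lerDl ip_ge0.
by rewrite lerDr ip_ge0.
Qed.

Lemma energy_nrm : exists2 C : R, 0 < C & forall W,
  hn energy W <= C * (nrm L2 (sub_val W.1) + nrm L2 (sub_val W.2)).
Proof.
have [c [C [_ C0 heq]]] := energy_equiv; exists (Num.sqrt C); first by rewrite sqrtr_gt0.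
move=> W; have /andP[_ h] := heq W; have [n1 n2] := (nrm_ge0 Omega (sub_val W.1), nrm_ge0 Omega (sub_val W.2)).
rewrite -[X in _ <= _ * X]ger0_norm ?addr_ge0 // -sqrtr_sqr -sqrtrM ?(ltW C0) // /hn ler_wsqrtr //.
apply: le_trans h _; rewrite ler_wpM2l ?(ltW C0) // /sqn -!nrm_sqr.
have := mulr_ge0 n1 n2; move: (nrm L2 _) (nrm L2 _) => a b; lra.
Qed.

Lemma mass_bd i : exists C : R, forall W, `|mass i W| <= C * hn energy W.
Proof.
have [K K0 hK] := nrm_energy; have [C1 C10 h1] := form_bound oO heps.
exists (C1 * K * nrm L2 (proj1_sig i.1) + K * nrm L2 (proj1_sig i.2)) => W.
have [n1 n2] := hK W; have k1 := h1 _ _ (L2P W.1) (dpsi2 i); have k2 := ip_cs oO (L2P W.2) (dphi2 i).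
have [p1 p2] := (nrm_ge0 Omega (proj1_sig i.1), nrm_ge0 Omega (proj1_sig i.2)).
apply: le_trans (ler_normD _ _) _; rewrite mulrDl lerD //.
  exact: bound3 k1 C10 p1 n1.
exact: bound2 k2 p2 n2.
Qed.

Lemma stiff_bd i : exists C : R, forall W, `|stiff i W| <= C * hn energy W.
Proof.
have [K K0 hK] := nrm_energy; have [C1 C10 h1] := form_bound oO hsigma.
have [C3 C30 h3] := form_bound oO limu.
exists (C1 * K * nrm L2 (proj1_sig i.1) + C3 * K * nrm L2 (curl (proj1_sig i.1)) +
   K * nrm L2 (curl (proj1_sig i.2))) => W.
have [n1 n2] := hK W; have k1 := h1 _ _ (L2P W.1) (dpsi2 i).
have k3 := h3 _ _ (L2P W.2) (dom_curl Omega (proj1_sig i.1)).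
have k2 := ip_cs oO (L2P W.1) (dom_curl Omega (proj1_sig i.2)).
have p1 := nrm_ge0 Omega (proj1_sig i.1); have p2 := nrm_ge0 Omega (curl (proj1_sig i.1)).
have p3 := nrm_ge0 Omega (curl (proj1_sig i.2)).
apply: le_trans (ler_normB _ _) _; rewrite mulrDl lerD //; last first.
  exact: bound2 k2 p3 n1.
apply: le_trans (ler_normD _ _) _; rewrite normrN mulrDl lerD //.
  exact: bound3 k1 C10 p1 n1.
exact: bound3 k3 C30 p2 n2.
Qed.

Lemma mass_inj W : (forall i, mass i W = 0) -> hn energy W = 0.
Proof.
move=> h; have [dE dB] := (L2P W.1, L2P W.2).
have t1 psi (hp : dom H0curl psi) : ip (mulf eps (sub_val W.1)) psi = 0.
  have := h (exist _ psi hp, exist _ 0 (Hcurl0 oO)); rewrite /mass /=.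
  by rewrite (ip_sym _ _ 0) (ip0l oO dB) addr0.
have t2 phi (hp : dom Hcurl phi) : ip (sub_val W.2) phi = 0.
  have := h (exist _ 0 (H0curl0 oO), exist _ phi hp); rewrite /mass /=.
  by rewrite (ip_sym _ _ 0) (ip0l oO (dom_mulf oO heps dE)) add0r.
have de := dom_mulf oO heps dE; have di := dom_mulf oO limu dB.
have z1 : nrm L2 (mulf eps (sub_val W.1)) = 0.
  by apply: (test_total oO de) => phi tp; apply: t1; exact: test_H0curl.
have z2 : nrm L2 (sub_val W.2) = 0.
  by apply: (test_total oO dB) => phi tp; apply: t2; have [] := test_H0curl oO tp.
apply/(hn_eq0P energy_hilbert); rewrite /energy (ip_null oO de dE z1).
by rewrite (ip_eq0 dB di z2) addr0.
Qed.

(** The relation tested with all of H(curl) contains Green's formula for this electric field: its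
    curl is the opposite of the second component of [W], and its tangential trace vanishes. It is
    therefore an admissible test; the two curl terms cancel and only the conductivity term is
    left. *)
Lemma maxwell_diss U W : gr mass stiff U W -> energy W U <= 0.
Proof.
move=> g; have [[dE dB] [dE' dB']] := ((L2P U.1, L2P U.2), (L2P W.1, L2P W.2)).
have t1 psi (hp : dom H0curl psi) : ip (mulf eps (sub_val W.1)) psi =
    - ip (mulf sigma (sub_val U.1)) psi + ip (mulf imu (sub_val U.2)) (curl psi).
  have := g (exist _ psi hp, exist _ 0 (Hcurl0 oO)); rewrite /mass /stiff /=.
  rewrite (ip_sym _ _ 0) (ip0l oO dB') addr0 => ->.
  have wc0 : weak_curl Omega 0 0.
    by move=> phi tp; rewrite !ip0l //; [exact: test_dom|exact: test_dom (curl_smooth_test tp)].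
  by rewrite (ip_sym _ _ (curl 0)) (curl_eq oO (dom0 Omega) (dom0 Omega) wc0 dE) (ip0l oO dE) subr0.
have t2 phi (hp : dom Hcurl phi) : ip (sub_val W.2) phi = - ip (sub_val U.1) (curl phi).
  have := g (exist _ 0 (H0curl0 oO), exist _ phi hp); rewrite /mass /stiff /=.
  rewrite (ip_sym _ _ 0) (ip0l oO (dom_mulf oO heps dE')) add0r => ->.
  have wc0 : weak_curl Omega 0 0.
    by move=> ph tp; rewrite !ip0l //; [exact: test_dom|exact: test_dom (curl_smooth_test tp)].
  rewrite (ip_sym _ _ 0) (ip0l oO (dom_mulf oO hsigma dE)) oppr0 add0r.
  by rewrite (ip_sym _ _ (curl 0)) (curl_eq oO (dom0 Omega) (dom0 Omega) wc0 (dom_mulf oO limu dB)) (ip0l oO (dom_mulf oO limu dB)) add0r.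
have dmB : dom L2 ((-1) *: sub_val W.2 + 0) by exact: domD (dom0 Omega).
have mBE w : dom L2 w -> ip ((-1) *: sub_val W.2 + 0) w = - ip (sub_val W.2) w.
  by move=> hw; rewrite (ip_lin _ dB' (dom0 Omega) hw) (ip0l oO hw) addr0 mulN1r.
have wc : weak_curl Omega (sub_val U.1) ((-1) *: sub_val W.2 + 0).
  move=> phi tp; have [hph _] := test_H0curl oO tp; have dp := test_dom tp.
  rewrite (mBE _ dp) t2 // opprK (ip_sym _ _ (curl phi)).
  by rewrite (curl_eq oO dp (test_dom (curl_smooth_test tp)) (test_wc tp) dE) ip_sym.
have hE := wc_Hcurl dE dmB wc.
have hE0 : dom H0curl (sub_val U.1).
  split=> // w hw; have hcw := H1_curl hw; have dw := Hcurl_dom hcw.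
  by rewrite /tangential_trace (curl_eq oO dE dmB wc dw) (mBE _ dw) (t2 _ hcw) opprK subrr.
rewrite /energy (t1 _ hE0).
have dmu := dom_mulf oO limu dB.
rewrite (ip_sym _ _ (curl _)) (curl_eq oO dE dmB wc dmu) (mBE _ dmu).
rewrite (mulf_sym oO limu simu dB' dB).
have := mulf_coercive oO hsigma psigma dE; rewrite mul0r.
by move: (ip _ _) (ip _ _) => a b; lra.
Qed.

(** The electric part solves the elliptic step, and the magnetic part is defined by the second
    equation. That this equation holds against every field of H(curl), not only H^1 fields, is
    Green's formula. *)
Lemma maxwell_range (h : R) (F : state_space) : 0 < h -> exists U, gr mass stiff U (h^-1 *: (U - F)).
Proof.
move=> h0; have [dF1 dF2] := (L2P F.1, L2P F.2).
have [u hu hstep] := implicit_step h0 dF1 dF2.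
have hcu := hu.1; have du := Hcurl_dom hcu; have dcu := dom_curl Omega u.
have dU2 : dom L2 ((- h) *: curl u + sub_val F.2) by exact: domD.
pose U : state_space := (mkV du, mkV dU2); exists U => -[[psi hpsi] [phi hphi]].
have dpsi' := Hcurl_dom hpsi.1; have dphi' := Hcurl_dom hphi; have dcp := dom_curl Omega psi.
have e2' : h^-1 *: ((- h) *: curl u + sub_val F.2 - sub_val F.2) = (-1) *: curl u + 0.
  by rewrite addrK scalerA mulrN mulVf ?lt0r_neq0 // addr0.
have e1' : h^-1 *: (u - sub_val F.1) = h^-1 *: ((-1) *: sub_val F.1 + u) + 0.
  by rewrite addr0 scaleN1r addrC.
set i := (_, _).
have me : mass i (h^-1 *: (U - F)) = ip (mulf eps (h^-1 *: (u - sub_val F.1))) psi +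
    ip (h^-1 *: ((- h) *: curl u + sub_val F.2 - sub_val F.2)) phi by [].
rewrite me e2' e1' /stiff /=.
have d0 := dom0 Omega; have dd : dom L2 ((-1) *: sub_val F.1 + u) by exact: domD.
rewrite (form_lin oO heps _ dd d0 dpsi') (form_lin oO heps _ dF1 du dpsi').
rewrite (ip_lin _ dcu d0 dphi') (ip0l oO dphi') addr0 mulN1r -(green lip hu hphi).
rewrite (form_lin oO limu _ dcu dF2 dcp).
have z : ip (mulf eps 0) psi = 0 by rewrite (mulf_sym oO heps seps d0 dpsi') (ip0l oO (dom_mulf oO heps dpsi')).
have := hstep psi hpsi; rewrite /stepform z.
move: (ip (mulf eps u) psi) (ip (mulf sigma u) psi) (ip (mulf imu (curl u)) (curl psi))
  (ip (mulf eps (sub_val F.1)) psi) (ip (mulf imu (sub_val F.2)) (curl psi)) (ip u (curl phi)).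
move=> a b d f k l es; have -> : a = f + h * k - h * b - h ^+ 2 * d by lra.
by field; rewrite lt0r_neq0.
Qed.
End MaxwellOperator.

(** * Integrals over the time interval *)

Section LowerIntegral.
Context d (X : measurableType d) (R : realType) (mu : {measure set X -> \bar R}).
Import HBNNSimple.
Local Open Scope ereal_scope.

(* the integral of a nonnegative function is a supremum over simple functions
   below it, so monotonicity and a.e. invariance do not need measurability *)
Lemma lint_le (f g : X -> \bar R) : (forall x, 0 <= f x) -> (forall x, f x <= g x) ->
  \int[mu]_x f x <= \int[mu]_x g x.
Proof.
move=> f0 fg; rewrite !ge0_integralTE //; last by move=> x; exact: le_trans (fg x).
by apply: le_ereal_sup => _ [h /= hf <-]; exists h => //= x; exact: le_trans (fg x).
Qed.

Lemma lint_le_ae (f g : X -> \bar R) : (forall x, 0 <= f x) -> (forall x, 0 <= g x) ->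
  (\forall x \ae mu, f x <= g x) -> \int[mu]_x f x <= \int[mu]_x g x.
Proof.
move=> f0 g0 [N [mN N0 hN]]; rewrite ge0_integralTE //; apply: ge_ereal_sup => _ [h /= hf <-].
have mh : measurable_fun setT (EFin \o h) by exact/measurable_EFinP.
(* Cutting the simple function off on the null set keeps its integral and puts it below [g]
   everywhere. *)
have mC : measurable_fun setT (fun x => (h x * \1_(~` N) x)%:E).
  apply/measurable_EFinP; apply: measurable_funM => //; apply: measurable_indic; exact: measurableC.
have -> : sintegral mu h = \int[mu]_x (h x)%:E.
  rewrite ge0_integralTE; last by move=> x; rewrite lee_fin.
  apply/eqP; rewrite eq_le; apply/andP; split.
    by apply: ereal_sup_ubound; exists h.
  by apply: ge_ereal_sup => /= _ [k /= kh <-]; rewrite le_sintegral.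
rewrite (ae_eq_integral (fun x => (h x * \1_(~` N) x)%:E)) //.
  apply: lint_le => x; first by rewrite lee_fin mulr_ge0.
  have [Nx|Nx] := pselect (N x).
    by rewrite indicE memNset ?mulr0 //=; apply.
  rewrite indicE mem_set // mulr1; apply: le_trans (hf x) _.
  by apply: contrapT => k; apply: Nx; exact: hN.
exists N; split => // x /= k; apply: contrapT => Nx; apply: k => _.
by rewrite indicE mem_set // mulr1.
Qed.

Lemma lint_ae (f g : X -> \bar R) : (forall x, 0 <= f x) -> (forall x, 0 <= g x) ->
  (\forall x \ae mu, f x = g x) -> \int[mu]_x f x = \int[mu]_x g x.
Proof.
move=> f0 g0 fg; apply/eqP; rewrite eq_le; apply/andP; split; apply: lint_le_ae => //.
  by apply: filterS fg => x ->.
by apply: filterS fg => x ->.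
Qed.

Lemma integral_ae (f g : X -> \bar R) : (\forall x \ae mu, f x = g x) ->
  \int[mu]_x f x = \int[mu]_x g x.
Proof.
move=> fg; rewrite integralE [RHS]integralE.
by congr (_ - _); apply: lint_ae => //; apply: filterS fg => x e; rewrite ?funeposE ?funenegE e.
Qed.

End LowerIntegral.

#[global] Instance ae_leb1_filter (R : realType) : Filter (nbhs (almost_everywhere (@leb1 R))) :=
  @ae_filter_ringOfSetsType _ _ _ (@lebesgue_measure R).

(** * Integration by parts and du Bois-Reymond's lemma in time *)

Section TimeInterval.
Context (R : realType) (T : R) (T0 : 0 < T).
Notation leb := (@lebesgue_measure R).
Implicit Types (f g h : R -> R).

Definition tint h : R := \int[@leb1 R]_(t in `]0, T[) h t.

Definition aet (P : R -> Prop) := \forall t \ae @leb1 R, `]0, T[%classic t -> P t.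

Lemma aet_filter (P Q : R -> Prop) : (forall t : R, 0 < t < T -> P t -> Q t) -> aet P -> aet Q.
Proof. by rewrite /aet => PQ; apply: filterS => t h /= k; apply: PQ (h k); move: k; rewrite in_itv. Qed.

Lemma aet_and (P Q : R -> Prop) : aet P -> aet Q -> aet (fun t => P t /\ Q t).
Proof. by rewrite /aet => hP hQ; apply: filterS2 hP hQ => t h1 h2 k; split; [exact: h1|exact: h2]. Qed.

Lemma aet_all (P : R -> Prop) : (forall t : R, 0 < t < T -> P t) -> aet P.
Proof. by move=> h; apply: aeW => t /=; rewrite in_itv; exact: h. Qed.

Lemma tint_ae h h' : aet (fun t => h t = h' t) -> tint h = tint h'.
Proof.
rewrite /aet => hh; rewrite /tint /Rintegral; congr fine; rewrite [LHS]integral_mkcond [RHS]integral_mkcond.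
apply: integral_ae; apply: filterS hh => t ht; rewrite !patchE.
by case: ifPn => // /set_mem /ht ->.
Qed.

Lemma tint_iint h : tint h = iint h 0 T.
Proof.
rewrite /tint /iint /Rintegral; congr fine; rewrite [LHS]integral_mkcond [RHS]integral_mkcond.
apply: (@integral_ae _ _ _ leb).
exists ([set 0] `|` [set T]); split; first exact: measurableU.
  apply/eqP; rewrite eq_le measure_ge0 andbT.
  apply: le_trans (measureU2 _ _ _) _ => //.
  have e0 : (leb [set 0%R] = 0)%E := lebesgue_measure_set1 0.
  have eT : (leb [set T] = 0)%E := lebesgue_measure_set1 T.
  have e : (leb [set 0%R] + leb [set T] = 0)%E by rewrite e0 eT adde0.
  exact: (eq_ind_r (fun x => (x <= 0)%E) (lexx _) e).
move=> t /= k; apply: contrapT => /not_orP[t0 tT]; apply: k; rewrite !patchE.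
have -> : (t \in `]0, T[%classic) = (t \in `[0, T]%classic).
  rewrite !mem_setE !in_itv /= !lt_neqAle.
  by move/eqP/negPf: t0 => t0; move/eqP/negPf: tT => tT; rewrite eq_sym t0 tT.
by [].
Qed.

Lemma lint_itv_le h h' : (forall t, 0 <= h t) -> (forall t, 0 <= h' t) -> aet (fun t => h t <= h' t) ->
  (\int[@leb1 R]_(t in `]0%R, T[) (h t)%:E <= \int[@leb1 R]_(t in `[0%R, T]) (h' t)%:E)%E.
Proof.
rewrite /aet => h0 h'0 hh; rewrite [leLHS]integral_mkcond [leRHS]integral_mkcond.
apply: lint_le_ae => [t|t|].
- by rewrite patchE; case: ifP => // _; rewrite lee_fin.
- by rewrite patchE; case: ifP => // _; rewrite lee_fin.
apply: filterS hh => t ht; rewrite !patchE; case: ifPn => [/set_mem k|_].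
  rewrite mem_set ?lee_fin; first exact: ht.
  by move: k; rewrite /= !in_itv /= => /andP[/ltW -> /ltW ->].
by case: ifP => // _; rewrite lee_fin.
Qed.

(** Only the majorant has to be integrable, as [h] will be the norm of a derivative picked by
    [xget]. *)
Lemma tint_le h h' : (forall t, 0 <= h t) -> (forall t, 0 <= h' t) -> ii h' -> aet (fun t => h t <= h' t) ->
  tint h <= iint h' 0 T.
Proof.
move=> h0 h'0 ih hh; have le := lint_itv_le h0 h'0 hh.
have fin : (\int[leb]_(t in `[0%R, T]) (h' t)%:E)%E \is a fin_num.
  by apply: integrable_fin_num => //; exact: ih.
rewrite /tint /iint /Rintegral fine_le //.
rewrite ge0_fin_numE; last by apply: integral_ge0 => t _; rewrite lee_fin.
by apply: le_lt_trans le _; rewrite -ge0_fin_numE //; apply: integral_ge0 => t _; rewrite lee_fin.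
Qed.

(** Cauchy-Schwarz against the constant 1, by optimizing [c] in Young's inequality. *)
Lemma iint_cs f : ii f -> ii (fun t => f t ^+ 2) -> (forall t, 0 <= f t) ->
  iint f 0 T <= Num.sqrt T * Num.sqrt (iint (fun t => f t ^+ 2) 0 T).
Proof.
move=> i1 i2 f0; set a := iint f 0 T; set b := iint _ 0 T.
have key (c : R) : 0 < c -> 2 * a <= c * T + b / c.
  move=> c0; have : iint (fun t => 2 * f t) 0 T <= iint (fun t => c + c^-1 * f t ^+ 2) 0 T.
    apply: iint_le; [exact: iiZ|by apply: iiD; [exact: ii_cst|exact: iiZ]|move=> t _].
    have : 0 <= (c - f t) ^+ 2 / c by rewrite divr_ge0 ?sqr_ge0 ?ltW.
    rewrite (_ : _ / c = c + c^-1 * f t ^+ 2 - 2 * f t); first by lra.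
    by field; rewrite lt0r_neq0.
  rewrite iintZ // iintD; [|exact: ii_cst|exact: iiZ].
  by rewrite iintZ // (iint_cst _ (ltW T0)) subr0 mulrC [T * c]mulrC [_^-1 * _]mulrC [a * 2]mulrC.
have b0 : 0 <= b by apply: iint_ge0 => t _; exact: sqr_ge0.
have sT : 0 < Num.sqrt T by rewrite sqrtr_gt0.
have [s0|s0] := ltP 0 (Num.sqrt b).
  have := key (Num.sqrt b / Num.sqrt T) (divr_gt0 s0 sT).
  rewrite -{2}(sqr_sqrtr (ltW T0)) -{2}(sqr_sqrtr b0).
  have -> : Num.sqrt b / Num.sqrt T * Num.sqrt T ^+ 2 = Num.sqrt T * Num.sqrt b.
    by field; rewrite lt0r_neq0.
  have -> : Num.sqrt b ^+ 2 / (Num.sqrt b / Num.sqrt T) = Num.sqrt T * Num.sqrt b.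
    by field; rewrite !lt0r_neq0.
  lra.
(* When the square integral vanishes there is no optimal [c]; arbitrarily small values are used
   instead. *)
have bz : b = 0 by apply/eqP; rewrite eq_le b0 andbT -sqrtr_eq0 eq_le s0 sqrtr_ge0.
rewrite bz sqrtr0 mulr0; apply/ler_addgt0Pr => e e0; rewrite add0r.
have := key (e / T) (divr_gt0 e0 T0); rewrite bz mul0r addr0 divfK ?lt0r_neq0 //; lra.
Qed.

Lemma rint_swap (K : measurableTypeR R * measurableTypeR R -> R) :
  (leb \x leb)%E.-integrable setT (EFin \o K) ->
  (forall s : R, L1f leb (fun t => K (s, t))) -> (forall t : R, L1f leb (fun s => K (s, t))) ->
  rint leb (fun t => rint leb (fun s => K (s, t))) = rint leb (fun s => rint leb (fun t => K (s, t))).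
Proof.
move=> iK l1 l2; have rf (f : measurableTypeR R -> R) : rint leb f = fine (\int[leb]_x (f x)%:E)%E by [].
rewrite (rf (fun t => rint leb (fun s => K (s, t)))) (rf (fun s => rint leb (fun t => K (s, t)))).
congr fine; have Fu : (\int[leb]_s \int[leb]_t (K (s, t))%:E = \int[leb]_t \int[leb]_s (K (s, t))%:E)%E := Fubini iK.
transitivity (\int[leb]_t \int[leb]_s (K (s, t))%:E)%E.
  by congr (integral _ _ _); apply/funext => t; exact: rintE (l2 t).
rewrite -Fu; congr (integral _ _ _); apply/funext => s; exact: esym (rintE (l1 s)).
Qed.

Section Ibp.
Context (g : R -> R) (ig : ii g) (th : R -> R) (tth : test_fun (`]0, T[%classic : set R) th).

Let dth (t : R) : R := 'D_1 th t.
Lemma test1_smooth : smooth th. Proof. by case: tth. Qed.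

Lemma test1_out t : ~ (0 < t < T) -> th t = 0.
Proof. by move=> h; have [_ [K [_ KT hK]]] := tth; apply: hK => /KT; rewrite /= in_itv. Qed.

Lemma test1_der (t : R) : is_derive t (1 : R) th (dth t).
Proof. by split => //; exact: smooth_derivable test1_smooth. Qed.

Lemma test1_cder : continuous dth.
Proof. by apply: (@smooth_continuous R R); apply: smooth_derive; exact: test1_smooth. Qed.

Lemma test1_bound : exists2 M, 0 <= M & forall t, 0 <= t <= T -> `|dth t| <= M.
Proof.
have : compact (dth @` `[0, T]).
  apply: continuous_compact; last exact: segment_compact.
  by apply: continuous_subspaceT; exact: test1_cder.
move=> /compact_bounded [M [_ hM]]; exists (`|M| + 1) => [|t ht]; first by have := normr_ge0 M; lra.
by apply: hM; [have := ler_norm M; lra|exists t => //=; rewrite in_itv].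
Qed.

Lemma ftc2 (F f : R -> R) (a b : R) : a < b -> continuous f ->
  (forall t : R, is_derive t (1 : R) F (f t)) -> iint f a b = F b - F a.
Proof.
move=> ab cf dF.
have cF : continuous F.
  by move=> t; apply: differentiable_continuous; apply/derivable1_diffP; have [] := dF t.
have h := @continuous_FTC2 R f F a b ab (continuous_subspaceT cf).
rewrite /iint /Rintegral h //.
- split; [by move=> t _; have [] := dF t|exact: (cvg_at_right_filter (cF a))|exact: (cvg_at_left_filter (cF b))].
- by move=> t _; rewrite derive1E; have [_ ->] := dF t.
Qed.

Lemma test1_ftc (a : R) : 0 <= a <= T -> iint dth a T = - th a.
Proof.
move=> /andP[a0]; rewrite le_eqVlt => /predU1P[->|aT].
  by rewrite iint_refl test1_out ?oppr0 // ltxx andbF.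
rewrite (ftc2 aT test1_cder test1_der) (@test1_out T) ?sub0r //.
by rewrite ltxx andbF.
Qed.

Let I0 : R -> R := \1_(`[0, T]%classic).
Let K (z : measurableTypeR R * measurableTypeR R) : R := (g z.1 * I0 z.1) * ((z.1 <= z.2)%R%:R * (dth z.2 * I0 z.2)).

Let L1g : L1f leb (fun s => g s * I0 s).
Proof.
have h := ig 0 T; rewrite integrable_mkcond // in h.
rewrite /L1f (_ : EFin \o _ = (EFin \o g) \_ `[0, T]) //.
apply/funext => s /=; rewrite patchE /I0 indicE; case: ifP => _ /=; first by rewrite mulr1.
by rewrite mulr0.
Qed.

(** The primitive of an integrable [g] is not differentiable everywhere, so the product rule is
    replaced by Fubini's theorem on the triangle below the diagonal: integrating the derivative of
    [th] from [s] to [T] gives [- th s]. *)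
Lemma ibp_kernel : iint (fun t => iint g 0 t * dth t) 0 T = - iint (fun t => g t * th t) 0 T.
Proof.
have [M M0 hM] := test1_bound.
have mI : measurable_fun setT (I0 : measurableTypeR R -> R) by apply: measurable_indic.
have md : measurable_fun setT (dth : measurableTypeR R -> R).
  by apply: continuous_measurable_fun; exact: test1_cder.
have m1 : measurable_fun setT (fun z : measurableTypeR R * measurableTypeR R => z.1) by exact: measurable_fst.
have m2 : measurable_fun setT (fun z : measurableTypeR R * measurableTypeR R => z.2) by exact: measurable_snd.
have mK : measurable_fun setT K.
  apply: measurable_funM; first exact: (measurableT_comp (L1f_meas L1g) m1).
  apply: measurable_funM; last exact: (measurableT_comp (measurable_funM md mI) m2).
  rewrite (_ : (fun _ => _) = (fun z : measurableTypeR R * measurableTypeR R => if z.1 <= z.2 then 1 else 0 : R)).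
    by apply: measurable_fun_ifT => //; exact: measurable_fun_ler.
  by apply/funext => z; case: ifP.
have meK : measurable_fun setT (EFin \o K) by exact/measurable_EFinP.
have bI : forall t, `|dth t * I0 t| <= M * I0 t.
  move=> t; rewrite /I0 indicE; case: (boolP (t \in _)) => [/set_mem|] /=; rewrite ?mulr0 ?normr0 //.
  by rewrite in_itv !mulr1 => /hM.
have lI : L1f leb I0.
  by apply: integrable_indic_itv.
have lK2 (t : R) : L1f leb (fun s => K (s, t)).
  apply: (L1f_dom _ (L1fZ M (L1f_norm L1g))); first exact: (measurableT_comp mK (measurable_pair2 (t : measurableTypeR R))).
  move=> s; rewrite normrM mulrC ler_wpM2r // normrM; case: (s <= t)%R; rewrite ?normr1 ?normr0 ?mul0r // mul1r.
  apply: le_trans (bI t) _; rewrite ler_piMr // /I0 indicE; by case: (_ \in _).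
have lK1 (s : R) : L1f leb (fun t => K (s, t)).
  apply: (L1f_dom _ (L1fZ `|g s * I0 s| (L1fZ M lI))); first exact: (measurableT_comp mK (measurable_pair1 (s : measurableTypeR R))).
  move=> t; rewrite normrM ler_wpM2l // normrM; case: (s <= t)%R; rewrite ?normr1 ?normr0 ?mul0r ?mul1r //.
  by rewrite mulr_ge0 // /I0 indicE; case: (_ \in _).
have iK : (leb \x leb)%E.-integrable setT (EFin \o K).
  apply/integrable12ltyP => //.
  have lC : L1f leb (fun s => rint leb (fun t => M * I0 t) * `|g s * I0 s|) by exact: (L1fZ _ (L1f_norm L1g)).
  have C0 : 0 <= rint leb (fun t => M * I0 t).
    by apply: rint_ge0 => t; rewrite mulr_ge0 // /I0 indicE; case: (_ \in _).
  apply: (@le_lt_trans _ _ (\int[leb]_s (rint leb (fun t => M * I0 t) * `|g s * I0 s|)%:E)%E); last first.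
    by rewrite -(rintE lC) ltry.
  apply: lint_le => s; first by apply: integral_ge0 => t _; exact: abse_ge0.
  have l1 := L1f_norm (lK1 s).
  rewrite (_ : (\int[_]_x _)%E = (rint leb (fun t => `|K (s, t)|))%:E); last by rewrite (rintE l1).
  rewrite lee_fin mulrC -rintZ; last exact: L1fZ.
  apply: rint_le => //; first by apply: L1fZ; exact: L1fZ.
  move=> t; rewrite normrM ler_wpM2l // normrM; case: (s <= t)%R; rewrite ?normr1 ?normr0 ?mul0r ?mul1r //.
  by rewrite mulr_ge0 // /I0 indicE; case: (_ \in _).
have itv (f : R -> R) (a b : R) : iint f a b = rint leb (fun t => f t * \1_(`[a, b]%classic) t).
  rewrite /iint Rintegral_mkcond; congr fine; congr (integral _ _ _); apply/funext => t.
  by rewrite patchE indicE; case: ifP; rewrite ?mulr1 ?mulr0.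
have e1 s : rint leb (fun t => K (s, t)) = - (g s * th s) * I0 s.
  rewrite /K /= rintZ; last first.
    apply: (L1f_dom _ (L1fZ M lI)).
      have h := measurableT_comp mK (measurable_pair1 (s : measurableTypeR R)).
      apply: measurable_funM; last exact: measurable_funM md mI.
      rewrite (_ : (fun _ => _) = (fun t : measurableTypeR R => if (s : R) <= t then 1 else 0 : R)).
        by apply: measurable_fun_ifT => //; apply: measurable_fun_ler => //; exact: measurable_cst.
      by apply/funext => z; case: ifP.
    move=> t; rewrite normrM; case: (s <= t)%R; rewrite ?normr1 ?normr0 ?mul0r ?mul1r //.
    by rewrite mulr_ge0 // /I0 indicE; case: (_ \in _).
  rewrite /I0 [in LHS]indicE; case: (boolP (s \in _)) => [/set_mem|ns]; last by rewrite indicE (negPf ns) /= !mulr0 mul0r.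
  rewrite /= in_itv /= => sT; rewrite indicE mem_set ?mulr1; last by rewrite /= in_itv.
  rewrite (_ : rint _ _ = iint dth s T); first by rewrite test1_ftc // mulrN.
  rewrite itv; apply: eq_rint => t; rewrite mulrCA; congr (_ * _); rewrite !indicE.
  case/andP: sT => s0 _; rewrite -natrM mulnb; congr (_%:R); congr nat_of_bool.
  rewrite !mem_setE !in_itv /=; case st : (s <= t) => //=.
  by rewrite (le_trans s0 st).
have e2 t : rint leb (fun s => K (s, t)) = iint g 0 t * dth t * I0 t.
  transitivity (rint leb (fun s : measurableTypeR R => (dth t * I0 t) * (g s * I0 s * ((s : R) <= t)%R%:R))).
    by apply: eq_rint => s; rewrite /K /=; ring.
  have lgs : L1f leb (fun s : measurableTypeR R => g s * I0 s * ((s : R) <= t)%R%:R).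
    apply: (L1f_dom _ (L1f_norm L1g)).
      apply: measurable_funM; first exact: L1f_meas L1g.
      rewrite (_ : (fun _ => _) = (fun s : measurableTypeR R => if (s : R) <= t then 1 else 0 : R)).
        by apply: measurable_fun_ifT => //; apply: measurable_fun_ler => //; exact: measurable_cst.
      by apply/funext => z; case: ifP.
    by move=> s; rewrite normrM ler_piMr //; case: (s <= t)%R; rewrite ?normr1 ?normr0.
  rewrite rintZ // /I0 [in LHS]indicE; case: (boolP (t \in _)) => [/set_mem|ns]; last by rewrite indicE (negPf ns) /= !mulr0 mul0r.
  rewrite /= in_itv /= => /andP[t0 tT]; rewrite indicE mem_set ?mulr1; last by rewrite /= in_itv /= t0.
  rewrite mulrC; congr (_ * _); rewrite itv; apply: eq_rint => s; rewrite -mulrA; congr (_ * _).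
  rewrite !indicE -natrM mulnb; congr (_%:R); congr nat_of_bool.
  rewrite !mem_setE !in_itv /=; case st : (s <= t); rewrite ?andbF // andbT.
  by rewrite (le_trans st tT) andbT.
rewrite !itv -/I0.
transitivity (rint leb (fun t => rint leb (fun s => K (s, t)))).
  by apply: eq_rint => t; rewrite e2.
transitivity (rint leb (fun s => rint leb (fun t => K (s, t)))).
  exact: rint_swap.
have l1 : L1f leb (fun s => g s * th s * I0 s).
  have [Mt _ hMt] : exists2 M, 0 <= M & forall t, `|th t| <= M.
    have [sth [K' [cK _ hK]]] := tth.
    have : compact (th @` K') by apply: continuous_compact cK; apply: continuous_subspaceT; exact: smooth_continuous.
    move=> /compact_bounded [B [_ hB]]; exists (`|B| + 1) => [|t]; first by have := normr_ge0 B; lra.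
    have [Kt|nK] := pselect (K' t); last by rewrite hK // normr0; have := normr_ge0 B; lra.
    by apply: hB; [have := ler_norm B; lra|exists t].
  rewrite (_ : (fun _ => _) = (fun s => (g s * I0 s) * th s)); last by apply/funext => s; ring.
  apply: (L1f_dom _ (L1fZ Mt (L1f_norm L1g))).
    apply: measurable_funM; first exact: L1f_meas L1g.
    by apply: continuous_measurable_fun; exact: smooth_continuous test1_smooth.
  by move=> s; rewrite normrM mulrC ler_wpM2r.
rewrite -[RHS]mulN1r -rintZ //; apply: eq_rint => s; rewrite e1; ring.
Qed.
End Ibp.

Lemma dstep0 (x : R) : ~ (0 <= x <= 1) -> 'D_1 (@step R) x = 0.
Proof.
move=> h; have [x0|x0] := ltP x 0.
  rewrite (@near_eq_derive _ _ _ (@step R) (fun=> 0 : R) x 1) ?derive_cst //.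
  by have := lt_nbhsl x0; apply: filterS => y y0; rewrite step0 // ltW.
have x1 : 1 < x by rewrite ltNge; apply/negP => x1; apply: h; rewrite x0.
rewrite (@near_eq_derive _ _ _ (@step R) (fun=> 1 : R) x 1) ?derive_cst //.
by have := lt_nbhsr x1; apply: filterS => y y1; rewrite step1 // ltW.
Qed.

Lemma dstep_bound : exists2 M : R, 0 <= M & forall x : R, `|'D_1 (@step R) x| <= M.
Proof.
have cd : continuous (fun x : R => 'D_1 (@step R) x).
  by apply: (@smooth_continuous R R); apply: smooth_derive; exact: step_smooth.
have : compact ((fun x : R => 'D_1 (@step R) x) @` `[0, 1]).
  by apply: continuous_compact; [exact: continuous_subspaceT|exact: segment_compact].
move=> /compact_bounded [M [_ hM]]; exists (`|M| + 1) => [|x]; first by have := normr_ge0 M; lra.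
have [h|h] := pselect (0 <= x <= 1); last by rewrite dstep0 // normr0; have := normr_ge0 M; lra.
by apply: hM; [have := ler_norm M; lra|exists x => //=; rewrite in_itv].
Qed.

(** Rises smoothly from 0 at [s] to 1 at [s + e]; its derivative is an approximate identity
    concentrated just after [s]. *)
Definition ramp (e s : R) (r : R) : R := step (e^-1 * r - e^-1 * s).

Lemma ramp_smooth e s : smooth (ramp e s).
Proof.
move=> n; apply: (@Ck_comp_linear _ _ _ n (@step R) (fun r : R => e^-1 * r) (- (e^-1 * s))).
- by move=> a u v; rewrite mulrDr /GRing.scale /= mulrCA.
- by move=> r; apply: cvgM; [exact: cvg_cst|exact: cvg_id].
- exact: step_smooth.
Qed.

Lemma ramp_der e s (r : R) :
  is_derive r (1 : R) (ramp e s) ('D_1 (@step R) (e^-1 * r - e^-1 * s) * e^-1).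
Proof.
have h1 : is_derive (e^-1 * r - e^-1 * s) (1 : R) (@step R) ('D_1 (@step R) (e^-1 * r - e^-1 * s)).
  by split => //; exact: smooth_derivable (@step_smooth R).
have h2 : is_derive r (1 : R) (fun r : R => e^-1 * r - e^-1 * s) (e^-1).
  by apply: is_derive_eq; rewrite /GRing.scale /= mulr1 subr0.
exact: (is_derive1_comp (f := @step R) (g := fun r : R => e^-1 * r - e^-1 * s) h1 h2).
Qed.

Lemma ramp_low e s r : 0 < e -> r <= s -> ramp e s r = 0.
Proof. by move=> e0 rs; rewrite /ramp step0 // -mulrBr pmulr_rle0 ?invr_gt0 // subr_le0. Qed.
Lemma ramp_high e s r : 0 < e -> s + e <= r -> ramp e s r = 1.
Proof. by move=> e0 rs; rewrite /ramp step1 // -mulrBr ler_pdivlMl // mulr1; lra. Qed.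

(** The derivative of the ramp has integral 1, vanishes off an interval of length [e], and is at
    most [M / e], so it averages [L] near [s] with error [w * M]. *)
Lemma ramp_average (L : R -> R) (M w e s : R) : continuous L -> (forall x : R, `|'D_1 (@step R) x| <= M) ->
  0 < e -> 0 <= s -> s + e <= T -> (forall r, s <= r <= s + e -> `|L r - L s| <= w) ->
  `|iint (fun r => L r * 'D_1 (ramp e s) r) 0 T - L s| <= w * M.
Proof.
move=> cL hM e0 s0 sT hw.
have cd : continuous (fun r : R => 'D_1 (ramp e s) r).
  by apply: (@smooth_continuous R R); apply: smooth_derive; exact: ramp_smooth.
have dE r : 'D_1 (ramp e s) r = 'D_1 (@step R) (e^-1 * r - e^-1 * s) * e^-1.
  by have h := ramp_der e s r; exact: derive_val.
have i1 := ii_continuous cd.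
have cLd : continuous (fun r => (L r - L s) * 'D_1 (ramp e s) r).
  by move=> r; apply: cvgM; [apply: cvgB; [exact: cL|exact: cvg_cst]|exact: cd].
have i2 := ii_continuous cLd.
have out r : ~ (s <= r <= s + e) -> 'D_1 (ramp e s) r = 0.
  move=> h; rewrite dE dstep0 ?mul0r // => /andP[k1 k2]; apply: h.
  by move: k1 k2; rewrite -mulrBr pmulr_rge0 ?invr_gt0 // ler_pdivrMl // mulr1 => k1 k2; apply/andP; split; lra.
have -> : iint (fun r => L r * 'D_1 (ramp e s) r) 0 T =
    iint (fun r => (L r - L s) * 'D_1 (ramp e s) r) 0 T + L s.
  have one : iint (fun r => 'D_1 (ramp e s) r) 0 T = 1.
    have dr (t : R) : is_derive t (1 : R) (ramp e s) ('D_1 (ramp e s) t).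
      by split => //; exact: smooth_derivable (ramp_smooth e s).
    by apply: etrans (ftc2 T0 cd dr) _; rewrite ramp_high // ramp_low // subr0.
  have e1 : iint (fun r => L s * 'D_1 (ramp e s) r) 0 T = L s by rewrite iintZ // one mulr1.
  transitivity (iint (fun r => (L r - L s) * 'D_1 (ramp e s) r) 0 T + iint (fun r => L s * 'D_1 (ramp e s) r) 0 T); last by rewrite e1.
  transitivity (iint (fun r => (L r - L s) * 'D_1 (ramp e s) r + L s * 'D_1 (ramp e s) r) 0 T).
    by apply: eq_iint => r _; rewrite -mulrDl subrK.
  by apply: iintD; [exact: i2|exact: iiZ].
rewrite addrK.
have sT' : s <= T by lra.
have se : s <= s + e by lra.
rewrite (iint_add i2 s0 sT') (iint_add i2 se sT).
have z1 : iint (fun r => (L r - L s) * 'D_1 (ramp e s) r) 0 s = 0.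
  have [->|s1] := eqVneq s 0; first by rewrite iint_refl.
  apply/eqP; rewrite -normr_eq0 eq_le normr_ge0 andbT.
  have b : forall x, 0 < x -> `|iint (fun r => (L r - L s) * 'D_1 (ramp e s) r) 0 s| <= (s - 0) * x.
    move=> x x0; apply: iint_bound => // r /andP[r0]; rewrite le_eqVlt => /predU1P[->|rs].
      by rewrite subrr mul0r normr0 ltW.
    by rewrite out ?mulr0 ?normr0; [exact: ltW|move=> /andP[k1 k2]; lra].
  apply/ler_addgt0Pr => x x0; rewrite add0r.
  have s2 : 0 < s by rewrite lt_neqAle eq_sym s1.
  by have := b (x / s) (divr_gt0 x0 s2); rewrite subr0 mulrCA mulfV ?mulr1.
have z2 : iint (fun r => (L r - L s) * 'D_1 (ramp e s) r) (s + e) T = 0.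
  have [->|s1] := eqVneq (s + e) T; first by rewrite iint_refl.
  have d0 r : s + e <= r -> 'D_1 (ramp e s) r = 0.
    rewrite le_eqVlt => /predU1P[<-|rs]; last by apply: out => /andP[k1 k2]; lra.
    have := cvg_at_right_filter (cd (s + e)).
    move=> k; have k0 : 'D_1 (ramp e s) z @[z --> (s + e)^'+] --> (0 : R).
      apply: cvg_near_cst; near=> q; apply: out => /andP[_]; apply/negP; rewrite -ltNge.
      by near: q; exact: nbhs_right_gt.
    by apply: (cvg_unique _ k k0); exact: norm_hausdorff.
  rewrite (eq_iint (g := fun=> 0)); first by rewrite iint_cst // mulr0.
  by move=> r /andP[r1 _]; rewrite d0 // mulr0.
rewrite z1 z2 add0r addr0.
have := iint_bound (e := w * (M * e^-1)) i2 se; rewrite addrAC subrr add0r.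
have -> : e * (w * (M / e)) = w * M by field; rewrite lt0r_neq0.
apply=> r hr; rewrite normrM; apply: ler_pM => //; first exact: hw.
by rewrite dE normrM (@gtr0_norm _ e^-1) ?invr_gt0 // ler_wpM2r // invr_ge0 ltW.
Unshelve. all: by end_near.
Qed.

(** The difference of the ramps at [s] and at [t] is a test function on the open interval, and its
    derivative compares averages of [L] near the two points. The endpoints are reached by
    continuity. *)
Lemma const_of_weak_deriv0 (L : R -> R) : continuous L ->
  (forall th, test_fun (`]0, T[%classic : set R) th -> iint (fun t => L t * 'D_1 th t) 0 T = 0) ->
  forall s t, 0 <= s <= T -> 0 <= t <= T -> L s = L t.
Proof.
move=> cL h; have [M M0 hM] := dstep_bound.
have inner s t : 0 < s -> s < t -> t < T -> L s = L t.
  move=> s0 st tT; apply/eqP; rewrite -subr_eq0 -normr_eq0 eq_le normr_ge0 andbT.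
  apply/ler_addgt0Pr => x x0; rewrite add0r.
  (* Two averaging errors [w * M] must fit in [x]; the 1 keeps the quotient defined when [M] is
     0. *)
  pose w := x / (2 * (M + 1)); have w0 : 0 < w by rewrite divr_gt0 // mulr_gt0 //; lra.
  have near_s q : exists2 d, 0 < d & forall r, q <= r <= q + d -> `|L r - L q| <= w.
    have /cvgrPdist_le /(_ w w0) /nbhs_ballP[d /= d0 hd] := cL q.
    exists (d / 2) => [|r /andP[r1 r2]]; first lra.
    by rewrite distrC; apply: hd; rewrite -ball_normE /= ltr_norml; apply/andP; split; lra.
  have [d1 d10 hd1] := near_s s; have [d2 d20 hd2] := near_s t.
  pose e := Num.min (Num.min d1 d2) ((T - t) / 2).
  have e0 : 0 < e by rewrite !lt_min d10 d20 /=; lra.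
  have [ed1 ed2] : e <= d1 /\ e <= d2 by rewrite /e !ge_min !lexx !orbT.
  have eT : e <= (T - t) / 2 by rewrite /e ge_min lexx orbT.
  have a1 := @ramp_average L M w e s cL hM e0 (ltW s0) _ _.
  have a2 := @ramp_average L M w e t cL hM e0 _ _ _.
  have k1 : `|iint (fun r => L r * 'D_1 (ramp e s) r) 0 T - L s| <= w * M.
    by apply: a1; [lra|move=> r /andP[? ?]; apply: hd1; apply/andP; split; lra].
  have k2 : `|iint (fun r => L r * 'D_1 (ramp e t) r) 0 T - L t| <= w * M.
    by apply: a2; [lra|lra|move=> r /andP[? ?]; apply: hd2; apply/andP; split; lra].
  have tth : test_fun (`]0, T[%classic : set R) (fun r => ramp e s r + -1 * ramp e t r).
    split.
      by apply: smoothD; [exact: ramp_smooth|apply: smoothM; [exact: smooth_cst|exact: ramp_smooth]].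
    exists (`[s, t + e]%classic : set R); split; first exact: segment_compact.
      by move=> r /=; rewrite !in_itv /= => /andP[? ?]; apply/andP; split; lra.
    move=> r /=; rewrite in_itv /= => /negP; rewrite negb_and -!ltNge => /orP[rs|rt].
      by rewrite !ramp_low //; try lra; rewrite mulr0 addr0.
    by rewrite !ramp_high //; try lra; rewrite mulr1 subrr.
  have cd q : continuous (fun r : R => 'D_1 (ramp e q) r).
    by apply: (@smooth_continuous R R); apply: smooth_derive; exact: ramp_smooth.
  have ic q : ii (fun r => L r * 'D_1 (ramp e q) r).
    by apply: ii_continuous => r; apply: cvgM; [exact: cL|exact: cd].
  have fin (a b Ls Lt : R) : `|a - Ls| <= w * M -> `|b - Lt| <= w * M -> a - b = 0 -> `|Ls - Lt| <= x.
    have wx : 2 * (w * M) + 2 * w = x by rewrite /w; field; rewrite lt0r_neq0 //; lra.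
    clear - w0 wx; rewrite !ler_norml; move: (w * M) wx => wM wx /andP[? ?] /andP[? ?] ?.
    by apply/andP; split; lra.
  apply: fin k1 k2 _; rewrite -iintB //; apply: etrans (h _ tth); apply: eq_iint => r _.
  have dd q : derivable (ramp e q) r 1 by exact: smooth_derivable (ramp_smooth e q).
  have -> : (fun r0 => ramp e s r0 + -1 * ramp e t r0) = ramp e s - ramp e t.
    by apply/funext => q; rewrite mulN1r.
  by rewrite deriveB // mulrBr.
have mid s : 0 <= s <= T -> L s = L (T / 2).
  move=> /andP[s0 sT].
  have cv : (fun n => L (s + (T / 2 - s) * n.+2%:R^-1)) @ \oo --> L s.
    apply: (cvg_comp _ L _ (cL s)).
    have h1 : (fun n => (T / 2 - s) * n.+2%:R^-1) @ \oo --> (0 : R).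
      by have := cvgZ_harmonic (T / 2 - s); rewrite -cvg_shiftS.
    have h2 : (fun n => s + (T / 2 - s) * n.+2%:R^-1) @ \oo --> s + 0 by apply: cvgD => //; exact: cvg_cst.
    by rewrite addr0 in h2.
  apply: (cvg_unique _ cv); first exact: norm_hausdorff.
  rewrite (_ : (fun n => _) = fun=> L (T / 2)); first exact: cvg_cst.
  apply/funext => n.
  have k0 : 0 < n.+2%:R^-1 :> R by rewrite invr_gt0.
  have k1 : n.+2%:R^-1 < 1 :> R by rewrite invf_lt1 // ltr1n.
  move: (n.+2%:R^-1) k0 k1 => k k0 k1.
  have p1 : 0 <= s * (1 - k) by rewrite mulr_ge0 //; lra.
  have p2 : 0 <= (T - s) * (1 - k) by rewrite mulr_ge0 //; lra.
  have p3 : 0 < T * k by rewrite mulr_gt0.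
  have q1 : 0 < s + (T / 2 - s) * k by move: p1 p2 p3; rewrite !mulrBr !mulrBl !mulr1; lra.
  have q2 : s + (T / 2 - s) * k < T by move: p1 p2 p3; rewrite !mulrBr !mulrBl !mulr1; lra.
  have [h1|h1|->//] := ltgtP (s + (T / 2 - s) * k) (T / 2).
    by apply: inner => //; lra.
  by apply/esym; apply: inner => //; lra.
by move=> s t hs ht; rewrite (mid s hs) (mid t ht).
Qed.

(** By Lebesgue's differentiation theorem [g] is almost everywhere the derivative of its primitive,
    which is constant. *)
Lemma iint0_ae (g : R -> R) : ii g -> (forall t, 0 <= t <= T -> iint g 0 t = 0) -> aet (fun t => g t = 0).
Proof.
move=> ig h; pose f := g \_ `[0, T].
have lf : leb.-integrable setT (EFin \o f).
  have := ig 0 T; rewrite integrable_mkcond // => k.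
  rewrite (_ : EFin \o f = (EFin \o g) \_ `[0, T]) //.
  by apply/funext => t /=; rewrite /f !patchE; case: ifP.
have loc : locally_integrable setT f.
  by apply: integrable_locally.
have := lebesgue_differentiation loc.
rewrite /aet; apply: filterS => t ht; rewrite /= in_itv /= => /andP[t0 tT].
have lfT : leb.-integrable `[0, T] (EFin \o f) by apply: integrableS lf.
have [dF F'] := FTC1_lebesgue_pt (f := f) (a := BLeft 0) tT lfT t0 ht.
have fE : f t = g t by rewrite /f patchE mem_set //= in_itv /= !ltW.
rewrite -fE -F' derive1E (@near_eq_derive _ _ _ _ (fun=> 0 : R) t 1) ?derive_cst //.
near=> y; have y0 : 0 < y by near: y; exact: lt_nbhsr.
have yT : y < T by near: y; exact: lt_nbhsl.
rewrite -[RHS](h y); last by rewrite !ltW.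
apply: eq_Rintegral => r; rewrite inE /= in_itv /= => /andP[r0 ry].
by rewrite /f patchE mem_set //= in_itv /= r0 (le_trans ry) // ltW.
Unshelve. all: by end_near.
Qed.
End TimeInterval.

(** * Bochner spaces *)

(** The axioms are required on [dom X] only, since elements outside the domain carry meaningless
    seminorms. *)
Record seminormed (R : realType) (X : nspace R) : Prop := Seminormed {
  sn0 : dom X 0;
  sn_lin : forall a u v, dom X u -> dom X v -> dom X (a *: u + v);
  sn_ge0 : forall u, dom X u -> 0 <= nrm X u;
  sn_nrm0 : nrm X 0 = 0;
  sn_le : forall a u v, dom X u -> dom X v -> nrm X (a *: u + v) <= `|a| * nrm X u + nrm X v }.

Section Strong.
Context (R : realType) (T : R) (T0 : 0 < T).
Notation mR := (measurableTypeR R).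
Implicit Types X Y : nspace R.

Fixpoint sok X (s : seq (set mR * X)) : Prop :=
  if s is a :: s' then (measurable a.1 /\ dom X a.2) /\ sok s' else True.

Section OneSpace.
Context X (sX : seminormed X).
Implicit Types (u v w : X) (s : seq (set mR * X)) (f : R -> X).

Lemma snB u v : dom X u -> dom X v -> dom X (u - v).
Proof. by move=> hu hv; rewrite addrC -scaleN1r; exact: sn_lin. Qed.

Lemma snZ a u : dom X u -> dom X (a *: u).
Proof. by move=> hu; have := sn_lin sX a hu (sn0 sX); rewrite addr0. Qed.

Lemma nrmZ_le a u : dom X u -> nrm X (a *: u) <= `|a| * nrm X u.
Proof. by move=> hu; have := sn_le sX a hu (sn0 sX); rewrite addr0 sn_nrm0 // addr0. Qed.

Lemma nrmD_le u v : dom X u -> dom X v -> nrm X (u + v) <= nrm X u + nrm X v.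
Proof. by move=> hu hv; have := sn_le sX 1 hu hv; rewrite scale1r normr1 mul1r. Qed.

Lemma nrmBC u v : dom X u -> dom X v -> nrm X (u - v) = nrm X (v - u).
Proof.
have le u' v' : dom X u' -> dom X v' -> nrm X (u' - v') <= nrm X (v' - u').
  by move=> hu hv; have := nrmZ_le (-1) (snB hv hu); rewrite scaleN1r opprB normrN1 mul1r.
by move=> hu hv; apply/eqP; rewrite eq_le !le.
Qed.

Lemma nrm_tri v u w : dom X u -> dom X v -> dom X w -> nrm X (u - w) <= nrm X (u - v) + nrm X (v - w).
Proof.
by move=> hu hv hw; apply: le_trans (nrmD_le _ _); rewrite ?subrKA ?addrA ?subrK //; exact: snB.
Qed.

Lemma nrm_dist u v : dom X u -> dom X v -> `|nrm X u - nrm X v| <= nrm X (u - v).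
Proof.
have le u' v' : dom X u' -> dom X v' -> nrm X u' <= nrm X (u' - v') + nrm X v'.
  by move=> hu hv; have := nrmD_le (snB hu hv) hv; rewrite subrK.
move=> hu hv; have h1 := le _ _ hu hv; have h2 := le _ _ hv hu; rewrite (nrmBC hv hu) in h2.
by rewrite ler_norml; apply/andP; split; lra.
Qed.

Lemma sok_mset s : sok s -> mset s.
Proof. by elim: s => [_ b []|a s IH /= [[ma _] /IH ms] b [<-|/ms]]. Qed.

Lemma sfun_cons (a : set mR * X) s t : sfun (a :: s) t = (\1_(a.1) t : R) *: a.2 + sfun s t.
Proof. by rewrite /sfun big_cons. Qed.

Lemma dom_sfun s t : sok s -> dom X (sfun s t).
Proof.
elim: s => [_|a s IH /= [[_ da] /IH ds]]; first by rewrite /sfun big_nil; exact: sn0.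
by rewrite sfun_cons; exact: sn_lin.
Qed.

Lemma sok_map (I : Type) (l : seq I) (h : I -> set mR * X) :
  (forall i, measurable (h i).1 /\ dom X (h i).2) -> sok [seq h i | i <- l].
Proof. by move=> hh; elim: l => //= i l IH; split. Qed.

(** A simple function takes finitely many values, so [h] needs no regularity. The induction absorbs
    the head of the list into [h] by a translation. *)
Lemma meas_sfun_fun s (h : X -> R) : mset s -> meas (fun t => h (sfun s t)).
Proof.
rewrite /meas; elim: s h => [|a s IH] h ms.
  by under [X in measurable_fun _ X]eq_fun do rewrite /sfun big_nil; exact: measurable_cst.
have ma : measurable a.1 by apply: ms; left.
have ms' : mset s by move=> b bs; apply: ms; right.
rewrite (_ : (fun t => _) = (fun t => if t \in a.1 then h (a.2 + sfun s t) else h (sfun s t))).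
  apply: measurable_fun_ifT; last exact: IH.
    apply: (@measurable_fun_bool _ _ _ _ true); rewrite setTI (_ : _ @^-1` _ = a.1) //.
    by apply/seteqP; split => t /= => [/set_mem//|?]; exact: mem_set.
  exact: (IH (fun x => h (a.2 + x))).
apply/funext => t; rewrite sfun_cons indicE; case: (t \in a.1) => /=; first by rewrite scale1r.
by rewrite scale0r add0r.
Qed.

Lemma simple_seq (F : R -> X) : simple_fun X F -> exists2 s, sok s & F = sfun s.
Proof.
move=> [n [A [x [h ->]]]]; exists [seq (A i, x i) | i <- enum 'I_n].
  by apply: (@sok_map _ _ (fun i => (A i, x i))).
by apply/funext => t; rewrite /sfun big_map big_enum.
Qed.

Lemma seq_simple s : sok s -> simple_fun X (sfun s).
Proof.
move=> hs; pose a i := nth (set0, 0) s i.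
exists (size s), (fun i => (a i).1), (fun i => (a i).2); split.
  move=> [i /= hi]; rewrite {}/a; elim: s hs i hi => [//|b s IH /= [hb hs]] [|i] //=.
  by rewrite ltnS; exact: IH.
by apply/funext => t; rewrite /sfun (big_nth (set0, 0)) big_mkord.
Qed.

Lemma sfun_restr (A : set mR) s t :
  sfun [seq (a.1 `&` A, a.2) | a <- s] t = (\1_A t : R) *: sfun s t.
Proof.
rewrite /sfun big_map scaler_sumr; apply: eq_bigr => a _ /=.
by rewrite scalerA !indicE in_setI -natrM mulnb andbC.
Qed.

Lemma sok_restr (A : set mR) s : measurable A -> sok s -> sok [seq (a.1 `&` A, a.2) | a <- s].
Proof.
by move=> mA; elim: s => //= a s IH [[m1 d1] /IH h]; split => //; split => //; exact: measurableI.
Qed.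

(** Convergence of the simple approximants is required at every time, which makes norms and
    evaluations Borel functions. [L2t_strong] provides such a representative of each element of the
    Bochner space. *)
Definition smeas f := (forall t, dom X (f t)) /\
  exists2 s : nat -> seq (set mR * X), forall n, sok (s n) &
    forall t, (fun n => nrm X (sfun (s n) t - f t)) @ \oo --> (0 : R).

Definition strong f := smeas f /\ ii (fun t => nrm X (f t) ^+ 2).

Lemma smeas_nrm f : smeas f -> meas (fun t => nrm X (f t)).
Proof.
move=> [df [s hs cs]]; apply: (@measurable_fun_cvg _ _ _ setT (fun n t => nrm X (sfun (s n) t))) => //.
  by move=> n; apply: meas_sfun_fun; exact: sok_mset.
move=> t _; apply: (cvgr_dist_le _ (cs t)) => n; exact: nrm_dist (dom_sfun t (hs n)) (df t).
Qed.

Lemma strong_ii f : strong f -> ii (fun t => nrm X (f t)).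
Proof.
move=> [sf i2]; apply: (ii_dom (smeas_nrm sf) (iiD (ii_cst 1) i2)) => t.
have n0 := sn_ge0 sX (sf.1 t); rewrite ger0_norm //.
have := sqr_ge0 (nrm X (f t) - 1); rewrite sqrrB1 => h.
have := sqr_ge0 (nrm X (f t)); lra.
Qed.

(** Outside the open interval and on a measurable null set [f] is replaced by 0, and the sets of the
    approximants are cut accordingly. *)
Lemma L2t_strong f : in_L2t T X f -> exists2 f1, strong f1 & aet T (fun t => f t = f1 t).
Proof.
move=> [[s [hs [N [mN N0 hN]]]] fin].
pose A : set mR := (`]0, T[%classic : set mR) `\` N.
have mA : measurable A by apply: measurableD.
have cA t : A t -> dom X (f t) /\ (fun n => nrm X (s n t - f t)) @ \oo --> (0 : R).
  by move=> [h1 h2]; apply: contrapT => k; apply: h2; apply: hN => /= h; apply: k; exact: h.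
have /choice[q hq] n : exists q, sok q /\ s n = sfun q.
  by have [q] := simple_seq (hs n); exists q.
pose f1 t := if t \in A then f t else 0.
have sm : smeas f1.
  split=> [t|]; first by rewrite /f1; case: ifPn => [/set_mem/cA[]//|_]; exact: sn0.
  exists (fun n => [seq (a.1 `&` A, a.2) | a <- q n]) => [n|t].
    by apply: sok_restr => //; have [] := hq n.
  rewrite /f1; case: ifPn => [tA|tA].
    have [_ h] := cA t (set_mem tA); apply: cvg_trans h; apply: near_eq_cvg.
    by apply: nearW => n; rewrite sfun_restr indicE tA scale1r; have [_ ->] := hq n.
  rewrite (_ : (fun n => _) = fun=> 0); first exact: cvg_cst.
  by apply/funext => n; rewrite sfun_restr indicE (negPf tA) scale0r subr0 sn_nrm0.
exists f1; last first.
  exists N; split => // t /= k; apply: contrapT => tN; apply: k => h.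
  by rewrite /f1 mem_set.
split => //; have m1 := smeas_nrm sm.
have m2 : measurable_fun [set: mR] (fun t : mR => nrm X (f1 t) ^+ 2) by exact: measurable_funX.
move=> a b; apply: (@integrableS _ _ _ _ setT) => //.
apply/integrableP; split; first exact/measurable_EFinP.
apply: le_lt_trans fin; rewrite [leRHS]integral_mkcond; apply: lint_le => t; first exact: abse_ge0.
rewrite patchE /f1 /= ger0_norm ?sqr_ge0 //; case: ifPn => [/set_mem[h1 _]|_].
  by rewrite mem_set.
by rewrite sn_nrm0 // expr0n /=; case: ifP => // _; rewrite lee_fin sqr_ge0.
Qed.

Lemma strong_L2t f1 f : strong f1 -> aet T (fun t => dom X (f t) /\ nrm X (f t - f1 t) = 0) ->
  in_L2t T X f.
Proof.
move=> [[d1 [s hs cs]] i2] hf; split.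
  exists (fun n => sfun (s n)); split=> [n|]; first exact: seq_simple.
  move: hf; rewrite /aet; apply: filterS => t ht h; have [df z] := ht h; split=> //.
  apply: (cvgr0_le _ (cs t)) => n; have ds := dom_sfun t (hs n).
  rewrite sn_ge0 //=; last exact: snB.
  by apply: le_trans (nrm_tri ds (d1 t) df) _; rewrite (nrmBC (d1 t) df) z addr0.
have j2 : (\int[@leb1 R]_(t in `[0%R, T]) (nrm X (f1 t) ^+ 2)%:E < +oo)%E.
  rewrite -ge0_fin_numE; last by apply: integral_ge0 => t _; rewrite lee_fin sqr_ge0.
  by apply: integrable_fin_num => //; exact: i2.
apply: le_lt_trans j2; apply: lint_itv_le => [t|t|]; rewrite ?sqr_ge0 //.
apply: aet_filter hf => t _ [df z]; have := nrm_dist df (d1 t); rewrite z normr_le0 subr_eq0 => /eqP ->.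
exact: lexx.
Qed.

Lemma smeas_lin a f g : smeas f -> smeas g -> smeas (fun t => a *: f t + g t).
Proof.
move=> [df [s hs cs]] [dg [s' hs' cs']]; split=> [t|]; first exact: sn_lin.
exists (fun n => [seq (b.1, a *: b.2) | b <- s n] ++ s' n) => [n|t].
  elim: (s n) (hs n) => [_|b l IH /= [[mb db] /IH h]]; first exact: hs'.
  by split => //; split => //; exact: snZ.
apply: (@cvgr0_le _ _ (fun n => `|a| * nrm X (sfun (s n) t - f t) + nrm X (sfun (s' n) t - g t))).
  move=> n; have [e1 e2] := (dom_sfun t (hs n), dom_sfun t (hs' n)).
  have -> : sfun ([seq (b.1, a *: b.2) | b <- s n] ++ s' n) t = a *: sfun (s n) t + sfun (s' n) t.
    rewrite /sfun big_cat big_map scaler_sumr; congr (_ + _); apply: eq_bigr => b _ /=.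
    by rewrite !scalerA mulrC.
  have -> : a *: sfun (s n) t + sfun (s' n) t - (a *: f t + g t) =
     a *: (sfun (s n) t - f t) + (sfun (s' n) t - g t) by rewrite scalerBr; lmod R (carrier X).
  have [k1 k2] := (snB e1 (df t), snB e2 (dg t)).
  by rewrite (sn_le sX a k1 k2) andbT sn_ge0 //; exact: sn_lin.
rewrite -[X in _ --> X](addr0 (0 : R)); apply: cvgD => //.
by rewrite -[X in _ --> X](mulr0 `|a|); apply: cvgM => //; exact: cvg_cst.
Qed.

Lemma strong_lin a f g : strong f -> strong g -> strong (fun t => a *: f t + g t).
Proof.
move=> [sf i1] [sg i2]; have sl := smeas_lin a sf sg; split => //.
apply: (ii_dom _ (iiD (iiZ (2 * a ^+ 2) i1) (iiZ 2 i2))).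
  by apply: measurable_funX; exact: smeas_nrm.
move=> t; rewrite ger0_norm ?sqr_ge0 //.
have h := sn_le sX a (sf.1 t) (sg.1 t); have n0 := sn_ge0 sX (sl.1 t).
have [p q] := (sn_ge0 sX (sf.1 t), sn_ge0 sX (sg.1 t)).
have a0 := normr_ge0 a; rewrite -(@real_normK _ a) ?num_real //.
move: h n0 p q a0; move: (nrm X _) (nrm X _) (nrm X _) `|a| => x y z b h n0 p q a0.
apply: (@le_trans _ _ ((b * y + x) ^+ 2)); first by rewrite ler_pXn2r ?nnegrE //; apply: le_trans h.
by have := sqr_ge0 (b * y - x); nra.
Qed.

Lemma Ct_dom f t : in_Ct T X f -> 0 <= t <= T -> dom X (f t).
Proof. by move=> hf tT; have [] := hf t tT. Qed.

Lemma Ct_clamp f : in_Ct T X f -> forall s : R, nrm X (f (clamp T t) - f (clamp T s)) @[t --> s] --> (0 : R).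
Proof.
move=> hf s; have [_ h] := hf (clamp T s) (clamp_itv s T0).
apply/cvgrPdist_lt => e e0.
have /cvgrPdist_lt /(_ _ e0) := h; rewrite near_withinE => /nbhs_ballP[d /= d0 hd].
apply: filterS (nbhsx_ballx s d d0) => t; rewrite -ball_normE /= => std.
apply: hd; last exact: clamp_itv.
by rewrite -ball_normE /=; apply: le_lt_trans (clamp_lip T s t) std.
Qed.

Lemma Ct_nrm_continuous f : in_Ct T X f -> continuous (fun t => nrm X (f (clamp T t))).
Proof.
move=> hf s; apply/cvgrPdist_lt => e e0.
have /cvgrPdist_lt /(_ _ e0) := Ct_clamp hf s; apply: filterS => t; rewrite sub0r normrN.
have [d1 d2] := (Ct_dom hf (clamp_itv s T0), Ct_dom hf (clamp_itv t T0)).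
by apply: le_lt_trans; rewrite distrC; apply: le_trans (nrm_dist d2 d1) (ler_norm _).
Qed.

(** The approximants sample [f] at the left ends of half-open cells of length [T / n.+1%:R]. The
    value at [T] is dropped so that these cells cover the support exactly. *)
Lemma strong_Ct f : in_Ct T X f -> exists2 f1, strong f1 & forall t, 0 < t < T -> f t = f1 t.
Proof.
move=> hf; pose f1 t := if 0 <= t < T then f t else 0.
exists f1; last by move=> t /andP[t0 tT]; rewrite /f1 tT (ltW t0).
pose pt n (k : nat) : R := k%:R * (T / n.+1%:R).
have h0 n : 0 < T / n.+1%:R by rewrite divr_gt0.
pose s n := [seq (`[pt n k, pt n k.+1[%classic : set mR, f (clamp T (pt n k))) | k <- iota 0 n.+1].
have hs n : sok (s n).
  by apply: (@sok_map _ _ (fun k => (`[pt n k, pt n k.+1[%classic : set mR, f (clamp T (pt n k))))) => k; split => //=; exact: (Ct_dom hf (clamp_itv _ T0)).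
have sm : smeas f1.
  split=> [t|].
    by rewrite /f1; case: ifP => [/andP[t0 tT]|_]; [apply: Ct_dom => //; rewrite t0 ltW|exact: sn0].
  exists s => // t; rewrite /f1; case: ifPn => [/andP[t0 tT]|tn]; last first.
    rewrite (_ : (fun n => _) = fun=> 0); first exact: cvg_cst.
    apply/funext => n; rewrite subr0 (_ : sfun _ _ = 0) ?sn_nrm0 // /sfun big_map big_seq big1 // => k.
    rewrite mem_iota add0n => /andP[_ kn]; rewrite indicE memNset ?scale0r //= in_itv /= => /andP[k1 k2].
    move/negP: tn; apply; apply/andP; split.
      by apply: le_trans k1; rewrite mulr_ge0 // ltW.
    apply: lt_le_trans k2 _; rewrite /pt mulrA ler_pdivrMr // mulrC ler_wpM2l ?(ltW T0) // ler_nat.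
    exact: kn.
  pose k n := Num.trunc (t / (T / n.+1%:R)).
  have hk n : pt n (k n) <= t < pt n (k n).+1.
    have q0 : 0 <= t / (T / n.+1%:R) by rewrite divr_ge0 // ltW.
    by rewrite /pt -ler_pdivlMr // -ltr_pdivrMr //; exact: truncn_itv.
  have kn n : (k n < n.+1)%N.
    have /andP[h1 _] := hk n; rewrite -(@ltr_nat R) -(ltr_pM2r (h0 n)).
    by apply: le_lt_trans h1 _; rewrite mulrC divfK.
  have sE n : sfun (s n) t = f (pt n (k n)).
    have e0 : clamp T (pt n (k n)) = pt n (k n).
      have /andP[h1 _] := hk n; rewrite clamp_id // (le_trans h1 (ltW tT)) andbT mulr_ge0 // ltW //.
    have ki : k n \in iota 0 n.+1 by rewrite mem_iota add0n; exact: kn.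
    rewrite /sfun big_map (bigD1_seq _ ki (iota_uniq 0 n.+1)) /=.
    rewrite big1 ?addr0; last first.
      move=> j jk; rewrite indicE memNset ?scale0r //= in_itv /= => /andP[j1 j2].
      have /andP[i1 i2] := hk n; move: jk; rewrite neq_ltn => /orP[jk|jk].
        have : pt n j.+1 <= pt n (k n) by rewrite ler_wpM2r ?(ltW (h0 n)) // ler_nat.
        by lra.
      have : pt n (k n).+1 <= pt n j by rewrite ler_wpM2r ?(ltW (h0 n)) // ler_nat.
      by lra.
    by rewrite indicE mem_set ?scale1r ?e0 //= in_itv /= hk.
  have tT' : 0 <= t <= T by rewrite t0 ltW.
  have hpt n : 0 <= pt n (k n) <= T.
    have /andP[h1 _] := hk n; rewrite (le_trans h1 (ltW tT)) andbT mulr_ge0 // ltW //.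
  have cp : (fun n => pt n (k n)) @ \oo --> t.
    apply: (cvgr_dist_le _ (cvgZ_harmonic T)) => n; have /andP[h1 h2] := hk n.
    move: h2; rewrite /pt -natr1 mulrDl mul1r -/(pt n (k n)) => h2.
    by rewrite distrC ger0_norm ?subr_ge0 // lerBlDl; exact: ltW.
  have h := cvg_comp _ _ cp (Ct_clamp hf t).
  apply: cvg_trans h; apply: near_eq_cvg; apply: nearW => n /=.
  by rewrite sE !clamp_id.
split => //; have c2 : continuous (fun t => nrm X (f (clamp T t)) ^+ 2).
  by move=> t; apply: (@continuous_comp _ _ _ (fun t => nrm X (f (clamp T t))) (fun x : R => x ^+ 2));
   [exact: Ct_nrm_continuous|exact: exprn_continuous].
apply: (ii_dom _ (ii_continuous c2)); first by apply: measurable_funX; exact: smeas_nrm.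
move=> t; rewrite ger0_norm ?sqr_ge0 // /f1; case: ifP => [/andP[t0 tT]|_].
  by rewrite clamp_id // t0 ltW.
by rewrite sn_nrm0 // expr0n sqr_ge0.
Qed.
End OneSpace.

(** [L] is assumed linear up to null vectors only: the curl, whose representatives are picked by
    [xget], is linear in no stronger sense. *)
Lemma strong_map X Y (sX : seminormed X) (sY : seminormed Y) (L : X -> Y) (K : R) (f : R -> X) :
  0 <= K -> (forall u, dom X u -> dom Y (L u)) ->
  (forall u v, dom X u -> dom X v -> nrm Y (L u - L v) <= K * nrm X (u - v)) ->
  (forall a u v, dom X u -> dom X v -> nrm Y (L (a *: u + v) - (a *: L u + L v)) = 0) ->
  nrm Y (L 0) = 0 -> strong f -> strong (fun t => L (f t)).
Proof.
move=> K0 Ld Lb Ll L0 [[df [s hs cs]] i2].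
have sE q t : sok q -> nrm Y (sfun [seq (b.1, L b.2) | b <- q] t - L (sfun q t)) = 0.
  have d q' : sok q' -> dom Y (sfun [seq (b.1, L b.2) | b <- q'] t).
    move=> hq; apply: dom_sfun => //.
    by elim: q' hq => //= b l IH [[mb db] /IH h]; split => //; split => //; exact: Ld.
  elim: q => [_|b q IH /= hq].
    rewrite /sfun !big_nil sub0r.
    by have := nrmBC sY (sn0 sY) (Ld _ (sn0 sX)); rewrite sub0r subr0 L0.
  have [[mb db] hq'] := hq; have dq := dom_sfun sX t hq'; rewrite !sfun_cons /=.
  have [e1 e2] := (Ld _ db, Ld _ dq); set c := \1_(b.1) t : R.
  have e3 := sn_lin sY c e1 (d _ hq'); have e4 := sn_lin sY c e1 e2.
  have e5 := Ld _ (sn_lin sX c db dq).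
  apply/eqP; rewrite eq_le (sn_ge0 sY (snB sY e3 e5)) andbT.
  apply: le_trans (nrm_tri sY e3 e4 e5) _; rewrite (nrmBC sY e4 e5) Ll // addr0.
  rewrite opprD addrACA subrr add0r; have := IH hq'; set x := nrm Y _; by move=> ->.
have sm : smeas (fun t => L (f t)).
  split=> [t|]; first exact: Ld.
  exists (fun n => [seq (b.1, L b.2) | b <- s n]) => [n|t].
    by elim: (s n) (hs n) => //= b l IH [[mb db] /IH h]; split => //; split => //; exact: Ld.
  apply: (@cvgr0_le _ _ (fun n => K * nrm X (sfun (s n) t - f t))); last first.
    by rewrite -[X in _ --> X](mulr0 K); apply: cvgM => //; exact: cvg_cst.
  move=> n; have dn := dom_sfun sX t (hs n).
  have dm : dom Y (sfun [seq (b.1, L b.2) | b <- s n] t).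
    apply: dom_sfun => //.
    by elim: (s n) (hs n) => //= b l IH [[mb db] /IH h]; split => //; split => //; exact: Ld.
  rewrite (sn_ge0 sY (snB sY dm (Ld _ (df t)))) /=.
  apply: le_trans (nrm_tri sY dm (Ld _ dn) (Ld _ (df t))) _.
  by rewrite sE // add0r; exact: Lb.
split => //; apply: (ii_dom _ (iiZ (K ^+ 2) i2)); first by apply: measurable_funX; exact: smeas_nrm sY _ sm.
move=> t; rewrite ger0_norm ?sqr_ge0 // -exprMn ler_pXn2r ?nnegrE ?(sn_ge0 sY (Ld _ (df t))) ?mulr_ge0 ?(sn_ge0 sX (df t)) //.
have := Lb _ _ (df t) (sn0 sX); rewrite subr0; apply: le_trans.
have := nrmD_le sY (snB sY (Ld _ (df t)) (Ld _ (sn0 sX))) (Ld _ (sn0 sX)).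
by rewrite subrK L0 addr0.
Qed.
End Strong.

(** * Seminormed spaces and their duals *)

Section Spaces.
Context (R : realType).

Lemma seminormed_sub (X : nspace R) (D : set X) : seminormed X -> D 0 ->
  (forall a u v, D u -> D v -> D (a *: u + v)) -> D `<=` dom X ->
  seminormed (@NSpace R (carrier X) D (nrm X)).
Proof.
move=> sX D0 Dl DX; split => //= [u /DX||]; [exact: sn_ge0|exact: sn_nrm0|].
by move=> a u v /DX hu /DX hv; exact: sn_le.
Qed.

Definition hn_space (V : lmodType R) (m : V -> V -> R) : nspace R := @NSpace R V setT (hn m).

Lemma hn_seminormed (V : lmodType R) (m : V -> V -> R) : semi_hilbert m -> seminormed (hn_space m).
Proof.
move=> H; split => //= [u _||a u v _ _]; [exact: hn_ge0|exact: hn0|].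
by rewrite -(hnZ H); exact: hnD.
Qed.

Definition real_space : nspace R := @NSpace R (R^o : lmodType R) setT (fun x => `|x|).

Section DualSpace.
Context (X : nspace R) (sX : seminormed X).
Implicit Types (l : dual X) (u v : X).

Lemma dual_lin l a u v : dom (dual X) l -> dom X u -> dom X v -> l (a *: u + v) = a * l u + l v.
Proof. by move=> [h _]; exact: h. Qed.

Lemma dual0 l : dom (dual X) l -> l 0 = 0.
Proof. by move=> dl; have := dual_lin 1 dl (sn0 sX) (sn0 sX); rewrite scale1r addr0 mul1r; lra. Qed.

Lemma dualZ l a u : dom (dual X) l -> dom X u -> l (a *: u) = a * l u.
Proof. by move=> dl du; have := dual_lin a dl du (sn0 sX); rewrite addr0 (dual0 dl) addr0. Qed.

Let values l := [set `|l v| | v in [set v | dom X v /\ nrm X v <= 1]].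

Lemma dual_has_sup l : dom (dual X) l -> has_sup (values l).
Proof.
move=> dl; split; first by exists `|l 0|, 0 => //=; rewrite sn_nrm0 //; split => //; exact: sn0.
have [_ [M hM]] := dl; exists `|M| => _ [v [dv nv] <-].
apply: le_trans (hM v dv) _; apply: le_trans (ler_norm _) _; rewrite normrM.
by rewrite ler_piMr // ger0_norm ?(sn_ge0 sX).
Qed.

Lemma dual_nrm_ge l v : dom (dual X) l -> dom X v -> nrm X v <= 1 -> `|l v| <= nrm (dual X) l.
Proof. by move=> dl dv nv; apply: sup_upper_bound (dual_has_sup dl) _ _; exists v. Qed.

Lemma dual_ge0 l : dom (dual X) l -> 0 <= nrm (dual X) l.
Proof.
move=> dl; apply: le_trans (normr_ge0 (l 0)) (dual_nrm_ge dl (sn0 sX) _).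
by rewrite sn_nrm0.
Qed.

Lemma dual_bound l v : dom (dual X) l -> dom X v -> `|l v| <= nrm (dual X) l * nrm X v.
Proof.
move=> dl dv; have [n0|n0] := eqVneq (nrm X v) 0.
  by have [_ [M hM]] := dl; have := hM v dv; rewrite n0 !mulr0.
have np : 0 < nrm X v by rewrite lt_def n0 (sn_ge0 sX dv).
have := dual_nrm_ge dl (snZ sX (nrm X v)^-1 dv); rewrite (dualZ _ dl dv) normrM.
rewrite (gtr0_norm (x := (nrm X v)^-1)) ?invr_gt0 // mulrC ler_pdivrMr //; apply.
by apply: le_trans (nrmZ_le sX _ dv) _; rewrite gtr0_norm ?invr_gt0 // mulVf.
Qed.

Lemma dual_le l c : 0 <= c -> (forall v, dom X v -> `|l v| <= c * nrm X v) -> nrm (dual X) l <= c.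
Proof.
move=> c0 h; apply: ge_sup.
  by exists `|l 0|, 0 => //=; rewrite sn_nrm0 //; split => //; exact: sn0.
move=> _ [v [dv nv] <-]; apply: le_trans (h v dv) _; by rewrite ler_piMr.
Qed.

Lemma dual_ext l l' : (forall v, dom X v -> l v = l' v) -> nrm (dual X) l = nrm (dual X) l'.
Proof.
move=> h; congr (sup _); apply/seteqP; split => x [v hv <-]; exists v => //; by rewrite h //; case: hv.
Qed.

Lemma dual_norming l e : dom (dual X) l -> 0 < e -> exists v, [/\ dom X v, nrm X v <= 1 &
  nrm (dual X) l <= `|l v| + e].
Proof.
move=> dl e0; have [_ [v [dv nv] <-] h] := sup_adherent e0 (dual_has_sup dl).
by exists v; split => //; rewrite -lerBlDr; exact: ltW.
Qed.

Lemma dom_dual0 : dom (dual X) 0.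
Proof.
split=> [a u v _ _|]; first by rewrite -[LHS]/(0 : R) -[X in a * X]/(0 : R) -[X in _ + X]/(0 : R) mulr0 addr0.
by exists 0 => v _; rewrite -[X in `|X|]/(0 : R) normr0 mul0r.
Qed.

Lemma dual_seminormed : seminormed (dual X).
Proof.
have dl a (u v : dual X) : dom (dual X) u -> dom (dual X) v -> dom (dual X) (a *: u + v).
  move=> du dv; split=> [b x y dx dy|].
    rewrite -[(a *: u + v) _]/(a * u _ + v _) (dual_lin _ du) // (dual_lin _ dv) //.
    by rewrite -[(a *: u + v) x]/(a * u x + v x) -[(a *: u + v) y]/(a * u y + v y); ring.
  exists (`|a| * nrm (dual X) u + nrm (dual X) v) => x dx.
  rewrite -[(a *: u + v) x]/(a * u x + v x); apply: le_trans (ler_normD _ _) _.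
  rewrite normrM mulrDl -mulrA; apply: lerD; last exact: dual_bound.
  by rewrite ler_wpM2l //; exact: dual_bound.
split => //; first exact: dom_dual0; first exact: dual_ge0.
  apply/eqP; rewrite eq_le (dual_ge0 dom_dual0) andbT; apply: dual_le => // v _.
  by rewrite -[X in `|X|]/(0 : R) normr0 mul0r.
move=> a u v du dv; apply: dual_le.
  by rewrite addr_ge0 ?mulr_ge0 // dual_ge0.
move=> x dx; rewrite -[(a *: u + v) x]/(a * u x + v x); apply: le_trans (ler_normD _ _) _.
rewrite normrM mulrDl -mulrA; apply: lerD; last exact: dual_bound.
by rewrite ler_wpM2l //; exact: dual_bound.
Qed.
End DualSpace.
End Spaces.

(** * Weak time derivatives of functions with values in a dual *)

Section TimeDerivative.
Context (R : realType) (T : R) (T0 : 0 < T).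
Notation mR := (measurableTypeR R).
Notation leb := (@lebesgue_measure R).

Lemma ii_mul_bounded (f g : R -> R) (M : R) : ii f -> meas f -> meas g -> (forall t, `|g t| <= M) ->
  ii (fun t => f t * g t).
Proof.
move=> iif mf mg hg; apply: (ii_dom _ (iiZ M (ii_norm iif))); first exact: measurable_funM.
by move=> t; rewrite normrM mulrC ler_wpM2r.
Qed.

Lemma iint_continuous (k : R -> R) : ii k -> continuous (fun t => iint k 0 (clamp T t)).
Proof.
move=> ik; have h := @parameterized_integral_continuous R 0 T k (ltW T0) (ik 0 T).
have c : in_Ct T (real_space R) (fun t => iint k 0 t).
  move=> s sT; split=> //; move/subspace_continuousP: h => /(_ s sT) h'.
  apply/cvgrPdist_lt => e e0.
  have /cvgrPdist_lt /(_ _ e0) := h'; apply: filterS => t /=.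
  by rewrite sub0r normrN normr_id distrC.
move=> s; apply/cvgrPdist_lt => e e0.
have /cvgrPdist_lt /(_ _ e0) := Ct_clamp T0 c s; apply: filterS => t.
by rewrite /= sub0r normrN normr_id distrC.
Qed.

Lemma test1_bounded (th : R -> R) : test_fun (`]0, T[%classic : set R) th ->
  meas th /\ exists M, forall t, `|th t| <= M.
Proof.
move=> tth; have [sth [K' [cK _ hK]]] := tth; split.
  by apply: continuous_measurable_fun; exact: smooth_continuous.
have : compact (th @` K') by apply: continuous_compact cK; apply: continuous_subspaceT; exact: smooth_continuous.
move=> /compact_bounded [B [_ hB]]; exists (`|B| + 1) => t.
have [Kt|nK] := pselect (K' t); last by rewrite hK // normr0; have := normr_ge0 B; lra.
by apply: hB; [have := ler_norm B; lra|exists t].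
Qed.

(** Subtracting the primitive of [k] leaves a continuous function with zero weak derivative, hence a
    constant. *)
Lemma weak_deriv_integral (l k : R -> R) : continuous l -> ii k -> meas k ->
  (forall th, test_fun (`]0, T[%classic : set R) th ->
    tint T (fun t => l t * derive1 th t) = - tint T (fun t => k t * th t)) ->
  forall t, 0 <= t <= T -> l t = l 0 + iint k 0 t.
Proof.
move=> cl ik mk h; pose L t := l t - iint k 0 (clamp T t).
have cL : continuous L by move=> t; apply: cvgB; [exact: cl|exact: iint_continuous].
have hL th : test_fun (`]0, T[%classic : set R) th -> iint (fun t => L t * 'D_1 th t) 0 T = 0.
  move=> tth; have cd := test1_cder tth.
  have i1 : ii (fun t => l t * 'D_1 th t).
    by apply: ii_continuous => t; apply: cvgM; [exact: cl|exact: cd].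
  have i2 : ii (fun t => iint k 0 (clamp T t) * 'D_1 th t).
    by apply: ii_continuous => t; apply: cvgM; [exact: iint_continuous|exact: cd].
  transitivity (iint (fun t => l t * 'D_1 th t - iint k 0 (clamp T t) * 'D_1 th t) 0 T).
    by apply: eq_iint => t _; rewrite -mulrBl.
  rewrite iintB //; have := h _ tth; rewrite !tint_iint => e.
  have -> : iint (fun t => l t * 'D_1 th t) 0 T = iint (fun t => l t * derive1 th t) 0 T.
    by apply: eq_iint => t _; rewrite derive1E.
  have -> : iint (fun t => iint k 0 (clamp T t) * 'D_1 th t) 0 T = iint (fun t => iint k 0 t * 'D_1 th t) 0 T.
    by apply: eq_iint => t tT; rewrite clamp_id.
  by rewrite (ibp_kernel ik tth) e opprK addNr.
move=> t tT; have := const_of_weak_deriv0 T0 cL hL tT (t := 0); rewrite lexx (ltW T0) /L => /(_ isT).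
by rewrite !clamp_id ?lexx ?(ltW T0) // iint_refl subr0 => <-; rewrite subrK.
Qed.

Lemma integral_weak_deriv (l k : R -> R) (c : R) : ii k ->
  (forall t, 0 <= t <= T -> l t = c + iint k 0 t) ->
  forall th, test_fun (`]0, T[%classic : set R) th ->
    tint T (fun t => l t * derive1 th t) = - tint T (fun t => k t * th t).
Proof.
move=> ik h th tth; rewrite !tint_iint -(ibp_kernel ik tth); have cd := test1_cder tth.
have i0 := ii_continuous cd.
have i2 : ii (fun t => iint k 0 (clamp T t) * 'D_1 th t).
  by apply: ii_continuous => t; apply: cvgM; [exact: iint_continuous|exact: cd].
transitivity (iint (fun t => c * 'D_1 th t + iint k 0 (clamp T t) * 'D_1 th t) 0 T).
  by apply: eq_iint => t tT; rewrite derive1E h // clamp_id // mulrDl.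
rewrite iintD //; last exact: iiZ.
rewrite iintZ // (test1_ftc tth) ?lexx ?(ltW T0) // (test1_out tth) ?ltxx // oppr0 mulr0 add0r.
by apply: eq_iint => t tT; rewrite clamp_id.
Qed.

Lemma aet_forall (I : countType) (P : I -> R -> Prop) : (forall i, aet T (P i)) ->
  aet T (fun t => forall i, P i t).
Proof.
move=> h; have h' n : leb.-negligible (fun t => `]0, T[%classic t /\ exists i, pickle i = n /\ ~ P i t).
  case e : (@unpickle I n) => [i|].
    apply: negligibleS (h i) => t [tT [j [ej nP]]] /(_ tT).
    by move: e; rewrite -ej pickleK => -[<-].
  apply: negligibleS (negligible_set0 leb) => t [_ [j [ej _]]].
  by move: e; rewrite -ej pickleK.
rewrite /aet /almost_everywhere /=; apply: negligibleS (negligible_bigcup h') => t /= k.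
have [tT [i nP]] : `]0, T[%classic t /\ exists i, ~ P i t.
  by split; [apply: contrapT => q; apply: k => /q|apply/existsNP => q; apply: k => _ i; exact: q].
by exists (pickle i) => //; split => //; exists i.
Qed.

Section DualValued.
Context (X : nspace R) (sX : seminormed X).
Let sD := dual_seminormed sX.
Implicit Types (g : R -> dual X) (psi : X).

Lemma smeas_eval g psi : smeas g -> dom X psi -> meas (fun t => g t psi).
Proof.
move=> [dg [s hs cs]] dp; apply: (@measurable_fun_cvg _ _ _ setT (fun n t => sfun (s n) t psi)) => //.
  by move=> n; apply: (meas_sfun_fun (fun l : dual X => l psi)); exact: (@sok_mset R (dual X)).
move=> t _; apply: (@cvgr_dist_le _ _ (fun n => nrm (dual X) (sfun (s n) t - g t) * nrm X psi)).
  move=> n; have d := snB sD (dom_sfun sD t (hs n)) (dg t); exact: (dual_bound sX d dp).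
by rewrite -[X in _ --> X](mul0r (nrm X psi)); apply: cvgM => //; exact: cvg_cst.
Qed.

Lemma strong_eval g psi : strong g -> dom X psi -> ii (fun t => g t psi).
Proof.
move=> sg dp; apply: (ii_dom (smeas_eval sg.1 dp) (iiZ (nrm X psi) (strong_ii sD sg))) => t.
by rewrite mulrC; exact: (dual_bound sX (sg.1.1 t) dp).
Qed.

Lemma sfun_mask (V : lmodType R) (s : seq (set mR * V)) t :
  sfun s t = \sum_(a <- mask [seq t \in a.1 | a <- s] s) a.2.
Proof.
rewrite /sfun; elim: s => [|a s IH]; first by rewrite !big_nil.
by rewrite big_cons /= indicE; case: (t \in a.1); rewrite /= ?big_cons IH ?scale1r // scale0r add0r.
Qed.

(** The exceptional null set depends on [psi], so only countably many tests can be combined. Each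
    approximant takes finitely many values, indexed by bit masks, and each value has almost norming
    vectors. Where [h t] kills all of these, the norm of an approximant is at most its distance to
    [h t], which tends to 0. *)
Lemma strong_eq0 (h : R -> dual X) : strong h -> (forall psi, dom X psi -> aet T (fun t => h t psi = 0)) ->
  aet T (fun t => forall psi, dom X psi -> h t psi = 0).
Proof.
move=> [[dh [s hs cs]] _] hz.
pose val (i : nat * bitseq * nat) : dual X := \sum_(a <- mask i.1.2 (s i.1.1)) a.2.
have /choice[psi hpsi] i : exists psi, [/\ dom X psi, nrm X psi <= 1 &
    dom (dual X) (val i) -> nrm (dual X) (val i) <= `|val i psi| + i.2.+1%:R^-1].
  have [d|nd] := pselect (dom (dual X) (val i)).
    have e0 : 0 < i.2.+1%:R^-1 :> R by rewrite invr_gt0.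
    by have [v [h1 h2 h3]] := dual_norming sX d e0; exists v.
  by exists 0; split => //; [exact: sn0|rewrite sn_nrm0].
have := aet_forall (fun i => hz (psi i) (let: And3 d _ _ := hpsi i in d)).
apply: aet_filter => t _ ht q dq.
have dS n := dom_sfun sD t (hs n).
have small n : nrm (dual X) (sfun (s n) t) <= nrm (dual X) (sfun (s n) t - h t).
  apply: (cvgr_le_near (u := fun k : nat => nrm (dual X) (sfun (s n) t) - k.+1%:R^-1)).
    rewrite -[X in _ --> X]subr0; apply: cvgB; [exact: cvg_cst|exact: cvg_harmonic].
  apply: nearW => k; pose i := (n, [seq t \in a.1 | a <- s n], k).
  have vE : val i = sfun (s n) t by rewrite sfun_mask.
  have [d1 d2] := hpsi i; rewrite vE => /(_ (dS n)) d3.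
  rewrite lerBlDr; apply: le_trans d3 _; rewrite lerD2r.
  have := dual_nrm_ge sX (snB sD (dS n) (dh t)) d1 d2.
  by rewrite -[(sfun (s n) t - h t) _]/(sfun (s n) t (psi i) - h t (psi i)) ht subr0.
have z : nrm (dual X) (h t) <= 0.
  apply: (cvgr_ge_near (u := fun n => 2 * nrm (dual X) (sfun (s n) t - h t))).
    by rewrite -[X in _ --> X](mulr0 2); apply: cvgM; [exact: cvg_cst|exact: cs].
  apply: nearW => n; have := nrm_dist sD (dS n) (dh t); have := small n.
  move: (nrm _ (sfun _ _)) (nrm _ (h t)) (nrm _ (_ - _)) => x y w; rewrite ler_norml => ? /andP[]; lra.
have := dual_bound sX (dh t) dq; apply: contraTeq => nz; rewrite -ltNge.
by apply: le_lt_trans (_ : 0 < _); [rewrite mulr_le0_ge0 // sn_ge0|rewrite normr_gt0].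
Qed.

Lemma weak_deriv_unique (l g1 g2 : R -> dual X) : in_L2t T (dual X) g1 -> in_L2t T (dual X) g2 ->
  weak_deriv T X l g1 -> weak_deriv T X l g2 ->
  aet T (fun t => forall psi, dom X psi -> g1 t psi = g2 t psi).
Proof.
move=> L1 L2 w1 w2; have [h1 s1 e1] := L2t_strong sD L1; have [h2 s2 e2] := L2t_strong sD L2.
have sh := strong_lin sD (-1) s2 s1.
have hE t psi : ((-1) *: h2 t + h1 t) psi = h1 t psi - h2 t psi.
  by rewrite -[LHS]/(-1 * h2 t psi + h1 t psi); ring.
have z psi : dom X psi -> aet T (fun t => ((-1) *: h2 t + h1 t) psi = 0).
  move=> dp; have i1 := strong_eval s1 dp; have i2 := strong_eval s2 dp.
  have m1 := smeas_eval s1.1 dp; have m2 := smeas_eval s2.1 dp.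
  have ih := strong_eval sh dp; apply: (iint0_ae ih) => t tT.
  have := @weak_deriv_integral (fun=> 0) _ _ ih (smeas_eval sh.1 dp) _ t tT; rewrite add0r => <- //.
    by move=> x; exact: cvg_cst.
  move=> th tth; have [mth [M hM]] := test1_bounded tth.
  have := etrans (esym (w1 psi dp th tth)) (w2 psi dp th tth) => /oppr_inj.
  rewrite -!/(tint T _) => e.
  have -> : tint T (fun t => 0 * derive1 th t) = 0.
    rewrite tint_iint (eq_iint (g := fun=> 0)) => [|x _]; last by rewrite mul0r.
    by rewrite (iint_cst _ (ltW T0)) mulr0.
  have e1' : tint T (fun t => g1 t psi * th t) = iint (fun t => h1 t psi * th t) 0 T.
    by rewrite -tint_iint; apply: tint_ae; apply: aet_filter e1 => x _ ->.
  have e2' : tint T (fun t => g2 t psi * th t) = iint (fun t => h2 t psi * th t) 0 T.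
    by rewrite -tint_iint; apply: tint_ae; apply: aet_filter e2 => x _ ->.
  rewrite tint_iint (eq_iint (g := fun t => h1 t psi * th t - h2 t psi * th t)) => [|x _]; last first.
    by rewrite hE mulrBl.
  rewrite iintB; try exact: (ii_mul_bounded _ _ _ hM).
  by rewrite -e1' -e2' e subrr oppr0.
have := strong_eq0 sh z; move=> h; have := aet_and h (aet_and e1 e2).
apply: aet_filter => t _ [k [-> ->]] psi dp; apply/eqP; rewrite -subr_eq0 -hE; apply/eqP; exact: k.
Qed.

Lemma dt_unique (l g : R -> dual X) : in_L2t T (dual X) g -> weak_deriv T X l g ->
  aet T (fun t => forall psi, dom X psi -> dt T X l t psi = g t psi).
Proof.
move=> L w; have ex : exists g, in_L2t T (dual X) g /\ weak_deriv T X l g by exists g.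
have [L' w'] := @xgetPex _ 0 [set g | in_L2t T (dual X) g /\ weak_deriv T X l g] ex.
exact: weak_deriv_unique L' L w' w.
Qed.
End DualValued.
End TimeDerivative.

(** * Strongly measurable functions as forces *)

Section GoodStrong.
Context (R : realType) (T : R) (T0 : 0 < T).
Notation mR := (measurableTypeR R).
Notation leb := (@lebesgue_measure R).
Context (V : lmodType R) (m : V -> V -> R) (H : semi_hilbert m).

Lemma L1f_itv (g : R -> R) : ii g -> L1f leb (fun s => g s * \1_(`[0, T]%classic : set mR) s).
Proof.
move=> ig; have h := ig 0 T; rewrite integrable_mkcond // in h.
rewrite /L1f (_ : EFin \o _ = (EFin \o g) \_ `[0, T]) //.
apply/funext => s /=; rewrite patchE indicE; case: ifP => _ /=; first by rewrite mulr1.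
by rewrite mulr0.
Qed.

Lemma iint_rint (f : R -> R) : iint f 0 T = rint leb (fun t => f t * \1_(`[0, T]%classic : set mR) t).
Proof.
rewrite /iint Rintegral_mkcond; congr fine; congr (integral _ _ _); apply/funext => t.
by rewrite patchE indicE; case: ifP; rewrite ?mulr1 ?mulr0.
Qed.

(* truncating the approximants where they exceed [2 |F| + 1] makes dominated
   convergence applicable *)
Lemma good_strong (F : R -> V) : @strong R (hn_space m) F -> good m T F.
Proof.
have sV := hn_seminormed H; move=> sF; have [[_ [s hs cs]] _] := sF.
have ms n : mset (s n) by exact: (@sok_mset R (hn_space m)).
have iF : ii (fun t => hn m (F t)) := strong_ii sV sF.
have mF : meas (fun t => hn m (F t)) := smeas_nrm sV sF.1.
split => //.
  move=> x; apply: (@measurable_fun_cvg _ _ _ setT (fun n t => m (sfun (s n) t) x)) => //.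
    by move=> n; exact: (meas_m_sfun H).
  move=> t _; apply: (@cvgr_dist_le _ _ (fun n => hn m (sfun (s n) t - F t) * hn m x)).
    by move=> n; have := cauchy_schwarz H (sfun (s n) t - F t) x; rewrite (shDl H) (shNl H).
  by rewrite -[X in _ --> X](mul0r (hn m x)); apply: cvgM; [exact: cs|exact: cvg_cst].
move=> e e0.
pose b n (t : mR) := hn m (sfun (s n) t) <= 2 * hn m (F t) + 1.
have mB n : measurable [set t : mR | b n t].
  have mb : measurable_fun setT (b n).
    apply: measurable_fun_ler; first exact: (meas_hn_sfun H (ms n)).
    by apply: measurable_funD => //; apply: measurable_funM.
  by have := mb measurableT [set true] I; rewrite setTI.
pose q n := [seq (a.1 `&` [set t : mR | b n t], a.2) | a <- s n].
have sq n : @sok R (hn_space m) (q n) by apply: sok_restr.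
have mq n : mset (q n) by exact: (@sok_mset R (hn_space m)).
have qE n t : sfun (q n) t = (b n t)%:R *: sfun (s n) t.
  by have := @sfun_restr R (hn_space m) [set t : mR | b n t] (s n) t; rewrite indicE mem_setE.
pose I0 : mR -> R := \1_(`[0, T]%classic).
have I01 t : 0 <= I0 t <= 1 by rewrite /I0 indicE; case: (_ \in _); rewrite ?lexx ?ler01.
have mI : measurable_fun setT I0 by apply: measurable_indic.
have [k hk] : exists n, iint (fun t => hn m (F t - sfun (q n) t)) 0 T < e.
  pose G n (t : mR) := hn m (F t - sfun (q n) t) * I0 t.
  have dm n : meas (fun t => hn m (F t - sfun (q n) t)).
    have st : @smeas R (hn_space m) (fun t => (-1) *: sfun (q n) t + F t).
      apply: (smeas_lin sV); last exact: sF.1.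
      split=> [t //|]; exists (fun=> q n) => // t.
      rewrite (_ : (fun _ => _) = fun=> 0); first exact: cvg_cst.
      by apply/funext => j; rewrite subrr; exact: (hn0 H).
    have := smeas_nrm sV st; rewrite /meas; apply: eq_measurable_fun => t _ /=.
    by rewrite scaleN1r addrC.
  have mG n : measurable_fun setT (G n) by apply: measurable_funM => //; exact: dm.
  have cG t : G n t @[n --> \oo] --> (0 : R).
    apply/cvgrPdist_lt => d d0.
    have md : 0 < Num.min d 1 by rewrite lt_min d0 ltr01.
    have /cvgrPdist_lt /(_ _ md) := cs t; apply: filterS => n.
    rewrite sub0r normrN -[nrm _ _]/(hn m _) ger0_norm ?hn_ge0 // lt_min => /andP[h1 h2].
    have bt : b n t.
      rewrite /b; have := hn_le H (sfun (s n) t) (F t); have := hn_ge0 m (F t).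
      by move: h2; move: (hn m (_ - _)) (hn m (sfun _ _)) (hn m (F t)) => *; lra.
    rewrite sub0r normrN /G qE bt scale1r normrM (ger0_norm (hn_ge0 _ _)) (hnBC H).
    have /andP[i0 i1] := I01 t; rewrite (ger0_norm i0).
    by apply: le_lt_trans h1; rewrite ler_piMr // hn_ge0.
  have iG : L1f leb (fun t => (3 * hn m (F t) + 1) * I0 t).
    by apply: L1f_itv; apply: iiD; [exact: iiZ|exact: ii_cst].
  have bG n t : `|G n t| <= (3 * hn m (F t) + 1) * I0 t.
    have /andP[i0 i1] := I01 t; rewrite /G normrM (ger0_norm i0) ler_wpM2r // ger0_norm ?hn_ge0 //.
    have f0 := hn_ge0 m (F t).
    rewrite qE; case bt : (b n t); rewrite ?scale1r ?scale0r ?subr0.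
      apply: le_trans (hnB H _ _) _; move: bt; rewrite /b; lra.
    lra.
  have [_ h] := rdct mG cG iG bG.
  have z : rint leb (fun=> 0 : R) = 0 by rewrite /rint Rintegral_cst // mul0r.
  rewrite z in h; have /cvgrPdist_lt /(_ _ e0) [n _ /(_ n (leqnn n))] := h.
  rewrite sub0r normrN => hn'; exists n; rewrite iint_rint; exact: le_lt_trans (ler_norm _) hn'.
by exists (q k).
Qed.
End GoodStrong.

(** * The spaces of fields and functionals on them *)

Section FieldSpaces.
Context (R : realType) (Omega : set (R3 R)) (oO : open Omega).
Notation L2 := (L2 Omega).
Notation Hcurl := (Hcurl Omega).
Notation H0curl := (H0curl Omega).
Notation ip := (ip Omega).
Notation curl := (curl Omega).
Local Opaque Defs.ip Defs.curl.

Lemma L2_seminormed : seminormed L2.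
Proof.
split; [exact: dom0|by move=> a u v; exact: domD|by move=> u _; exact: nrm_ge0| |].
  by rewrite nrmE ip0l ?sqrtr0 //; exact: dom0.
move=> a u v hu hv; have H := mip_hilbert oO.
have := hnD H (a *: mkV hu) (mkV hv); rewrite (hnZ H); exact: id.
Qed.

Lemma curl_lin_nrm (a : R) (u v : vfield R) : dom Hcurl u -> dom Hcurl v ->
  nrm L2 (curl (a *: u + v) - (a *: curl u + curl v)) = 0.
Proof.
move=> hu hv; have dd : dom L2 (a *: curl u + curl v) by apply: domD; exact: dom_curl.
apply: (proj1 (ip_eqP oO (dom_curl _ _) dd _)) => phi tp; have dp := test_dom tp.
by rewrite (curl_lin oO a hu hv dp) (ip_lin _ (dom_curl _ _) (dom_curl _ _) dp).
Qed.

Lemma Hcurl_seminormed : seminormed Hcurl.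
Proof.
have sL := L2_seminormed.
(* [curl 0] is a chosen representative, hence only a null field; additivity up to null fields shows
   this. *)
have c0 : nrm L2 (curl 0) = 0.
  have := curl_lin_nrm 0 (Hcurl0 oO) (Hcurl0 oO); rewrite !scale0r add0r !add0r subrr.
  move=> _; have := curl_lin_nrm 1 (Hcurl0 oO) (Hcurl0 oO); rewrite !scale1r addr0.
  have e : curl 0 - (curl 0 + curl 0) = (-1) *: curl 0 by rewrite scaleN1r opprD addrA subrr add0r.
  move=> h; apply/eqP; rewrite eq_le nrm_ge0 andbT.
  have := nrmZ_le sL (-1) (snZ sL (-1) (dom_curl Omega 0)); rewrite -e h mulr0.
  by rewrite e scalerA mulrNN mulr1 scale1r.
split; [exact: (Hcurl0 oO)|by move=> a u v hu hv; exact: (@Hcurl_lin R Omega a u v hu hv)|by move=> u _; exact: sqrtr_ge0| |].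
  have E0 : nrm Hcurl 0 = Num.sqrt (nrm L2 0 ^+ 2 + nrm L2 (curl 0) ^+ 2) by [].
  by rewrite E0 (sn_nrm0 sL) c0 expr0n addr0 sqrtr0.
move=> a u v hu hv.
have n1 := sn_le sL a (Hcurl_dom hu) (Hcurl_dom hv).
have n2 : nrm L2 (curl (a *: u + v)) <= `|a| * nrm L2 (curl u) + nrm L2 (curl v).
  have d1 := dom_curl Omega (a *: u + v); have [du dv] := (dom_curl Omega u, dom_curl Omega v).
  have d2 := sn_lin sL a du dv.
  have := nrm_dist sL d1 d2; rewrite curl_lin_nrm // normr_le0 subr_eq0 => /eqP ->.
  exact: (sn_le sL a du dv).
have E (w : vfield R) : nrm Hcurl w = Num.sqrt (nrm L2 w ^+ 2 + nrm L2 (curl w) ^+ 2) by [].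
rewrite !E; move: n1 n2.
have [p1 [p2 p3]] := (nrm_ge0 Omega u, (nrm_ge0 Omega v, nrm_ge0 Omega (a *: u + v))).
have [q1 [q2 q3]] := (nrm_ge0 Omega (curl u), (nrm_ge0 Omega (curl v), nrm_ge0 Omega (curl (a *: u + v)))).
move: p1 p2 p3 q1 q2 q3 (normr_ge0 a).
move: (nrm L2 u) (nrm L2 v) (nrm L2 (a *: u + v)) (nrm L2 (curl u)) (nrm L2 (curl v)) (nrm L2 (curl (a *: u + v))) `|a|.
move=> x y z x' y' z' b x0 y0 z0 x'0 y'0 z'0 b0 n1 n2.
pose A := Num.sqrt (x ^+ 2 + x' ^+ 2); pose B := Num.sqrt (y ^+ 2 + y' ^+ 2).
have sA : A ^+ 2 = x ^+ 2 + x' ^+ 2 by rewrite sqr_sqrtr // addr_ge0 ?sqr_ge0.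
have sB : B ^+ 2 = y ^+ 2 + y' ^+ 2 by rewrite sqr_sqrtr // addr_ge0 ?sqr_ge0.
have [A0 B0] : 0 <= A /\ 0 <= B by rewrite !sqrtr_ge0.
have cs : x * y + x' * y' <= A * B.
  rewrite -(@ler_pXn2r _ 2) ?nnegrE ?addr_ge0 ?mulr_ge0 // exprMn sA sB.
  by have := sqr_ge0 (x * y' - x' * y); lra.
rewrite -/A -/B -(@ler_pXn2r _ 2) ?nnegrE ?addr_ge0 ?mulr_ge0 ?sqrtr_ge0 //.
rewrite sqr_sqrtr ?addr_ge0 ?sqr_ge0 //.
have z2 : z ^+ 2 <= (b * x + y) ^+ 2 by rewrite ler_pXn2r ?nnegrE //; apply: le_trans n1.
have z2' : z' ^+ 2 <= (b * x' + y') ^+ 2 by rewrite ler_pXn2r ?nnegrE //; apply: le_trans n2.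
have := ler_wpM2l b0 cs; rewrite sqrrD exprMn sA sB; move: z2 z2'; rewrite !sqrrD !exprMn.
lra.
Qed.

Lemma H0curl_seminormed : seminormed H0curl.
Proof.
apply: (seminormed_sub Hcurl_seminormed); [exact: (H0curl0 oO)|exact: (H0curl_lin oO)|].
by move=> u [].
Qed.

Lemma div_free_lin (a : R) u v : dom L2 u -> dom L2 v -> div_free Omega u -> div_free Omega v ->
  div_free Omega (a *: u + v).
Proof.
move=> du dv hu hv phi tp; have dg := test_dom (grad_test tp).
by rewrite (ip_lin _ du dv dg) hu // hv // mulr0 addr0.
Qed.

Lemma Hdiv0_seminormed : seminormed (Hdiv0 Omega).
Proof.
apply: (seminormed_sub L2_seminormed) => [|a u v [du hu] [dv hv]|u []] //.
  by split; [exact: dom0|move=> phi tp; rewrite ip0l //; exact: test_dom (grad_test tp)].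
by split; [exact: domD|exact: div_free_lin].
Qed.

Section Functional.
(* functionals [psi |-> (A u, J psi)] on a space [X] with [J] the inclusion or the curl *)
Context (X : nspace R) (sX : seminormed X) (J : X -> vfield R).
Hypothesis J_dom : forall psi, dom X psi -> dom L2 (J psi).
Hypothesis J_le : forall psi, dom X psi -> nrm L2 (J psi) <= nrm X psi.
Hypothesis J_lin : forall (a : R) psi phi w, dom X psi -> dom X phi -> dom L2 w ->
  ip w (J (a *: psi + phi)) = a * ip w (J psi) + ip w (J phi).
Context (A : vfield R -> vfield R) (K : R) (K0 : 0 <= K).
Hypothesis A_dom : forall u, dom L2 u -> dom L2 (A u).
Hypothesis A_lin : forall a u v, A (a *: u + v) = a *: A u + A v.
Hypothesis A_le : forall u, dom L2 u -> nrm L2 (A u) <= K * nrm L2 u.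

Definition functional (u : vfield R) : dual X := fun psi => ip (A u) (J psi).

Lemma functional_bound u psi : dom L2 u -> dom X psi -> `|functional u psi| <= K * nrm L2 u * nrm X psi.
Proof.
move=> du dp; apply: le_trans (ip_cs oO (A_dom du) (J_dom dp)) _.
by apply: ler_pM; rewrite ?nrm_ge0 //; [exact: A_le|exact: J_le].
Qed.

Lemma functional_dom u : dom L2 u -> dom (dual X) (functional u).
Proof.
move=> du; split=> [a v w dv dw|]; first exact: J_lin dv dw (A_dom du).
by exists (K * nrm L2 u) => v dv; exact: functional_bound.
Qed.

Lemma functional_nrm u : dom L2 u -> nrm (dual X) (functional u) <= K * nrm L2 u.
Proof.
move=> du; apply: (dual_le sX); first by rewrite mulr_ge0 // nrm_ge0.
by move=> v dv; exact: functional_bound.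
Qed.

Lemma functional_lin (a : R) u v psi : dom L2 u -> dom L2 v -> dom X psi ->
  functional (a *: u + v) psi = a * functional u psi + functional v psi.
Proof. by move=> du dv dp; rewrite /functional A_lin (ip_lin _ (A_dom du) (A_dom dv) (J_dom dp)). Qed.

Lemma strong_functional (u : R -> vfield R) : @strong R L2 u -> @strong R (dual X) (fun t => functional (u t)).
Proof.
have sL := L2_seminormed; have d0 := sn0 sL.
apply: (strong_map sL (dual_seminormed sX) K0).
- exact: functional_dom.
- move=> x y dx dy; apply: le_trans (functional_nrm (snB sL dx dy)).
  rewrite le_eqVlt; apply/orP; left; apply/eqP; apply: dual_ext => v dv.
  rewrite -[LHS]/(functional x v - functional y v).
  have -> : x - y = (-1) *: y + x by rewrite scaleN1r addrC.
  by rewrite (functional_lin (-1) dy dx dv) mulN1r addrC.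
- move=> a x y dx dy; rewrite -(sn_nrm0 (dual_seminormed sX)); apply: dual_ext => v dv.
  rewrite -[LHS]/(functional (a *: x + y) v - (a * functional x v + functional y v)) functional_lin //.
  by rewrite subrr.
- apply/eqP; rewrite eq_le (dual_ge0 sX (functional_dom d0)) andbT.
  by apply: le_trans (functional_nrm d0) _; rewrite (sn_nrm0 sL) mulr0.
Qed.
End Functional.
End FieldSpaces.

(** * Weak and mild solutions of the Maxwell system *)

Section PairFunctionals.
Context (R : realType) (Omega : set (R3 R)) (oO : open Omega).
Notation L2 := (L2 Omega).
Notation Hcurl := (Hcurl Omega).
Notation ip := (ip Omega).
Notation curl := (curl Omega).
Local Opaque Defs.ip Defs.curl.
Context (D : set (vfield R)).
Let X := @NSpace R (vfield R : lmodType R) D (nrm Hcurl).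
Hypothesis sX : seminormed X.
Hypothesis DH : D `<=` dom Hcurl.
Context (A : vfield R -> vfield R) (K : R) (K0 : 0 <= K).
Hypothesis A_dom : forall u, dom L2 u -> dom L2 (A u).
Hypothesis A_lin : forall a u v, A (a *: u + v) = a *: A u + A v.
Hypothesis A_le : forall u, dom L2 u -> nrm L2 (A u) <= K * nrm L2 u.

Lemma strong_pairing (u : R -> vfield R) : @strong R L2 u ->
  @strong R (dual X) (fun t psi => ip (A (u t)) psi).
Proof.
apply: (@strong_functional R Omega oO X sX (fun psi => psi) _ _ _ A K K0 A_dom A_lin A_le).
- by move=> psi /DH; exact: Hcurl_dom.
- by move=> psi _; exact: nrm_le_Hcurl.
- by move=> a psi phi w /DH h1 /DH h2 dw; exact: (ip_linr a (Hcurl_dom h1) (Hcurl_dom h2) dw).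
Qed.

Lemma strong_curl_pairing (u : R -> vfield R) : @strong R L2 u ->
  @strong R (dual X) (fun t psi => ip (A (u t)) (curl psi)).
Proof.
apply: (@strong_functional R Omega oO X sX curl _ _ _ A K K0 A_dom A_lin A_le).
- by move=> psi _; exact: dom_curl.
- by move=> psi _; exact: nrm_curl_le.
- by move=> a psi phi w /DH h1 /DH h2 dw; rewrite !(ip_sym _ w) (curl_lin oO a h1 h2 dw).
Qed.
End PairFunctionals.

Section MaxwellEvolution.
Context (R : realType) (Omega : set (R3 R)) (lip : bounded_Lipschitz_domain Omega).
Context (T : R) (T0 : 0 < T).
Context (eps mu sigma : mfield R) (eps0 mu0 : R) (heps0 : 0 < eps0) (hmu0 : 0 < mu0).
Context (heps : Linf_mfield Omega eps) (hmu : Linf_mfield Omega mu) (hsigma : Linf_mfield Omega sigma).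
Context (seps : symmetric_mfield Omega eps) (smu : symmetric_mfield Omega mu)
  (ssigma : symmetric_mfield Omega sigma).
Context (ceps : bounded_below_mfield Omega eps0 eps) (cmu : bounded_below_mfield Omega mu0 mu)
  (psigma : bounded_below_mfield Omega 0 sigma).
Notation L2 := (L2 Omega).
Notation Hcurl := (Hcurl Omega).
Notation H0curl := (H0curl Omega).
Notation ip := (ip Omega).
Notation curl := (curl Omega).
Notation mulf := Defs.mulf.
Notation imu := (Defs.invf mu).
Notation ieps := (Defs.invf eps).
Notation state_space := (state_space Omega).
Notation energy := (@energy R Omega eps mu).
Notation Ms := (mass eps).
Notation St := (stiff mu sigma).
Notation tests := (tests Omega).
Local Opaque Defs.ip Defs.curl.
Implicit Types (u v : vfield R) (E B f : R -> vfield R) (U W : R -> state_space).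

Let oO := lip_open lip.
Let limu : Linf_mfield Omega imu. Proof. exact: (invf_Linf oO hmu0 hmu cmu). Qed.
Let lieps : Linf_mfield Omega ieps. Proof. exact: (invf_Linf oO heps0 heps ceps). Qed.
Let H : semi_hilbert energy. Proof. exact: (energy_hilbert lip heps0 hmu0). Qed.
Let sL : seminormed L2. Proof. exact: L2_seminormed. Qed.
Let plin (i : tests) a (u v : state_space) : Ms i (a *: u + v) = a * Ms i u + Ms i v.
Proof. exact: (mass_lin lip heps). Qed.
Let qlin (i : tests) a (u v : state_space) : St i (a *: u + v) = a * St i u + St i v.
Proof. exact: (stiff_lin lip hmu0). Qed.
Let pbd (i : tests) : exists C, forall u : state_space, `|Ms i u| <= C * hn energy u.
Proof. exact: (mass_bd lip heps0 hmu0). Qed.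
Let qbd (i : tests) : exists C, forall u : state_space, `|St i u| <= C * hn energy u.
Proof. exact: (stiff_bd lip heps0 hmu0). Qed.

Let pB (i : tests) (u v : state_space) : Ms i (u - v) = Ms i u - Ms i v.
Proof. by rewrite (addrC u) -scaleN1r plin mulN1r addrC. Qed.
Let qB (i : tests) (u v : state_space) : St i (u - v) = St i u - St i v.
Proof. by rewrite (addrC u) -scaleN1r qlin mulN1r addrC. Qed.

(** The default value 0 turns any field into a component of a state, so no proof of membership has
    to be carried along. *)
Definition mkL2 u : sub_elt (VL2 Omega) := if pselect (dom L2 u) is left h then mkV h else 0.

Lemma mkL2E u : dom L2 u -> sub_val (mkL2 u) = u.
Proof. by move=> du; rewrite /mkL2; case: pselect. Qed.

(** The inverse of [eps] compensates the weight in [mass], so that testing the force gives the plain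
    product with [u]. *)
Definition force u : state_space := (mkL2 (mulf ieps u), 0).

Lemma ip_curl0 w : dom L2 w -> ip w (curl 0) = 0.
Proof.
move=> dw; have := curl_lin oO 1 (Hcurl0 oO) (Hcurl0 oO) dw; rewrite scale1r addr0 mul1r ip_sym.
by move: (ip _ _) => x; lra.
Qed.

Lemma ip0r w : dom L2 w -> ip w 0 = 0.
Proof. by move=> dw; rewrite ip_sym (ip0l oO dw). Qed.

Definition iE (psi : vfield R) (h : dom H0curl psi) : tests := (exist _ psi h, exist _ 0 (Hcurl0 oO)).
Definition iB (phi : vfield R) (h : dom Hcurl phi) : tests := (exist _ 0 (H0curl0 oO), exist _ phi h).

Lemma mass_iE psi (h : dom H0curl psi) (U : state_space) : Ms (iE h) U = ip (mulf eps (sub_val U.1)) psi.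
Proof. by rewrite /mass /= (ip0r (VL2P U.2)) addr0. Qed.

Lemma stiff_iE psi (h : dom H0curl psi) (U : state_space) :
  St (iE h) U = - ip (mulf sigma (sub_val U.1)) psi + ip (mulf imu (sub_val U.2)) (curl psi).
Proof. by rewrite /stiff /= (ip_curl0 (VL2P U.1)) subr0. Qed.

Lemma mass_iB phi (h : dom Hcurl phi) (U : state_space) : Ms (iB h) U = ip (sub_val U.2) phi.
Proof. by rewrite /mass /= (ip0r (dom_mulf oO heps (VL2P U.1))) add0r. Qed.

Lemma stiff_iB phi (h : dom Hcurl phi) (U : state_space) : St (iB h) U = - ip (sub_val U.1) (curl phi).
Proof.
rewrite /stiff /= (ip0r (dom_mulf oO hsigma (VL2P U.1))) (ip_curl0 (dom_mulf oO limu (VL2P U.2))).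
by rewrite oppr0 !add0r.
Qed.

Lemma mass_split (i : tests) (U : state_space) :
  Ms i U = Ms (iE (proj2_sig i.1)) U + Ms (iB (proj2_sig i.2)) U.
Proof. by rewrite mass_iE mass_iB. Qed.

Lemma stiff_split (i : tests) (U : state_space) :
  St i U = St (iE (proj2_sig i.1)) U + St (iB (proj2_sig i.2)) U.
Proof. by rewrite stiff_iE stiff_iB. Qed.

Lemma test_dom1 (i : tests) : dom L2 (proj1_sig i.1).
Proof. by have [h _] := proj2_sig i.1; exact: Hcurl_dom h. Qed.

Lemma mass_force (i : tests) u : dom L2 u -> Ms i (force u) = ip u (proj1_sig i.1).
Proof.
move=> du; rewrite mass_split mass_iE mass_iB /= (ip0l oO) ?addr0; last first.
  by case: i => ? [phi h]; exact: Hcurl_dom h.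
by rewrite mkL2E; [exact: (mulf_invf oO heps0 heps ceps du (test_dom1 i))|exact: dom_mulf].
Qed.

Lemma energy_le : exists2 C : R, 0 < C & forall U : state_space,
  hn energy U <= C * (nrm L2 (sub_val U.1) + nrm L2 (sub_val U.2)).
Proof. exact: (energy_nrm lip heps0 hmu0). Qed.

Lemma le_energy : exists2 C : R, 0 < C & forall U : state_space,
  nrm L2 (sub_val U.1) <= C * hn energy U /\ nrm L2 (sub_val U.2) <= C * hn energy U.
Proof. exact: (nrm_energy lip heps0 hmu0). Qed.

Lemma energy_eq0 (U : state_space) : nrm L2 (sub_val U.1) = 0 -> nrm L2 (sub_val U.2) = 0 -> hn energy U = 0.
Proof.
move=> h1 h2; have [C _ hC] := energy_le; apply/eqP; rewrite eq_le hn_ge0 andbT.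
by have := hC U; rewrite h1 h2 addr0 mulr0.
Qed.

Lemma energy_force_bound : exists2 K : R, 0 <= K &
  (forall u v, dom L2 u -> dom L2 v -> hn energy (force u - force v) <= K * nrm L2 (u - v)) /\
  (forall u, dom L2 u -> hn energy (force u) <= K * nrm L2 u).
Proof.
have [C C0 hC] := energy_le; have [M [M0 hM]] := mulf_bound oO lieps.
have n0 : nrm L2 0 = 0 := sn_nrm0 sL.
exists (C * M); first by rewrite mulr_ge0 // ltW.
split=> [u v du dv|u du].
  apply: le_trans (hC _) _.
  have e1 : sub_val (force u - force v).1 = mulf ieps (u - v).
    rewrite -[LHS]/(sub_val (mkL2 (mulf ieps u)) - sub_val (mkL2 (mulf ieps v))).
    rewrite !mkL2E; try exact: dom_mulf.
    by rewrite addrC -scaleN1r -mulf_lin scaleN1r addrC.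
  have e2 : sub_val (force u - force v).2 = 0 - 0 by [].
  rewrite e1 e2 subr0 n0 addr0 -mulrA ler_wpM2l ?(ltW C0) //; apply: hM; exact: domB.
apply: le_trans (hC _) _; have e2 : sub_val (force u).2 = 0 by [].
rewrite e2 n0 addr0 -mulrA ler_wpM2l ?(ltW C0) //= mkL2E; [exact: hM|exact: dom_mulf].
Qed.

Lemma strong_force f : @strong R L2 f -> @strong R (hn_space energy) (fun t => force (f t)).
Proof.
have [K K0 [h1 h2]] := energy_force_bound; have d0 := dom0 Omega.
apply: (strong_map sL (hn_seminormed H) K0) => //.
  move=> a u v du dv; apply: energy_eq0; last first.
    have -> : sub_val (force (a *: u + v) - (a *: force u + force v)).2 = 0 - (a *: 0 + 0) by [].
    by rewrite scaler0 addr0 subr0; exact: sn_nrm0.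
  have -> : sub_val (force (a *: u + v) - (a *: force u + force v)).1 = 0.
    rewrite -[LHS]/(sub_val (mkL2 (mulf ieps (a *: u + v))) -
      (a *: sub_val (mkL2 (mulf ieps u)) + sub_val (mkL2 (mulf ieps v)))).
    by rewrite !mkL2E ?mulf_lin ?subrr //; try exact: dom_mulf; rewrite -mulf_lin; apply: dom_mulf => //; exact: domD.
  exact: sn_nrm0.
apply/eqP; rewrite eq_le hn_ge0 andbT; apply: le_trans (h2 _ d0) _.
by rewrite (sn_nrm0 sL) mulr0.
Qed.

Lemma good_force f : @strong R L2 f -> good energy T (fun t => force (f t)).
Proof. by move=> sf; exact: (@good_strong R T _ _ H _ (strong_force sf)). Qed.

(** * From weak to mild solutions *)

Definition lift E B (t : R) : state_space := (mkL2 (E (clamp T t)), mkL2 (B (clamp T t))).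

Lemma hcont_lift E B : in_Ct T L2 E -> in_Ct T L2 B -> hcont energy (lift E B).
Proof.
move=> cE cB s; have [C C0 hC] := energy_le.
have k : C * (nrm L2 (E (clamp T t) - E (clamp T s)) + nrm L2 (B (clamp T t) - B (clamp T s))) @[t --> s] --> (0 : R).
  rewrite -[X in _ --> X](mulr0 C) -[X in _ --> C * X](addr0 0).
  by apply: cvgM; [exact: cvg_cst|apply: cvgD; exact: Ct_clamp].
apply/cvgrPdist_lt => e e0; have /cvgrPdist_lt /(_ _ e0) := k; apply: filterS => t.
rewrite !sub0r !normrN (ger0_norm (hn_ge0 _ _)) => h.
apply: le_lt_trans (le_lt_trans (ler_norm _) h); apply: le_trans (hC _) _.
have d (G : R -> vfield R) r : in_Ct T L2 G -> dom L2 (G (clamp T r)) by move=> cG; apply: Ct_dom cG _; exact: clamp_itv.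
have e1 : sub_val (lift E B t - lift E B s).1 = E (clamp T t) - E (clamp T s).
  by rewrite -[LHS]/(sub_val (mkL2 _) - sub_val (mkL2 _)) !mkL2E //; exact: d.
have e2 : sub_val (lift E B t - lift E B s).2 = B (clamp T t) - B (clamp T s).
  by rewrite -[LHS]/(sub_val (mkL2 _) - sub_val (mkL2 _)) !mkL2E //; exact: d.
by rewrite e1 e2.
Qed.

Lemma Ct_hcont U : hcont energy U ->
  in_Ct T L2 (fun t => sub_val (U t).1) /\ in_Ct T L2 (fun t => sub_val (U t).2).
Proof.
move=> hU; have [C C0 hC] := le_energy.
have k s : C * hn energy (U t - U s) @[t --> s] --> (0 : R).
  by rewrite -[X in _ --> X](mulr0 C); apply: cvgM; [exact: cvg_cst|exact: hU].
have key (G : R -> vfield R) : (forall t, dom L2 (G t)) ->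
    (forall t s, nrm L2 (G t - G s) <= C * hn energy (U t - U s)) -> in_Ct T L2 G.
  move=> dG hG s sT; split=> //; apply: cvg_within_filter; apply/cvgrPdist_lt => e e0.
  have /cvgrPdist_lt /(_ _ e0) := k s; apply: filterS => t.
  rewrite !sub0r !normrN => h; apply: le_lt_trans (le_lt_trans (ler_norm _) h).
  by rewrite ger0_norm; [exact: hG|exact: nrm_ge0].
split; apply: key.
- by move=> t; exact: VL2P.
- by move=> t s; have [h _] := hC (U t - U s); exact: h.
- by move=> t; exact: VL2P.
- by move=> t s; have [_ h] := hC (U t - U s); exact: h.
Qed.

Lemma mass_cont (i : tests) U (hU : hcont energy U) : continuous (fun t => Ms i (U t)).
Proof. by have [C hC] := pbd i; exact: (hcont_lin (plin i) hC hU). Qed.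

Lemma stiff_cont (i : tests) U (hU : hcont energy U) : continuous (fun t => St i (U t)).
Proof. by have [C hC] := qbd i; exact: (hcont_lin (qlin i) hC hU). Qed.

Lemma ii_rate (i : tests) U f : hcont energy U -> @strong R L2 f ->
  [/\ ii (fun t => St i (U t)), ii (fun t => Ms i (force (f t))) &
   meas (fun t => St i (U t) + Ms i (force (f t)))].
Proof.
move=> hU sf; have c := @stiff_cont i U hU; split; first exact: ii_continuous.
  exact: (ii_p_good H plin pbd i (good_force sf)).
apply: measurable_funD; first exact: continuous_measurable_fun.
have [x hx] := p_riesz H plin pbd i.
by rewrite /meas; under eq_fun do rewrite hx; exact: (good_m (good_force sf)).
Qed.

Lemma solution_mild f f1 (E0 B0 : vfield R) E B : @strong R L2 f1 -> aet T (fun t => f t = f1 t) ->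
  dom L2 E0 -> dom L2 B0 -> weak_solution Omega T eps mu sigma f E0 B0 (E, B) ->
  mild energy Ms St T (mkL2 E0, mkL2 B0) (fun t => force (f1 t)) (lift E B).
Proof.
move=> sf ef dE0 dB0 [[[_ [gE hgE]] cE] [[_ [gB hgB]] cB] eqE eqB [iniE iniB]].
have hU := hcont_lift cE cB; have df t := sf.1.1 t.
have [_ wE] := @xgetPex _ 0 [set g | in_L2t T (dual H0curl) g /\ weak_deriv T H0curl (embE Omega eps E) g] (ex_intro _ gE hgE).
have [_ wB] := @xgetPex _ 0 [set g | in_L2t T (dual Hcurl) g /\ weak_deriv T Hcurl (embB Omega B) g] (ex_intro _ gB hgB).
have dE t : 0 <= t <= T -> dom L2 (E t) by move=> tT; exact: (Ct_dom cE tT).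
have dB t : 0 <= t <= T -> dom L2 (B t) by move=> tT; exact: (Ct_dom cB tT).
have lE t : 0 < t < T -> sub_val (lift E B t).1 = E t /\ sub_val (lift E B t).2 = B t.
  move=> /andP[t0 tT]; have tT' : 0 <= t <= T by rewrite !ltW.
  by rewrite /lift /= clamp_id // !mkL2E; [|exact: dB|exact: dE].
(* The initial values agree up to null fields, which the functionals do not see. *)
have ini (i : tests) : Ms i (lift E B 0) = Ms i (mkL2 E0, mkL2 B0).
  have c0 : clamp T 0 = 0 by rewrite clamp_id // lexx ltW.
  have t00 : 0 <= (0 : R) <= T by rewrite lexx ltW.
  have z : hn energy (lift E B 0 - (mkL2 E0, mkL2 B0)) = 0.
    apply: energy_eq0.
      rewrite -[sub_val _]/(sub_val (mkL2 _) - sub_val (mkL2 E0)) c0 !mkL2E //; exact: dE.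
    rewrite -[sub_val _]/(sub_val (mkL2 _) - sub_val (mkL2 B0)) c0 !mkL2E //; exact: dB.
  have [C hC] := pbd i; apply/eqP; rewrite -subr_eq0 -normr_eq0 eq_le normr_ge0 andbT.
  have -> : Ms i (lift E B 0) - Ms i (mkL2 E0, mkL2 B0) = Ms i (lift E B 0 - (mkL2 E0, mkL2 B0)).
    by rewrite pB.
  by apply: le_trans (hC _) _; rewrite z mulr0.
pose k (i : tests) t := St i (lift E B t) + Ms i (force (f1 t)).
have ik (i : tests) : ii (k i) by have [h1 h2 _] := ii_rate i hU sf; exact: iiD.
have mk (i : tests) : meas (k i) by have [] := ii_rate i hU sf.
have eqn (i : tests) : (forall th, test_fun (`]0, T[%classic : set R) th ->
    tint T (fun t => Ms i (lift E B t) * derive1 th t) = - tint T (fun t => k i t * th t)) ->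
    forall t, 0 <= t <= T -> Ms i (lift E B t) = Ms i (mkL2 E0, mkL2 B0) + iint (k i) 0 t.
  by move=> h t tT; rewrite -ini; apply: (weak_deriv_integral T0 (@mass_cont i _ hU) (ik i) (mk i) h).
have hE psi (h : dom H0curl psi) : forall t, 0 <= t <= T ->
    Ms (iE h) (lift E B t) = Ms (iE h) (mkL2 E0, mkL2 B0) + iint (k (iE h)) 0 t.
  apply: eqn => th tth.
  transitivity (tint T (fun t => embE Omega eps E t psi * derive1 th t)).
    by apply: tint_ae; apply: aet_all => t tT; rewrite mass_iE (lE t tT).1.
  rewrite [LHS](wE psi h th tth); congr (- _); apply: tint_ae.
  have := aet_and eqE ef; apply: aet_filter => t tT [/(_ psi h) e e1]; congr (_ * _).
  rewrite /k mass_force // stiff_iE (lE t tT).1 (lE t tT).2 /= -e1 -e.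
  by rewrite -/(dt T H0curl (embE Omega eps E)); move: (dt _ _ _ _ _) (ip _ _) (ip _ _) => ? ? ?; ring.
have hB phi (h : dom Hcurl phi) : forall t, 0 <= t <= T ->
    Ms (iB h) (lift E B t) = Ms (iB h) (mkL2 E0, mkL2 B0) + iint (k (iB h)) 0 t.
  apply: eqn => th tth.
  transitivity (tint T (fun t => embB Omega B t phi * derive1 th t)).
    by apply: tint_ae; apply: aet_all => t tT; rewrite mass_iB (lE t tT).2.
  rewrite [LHS](wB phi h th tth); congr (- _); apply: tint_ae.
  apply: aet_filter eqB => t tT /(_ phi h) e; congr (_ * _).
  rewrite /k mass_force // stiff_iB (lE t tT).1 /= (ip0r (df t)) addr0.
  by apply/eqP; rewrite -subr_eq0 opprK; apply/eqP; exact: e.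
split=> [//|t|i t tT]; first by rewrite /lift (clamp_id (clamp_itv t T0)).
rewrite mass_split [Ms i (mkL2 E0, _)]mass_split hE // hB //.
have [a1 a2 _] := ii_rate (iE (proj2_sig i.1)) hU sf; have [b1 b2 _] := ii_rate (iB (proj2_sig i.2)) hU sf.
set j1 := iE _ in a1 a2 *; set j2 := iB _ in b1 b2 *.
have e1 : iint (k j1) 0 t = iint (fun r => St j1 (lift E B r)) 0 t + iint (fun r => Ms j1 (force (f1 r))) 0 t.
  exact: (@iintD R (fun r => St j1 (lift E B r)) (fun r => Ms j1 (force (f1 r))) 0 t a1 a2).
have e2 : iint (k j2) 0 t = iint (fun r => St j2 (lift E B r)) 0 t + iint (fun r => Ms j2 (force (f1 r))) 0 t.
  exact: (@iintD R (fun r => St j2 (lift E B r)) (fun r => Ms j2 (force (f1 r))) 0 t b1 b2).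
have e3 : iint (fun r => St i (lift E B r)) 0 t = iint (fun r => St j1 (lift E B r)) 0 t + iint (fun r => St j2 (lift E B r)) 0 t.
  by apply: etrans (@iintD R (fun r => St j1 (lift E B r)) (fun r => St j2 (lift E B r)) 0 t a1 b1); apply: eq_iint => r _; exact: stiff_split.
have e4 : iint (fun r => Ms i (force (f1 r))) 0 t = iint (fun r => Ms j1 (force (f1 r))) 0 t + iint (fun r => Ms j2 (force (f1 r))) 0 t.
  by apply: etrans (@iintD R (fun r => Ms j1 (force (f1 r))) (fun r => Ms j2 (force (f1 r))) 0 t a2 b2); apply: eq_iint => r _; exact: mass_split.
have fin (a b x y s p s1 s2 p1 p2 : R) : x = s1 + p1 -> y = s2 + p2 -> s = s1 + s2 -> p = p1 + p2 ->
  a + x + (b + y) = a + b + s + p by move=> -> -> -> ->; ring.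
exact: (fin _ _ _ _ _ _ _ _ _ _ e1 e2 e3 e4).
Qed.

(** * From mild to weak solutions *)

Lemma strong0 (X : nspace R) (sX : seminormed X) : @strong R X (fun=> 0).
Proof.
split; last by under eq_fun do rewrite (sn_nrm0 sX); exact: ii_cst.
split=> [t|]; first exact: (sn0 sX).
exists (fun=> [::]) => // t; rewrite (_ : (fun _ => _) = fun=> 0); first exact: cvg_cst.
by apply/funext => n; rewrite /sfun big_nil subrr (sn_nrm0 sX).
Qed.

Lemma L2t_dom (X : nspace R) (g : R -> X) : in_L2t T X g -> aet T (fun t => dom X (g t)).
Proof. by move=> [[s [_ h]] _]; move: h; rewrite /aet; apply: filterS => t h tT; have [] := h tT. Qed.

Lemma strong_L2t_eq (X : nspace R) (sX : seminormed X) (g g1 : R -> X) : @strong R X g1 ->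
  aet T (fun t => g t = g1 t) -> in_L2t T X g.
Proof.
move=> sg e; apply: (strong_L2t sX sg); apply: aet_filter e => t _ ->.
by split; [exact: sg.1.1|rewrite subrr sn_nrm0].
Qed.

Let sH0 : seminormed H0curl. Proof. exact: H0curl_seminormed. Qed.
Let sHc : seminormed Hcurl. Proof. exact: Hcurl_seminormed. Qed.

(** The candidates for the weak time derivatives, read off the two equations. *)
Definition rateE U f (t : R) : dual H0curl := fun psi =>
  ip (f t) psi - ip (mulf sigma (sub_val (U t).1)) psi + ip (mulf imu (sub_val (U t).2)) (curl psi).
Definition rateB U (t : R) : dual Hcurl := fun phi => - ip (sub_val (U t).1) (curl phi).

Section MildSolution.
Context (f1 : R -> vfield R) (sf : @strong R L2 f1) (y : state_space) (U : R -> state_space).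
Hypothesis mU : mild energy Ms St T y (fun t => force (f1 t)) U.
Let E (t : R) := sub_val (U t).1.
Let B (t : R) := sub_val (U t).2.
Let hU : hcont energy U. Proof. by case: mU. Qed.

Lemma mild_Ct : in_Ct T L2 E /\ in_Ct T L2 B.
Proof. exact: Ct_hcont. Qed.

Lemma mild_rate (i : tests) t : 0 <= t <= T ->
  Ms i (U t) = Ms i y + iint (fun r => St i (U r) + Ms i (force (f1 r))) 0 t.
Proof.
move=> tT; have [_ _ /(_ i t tT) ->] := mU; have [h1 h2 _] := ii_rate i hU sf.
have e := @iintD R (fun r => St i (U r)) (fun r => Ms i (force (f1 r))) 0 t h1 h2.
by rewrite -addrA; congr (_ + _); exact: esym e.
Qed.

Lemma rate_weak (i : tests) th : test_fun (`]0, T[%classic : set R) th ->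
  tint T (fun t => Ms i (U t) * derive1 th t) =
  - tint T (fun t => (St i (U t) + Ms i (force (f1 t))) * th t).
Proof.
move=> tth; have [h1 h2 _] := ii_rate i hU sf.
have h3 : ii (fun t => St i (U t) + Ms i (force (f1 t))) by exact: iiD.
exact: (integral_weak_deriv T0 h3 (mild_rate i) tth).
Qed.

(** Bochner measurability comes from the continuity in time of the fields, through bounded maps into
    the dual; the derivative is the integrated equation tested with [iE]. *)
Lemma embE_deriv : [/\ in_L2t T (dual H0curl) (embE Omega eps E),
  in_L2t T (dual H0curl) (rateE U f1) & weak_deriv T H0curl (embE Omega eps E) (rateE U f1)].
Proof.
have [cE cB] := mild_Ct.
have [E1 sE eE] := strong_Ct T0 sL cE; have [B1 sB eB] := strong_Ct T0 sL cB.
have [C1 [C10 h1]] := mulf_bound oO heps; have [C2 [C20 h2]] := mulf_bound oO hsigma.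
have [C3 [C30 h3]] := mulf_bound oO limu.
have sub : dom H0curl `<=` dom Hcurl by move=> u [].
have sD := dual_seminormed sH0.
split.
- have s1 := strong_pairing oO sH0 sub C10 (fun u => dom_mulf oO heps (u := u)) (mulf_lin eps) h1 sE.
  apply: (strong_L2t_eq sD s1); apply: aet_all => t tT; rewrite /embE eE //.
- have s1 := strong_pairing oO sH0 sub C20 (fun u => dom_mulf oO hsigma (u := u)) (mulf_lin sigma) h2 sE.
  have s2 := strong_curl_pairing oO sH0 sub C30 (fun u => dom_mulf oO limu (u := u)) (mulf_lin imu) h3 sB.
  have s3 := strong_pairing oO sH0 sub (A := id) ler01 (fun u h => h) (fun _ _ _ => erefl)
    (fun u _ => eq_ind_r (fun x => nrm L2 u <= x) (lexx _) (mul1r _)) sf.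
  apply: (strong_L2t_eq sD (strong_lin sD 1 s3 (strong_lin sD (-1) s1 s2))).
  apply: aet_all => t tT; apply/funext => psi; rewrite /rateE -/(E t) -/(B t) eE // eB //.
  rewrite -[RHS]/(1 * ip (f1 t) psi + (-1 * ip (mulf sigma (E1 t)) psi + ip (mulf imu (B1 t)) (curl psi))).
  by move: (ip _ _) (ip _ _) (ip _ _) => *; ring.
move=> psi h th tth; apply: etrans (etrans (rate_weak (iE h) tth) _).
  by apply: tint_ae; apply: aet_all => t tT; rewrite mass_iE.
congr (- _); apply: tint_ae; apply: aet_all => t tT; congr (_ * _).
rewrite mass_force ?stiff_iE /rateE /=; last exact: sf.1.1.
by move: (ip _ _) (ip _ _) (ip _ _) => *; ring.
Qed.

Lemma embB_deriv : [/\ in_L2t T (dual Hcurl) (embB Omega B),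
  in_L2t T (dual Hcurl) (rateB U) & weak_deriv T Hcurl (embB Omega B) (rateB U)].
Proof.
have [cE cB] := mild_Ct.
have [E1 sE eE] := strong_Ct T0 sL cE; have [B1 sB eB] := strong_Ct T0 sL cB.
have sub : dom Hcurl `<=` dom Hcurl by [].
have sD := dual_seminormed sHc.
have id_le u : dom L2 u -> nrm L2 u <= 1 * nrm L2 u by rewrite mul1r.
split.
- have s1 := strong_pairing oO sHc sub (A := id) ler01 (fun u h => h) (fun _ _ _ => erefl) id_le sB.
  apply: (strong_L2t_eq sD s1); apply: aet_all => t tT; rewrite /embB eB //.
- have s1 := strong_curl_pairing oO sHc sub (A := id) ler01 (fun u h => h) (fun _ _ _ => erefl) id_le sE.
  apply: (strong_L2t_eq sD (strong_lin sD (-1) s1 (strong0 sD))).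
  apply: aet_all => t tT; apply/funext => psi; rewrite /rateB -/(E t) eE //.
  by rewrite -[RHS]/(-1 * ip (E1 t) (curl psi) + 0) mulN1r addr0.
move=> phi h th tth; apply: etrans (etrans (rate_weak (iB h) tth) _).
  by apply: tint_ae; apply: aet_all => t tT; rewrite mass_iB.
congr (- _); apply: tint_ae; apply: aet_all => t tT; congr (_ * _).
by rewrite mass_force ?stiff_iB /rateB /= ?(ip0r (sf.1.1 t)) ?addr0 //; exact: sf.1.1.
Qed.

Lemma mild_dtE : aet T (fun t => forall psi, dom H0curl psi ->
  dt T H0curl (embE Omega eps E) t psi = rateE U f1 t psi).
Proof. by have [_ h1 h2] := embE_deriv; exact: (dt_unique T0 sH0 h1 h2). Qed.

Lemma mild_dtB : aet T (fun t => forall phi, dom Hcurl phi ->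
  dt T Hcurl (embB Omega B) t phi = rateB U t phi).
Proof. by have [_ h1 h2] := embB_deriv; exact: (dt_unique T0 sHc h1 h2). Qed.

Lemma mild_initial : hn energy (U 0 - y) = 0.
Proof.
apply: (mass_inj lip heps0 hmu0 heps hmu seps smu ceps cmu) => i; rewrite pB.
have t0 : 0 <= (0 : R) <= T by rewrite lexx ltW.
by rewrite mild_rate // iint_refl addr0 subrr.
Qed.

Lemma mild_solution f (E0 B0 : vfield R) : aet T (fun t => f t = f1 t) -> dom L2 E0 -> dom L2 B0 ->
  y = (mkL2 E0, mkL2 B0) -> weak_solution Omega T eps mu sigma f E0 B0 (E, B).
Proof.
move=> ef dE0 dB0 yE; have [cE cB] := mild_Ct.
have [LE LrE wE] := embE_deriv; have [LB LrB wB] := embB_deriv.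
split.
- exact: (conj (conj LE (ex_intro _ (rateE U f1) (conj LrE wE))) cE).
- exact: (conj (conj LB (ex_intro _ (rateB U) (conj LrB wB))) cB).
- have := aet_and mild_dtE ef; apply: aet_filter => t _ [h e] psi dp; rewrite (h psi dp) e /rateE /= -/(E t) -/(B t).
  by move: (ip _ _) (ip _ _) (ip _ _) => *; ring.
- apply: aet_filter mild_dtB => t _ h phi dp; rewrite (h phi dp) /rateB /= -/(E t).
  by move: (ip _ _) => *; ring.
have [C C0 hC] := le_energy; have [n1 n2] := hC (U 0 - y).
have e1 : sub_val (U 0 - y).1 = E 0 - E0.
  by rewrite -[LHS]/(E 0 - sub_val y.1) yE /= mkL2E.
have e2 : sub_val (U 0 - y).2 = B 0 - B0.
  by rewrite -[LHS]/(B 0 - sub_val y.2) yE /= mkL2E.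
rewrite mild_initial mulr0 e1 in n1; rewrite mild_initial mulr0 e2 in n2.
by split; apply/eqP; rewrite eq_le nrm_ge0 andbT.
Qed.

Lemma mild_div_free : div_free Omega (sub_val y.2) -> forall t, 0 <= t <= T -> div_free Omega (B t).
Proof.
move=> dy t tT chi tc; have [h hc0] := curl_grad oO tc.
have := mild_rate (iB h) tT; rewrite !mass_iB -/(B t) => ->; rewrite dy // add0r.
rewrite (eq_iint (g := fun=> 0)) => [|r _]; first by rewrite iint_cst ?mulr0 //; case/andP: tT.
rewrite stiff_iB mass_force /= ?(ip0r (sf.1.1 r)) ?addr0; last exact: sf.1.1.
by rewrite ip_sym hc0 ?oppr0 //; exact: VL2P.
Qed.

(** Being divergence free at every time, the field is continuous with values in [Hdiv0], hence
    measurable and bounded there. *)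
Lemma mild_Linft M : (forall t, 0 <= t <= T -> nrm L2 (B t) <= M) -> div_free Omega (sub_val y.2) ->
  in_Linft T (Hdiv0 Omega) B.
Proof.
move=> hM dy; have sd := Hdiv0_seminormed oO; have [cE cB] := mild_Ct.
have cd : in_Ct T (Hdiv0 Omega) B.
  move=> s sT; have [_ h] := cB s sT; split=> //; split; first exact: VL2P.
  exact: mild_div_free.
have [B1 sB eB] := strong_Ct T0 sd cd; split.
  by have [] := strong_L2t_eq sd sB (aet_all eB).
by exists M; apply: aet_all => t /andP[t0 tT]; apply: hM; rewrite !ltW.
Qed.
End MildSolution.

(** * Bounds for the solution and its time derivatives *)

Lemma rate_bounds : exists2 K : R, 0 <= K & forall f U t M, dom L2 (f t) ->
  nrm L2 (sub_val (U t).1) <= M -> nrm L2 (sub_val (U t).2) <= M ->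
  nrm (dual H0curl) (rateE U f t) <= nrm L2 (f t) + K * M /\ nrm (dual Hcurl) (rateB U t) <= M.
Proof.
have [C2 [C20 h2]] := mulf_bound oO hsigma; have [C3 [C30 h3]] := mulf_bound oO limu.
exists (C2 + C3); first exact: addr_ge0.
move=> f U t M df hE hB; have M0 : 0 <= M by apply: le_trans hE; exact: nrm_ge0.
have [dE dB] := (VL2P (U t).1, VL2P (U t).2); split; apply: dual_le => //.
- by rewrite addr_ge0 ?nrm_ge0 // mulr_ge0 // addr_ge0.
- move=> psi [hp _]; have dp := Hcurl_dom hp; have dc := dom_curl Omega psi.
  have k1 := ip_cs oO df dp; have k2 := ip_cs oO (dom_mulf oO hsigma dE) dp.
  have k3 := ip_cs oO (dom_mulf oO limu dB) dc.
  have [n1 n2] := (nrm_le_Hcurl Omega psi, nrm_curl_le Omega psi).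
  have n0 := nrm_ge0 Omega psi; have n0' := nrm_ge0 Omega (curl psi).
  have q2 : nrm L2 (mulf sigma (sub_val (U t).1)) <= C2 * M by apply: le_trans (h2 _ dE) _; rewrite ler_wpM2l.
  have q3 : nrm L2 (mulf imu (sub_val (U t).2)) <= C3 * M by apply: le_trans (h3 _ dB) _; rewrite ler_wpM2l.
  rewrite -[nrm H0curl psi]/(nrm Hcurl psi).
  apply: (@le_trans _ _ (nrm L2 (f t) * nrm Hcurl psi + C2 * M * nrm Hcurl psi + C3 * M * nrm Hcurl psi)); last first.
    by rewrite !mulrDl !addrA.
  apply: le_trans (ler_normD _ _) _; apply: lerD; last first.
    by apply: le_trans k3 _; apply: ler_pM => //; exact: nrm_ge0.
  apply: le_trans (ler_normB _ _) _; apply: lerD.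
    by apply: le_trans k1 _; rewrite ler_wpM2l // nrm_ge0.
  by apply: le_trans k2 _; apply: ler_pM => //; exact: nrm_ge0.
- move=> phi hp; rewrite /rateB normrN; have dc := dom_curl Omega phi.
  apply: le_trans (ip_cs oO dE dc) _; apply: ler_pM => //; [exact: nrm_ge0|exact: nrm_ge0|exact: nrm_curl_le].
Qed.

Lemma dt_bound : exists2 K : R, 0 <= K & forall f1 (y : state_space) U M, @strong R L2 f1 ->
  mild energy Ms St T y (fun t => force (f1 t)) U ->
  (forall t, 0 <= t <= T -> nrm L2 (sub_val (U t).1) <= M /\ nrm L2 (sub_val (U t).2) <= M) ->
  nrm_L2t T (dual H0curl) (dt T H0curl (embE Omega eps (fun t => sub_val (U t).1))) <=
    K * (Num.sqrt (iint (fun t => nrm L2 (f1 t) ^+ 2) 0 T) + M) /\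
  nrm_L2t T (dual Hcurl) (dt T Hcurl (embB Omega (fun t => sub_val (U t).2))) <=
    K * (Num.sqrt (iint (fun t => nrm L2 (f1 t) ^+ 2) 0 T) + M).
Proof.
(* One majorant serves both derivatives: the square of a sum gives the 2 and the [2 * C ^+ 2] for
   the electric one, and the 1 covers the magnetic one; the constant part is integrated over a time
   [T]. *)
have [C C0 hC] := rate_bounds; pose K := Num.sqrt (2 + (2 * C ^+ 2 + 1) * T).
have K2 : K ^+ 2 = 2 + (2 * C ^+ 2 + 1) * T.
  by rewrite sqr_sqrtr // addr_ge0 // mulr_ge0 ?(ltW T0) // addr_ge0 // mulr_ge0 // sqr_ge0.
have K0 : 0 <= K by exact: sqrtr_ge0.
exists K => // f1 y U M sf mU hM.
have M0 : 0 <= M by have [h _] := hM 0 (introT andP (conj (lexx 0) (ltW T0))); apply: le_trans h; exact: nrm_ge0.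
set N := iint _ 0 T.
have N0 : 0 <= N by apply: iint_ge0 => t _; exact: sqr_ge0.
have i2 := sf.2.
have ih : ii (fun t => 2 * nrm L2 (f1 t) ^+ 2 + (2 * C ^+ 2 + 1) * M ^+ 2) by apply: iiD; [exact: iiZ|exact: ii_cst].
have h0 t : 0 <= 2 * nrm L2 (f1 t) ^+ 2 + (2 * C ^+ 2 + 1) * M ^+ 2.
  by rewrite addr_ge0 // mulr_ge0 ?sqr_ge0 // addr_ge0 // mulr_ge0 // sqr_ge0.
have key (h : R -> R) : (forall t, 0 <= h t) -> aet T (fun t => h t <= 2 * nrm L2 (f1 t) ^+ 2 + (2 * C ^+ 2 + 1) * M ^+ 2) ->
    Num.sqrt (tint T h) <= K * (Num.sqrt N + M).
  move=> hh hae; have le := tint_le hh h0 ih hae.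
  rewrite -[leRHS]ger0_norm ?mulr_ge0 ?addr_ge0 ?sqrtr_ge0 // -sqrtr_sqr ler_wsqrtr //.
  apply: le_trans le _.
  have -> : iint (fun t => 2 * nrm L2 (f1 t) ^+ 2 + (2 * C ^+ 2 + 1) * M ^+ 2) 0 T = 2 * N + T * ((2 * C ^+ 2 + 1) * M ^+ 2).
    apply: etrans (@iintD R (fun t => 2 * nrm L2 (f1 t) ^+ 2) (fun=> (2 * C ^+ 2 + 1) * M ^+ 2) 0 T (iiZ 2 i2) (ii_cst _)) _.
    by rewrite (iint_cst _ (ltW T0)) subr0; congr (_ + _); exact: (iintZ 2 0 T i2).
  have [s0 sN] : 0 <= Num.sqrt N /\ Num.sqrt N ^+ 2 = N by rewrite sqrtr_ge0 sqr_sqrtr.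
  rewrite exprMn K2 sqrrD sN.
  have q1 : 0 <= Num.sqrt N * M by exact: mulr_ge0.
  have q2 : 0 <= (2 * C ^+ 2 + 1) * T by rewrite mulr_ge0 ?(ltW T0) // addr_ge0 // mulr_ge0 // sqr_ge0.
  have q3 := mulr_ge0 q2 q1; have q4 := mulr_ge0 q2 N0; have q5 := sqr_ge0 M.
  have fin (d n a b : R) : 0 <= a -> 0 <= d * T * a -> 0 <= d * T * n -> 0 <= b ->
      2 * n + T * (d * b) <= (2 + d * T) * (n + a *+ 2 + b) by move=> *; lra.
  exact: fin q1 q3 q4 q5.
have bnd t : 0 < t < T -> nrm (dual H0curl) (rateE U f1 t) <= nrm L2 (f1 t) + C * M /\ nrm (dual Hcurl) (rateB U t) <= M.
  by move=> /andP[t1 t2]; have [b1 b2] := hM t (introT andP (conj (ltW t1) (ltW t2))); apply: hC => //; exact: sf.1.1.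
have C2 : 0 <= C ^+ 2 * M ^+ 2 by rewrite mulr_ge0 ?sqr_ge0.
have [_ LE _] := embE_deriv sf mU; have [_ LB _] := embB_deriv sf mU.
have sq (a b : R) : 0 <= a -> a <= b -> a ^+ 2 <= b ^+ 2.
  by move=> a0 ab; rewrite ler_pXn2r ?nnegrE // (le_trans a0 ab).
split; apply: key => [t|]; rewrite ?sqr_ge0 //.
  have := aet_and (mild_dtE sf mU) (L2t_dom LE); apply: aet_filter => t tT [h d].
  have [b _] := bnd t tT; rewrite (dual_ext h); apply: le_trans (sq _ _ (dual_ge0 sH0 d) b) _.
  have fin (x c m : R) : (x + c * m) ^+ 2 <= 2 * x ^+ 2 + (2 * c ^+ 2 + 1) * m ^+ 2.
    by have := sqr_ge0 (x - c * m); have := sqr_ge0 m; lra.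
  exact: fin.
have := aet_and (mild_dtB sf mU) (L2t_dom LB); apply: aet_filter => t tT [h d].
have [_ b] := bnd t tT; rewrite (dual_ext h); apply: le_trans (sq _ _ (dual_ge0 sHc d) b) _.
have := sqr_ge0 (nrm L2 (f1 t)); move: C2; move: (C ^+ 2) (M ^+ 2) (nrm L2 (f1 t) ^+ 2) => c m n; lra.
Qed.

(** Arithmetic of the final estimate: [x1] and [x2] stand for the norms of the derivatives, [x3] and
    [x4] for those of the fields, [n] for the norm of the force and [d] for that of all data. *)
Lemma sum4_bound (k x1 x2 x3 x4 a d n : R) : x1 <= k * (n + a * d) -> x2 <= k * (n + a * d) ->
  x3 <= a * d -> x4 <= a * d -> k * (n + a * d) <= k * (d + a * d) -> 0 <= a * d -> 0 <= d ->
  x1 + x2 + x3 + x4 <= (2 * k * (1 + a) + 2 * a + a + 1) * d.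
Proof. move=> *; lra. Qed.

(** * Linear dependence on the data and uniqueness *)

Let pinj (w : state_space) : (forall i, Ms i w = 0) -> hn energy w = 0.
Proof. exact: (mass_inj lip heps0 hmu0 heps hmu seps smu ceps cmu). Qed.
Let diss (u w : state_space) : gr Ms St u w -> energy w u <= 0.
Proof. exact: (maxwell_diss lip hmu0 heps hmu hsigma smu cmu psigma). Qed.
Let range (h : R) (F : state_space) : 0 < h -> exists u : state_space, gr Ms St u (h^-1 *: (u - F)).
Proof. exact: (maxwell_range lip heps0 hmu0 heps hmu hsigma seps smu ssigma ceps cmu psigma). Qed.

Lemma iint_comb3 (a b : R) (k l j : R -> R) t : ii k -> ii l -> ii j ->
  iint (fun r => a * k r + (b * l r + j r)) 0 t = a * iint k 0 t + (b * iint l 0 t + iint j 0 t).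
Proof.
by move=> ik il ij; rewrite iintD ?iintD ?iintZ //; [exact: iiZ|exact: iiZ|apply: iiD => //; exact: iiZ].
Qed.

Lemma hcont_comb (a : R) U W : hcont energy U -> hcont energy W -> hcont energy (fun t => a *: U t + W t).
Proof.
move=> hU hW s; apply/cvgrPdist_lt => e e0.
have k : `|a| * hn energy (U t - U s) + hn energy (W t - W s) @[t --> s] --> (0 : R).
  rewrite -[X in _ --> X](addr0 (0 : R)); apply: cvgD; last exact: hW.
  by rewrite -[X in _ --> X](mulr0 `|a|); apply: cvgM; [exact: cvg_cst|exact: hU].
have /cvgrPdist_lt /(_ _ e0) := k; apply: filterS => t; rewrite !sub0r !normrN => h.
apply: le_lt_trans (le_lt_trans (ler_norm _) h); rewrite (ger0_norm (hn_ge0 _ _)) -(hnZ H).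
rewrite opprD addrACA -scalerBr; exact: (hnD H).
Qed.

Lemma aet_sub (P : R -> Prop) t : t <= T -> aet T P -> aet t P.
Proof.
move=> tT; rewrite /aet; apply: filterS => r h /=; rewrite in_itv /= => /andP[r0 rt]; apply: h.
by rewrite /= in_itv /= r0 (lt_le_trans rt).
Qed.

Lemma iint_ae0 (h : R -> R) t : 0 <= t <= T -> aet T (fun r => h r = 0) -> iint h 0 t = 0.
Proof.
move=> /andP[t0 tT] h0; rewrite -tint_iint (tint_ae (h' := fun=> 0)) ?tint_iint; last exact: aet_sub h0.
by rewrite (iint_cst _ t0) mulr0.
Qed.

(** The combination [V] of the three solutions is a mild solution with zero data. The right-hand
    sides are related through pairings only, because the curl is linear up to null fields. *)
Lemma solution_lin (c d : R) f g h f1 g1 h1 (E0 B0 E1 B1 E2 B2 : vfield R) E B E' B' E'' B'' :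
  @strong R L2 f1 -> @strong R L2 g1 -> @strong R L2 h1 ->
  aet T (fun t => f t = f1 t) -> aet T (fun t => g t = g1 t) -> aet T (fun t => h t = h1 t) ->
  dom L2 E1 -> dom L2 B1 -> dom L2 E2 -> dom L2 B2 ->
  E0 = c *: E1 + d *: E2 -> B0 = c *: B1 + d *: B2 ->
  aet T (fun t => forall psi, dom L2 psi -> ip (f t) psi = c * ip (g t) psi + d * ip (h t) psi) ->
  weak_solution Omega T eps mu sigma f E0 B0 (E, B) ->
  weak_solution Omega T eps mu sigma g E1 B1 (E', B') ->
  weak_solution Omega T eps mu sigma h E2 B2 (E'', B'') ->
  forall t, 0 <= t <= T -> nrm L2 (E t - (c *: E' t + d *: E'' t)) = 0 /\
    nrm L2 (B t - (c *: B' t + d *: B'' t)) = 0.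
Proof.
move=> sf sg sh ef eg eh d1 b1 d2 b2 eE0 eB0 efgh wf wg wh.
have comb (u v : vfield R) : dom L2 u -> dom L2 v -> dom L2 (c *: u + d *: v).
  by move=> du dv; apply: (sn_lin sL) => //; exact: (snZ sL).
have d0 : dom L2 E0 by rewrite eE0; exact: comb.
have b0 : dom L2 B0 by rewrite eB0; exact: comb.
have mf := solution_mild sf ef d0 b0 wf; have mg := solution_mild sg eg d1 b1 wg.
have mh := solution_mild sh eh d2 b2 wh.
have [hf _ _] := mf; have [hg _ _] := mg; have [hh _ _] := mh.
pose V t := (- c) *: lift E' B' t + ((- d) *: lift E'' B'' t + lift E B t).
have hV : hcont energy V by exact: (@hcont_comb (- c) (lift E' B') _ hg (@hcont_comb (- d) (lift E'' B'') (lift E B) hh hf)).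
pose y0 : state_space := (mkL2 E0, mkL2 B0); pose y1 : state_space := (mkL2 E1, mkL2 B1).
pose y2 : state_space := (mkL2 E2, mkL2 B2).
have ey : hn energy (y0 - (c *: y1 + d *: y2)) = 0.
  apply: energy_eq0.
    rewrite -[sub_val _]/(sub_val (mkL2 E0) - (c *: sub_val (mkL2 E1) + d *: sub_val (mkL2 E2))).
    by rewrite !mkL2E // eE0 subrr (sn_nrm0 sL).
  rewrite -[sub_val _]/(sub_val (mkL2 B0) - (c *: sub_val (mkL2 B1) + d *: sub_val (mkL2 B2))).
  by rewrite !mkL2E // eB0 subrr (sn_nrm0 sL).
have pZ (i : tests) a (u : state_space) : Ms i (a *: u) = a * Ms i u.
  have z : Ms i 0 = 0 by have := plin i 1 0 0; rewrite scale1r addr0 mul1r => k; lra.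
  by have := plin i a u 0; rewrite addr0 z addr0.
have my (i : tests) : Ms i y0 = c * Ms i y1 + d * Ms i y2.
  have [C hC] := pbd i; have := hC (y0 - (c *: y1 + d *: y2)); rewrite ey mulr0 normr_le0 pB plin pZ.
  by rewrite subr_eq0 => /eqP.
have eqV (i : tests) t : 0 <= t <= T -> Ms i (V t) = iint (fun r => St i (V r)) 0 t.
  move=> tT; rewrite /V !plin (mild_rate sf mf i tT) (mild_rate sg mg i tT) (mild_rate sh mh i tT).
  rewrite -/y0 -/y1 -/y2 my.
  have [f2 f3 _] := ii_rate i hf sf; have [g2 g3 _] := ii_rate i hg sg; have [h2 h3 _] := ii_rate i hh sh.
  pose kf r := St i (lift E B r); pose kg r := St i (lift E' B' r); pose kh r := St i (lift E'' B'' r).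
  pose lf r := Ms i (force (f1 r)); pose lg r := Ms i (force (g1 r)); pose lh r := Ms i (force (h1 r)).
  have z : iint (fun r => (- c) * lg r + ((- d) * lh r + lf r)) 0 t = 0.
    apply: iint_ae0 => //; have := aet_and efgh (aet_and ef (aet_and eg eh)).
    apply: aet_filter => r _ [k [e1 [e2 e3]]]; rewrite /lf /lg /lh !mass_force; try by [exact: sf.1.1|exact: sg.1.1|exact: sh.1.1].
    rewrite -e1 -e2 -e3 k; last exact: test_dom1.
    by move: (ip _ _) (ip _ _) => *; ring.
  have q1 : iint (fun r => St i (V r)) 0 t = (- c) * iint kg 0 t + ((- d) * iint kh 0 t + iint kf 0 t).
    apply: etrans (_ : iint (fun r => (- c) * kg r + ((- d) * kh r + kf r)) 0 t = _).
      by apply: eq_iint => r _; rewrite /V !qlin.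
    exact: (@iint_comb3 _ _ kg kh kf t g2 h2 f2).
  have q2 : (- c) * iint lg 0 t + ((- d) * iint lh 0 t + iint lf 0 t) = 0.
    exact: (etrans (esym (@iint_comb3 (- c) (- d) lg lh lf t g3 h3 f3)) z).
  have e1 : iint (fun r => St i (lift E B r) + Ms i (force (f1 r))) 0 t = iint kf 0 t + iint lf 0 t.
    exact: (@iintD R kf lf 0 t f2 f3).
  have e2 : iint (fun r => St i (lift E' B' r) + Ms i (force (g1 r))) 0 t = iint kg 0 t + iint lg 0 t.
    exact: (@iintD R kg lg 0 t g2 g3).
  have e3 : iint (fun r => St i (lift E'' B'' r) + Ms i (force (h1 r))) 0 t = iint kh 0 t + iint lh 0 t.
    exact: (@iintD R kh lh 0 t h2 h3).
  have fin (u1 u2 x1 x2 x3 s q a1 a2 a3 a4 a5 a6 : R) : s = (- c) * a1 + ((- d) * a2 + a3) ->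
     (- c) * a4 + ((- d) * a5 + a6) = 0 -> x3 = a3 + a6 -> x1 = a1 + a4 -> x2 = a2 + a5 ->
     (- c) * (u1 + x1) + ((- d) * (u2 + x2) + (c * u1 + d * u2 + x3)) = s.
    by move=> -> k -> -> ->; rewrite -[RHS]addr0 -k; ring.
  exact: (fin _ _ _ _ _ _ 0 _ _ _ _ _ _ q1 q2 e1 e2 e3).
have Vz := mild_unique H qlin qbd pinj diss T0 hV eqV.
move=> t tT; have [C C0 hC] := le_energy; have [n1 n2] := hC (V t); rewrite (Vz t tT) mulr0 in n1 n2.
have dm (G : R -> vfield R) : in_Ct T L2 G -> dom L2 (G t) by move=> cG; exact: (Ct_dom cG tT).
have [[_ cE] [_ cB] _ _ _] := wf; have [[_ cE'] [_ cB'] _ _ _] := wg; have [[_ cE''] [_ cB''] _ _ _] := wh.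
have v1 : sub_val (V t).1 = E t - (c *: E' t + d *: E'' t).
  rewrite -[LHS]/((- c) *: sub_val (mkL2 (E' (clamp T t))) + ((- d) *: sub_val (mkL2 (E'' (clamp T t))) + sub_val (mkL2 (E (clamp T t))))).
  rewrite (clamp_id tT) (mkL2E (dm E' cE')) (mkL2E (dm E'' cE'')) (mkL2E (dm E cE)).
  by rewrite !scaleNr addrA -opprD addrC.
have v2 : sub_val (V t).2 = B t - (c *: B' t + d *: B'' t).
  rewrite -[LHS]/((- c) *: sub_val (mkL2 (B' (clamp T t))) + ((- d) *: sub_val (mkL2 (B'' (clamp T t))) + sub_val (mkL2 (B (clamp T t))))).
  rewrite (clamp_id tT) (mkL2E (dm B' cB')) (mkL2E (dm B'' cB'')) (mkL2E (dm B cB)).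
  by rewrite !scaleNr addrA -opprD addrC.
have le0 (w : vfield R) (h0 : nrm L2 w <= 0) : nrm L2 w = 0 by apply/eqP; rewrite eq_le h0 nrm_ge0.
exact: (conj (le0 _ (eq_ind _ (fun w => nrm L2 w <= 0) n1 _ v1)) (le0 _ (eq_ind _ (fun w => nrm L2 w <= 0) n2 _ v2))).
Qed.

Lemma solution_unique f f1 (E0 B0 : vfield R) E B E' B' : @strong R L2 f1 -> aet T (fun t => f t = f1 t) ->
  dom L2 E0 -> dom L2 B0 -> weak_solution Omega T eps mu sigma f E0 B0 (E, B) ->
  weak_solution Omega T eps mu sigma f E0 B0 (E', B') ->
  forall t, 0 <= t <= T -> nrm L2 (E' t - E t) = 0 /\ nrm L2 (B' t - B t) = 0.
Proof.
move=> sf ef dE0 dB0 w w' t tT.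
(* Uniqueness is linear dependence with coefficients 1 and 0. *)
have e (u : vfield R) : u = 1 *: u + 0 *: u by rewrite scale1r scale0r addr0.
have rl : aet T (fun t => forall psi, dom L2 psi -> ip (f t) psi = 1 * ip (f t) psi + 0 * ip (f t) psi).
  by apply: aet_all => s _ psi _; rewrite mul1r mul0r addr0.
have := solution_lin sf sf sf ef ef ef dE0 dB0 dE0 dB0 (e E0) (e B0) rl w' w w tT.
by rewrite -!e.
Qed.

Lemma existence_bound : exists2 K : R, 0 < K & forall f f1 (E0 B0 : vfield R), @strong R L2 f1 ->
  aet T (fun t => f t = f1 t) -> dom L2 E0 -> dom (Hdiv0 Omega) B0 ->
  let D := Num.sqrt (iint (fun t => nrm L2 (f1 t) ^+ 2) 0 T) + nrm L2 E0 + nrm L2 B0 in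
  exists E B, [/\ weak_solution Omega T eps mu sigma f E0 B0 (E, B), in_Linft T (Hdiv0 Omega) B,
    forall t, 0 <= t <= T -> nrm L2 (E t) <= K * D /\ nrm L2 (B t) <= K * D &
    nrm_L2t T (dual H0curl) (dt T H0curl (embE Omega eps E)) + nrm_L2t T (dual Hcurl) (dt T Hcurl (embB Omega B))
      + nrm_Ct T L2 E + nrm_Ct T L2 B <= K * D].
Proof.
have [C1 C10 h1] := le_energy; have [C2 C20 h2] := energy_le; have [Kf Kf0 [_ h3]] := energy_force_bound.
have [Kd Kd0 h4] := dt_bound.
(* [C1] and [C2] convert between the energy norm and the L^2 norms, [Kf] bounds the force, and the
   square root of [T] comes from its L^1 norm in time. *)
pose A := C1 * (C2 + Kf * Num.sqrt T).
have A0 : 0 <= A by rewrite mulr_ge0 ?(ltW C10) // addr_ge0 ?(ltW C20) // mulr_ge0 // sqrtr_ge0.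
have K0 : 0 <= 2 * Kd * (1 + A) + 2 * A by rewrite addr_ge0 // mulr_ge0 // ?mulr_ge0 // addr_ge0.
exists (2 * Kd * (1 + A) + 2 * A + A + 1); first by rewrite ltr_wpDl // addr_ge0.
move=> f f1 E0 B0 sf ef dE0 [dB0 divB0] D.
pose N := Num.sqrt (iint (fun t => nrm L2 (f1 t) ^+ 2) 0 T); have N0 : 0 <= N by exact: sqrtr_ge0.
have [e0 b0] := (nrm_ge0 Omega E0, nrm_ge0 Omega B0).
have DE : D = N + nrm L2 E0 + nrm L2 B0 by [].
have D0 : 0 <= D by rewrite DE !addr_ge0.
clearbody D; move: DE => DE.
have [U [mU bU]] := mild_exists H plin qlin pbd qbd pinj diss range T0 (mkL2 E0, mkL2 B0) (good_force sf).
have iN : iint (fun r => hn energy (force (f1 r))) 0 T <= Kf * (Num.sqrt T * N).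
  have i1 := strong_ii sL sf.
  apply: (@le_trans _ _ (Kf * iint (fun r => nrm L2 (f1 r)) 0 T)).
    rewrite -(@iintZ R Kf (fun r => nrm L2 (f1 r)) 0 T i1); apply: iint_le.
    - exact: good_ii (good_force sf).
    - exact: iiZ.
    - by move=> r _; apply: h3; exact: sf.1.1.
  by rewrite ler_wpM2l //; apply: iint_cs => //; [exact: sf.2|move=> t; exact: nrm_ge0].
have yN : hn energy ((mkL2 E0, mkL2 B0) : state_space) <= C2 * (nrm L2 E0 + nrm L2 B0).
  by apply: le_trans (h2 _) _; rewrite /= !mkL2E.
have bM t : 0 <= t <= T -> C1 * hn energy (U t) <= A * D.
  move=> tT; have k := bU t tT.
  have k2 : hn energy (U t) <= C2 * (nrm L2 E0 + nrm L2 B0) + Kf * (Num.sqrt T * N).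
    by apply: le_trans k _; exact: lerD.
  rewrite /A -mulrA ler_wpM2l ?(ltW C10) //; apply: le_trans k2 _.
  have s0 : 0 <= Kf * Num.sqrt T by rewrite mulr_ge0 // sqrtr_ge0.
  have fin (x n e b : R) : 0 <= x -> 0 <= n -> 0 <= e -> 0 <= b ->
      C2 * (e + b) + x * n <= (C2 + x) * (n + e + b).
    move=> x0 n0 e1 b1; have := mulr_ge0 x0 e1; have := mulr_ge0 x0 b1; have := mulr_ge0 (ltW C20) n0; lra.
  by rewrite DE mulrA; exact: fin.
have bU' t : 0 <= t <= T -> nrm L2 (sub_val (U t).1) <= A * D /\ nrm L2 (sub_val (U t).2) <= A * D.
  by move=> tT; have [k1 k2] := h1 (U t); have k3 := bM t tT; split; [exact: le_trans k1 k3|exact: le_trans k2 k3].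
have AD : A * D <= (2 * Kd * (1 + A) + 2 * A + A + 1) * D.
  by rewrite ler_wpM2r // -addrA addrC -addrA lerDl addr_ge0.
exists (fun t => sub_val (U t).1), (fun t => sub_val (U t).2); split.
- exact: (mild_solution sf mU ef dE0 dB0 erefl).
- apply: (mild_Linft sf mU (M := A * D)); first by move=> t tT; have [] := bU' t tT.
  by rewrite /= mkL2E.
- by move=> t tT; have [k1 k2] := bU' t tT; split; [exact: le_trans k1 AD|exact: le_trans k2 AD].
have [k1 k2] := h4 f1 _ U (A * D) sf mU bU'; rewrite -/N in k1 k2.
have ct (G : R -> vfield R) : (forall t, 0 <= t <= T -> nrm L2 (G t) <= A * D) -> nrm_Ct T L2 G <= A * D.
  move=> hG; apply: ge_sup; first by exists (nrm L2 (G 0)), 0 => //=; rewrite in_itv /= lexx ltW.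
  by move=> _ [t /= tT <-]; apply: hG; move: tT; rewrite in_itv.
have k3 := ct _ (fun t tT => (bU' t tT).1); have k4 := ct _ (fun t tT => (bU' t tT).2).
have ND : N <= D by rewrite DE -addrA lerDl addr_ge0.
have kk : Kd * (N + A * D) <= Kd * (D + A * D) by rewrite ler_wpM2l // lerD2r.
by apply: (sum4_bound k1 k2 k3 k4 kk _ D0); rewrite mulr_ge0.
Qed.

(** * The control-to-state map *)

Lemma L2t0 (X : nspace R) (sX : seminormed X) : in_L2t T X (fun=> 0).
Proof. by apply: (strong_L2t_eq sX (strong0 sX)); exact: aet_all. Qed.

Lemma L2t_lin (X : nspace R) (sX : seminormed X) (a : R) (g h : R -> X) :
  in_L2t T X g -> in_L2t T X h -> in_L2t T X (fun t => a *: g t + h t).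
Proof.
move=> /(L2t_strong sX)[g1 sg eg] /(L2t_strong sX)[h1 sh eh].
apply: (strong_L2t_eq sX (strong_lin sX a sg sh)).
by apply: aet_filter (aet_and eg eh) => t _ [-> ->].
Qed.

Lemma Z_lin (c d : R) (z1 z2 : R -> vfield R) : in_Z Omega T z1 -> in_Z Omega T z2 ->
  in_Z Omega T (c *: z1 + d *: z2).
Proof.
move=> h1 h2; apply: (L2t_lin sHc c h1 (h := fun t => d *: z2 t)).
have := L2t_lin sHc d h2 (L2t0 sHc); rewrite (_ : (fun t => _) = (fun t => d *: z2 t)) //.
by apply/funext => t; rewrite addr0.
Qed.

Lemma iint_lin2 (a b : R) (k l : R -> R) : ii k -> ii l ->
  iint (fun r => a * k r + b * l r) 0 T = a * iint k 0 T + b * iint l 0 T.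
Proof. by move=> ik il; rewrite iintD ?iintZ //; exact: iiZ. Qed.

Lemma sqr_sqrt_tint (h : R -> R) x : tint T h = x -> 0 <= x -> Num.sqrt (tint T h) ^+ 2 = x.
Proof. by move=> ->; exact: sqr_sqrtr. Qed.

Lemma rhs_strong (a1 a2 : R) : 0 < a1 -> 0 < a2 -> exists2 K : R, 0 <= K &
  forall Isrc z, in_L2t T L2 Isrc -> in_Z Omega T z -> exists f1, [/\ @strong R L2 f1,
    aet T (fun t => rhs Omega Isrc z t = f1 t) &
    Num.sqrt (iint (fun t => nrm L2 (f1 t) ^+ 2) 0 T) <= K * (nrm_L2t T L2 Isrc + nrm_Z Omega T a1 a2 z)].
Proof.
(* The square of the sum of the source and the curl costs a factor 2, and the weight [a2] in the
   norm of the control is divided out. *)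
move=> a10 a20; pose K := Num.sqrt (2 + 2 * a2^-1).
have ia : 0 <= a2^-1 by rewrite invr_ge0 ltW.
have KK : K ^+ 2 = 2 + 2 * a2^-1 by rewrite sqr_sqrtr // addr_ge0 // mulr_ge0.
have K0 : 0 <= K by exact: sqrtr_ge0.
exists K => // Isrc z LI LZ; have [I1 sI eI] := L2t_strong sL LI; have [z1 sz ez] := L2t_strong sHc LZ.
have sc : @strong R L2 (fun t => curl (z1 t)).
  apply: (@strong_map R Hcurl L2 sHc sL curl 1 z1 ler01) sz.
  - by move=> u _; exact: dom_curl.
  - by move=> u v hu hv; rewrite mul1r (nrm_curlB oO hu hv) nrm_curl_le.
  - by move=> a u v hu hv; exact: (curl_lin_nrm oO).
  - apply/eqP; rewrite eq_le nrm_ge0 andbT; apply: le_trans (nrm_curl_le _ _) _.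
    by rewrite (sn_nrm0 sHc).
have sz2 : @strong R L2 z1.
  apply: (@strong_map R Hcurl L2 sHc sL (fun u => u) 1 z1 ler01) sz.
  - by move=> u; exact: Hcurl_dom.
  - by move=> u v hu hv; rewrite mul1r; exact: nrm_le_Hcurl.
  - by move=> a u v hu hv; rewrite subrr (sn_nrm0 sL).
  - exact: (sn_nrm0 sL).
have sf := strong_lin sL 1 sI sc; exists (fun t => 1 *: I1 t + curl (z1 t)); split => //.
  by apply: aet_filter (aet_and eI ez) => t _ [e1 e2]; rewrite /rhs e1 e2 scale1r.
set N := nrm_L2t _ _ _; set Z := nrm_Z _ _ _ _ _.
have N0 : 0 <= N by exact: sqrtr_ge0.
have Z0 : 0 <= Z by exact: sqrtr_ge0.
have NE : N ^+ 2 = iint (fun t => nrm L2 (I1 t) ^+ 2) 0 T.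
  have e : tint T (fun t => nrm L2 (Isrc t) ^+ 2) = iint (fun t => nrm L2 (I1 t) ^+ 2) 0 T.
    by rewrite -tint_iint; apply: tint_ae; apply: aet_filter eI => t _ ->.
  by apply: (sqr_sqrt_tint e); apply: iint_ge0 => t _; exact: sqr_ge0.
have ZE : a2 * iint (fun t => nrm L2 (curl (z1 t)) ^+ 2) 0 T <= Z ^+ 2.
  have e : tint T (fun t => a1 * nrm L2 (z t) ^+ 2 + a2 * nrm L2 (curl (z t)) ^+ 2) =
      iint (fun t => a1 * nrm L2 (z1 t) ^+ 2 + a2 * nrm L2 (curl (z1 t)) ^+ 2) 0 T.
    by rewrite -tint_iint; apply: tint_ae; apply: aet_filter ez => t _ ->.
  have p t : 0 <= a1 * nrm L2 (z1 t) ^+ 2 by rewrite mulr_ge0 ?sqr_ge0 ?(ltW a10).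
  have q t : 0 <= a2 * nrm L2 (curl (z1 t)) ^+ 2 by rewrite mulr_ge0 ?sqr_ge0 ?(ltW a20).
  have -> : Z ^+ 2 = iint (fun t => a1 * nrm L2 (z1 t) ^+ 2 + a2 * nrm L2 (curl (z1 t)) ^+ 2) 0 T.
    by apply: (sqr_sqrt_tint e); apply: iint_ge0 => t _; exact: addr_ge0.
  rewrite -(@iintZ R a2 (fun t => nrm L2 (curl (z1 t)) ^+ 2) 0 T sc.2); apply: iint_le.
  - exact: iiZ sc.2.
  - by apply: iiD; [exact: iiZ sz2.2|exact: iiZ sc.2].
  - by move=> t _; rewrite lerDr.
set Q := iint (fun t => nrm L2 (curl (z1 t)) ^+ 2) 0 T in ZE.
have FE : iint (fun t => nrm L2 (1 *: I1 t + curl (z1 t)) ^+ 2) 0 T <= 2 * N ^+ 2 + 2 * Q.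
  have e : iint (fun t => 2 * nrm L2 (I1 t) ^+ 2 + 2 * nrm L2 (curl (z1 t)) ^+ 2) 0 T = 2 * N ^+ 2 + 2 * Q.
    rewrite NE; exact: (@iint_lin2 2 2 (fun t => nrm L2 (I1 t) ^+ 2) (fun t => nrm L2 (curl (z1 t)) ^+ 2) sI.2 sc.2).
  rewrite -e; apply: iint_le; [exact: sf.2|by apply: iiD; [exact: iiZ sI.2|exact: iiZ sc.2]|move=> t _].
  have k := sn_le sL 1 (sI.1.1 t) (sc.1.1 t); rewrite normr1 mul1r in k.
  have fin (x a b : R) : 0 <= x -> x <= a + b -> x ^+ 2 <= 2 * a ^+ 2 + 2 * b ^+ 2.
    move=> x0 xab; have : x ^+ 2 <= (a + b) ^+ 2 by rewrite ler_pXn2r ?nnegrE // (le_trans x0 xab).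
    by have := sqr_ge0 (a - b); lra.
  exact: fin (nrm_ge0 _ _) k.
rewrite -[leRHS]ger0_norm ?mulr_ge0 ?addr_ge0 // -sqrtr_sqr ler_wsqrtr //.
apply: le_trans FE _; rewrite exprMn KK.
have QZ : Q <= a2^-1 * Z ^+ 2 by rewrite ler_pdivlMl.
have NZ : 0 <= N * Z by exact: mulr_ge0.
have fin (n z' i nz q : R) : 0 <= n -> 0 <= z' -> 0 <= i -> 0 <= nz -> q <= i * z' ->
    2 * n + 2 * q <= (2 + 2 * i) * (n + nz *+ 2 + z').
  move=> n0 z0 i0 nz0 qz; have := mulr_ge0 i0 n0; have := mulr_ge0 i0 nz0; lra.
by rewrite sqrrD; apply: fin => //; exact: sqr_ge0.
Qed.

Lemma rhs_lin (c d : R) (I0 I1 I2 z0 z1 z2 : R -> vfield R) :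
  in_L2t T L2 I1 -> in_L2t T L2 I2 -> in_Z Omega T z1 -> in_Z Omega T z2 ->
  I0 = c *: I1 + d *: I2 -> z0 = c *: z1 + d *: z2 ->
  aet T (fun t => forall psi, dom L2 psi ->
    ip (rhs Omega I0 z0 t) psi = c * ip (rhs Omega I1 z1 t) psi + d * ip (rhs Omega I2 z2 t) psi).
Proof.
move=> L1 L2' Z1 Z2 -> ->; have := aet_and (aet_and (L2t_dom L1) (L2t_dom L2')) (aet_and (L2t_dom Z1) (L2t_dom Z2)).
apply: aet_filter => t _ [[d1 d2] [h1 h2]] psi dp.
have [c1 c2] := (dom_curl Omega (z1 t), dom_curl Omega (z2 t)).
have addl (u v : vfield R) : dom L2 u -> dom L2 v -> ip (u + v) psi = ip u psi + ip v psi.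
  by move=> du dv; have := ip_lin 1 du dv dp; rewrite scale1r mul1r.
have Zl (a : R) (u : vfield R) : dom L2 u -> ip (a *: u) psi = a * ip u psi.
  by move=> du; have := ip_lin a du (dom0 Omega) dp; rewrite addr0 (ip0l oO dp) addr0.
have cZ : ip (curl (d *: z2 t)) psi = d * ip (curl (z2 t)) psi.
  have := curl_lin oO d h2 (Hcurl0 oO) dp; rewrite addr0 => ->.
  by rewrite (ip_sym _ (curl 0)) (ip_curl0 dp) addr0.
have hd : dom Hcurl (d *: z2 t) by exact: (snZ sHc).
rewrite -[rhs _ _ _ _]/((c *: I1 t + d *: I2 t) + curl (c *: z1 t + d *: z2 t)).
rewrite -[rhs _ I1 _ _]/(I1 t + curl (z1 t)) -[rhs _ I2 _ _]/(I2 t + curl (z2 t)).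
rewrite (addl _ _ (sn_lin sL c d1 (snZ sL d d2)) (dom_curl _ _)).
rewrite (addl _ _ d1 c1) (addl _ _ d2 c2) (curl_lin oO c h1 hd dp) cZ.
rewrite (addl _ _ (snZ sL c d1) (snZ sL d d2)) !Zl //.
by move: (ip _ _) (ip _ _) (ip _ _) (ip _ _) => *; ring.
Qed.

Lemma solution_Y f (E0 B0 : vfield R) EB : weak_solution Omega T eps mu sigma f E0 B0 EB -> in_Y Omega T EB.
Proof.
have L (G : R -> vfield R) : in_Ct T L2 G -> in_L2t T L2 G.
  by move=> cG; have [G1 sG eG] := strong_Ct T0 sL cG; apply: (strong_L2t_eq sL sG); exact: aet_all.
by case: EB => E B [[_ cE] [_ cB] _ _ _]; split; exact: L.
Qed.

Lemma Y_bound (EB : (R -> vfield R) * (R -> vfield R)) M :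
  (forall t, 0 <= t <= T -> nrm L2 (EB.1 t) <= M /\ nrm L2 (EB.2 t) <= M) ->
  nrm_Y Omega T EB <= Num.sqrt (2 * T) * M.
Proof.
have fin (a b m : R) : a <= T * m -> b <= T * m -> a + b <= 2 * T * m by lra.
move=> hM; have M0 : 0 <= M.
  by have [h _] := hM 0 (introT andP (conj (lexx 0) (ltW T0))); apply: le_trans h; exact: nrm_ge0.
have key (G : R -> vfield R) : (forall t, 0 <= t <= T -> nrm L2 (G t) <= M) -> nrm_L2t T L2 G ^+ 2 <= T * M ^+ 2.
  move=> hG.
  have le : tint T (fun t => nrm L2 (G t) ^+ 2) <= iint (fun=> M ^+ 2) 0 T.
    apply: tint_le => [t|t||]; rewrite ?sqr_ge0 //; first exact: ii_cst.
    apply: aet_all => t /andP[t0 tT]; rewrite ler_pXn2r ?nnegrE ?nrm_ge0 //.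
    by apply: hG; rewrite !ltW.
  rewrite (iint_cst _ (ltW T0)) subr0 in le.
  rewrite sqr_sqrtr //; apply: Rintegral_ge0 => t _; exact: sqr_ge0.
have k1 := key _ (fun t tT => (hM t tT).1); have k2 := key _ (fun t tT => (hM t tT).2).
rewrite -[X in _ * X](ger0_norm M0) -sqrtr_sqr -sqrtrM ?mulr_ge0 ?(ltW T0) // /nrm_Y ler_wsqrtr //.
exact: fin k1 k2.
Qed.

(** [state] picks some weak solution, not the constructed one; uniqueness transfers the bound at
    every time. *)
Lemma state_solution (a1 a2 : R) : 0 < a1 -> 0 < a2 -> exists2 K : R, 0 <= K &
  forall Isrc (E0 B0 : vfield R) z, in_L2t T L2 Isrc -> dom L2 E0 -> dom (Hdiv0 Omega) B0 -> in_Z Omega T z ->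
  weak_solution Omega T eps mu sigma (rhs Omega Isrc z) E0 B0 (state Omega T eps mu sigma Isrc E0 B0 z) /\
  nrm_Y Omega T (state Omega T eps mu sigma Isrc E0 B0 z) <=
    K * (nrm_L2t T L2 Isrc + nrm_Z Omega T a1 a2 z + nrm L2 E0 + nrm L2 B0).
Proof.
move=> a10 a20; have [K K0 hK] := existence_bound; have [Kr Kr0 hr] := rhs_strong a10 a20.
exists (Num.sqrt (2 * T) * (K * (Kr + 1))).
  by rewrite mulr_ge0 ?sqrtr_ge0 // mulr_ge0 ?(ltW K0) // addr_ge0.
move=> Isrc E0 B0 z LI dE0 dB0 LZ; have [f1 [sf ef bf]] := hr Isrc z LI LZ.
have [E [B [w _ bnd _]]] := hK _ f1 E0 B0 sf ef dE0 dB0.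
have ex : exists EB, weak_solution Omega T eps mu sigma (rhs Omega Isrc z) E0 B0 EB by exists (E, B).
have ws := @xgetPex _ 0 [set EB | weak_solution Omega T eps mu sigma (rhs Omega Isrc z) E0 B0 EB] ex.
rewrite -/(state Omega T eps mu sigma Isrc E0 B0 z) in ws; split; first exact: ws.
rewrite -mulrA; apply: Y_bound => t tT; move: ws; rewrite /=; case: (state _ _ _ _ _ _ _ _ _) => E' B' /= ws.
have dB : dom L2 B0 by case: dB0.
have [z1 z2] := solution_unique sf ef dE0 dB w ws tT; have [b1 b2] := bnd t tT.
have [[_ cE] [_ cB] _ _ _] := w; have [[_ cE'] [_ cB'] _ _ _] := ws.
have fin (G G' : vfield R) X : dom L2 G -> dom L2 G' -> nrm L2 (G' - G) = 0 -> nrm L2 G <= X -> nrm L2 G' <= X.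
  by move=> dG dG' z0; have := nrm_dist sL dG' dG; rewrite z0 normr_le0 subr_eq0 => /eqP ->.
have DD : K * (Num.sqrt (iint (fun t => nrm L2 (f1 t) ^+ 2) 0 T) + nrm L2 E0 + nrm L2 B0) <=
   K * (Kr + 1) * (nrm_L2t T L2 Isrc + nrm_Z Omega T a1 a2 z + nrm L2 E0 + nrm L2 B0).
  rewrite -mulrA ler_wpM2l ?(ltW K0) //; have NI : 0 <= nrm_L2t T L2 Isrc by exact: sqrtr_ge0.
  have NZ : 0 <= nrm_Z Omega T a1 a2 z by exact: sqrtr_ge0.
  have [e0 b0] := (nrm_ge0 Omega E0, nrm_ge0 Omega B0).
  have fi (n i z' e' b' : R) : n <= Kr * (i + z') -> 0 <= i -> 0 <= z' -> 0 <= e' -> 0 <= b' ->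
      n + e' + b' <= (Kr + 1) * (i + z' + e' + b').
    by move=> h i0 z0 e'0 b'0; have := mulr_ge0 Kr0 e'0; have := mulr_ge0 Kr0 b'0; lra.
  exact: fi bf NI NZ e0 b0.
split; first exact: (fin _ _ _ (Ct_dom cE tT) (Ct_dom cE' tT) z1 (le_trans b1 DD)).
exact: (fin _ _ _ (Ct_dom cB tT) (Ct_dom cB' tT) z2 (le_trans b2 DD)).
Qed.

(** Three uses follow: [d = 1 - c] with equal data gives affinity, [c = d = 1] splits off the state
    of the zero control, and [d = 1] with zero data gives linearity. *)
Lemma state_lin (a1 a2 c d : R) (I0 I1 I2 z0 z1 z2 : R -> vfield R) (E0 B0 E1 B1 E2 B2 : vfield R) :
  0 < a1 -> 0 < a2 -> in_L2t T L2 I0 -> in_L2t T L2 I1 -> in_L2t T L2 I2 ->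
  in_Z Omega T z0 -> in_Z Omega T z1 -> in_Z Omega T z2 ->
  dom L2 E0 -> dom (Hdiv0 Omega) B0 -> dom L2 E1 -> dom (Hdiv0 Omega) B1 -> dom L2 E2 -> dom (Hdiv0 Omega) B2 ->
  I0 = c *: I1 + d *: I2 -> z0 = c *: z1 + d *: z2 -> E0 = c *: E1 + d *: E2 -> B0 = c *: B1 + d *: B2 ->
  eq_Y Omega T (state Omega T eps mu sigma I0 E0 B0 z0)
    (c *: state Omega T eps mu sigma I1 E1 B1 z1 + d *: state Omega T eps mu sigma I2 E2 B2 z2).
Proof.
move=> a10 a20 L0 L1 L2' Z0 Z1 Z2 dE0 dB0 dE1 dB1 dE2 dB2 eI ez eE eB.
have [K _ hK] := state_solution a10 a20; have [Kr _ hr] := rhs_strong a10 a20.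
have [w0 _] := hK I0 E0 B0 z0 L0 dE0 dB0 Z0; have [w1 _] := hK I1 E1 B1 z1 L1 dE1 dB1 Z1.
have [w2 _] := hK I2 E2 B2 z2 L2' dE2 dB2 Z2.
have [f0 [s0 e0 _]] := hr _ _ L0 Z0; have [f1 [s1 e1 _]] := hr _ _ L1 Z1; have [f2 [s2 e2 _]] := hr _ _ L2' Z2.
have rl := rhs_lin L1 L2' Z1 Z2 eI ez.
move: w0 w1 w2; case: (state _ _ _ _ _ _ _ _ _) => F0 G0; case: (state _ _ _ _ _ _ _ _ _) => F1 G1.
case: (state _ _ _ _ _ _ _ _ _) => F2 G2 w0 w1 w2.
have h := solution_lin s0 s1 s2 e0 e1 e2 dE1 dB1.1 dE2 dB2.1 eE eB rl w0 w1 w2.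
have itv t : 0 < t < T -> 0 <= t <= T by move=> /andP[t0 tT]; rewrite !ltW.
exact: (conj (aet_all (fun t tT => (h t (itv t tT)).1)) (aet_all (fun t tT => (h t (itv t tT)).2))).
Qed.

Lemma Z0 : in_Z Omega T 0.
Proof. exact: (L2t0 sHc). Qed.

Lemma L2t_0 : in_L2t T L2 0.
Proof. exact: (L2t0 sL). Qed.

Lemma nrm_L2t_0 : nrm_L2t T L2 0 = 0.
Proof.
have e : tint T (fun t => nrm L2 ((0 : R -> vfield R) t) ^+ 2) = 0.
  rewrite (tint_ae (h' := fun=> 0)) ?tint_iint ?(iint_cst _ (ltW T0)) ?mulr0 //.
  by apply: aet_all => t _; rewrite (sn_nrm0 sL) expr0n.
by rewrite /nrm_L2t -[X in Num.sqrt X]/(tint T _) e sqrtr0.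
Qed.
End MaxwellEvolution.

Theorem lemma9 (R : realType) (Omega : set (R3 R)) (T : R)
    (eps mu sigma : mfield R) (eps0 mu0 a1 a2 : R)
    (hOmega : bounded_Lipschitz_domain Omega) (hT : 0 < T)
    (heps : Linf_mfield Omega eps) (hmu : Linf_mfield Omega mu)
    (hsigma : Linf_mfield Omega sigma)
    (seps : symmetric_mfield Omega eps) (smu : symmetric_mfield Omega mu)
    (ssigma : symmetric_mfield Omega sigma)
    (heps0 : 0 < eps0) (hmu0 : 0 < mu0)
    (ceps : bounded_below_mfield Omega eps0 eps)
    (cmu : bounded_below_mfield Omega mu0 mu)
    (psigma : bounded_below_mfield Omega 0 sigma)
    (ha1 : 0 < a1) (ha2 : 0 < a2) :
  (* existence, uniqueness and the a priori estimate *)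
  (exists C : R, 0 < C /\
    forall (Isrc : R -> vfield R) (E0 B0 : vfield R),
      in_L2t T (L2 Omega) Isrc -> dom (L2 Omega) E0 -> dom (Hdiv0 Omega) B0 ->
    forall z : R -> vfield R, in_Z Omega T z ->
    exists E B : R -> vfield R,
      [/\ weak_solution Omega T eps mu sigma (rhs Omega Isrc z) E0 B0 (E, B),
          forall E' B' : R -> vfield R,
            weak_solution Omega T eps mu sigma (rhs Omega Isrc z) E0 B0 (E', B') ->
            forall t, 0 <= t <= T ->
              nrm (L2 Omega) (E' t - E t) = 0 /\ nrm (L2 Omega) (B' t - B t) = 0,
          in_Linft T (Hdiv0 Omega) B &
          nrm_L2t T (dual (H0curl Omega)) (dt T (H0curl Omega) (embE Omega eps E))
          + nrm_L2t T (dual (Hcurl Omega)) (dt T (Hcurl Omega) (embB Omega B))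
          + nrm_Ct T (L2 Omega) E + nrm_Ct T (L2 Omega) B
          <= C * (nrm_L2t T (L2 Omega) Isrc + nrm_Z Omega T a1 a2 z
                  + nrm (L2 Omega) E0 + nrm (L2 Omega) B0)])
  /\
  (* the control-to-state map S and its linear part S0 *)
  (forall (Isrc : R -> vfield R) (E0 B0 : vfield R),
      in_L2t T (L2 Omega) Isrc -> dom (L2 Omega) E0 -> dom (Hdiv0 Omega) B0 ->
    let S := state Omega T eps mu sigma Isrc E0 B0 in
    let S0 := state Omega T eps mu sigma 0 0 0 in
    [/\ forall z, in_Z Omega T z ->
          weak_solution Omega T eps mu sigma (rhs Omega Isrc z) E0 B0 (S z)
          /\ in_Y Omega T (S z),
        (forall (c : R) z1 z2, in_Z Omega T z1 -> in_Z Omega T z2 ->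
          eq_Y Omega T (S (c *: z1 + (1 - c) *: z2))
                       (c *: S z1 + (1 - c) *: S z2))
        /\ (exists C : R, forall z, in_Z Omega T z ->
              nrm_Y Omega T (S z) <= C * (1 + nrm_Z Omega T a1 a2 z)),
        forall z, in_Z Omega T z -> eq_Y Omega T (S z) (S0 z + S 0),
        forall z, in_Z Omega T z ->
          weak_solution Omega T eps mu sigma (rhs Omega 0 z) 0 0 (S0 z)
          /\ in_Y Omega T (S0 z) &
        (forall (c : R) z1 z2, in_Z Omega T z1 -> in_Z Omega T z2 ->
          eq_Y Omega T (S0 (c *: z1 + z2)) (c *: S0 z1 + S0 z2))
        /\ (exists C : R, forall z, in_Z Omega T z ->
              nrm_Y Omega T (S0 z) <= C * nrm_Z Omega T a1 a2 z)]).
Proof.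
have oO := lip_open hOmega; have sL := L2_seminormed oO; have sd := Hdiv0_seminormed oO.
have NZ z : 0 <= nrm_Z Omega T a1 a2 z by exact: sqrtr_ge0.
have NI I : 0 <= nrm_L2t T (L2 Omega) I by exact: sqrtr_ge0.
have [Kr Kr0 hr] := rhs_strong hOmega T ha1 ha2.
split.
  have [K K0 hK] := existence_bound hOmega hT heps0 hmu0 heps hmu hsigma seps smu ssigma ceps cmu psigma.
  exists (K * (Kr + 1)); split=> [|Isrc E0 B0 LI dE0 dB0 z LZ]; first by rewrite mulr_gt0 // ltr_wpDl.
  have [f1 [sf ef bf]] := hr Isrc z LI LZ.
  have [E [B [w lin _ bnd]]] := hK _ f1 E0 B0 sf ef dE0 dB0; exists E, B; split=> //.
    move=> E' B' w'.
    exact: (solution_unique hOmega hT heps0 hmu0 heps hmu hsigma seps smu ceps cmu psigma sf ef dE0 dB0.1 w w').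
  apply: le_trans bnd _; rewrite -mulrA ler_wpM2l ?(ltW K0) //.
  have fin (n i z' e b : R) : n <= Kr * (i + z') -> 0 <= i -> 0 <= z' -> 0 <= e -> 0 <= b ->
      n + e + b <= (Kr + 1) * (i + z' + e + b).
    by move=> h i0 z0 e0 b0; have := mulr_ge0 Kr0 e0; have := mulr_ge0 Kr0 b0; lra.
  exact: fin bf (NI _) (NZ _) (nrm_ge0 _ _) (nrm_ge0 _ _).
move=> Isrc E0 B0 LI dE0 dB0 S S0.
have [K K0 hK] := state_solution hOmega hT heps0 hmu0 heps hmu hsigma seps smu ssigma ceps cmu psigma ha1 ha2.
have d0 := sn0 sL; have dd0 := sn0 sd; have z0 := Z0 hOmega T; have l0 := L2t_0 hOmega T.
(* Decompositions of the sources and initial data in the three uses of [state_lin]: equal data, zero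
   data, and zero plus given data. *)
have cc (V : lmodType R) (c : R) (v : V) : v = c *: v + (1 - c) *: v by rewrite -scalerDl addrC subrK scale1r.
have c0 (V : lmodType R) (c : R) : 0 = c *: (0 : V) + 1 *: 0 by rewrite !scaler0 addr0.
have one (V : lmodType R) (v : V) : v = 1 *: 0 + 1 *: v by rewrite scaler0 add0r scale1r.
split.
- move=> z LZ; have [w _] := hK Isrc E0 B0 z LI dE0 dB0 LZ; exact: (conj w (solution_Y hOmega hT w)).
- split=> [c z1 z2 h1 h2|].
    have lz := Z_lin hOmega c (1 - c) h1 h2.
    exact: (state_lin hOmega hT heps0 hmu0 heps hmu hsigma seps smu ssigma ceps cmu psigma ha1 ha2
      LI LI LI lz h1 h2 dE0 dB0 dE0 dB0 dE0 dB0 (cc _ c Isrc) erefl (cc _ c E0) (cc _ c B0)).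
  (* The source and the initial data are fixed here, so their norms may enter the constant. *)
  exists (K * (1 + nrm_L2t T (L2 Omega) Isrc + nrm (L2 Omega) E0 + nrm (L2 Omega) B0)) => z LZ.
  have [_ b] := hK Isrc E0 B0 z LI dE0 dB0 LZ; apply: le_trans b _; rewrite -mulrA ler_wpM2l //.
  have fin (i z' e b : R) : 0 <= i -> 0 <= z' -> 0 <= e -> 0 <= b ->
      i + z' + e + b <= (1 + i + e + b) * (1 + z').
    move=> i0 z'0 e0 b0; have := mulr_ge0 i0 z'0; have := mulr_ge0 e0 z'0; have := mulr_ge0 b0 z'0; lra.
  exact: fin (NI _) (NZ _) (nrm_ge0 _ _) (nrm_ge0 _ _).
- move=> z LZ.
  have ez : z = 1 *: z + 1 *: 0 by rewrite scaler0 addr0 scale1r.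
  have := (state_lin hOmega hT heps0 hmu0 heps hmu hsigma seps smu ssigma ceps cmu psigma ha1 ha2
    LI l0 LI LZ LZ z0 dE0 dB0 d0 dd0 dE0 dB0 (one _ Isrc) ez (one _ E0) (one _ B0)).
  by rewrite !scale1r.
- by move=> z LZ; have [w _] := hK 0 0 0 z l0 d0 dd0 LZ; exact: (conj w (solution_Y hOmega hT w)).
split=> [c z1 z2 h1 h2|].
  have e : c *: z1 + z2 = c *: z1 + 1 *: z2 by rewrite scale1r.
  have lz : in_Z Omega T (c *: z1 + z2) by rewrite e; exact: (Z_lin hOmega c 1 h1 h2).
  have := (state_lin hOmega hT heps0 hmu0 heps hmu hsigma seps smu ssigma ceps cmu psigma ha1 ha2
    l0 l0 l0 lz h1 h2 d0 dd0 d0 dd0 d0 dd0 (c0 _ c) e (c0 _ c) (c0 _ c)).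
  by rewrite !scale1r.
exists K => z LZ; have [_ b] := hK 0 0 0 z l0 d0 dd0 LZ; apply: le_trans b _.
by rewrite (nrm_L2t_0 hOmega hT) (sn_nrm0 sL) !addr0 add0r.
Qed.
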